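(* Let $m\ge2$ be an integer, let $1\le p\le\infty$, and define $q$ by $\frac1q:=\frac m2+\frac1p$ (with $\frac1\infty=0$). Let $\Omega\subset\mathbb{R}^2$ be a compact polygonal domain and let $f\in C^m(\Omega)$. (1) For every admissible sequence $(\mathcal{T}_N)_{N\ge N_0}$ of conforming triangulations of $\Omega$, $$\liminf_{N\to\infty}N^{\frac m2}e_{m,\mathcal{T}_N}(f)_p\ge\left\|K_{m,p}\left(\frac{d^mf}{m!}\right)\right\|_{L^q(\Omega)}.$$ (2) For every $\varepsilon>0$ there exists an admissible sequence $(\mathcal{T}_N^\varepsilon)_{N\ge N_0}$ of conforming triangulations of $\Omega$ such that $$\limsup_{N\to\infty}N^{\frac m2}e_{m,\mathcal{T}_N^\varepsilon}(f)_p\le\left\|K_{m,p}\left(\frac{d^mf}{m!}\right)\right\|_{L^q(\Omega)}+\varepsilon.$$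
   Context: $\mathbb{H}_m$ denotes the space of real homogeneous polynomials of degree $m$ in $(x,y)$ (including $0$) and $\mathbb{P}_{m-1}$ the space of real polynomials in $(x,y)$ of total degree at most $m-1$. For a triangle $T$ (closed, nondegenerate, of area $|T|$), $I_{m,T}:C^0(T)\to\mathbb{P}_{m-1}$ is the Lagrange interpolation operator: $I_{m,T}v(\gamma)=v(\gamma)$ for all points $\gamma\in T$ whose barycentric coordinates all belong to $\{0,\frac1{m-1},\frac2{m-1},\dots,1\}$. Local error: $e_{m,T}(v)_p:=\|v-I_{m,T}v\|_{L^p(T)}$. A conforming triangulation $\mathcal{T}$ of $\Omega$ is a finite set of triangles with union $\Omega$ and pairwise disjoint interiors, such that two distinct triangles intersect in the empty set, a common vertex or a common full edge. $\#(\mathcal{T})$ is its number of triangles. Global error: $e_{m,\mathcal{T}}(v)_p:=\left(\sum_{T\in\mathcal{T}}e_{m,T}(v)_p^p\right)^{1/p}$ if $p<\infty$, and $\max_{T\in\mathcal{T}}e_{m,T}(v)_\infty$ if $p=\infty$. A sequence $(\mathcal{T}_N)_{N\ge N_0}$ of conforming triangulations of $\Omega$ with $\#(\mathcal{T}_N)=N$ is admissible if there is a constant $C_A>0$ independent of $N$ such that $\sup_{T\in\mathcal{T}_N}\mathrm{diam}(T)\le C_AN^{-1/2}$ for all $N\ge N_0$. (In (2), $C_A$ and $N_0$ may depend on $\varepsilon$.) Shape function: for $\pi\in\mathbb{H}_m$, $K_{m,p}(\pi):=\inf_{|T|=1}e_{m,T}(\pi)_p$, the infimum being over all triangles $T\subset\mathbb{R}^2$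 of area $1$. At each $z\in\Omega$, $\frac{d^mf(z)}{m!}$ is identified with the polynomial $\sum_{k+l=m}\frac{\partial^mf}{\partial x^k\partial y^l}(z)\frac{x^k}{k!}\frac{y^l}{l!}\in\mathbb{H}_m$. $f\in C^m(\Omega)$ means that $f$ and its derivatives up to order $m$ are continuous up to the boundary of $\Omega$. For $0<q<\infty$, $\|g\|_{L^q(\Omega)}:=\left(\int_\Omega|g|^q\right)^{1/q}$ (possibly $q<1$). *)

(* Defs.v *)
From HB Require Import structures.
From mathcomp Require Import all_boot all_order all_algebra.
From mathcomp Require Import all_classical all_reals all_analysis.

Set Implicit Arguments.
Unset Strict Implicit.
Unset Printing Implicit Defensive.

Import Order.TTheory GRing.Theory Num.Theory.
Import numFieldNormedType.Exports.

Local Open Scope classical_set_scope.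
Local Open Scope ring_scope.

Definition plane_measure (R : realType) :=
  ((@lebesgue_measure R) \x (@lebesgue_measure R))%E.

(* The L^p(A) norm for 0 < p <= +oo (p < 1 included), as the norm over the plane
   of the extension of g by 0 outside A. *)
Definition LpNorm (R : realType) (p : \bar R) (A : set (R * R))
    (g : R * R -> \bar R) : \bar R :=
  ('N[@plane_measure R]_p [ g \_ A ])%E.

Definition edist (R : realType) (x y : R * R) : R :=
  Num.sqrt ((x.1 - y.1) ^+ 2 + (x.2 - y.2) ^+ 2).

Definition diam (R : realType) (A : set (R * R)) : \bar R :=
  ereal_sup [set r | exists2 x, A x & exists2 y, A y & r = (edist x y)%:E].

(* Nondegenerate triangles, given by their vertices. *)
Record triangle (R : realType) := Triangle {
  vertex :> 'I_3 -> R * R;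
  nondegenerate :
    ((vertex 1).1 - (vertex 0).1) * ((vertex 2).2 - (vertex 0).2)
    - ((vertex 2).1 - (vertex 0).1) * ((vertex 1).2 - (vertex 0).2) != 0
}.

Definition barycenter (R : realType) (T : triangle R) (l : 'I_3 -> R) : R * R :=
  \sum_(i < 3) l i *: T i.

Definition body (R : realType) (T : triangle R) : set (R * R) :=
  [set x | exists l : 'I_3 -> R,
    [/\ forall i, 0 <= l i, \sum_(i < 3) l i = 1 & x = barycenter T l]].

Definition area (R : realType) (T : triangle R) : \bar R :=
  @plane_measure R (body T).

Definition vertices (R : realType) (T : triangle R) : set (R * R) :=
  [set x | exists i : 'I_3, x = T i].

Definition segment (R : realType) (a b : R * R) : set (R * R) :=
  [set x | exists2 t : R, 0 <= t <= 1 & x = (1 - t) *: a + t *: b].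

Definition edges (R : realType) (T : triangle R) : set (set (R * R)) :=
  [set E | exists i j : 'I_3, i != j /\ E = segment (T i) (T j)].

(* Real polynomials in (x, y) are bivariate polynomials in the sense of polyXY:
   'X stands for x and 'Y for y, so that P`_i`_j is the coefficient of
   x ^ i * y ^ j. *)
Definition poly_fun (R : realType) (P : {poly {poly R}}) : R * R -> R :=
  fun z => P.[z.1, z.2].

Definition total_degree_le (R : realType) (d : nat) (P : {poly {poly R}}) :=
  forall i j : nat, (d < i + j)%N -> P`_i`_j = 0.

Definition homogeneous (R : realType) (d : nat) (P : {poly {poly R}}) :=
  forall i j : nat, (i + j)%N <> d -> P`_i`_j = 0.

Definition lagrange_nodes (R : realType) (m : nat) (T : triangle R) :
    set (R * R) :=
  [set x | exists k : 'I_3 -> 'I_m,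
    let l := fun i => (k i)%:R / m.-1%:R in
    \sum_(i < 3) l i = 1 /\ x = barycenter T l].

Definition lagrange (R : realType) (m : nat) (T : triangle R)
    (v : R * R -> R) : {poly {poly R}} :=
  xget 0 [set P | total_degree_le m.-1 P /\
                  {in lagrange_nodes m T, poly_fun P =1 v}].

Definition local_error (R : realType) (m : nat) (T : triangle R)
    (v : R * R -> R) (p : \bar R) : \bar R :=
  LpNorm p (body T) (fun z => (v z - poly_fun (lagrange m T v) z)%:E).

(* Compact polygonal domains as nonempty finite unions of closed triangles;
   connectedness is not required. *)
Definition polygonal_domain (R : realType) (Omega : set (R * R)) :=
  exists (n : nat) (T : 'I_n.+1 -> triangle R),
    Omega = \bigcup_i body (T i).

(* Conforming triangulations of cardinality N; by the disjointness of the
   interiors, the N triangles are pairwise distinct. *)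
Definition conforming (R : realType) (Omega : set (R * R)) (N : nat)
    (T : 'I_N -> triangle R) :=
  Omega = \bigcup_i body (T i) /\
  forall i j, i != j ->
    (body (T i))° `&` (body (T j))° = set0 /\
    let S := body (T i) `&` body (T j) in
    [\/ S = set0,
        exists2 x, S = [set x] & (vertices (T i) `&` vertices (T j)) x
      | (edges (T i) `&` edges (T j)) S].

Definition global_error (R : realType) (m N : nat) (T : 'I_N -> triangle R)
    (v : R * R -> R) (p : \bar R) : \bar R :=
  match p with
  | r%:E => ((\sum_(i < N) local_error m (T i) v p `^ r) `^ r^-1)%E
  | _ => (\big[maxe/0]_(i < N) local_error m (T i) v p)%E
  end.

Definition admissible (R : realType) (Omega : set (R * R)) (N0 : nat)
    (T : forall N : nat, 'I_N -> triangle R) :=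
  (forall N, (N0 <= N)%N -> conforming Omega (T N)) /\
  exists2 CA : R, 0 < CA &
    forall N, (N0 <= N)%N -> forall i : 'I_N,
      (diam (body (T N i)) <= (CA * N%:R `^ (- 2^-1))%:E)%E.

Definition shape_function (R : realType) (m : nat) (p : \bar R)
    (P : {poly {poly R}}) : \bar R :=
  ereal_inf [set local_error m T (poly_fun P) p |
             T in [set T : triangle R | area T = 1%E]].

(* D k l plays the role of the partial derivative of f of order k in x and l
   in y; on the boundary of Omega it is the continuous extension. *)
Definition partial_derivatives (R : realType) (m : nat) (Omega : set (R * R))
    (f : R * R -> R) (D : nat -> nat -> R * R -> R) :=
  [/\ {in Omega, D 0%N 0%N =1 f},
      forall k l, (k + l <= m)%N -> {within Omega, continuous (D k l)}
    & forall k l, (k + l < m)%N -> forall z, (Omega°) z ->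
        is_derive z (1, 0) (D k l) (D k.+1 l z) /\
        is_derive z (0, 1) (D k l) (D k l.+1 z)].

Definition Cm (R : realType) (m : nat) (Omega : set (R * R))
    (f : R * R -> R) :=
  exists D, partial_derivatives m Omega f D.

(* For a polygonal domain, which is the closure of its interior, the partial
   derivatives of order at most m of f in C^m are uniquely determined on Omega. *)
Definition partial (R : realType) (m : nat) (Omega : set (R * R))
    (f : R * R -> R) : nat -> nat -> R * R -> R :=
  xget (fun _ _ _ => 0) [set D | partial_derivatives m Omega f D].

(* d^m f(z) / m!, where (k`! * (m - k)`!)%:R is the factor k! l!, l = m - k. *)
Definition dm_poly (R : realType) (m : nat) (Omega : set (R * R))
    (f : R * R -> R) (z : R * R) : {poly {poly R}} :=
  \sum_(k < m.+1)
    (partial m Omega f k (m - k)%N z / (k`! * (m - k)`!)%:R)%:P%:P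
      * 'X ^+ k * 'Y ^+ (m - k).

Lemma dm_poly_homogeneous (R : realType) (m : nat) (Omega : set (R * R))
    (f : R * R -> R) (z : R * R) : homogeneous m (dm_poly m Omega f z).
Proof.
move=> i j ijm; rewrite /dm_poly coef_sum coef_sum big1// => k _.
rewrite -mulrA [_ * 'Y ^+ _]mulrC mulrA -polyC_exp -polyCM coefCM coefXn.
have [ik|_] := eqVneq i k; last by rewrite mulr0 coef0.
rewrite mulr1 coefCM coefXn; have [jk|_] := eqVneq j (m - k)%N; last first.
  by rewrite mulr0.
by case: ijm; rewrite ik jk subnKC// -ltnS.
Qed.

(* Main.v *)
(** On a small triangle [T] the interpolation error of [f] is that of the
    degree-[m] part [pi] of its Taylor expansion, up to [o(diam T ^ m)] times
    the appropriate power of the area.  By translation and scaling, the error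
    of [pi] on [T] is at least [K(pi) * |T| ^ (1/q)].  Raising to the power
    [q], summing over the triangles and comparing power means gives the lower
    bound.

    For the upper bound, [Omega] is cut into small cells on which [pi] is
    nearly constant.  Each cell is covered by homothetic copies of a
    near-optimal triangle for [pi], of area proportional to [K(pi) ^ (-q)], so
    that all local errors are nearly equal.  The copies that meet the boundary
    of a cell are replaced by a conforming transition layer: thin slivers along
    the edges of the copies that are kept, and tiny triangles elsewhere.  On a
    sliver the interpolation nearly factors through an edge of the tile, so its
    error does not exceed that of the tile.  The numbers of slivers and of tiny
    triangles are of lower order than [N], and bisections adjust the total to
    exactly [N]. *)

Require Import Defs.
From mathcomp Require Import all_boot all_order all_algebra.
From mathcomp Require Import all_classical all_reals all_analysis.
From mathcomp Require Import measurable_realfun ess_sup_inf.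
From mathcomp Require Import ring lra zify.
Set Implicit Arguments.
Unset Strict Implicit.
Unset Printing Implicit Defensive.
Import Order.TTheory GRing.Theory Num.Theory.
Import numFieldNormedType.Exports.
Local Open Scope classical_set_scope.
Local Open Scope ring_scope.

(** * Triangles and their subdivisions *)

(** The upper bound is proved triangle by triangle: every triangle, slivers included, has error at
    most ((J + delta) / N) ^ (1/q), where [J] is the integral of K(pi) ^ q. Rarity of the bad
    triangles would not suffice for infinite p. This dictates the transition layer: a kept tile
    tolerates no vertex inside its edges, whereas tiny triangles put vertices on theirs; a sliver
    starts with one intact edge facing the tile and takes the vertices on its other edges. K(pi) is
    an infimum that need not be attained and may vanish. It is replaced by its analogue over
    triangles of bounded diameter, Lipschitz in the coefficients of pi, and a positive constant is
    added before it determines the size of the tiles. Conformity is treated combinatorially: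
    interiors are kept disjoint by separating lines, and what remains is that no vertex lies inside
    an edge. Closing a mesh uses existing vertices only. To gain exactly one triangle, an edge of
    extreme slope at the lexicographically largest vertex is bisected: it belongs to a single
    triangle, so no vertex hangs. *)

Notation pt R := (R * R)%type.
Notation tri R := (pt R * pt R * pt R)%type.

Section RawTriangles.
Variable R : realType.
Implicit Types (x y z u v w a b c : pt R) (t : tri R) (k : pt R * R) (s : seq (tri R)).

(** Twice the signed area of the triangle [u], [v], [w]. *)
Definition cr u v w : R :=
  (v.1 - u.1) * (w.2 - u.2) - (w.1 - u.1) * (v.2 - u.2).

Definition verts t : seq (pt R) := [:: t.1.1; t.1.2; t.2].

Definition nd t := cr t.1.1 t.1.2 t.2 != 0.

(** Affine functionals are stored by their coefficients; [k.1] is the linear part, so [k.1 != 0]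
    says that the zero set is a line. *)
Definition af k x : R := k.1.1 * x.1 + k.1.2 * x.2 + k.2.

Definition nneg k (l : seq (pt R)) := forall x, x \in l -> 0 <= af k x.

Definition opk k : pt R * R := ((- k.1.1, - k.1.2), - k.2).

(* A triangle is the intersection of the half-planes that contain its vertices. *)
Definition inT t x := forall k, nneg k (verts t) -> 0 <= af k x.

Definition sub t t' := forall x, x \in verts t -> inT t' x.

(** For nondegenerate triangles this amounts to disjoint interiors, but it only involves the
    vertices and passes to subtriangles at once. *)
Definition sep t t' :=
  exists k, [/\ k.1 != 0, nneg k (verts t) & nneg (opk k) (verts t')].

Fixpoint pw s : Prop :=
  if s is t :: s' then (forall t', t' \in s' -> sep t t') /\ pw s' else True.

(** A dissection of [t]. The pieces may meet along parts of edges; conformity is restored later, for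
    the whole mesh. *)
Definition dis t s := [/\ forall t', t' \in s -> nd t' /\ sub t' t, pw s &
  forall x, inT t x -> exists2 t', t' \in s & inT t' x].

Definition lerp (r : R) a b : pt R :=
  ((1 - r) * a.1 + r * b.1, (1 - r) * a.2 + r * b.2).

Definition onE z a b := exists2 r, 0 < r < 1 & z = lerp r a b.

Definition hang z t :=
  exists a b, [/\ a \in verts t, b \in verts t, a != b & onE z a b].

(** A bound on the diameter in the sup norm; by convexity the vertices suffice ([wide_inT]). *)
Definition wide (d : R) t := forall x y, x \in verts t -> y \in verts t ->
  `|x.1 - y.1| <= d /\ `|x.2 - y.2| <= d.

Lemma nneg3 k a b c :
  nneg k [:: a; b; c] <-> [/\ 0 <= af k a, 0 <= af k b & 0 <= af k c].
Proof.
split=> [H|[Ha Hb Hc] x].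
  by split; apply: H; rewrite !inE eqxx ?orbT.
by rewrite !inE => /or3P[] /eqP->.
Qed.

Lemma in3 (P : pt R -> Prop) a b c :
  (forall x, x \in [:: a; b; c] -> P x) <-> [/\ P a, P b & P c].
Proof.
split=> [H|[Ha Hb Hc] x].
  by split; apply: H; rewrite !inE eqxx ?orbT.
by rewrite !inE => /or3P[] /eqP->.
Qed.

Lemma af_opk k x : af (opk k) x = - af k x.
Proof. by rewrite /af /=; ring. Qed.

Lemma opkK k : opk (opk k) = k.
Proof. by case: k => -[k1 k2] k3; rewrite /opk /= !opprK. Qed.

Lemma opk_neq0 k : k.1 != 0 -> (opk k).1 != 0.
Proof.
apply: contra; case: k => -[k1 k2] k3 /= /eqP[] /eqP H1 /eqP H2.
by move: H1 H2; rewrite !oppr_eq0 => /eqP-> /eqP->.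
Qed.

Lemma inT_mem t x : x \in verts t -> inT t x.
Proof. by move=> xt k; apply. Qed.

Lemma inT_sub t t' x : sub t t' -> inT t x -> inT t' x.
Proof. by move=> tt' tx k kt'; apply: tx => y /tt'; apply. Qed.

Lemma sub_refl t : sub t t.
Proof. by move=> x; apply: inT_mem. Qed.

Lemma sub_trans t2 t1 t3 : sub t1 t2 -> sub t2 t3 -> sub t1 t3.
Proof. by move=> H1 H2 x /H1; apply: inT_sub. Qed.

Lemma sep_sym t t' : sep t t' -> sep t' t.
Proof.
move=> [k [k0 kt kt']]; exists (opk k); split=> //; first exact: opk_neq0.
by rewrite opkK.
Qed.

Lemma nneg_sub k t t' : sub t t' -> nneg k (verts t') -> nneg k (verts t).
Proof. by move=> tt' kt' x /tt'; apply. Qed.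

Lemma sep_sub t1 t2 t1' t2' : sub t1' t1 -> sub t2' t2 -> sep t1 t2 -> sep t1' t2'.
Proof.
move=> s1 s2 [k [k0 k1 k2]]; exists k; split=> //; first exact: nneg_sub k1.
exact: nneg_sub k2.
Qed.

Lemma pw_cat s1 s2 : pw (s1 ++ s2) <->
  [/\ pw s1, pw s2 & forall t1 t2, t1 \in s1 -> t2 \in s2 -> sep t1 t2].
Proof.
elim: s1 => [|t s1 IH] /=; first by split=> [|[]//]; split.
split.
  move=> [H1 /IH[p1 p2 p12]]; split=> //.
    by split=> // t' t's; apply: H1; rewrite mem_cat t's.
  move=> t1 t2; rewrite inE => /orP[/eqP-> t2s|]; last exact: p12.
  by apply: H1; rewrite mem_cat t2s orbT.
move=> [[H1 p1] p2 p12]; split.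
  move=> t'; rewrite mem_cat => /orP[/H1//|]; apply: p12.
  exact: mem_head.
by apply/IH; split=> // t1 t2 t1s; apply: p12; rewrite inE t1s orbT.
Qed.

Lemma pw_sep s t1 t2 : pw s -> t1 \in s -> t2 \in s -> t1 != t2 -> sep t1 t2.
Proof.
elim: s => // t s IH /= [H ps]; rewrite !inE.
move=> /orP[/eqP->|t1s] /orP[/eqP->|t2s]; rewrite ?eqxx// => n12.
- exact: H.
- by apply: sep_sym; apply: H.
- exact: IH.
Qed.

Lemma pw_flatten s (f : tri R -> seq (tri R)) :
  pw s -> (forall t, t \in s -> pw (f t)) ->
  (forall t t', t \in s -> t' \in f t -> sub t' t) ->
  pw (flatten [seq f t | t <- s]).
Proof.
elim: s => // t s IH /= [H ps] pf sf; apply/pw_cat; split.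
- by apply: pf; rewrite mem_head.
- apply: IH => // [t' t's|t' t'' t's]; first by apply: pf; rewrite inE t's orbT.
  by apply: sf; rewrite inE t's orbT.
- move=> t1 t2 t1f /flatten_mapP[t' t's t2f].
  apply: (sep_sub _ _ (H _ t's)); first by apply: sf; rewrite ?mem_head.
  by apply: sf; rewrite // inE t's orbT.
Qed.

Lemma choose_list s (Q : tri R -> seq (tri R) -> Prop) :
  (forall t, t \in s -> exists c' : seq (tri R), Q t c') ->
  exists f, forall t, t \in s -> Q t (f t).
Proof.
move=> H; exists (fun t => xget [::] [set c' | Q t c']) => t /H[c' Qc].
exact: (xgetI _ Qc).
Qed.

Lemma dis_flatten t s (f : tri R -> seq (tri R)) :
  dis t s -> (forall t', t' \in s -> dis t' (f t')) ->
  dis t (flatten [seq f t' | t' <- s]).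
Proof.
move=> [ns ps cs] df; split.
- move=> t' /flatten_mapP[t1 t1s t'f].
  have [H _ _] := df _ t1s; have [n' s'] := H _ t'f; split=> //.
  by apply: sub_trans s' _; have [] := ns _ t1s.
- apply: pw_flatten => // [t1 /df[]//|t1 t2 /df[H _ _] /H[]//].
- move=> x /cs[t1 t1s]; have [_ _ H] := df _ t1s.
  by move=> /H[t2 t2f t2x]; exists t2 => //; apply/flatten_mapP; exists t1.
Qed.

Lemma dis1 t : nd t -> dis t [:: t].
Proof.
move=> nt; split=> //=; last by move=> x tx; exists t; rewrite ?mem_head.
by move=> t'; rewrite inE => /eqP->; split=> //; apply: sub_refl.
Qed.

Lemma dis_eqi t t' s : verts t =i verts t' -> dis t' s -> dis t s.
Proof.
move=> tt' [H ps cs].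
have sT x : inT t x -> inT t' x by apply: inT_sub => y; rewrite tt'; apply: inT_mem.
have sT' x : inT t' x -> inT t x by apply: inT_sub => y; rewrite -tt'; apply: inT_mem.
split=> // [t1 /H[n1 s1]|x /sT]; last exact: cs.
by split=> // x /s1 /sT'.
Qed.

(** Triples are ordered, while the constructions below single out an edge and its apex; any edge can
    be put last. Only the set of vertices is preserved, not the orientation. *)
Lemma edge_view t x y : nd t -> x \in verts t -> y \in verts t -> x != y ->
  exists v, nd (v, x, y) /\ verts t =i [:: v; x; y].
Proof.
case: t => -[a b] c; rewrite /nd /verts /= => n.
have crE (d : R) : d != 0 -> forall e, (d = e \/ d = - e) -> e != 0.
  by move=> d0 e [<-//|de]; move: d0; rewrite de oppr_eq0.
rewrite !inE => /or3P[]/eqP-> /or3P[]/eqP->; rewrite ?eqxx // => _.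
- by exists c; split; [apply: (crE _ n); rewrite /cr /=; left; ring
  |move=> z; rewrite !inE; case: (z == a); case: (z == b); case: (z == c)].
- by exists b; split; [apply: (crE _ n); rewrite /cr /=; right; ring
  |move=> z; rewrite !inE; case: (z == a); case: (z == b); case: (z == c)].
- by exists c; split; [apply: (crE _ n); rewrite /cr /=; right; ring
  |move=> z; rewrite !inE; case: (z == a); case: (z == b); case: (z == c)].
- by exists a; split; [apply: (crE _ n); rewrite /cr /=; left; ring
  |move=> z; rewrite !inE; case: (z == a); case: (z == b); case: (z == c)].
- by exists b; split; [apply: (crE _ n); rewrite /cr /=; left; ring
  |move=> z; rewrite !inE; case: (z == a); case: (z == b); case: (z == c)].
- by exists a; split; [apply: (crE _ n); rewrite /cr /=; right; ring
  |move=> z; rewrite !inE; case: (z == a); case: (z == b); case: (z == c)].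
Qed.

Lemma af_lerp k r a b : af k (lerp r a b) = (1 - r) * af k a + r * af k b.
Proof. by rewrite /af /lerp /=; ring. Qed.

Definition comb (l0 l1 l2 : R) t : pt R :=
  (l0 * t.1.1.1 + l1 * t.1.2.1 + l2 * t.2.1,
   l0 * t.1.1.2 + l1 * t.1.2.2 + l2 * t.2.2).

Lemma af_comb k l0 l1 l2 t : l0 + l1 + l2 = 1 ->
  af k (comb l0 l1 l2 t) = l0 * af k t.1.1 + l1 * af k t.1.2 + l2 * af k t.2.
Proof.
by move=> l1E; rewrite /af /comb /=; rewrite -[X in _ + X = _]mul1r -l1E; ring.
Qed.

Lemma inT_comb l0 l1 l2 t : 0 <= l0 -> 0 <= l1 -> 0 <= l2 -> l0 + l1 + l2 = 1 ->
  inT t (comb l0 l1 l2 t).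
Proof.
move=> p0 p1 p2 l1E k /nneg3[k0 k1 k2].
by rewrite af_comb// !addr_ge0// mulr_ge0.
Qed.

(* The affine functional cr u v _; normalized, it is a barycentric coordinate. *)
Definition kcr u v : pt R * R :=
  ((- (v.2 - u.2), v.1 - u.1), - (v.1 - u.1) * u.2 + (v.2 - u.2) * u.1).

Lemma af_kcr u v x : af (kcr u v) x = cr u v x.
Proof. by rewrite /af /kcr /cr /=; ring. Qed.

Definition sck (r : R) k : pt R * R := ((r * k.1.1, r * k.1.2), r * k.2).

Lemma af_sck r k x : af (sck r k) x = r * af k x.
Proof. by rewrite /af /sck /=; ring. Qed.

(** The barycentric coordinates of [t] as affine functionals; the sides of [t] lie on their zero
    lines. *)
Definition kb t : seq (pt R * R) :=
  let d := (cr t.1.1 t.1.2 t.2)^-1 in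
  [:: sck d (kcr t.1.2 t.2); sck d (kcr t.2 t.1.1); sck d (kcr t.1.1 t.1.2)].
Definition k0 t := (kb t)`_0.
Definition k1 t := (kb t)`_1.
Definition k2 t := (kb t)`_2.

Lemma kbE t : nd t ->
  [/\ af (k0 t) t.1.1 = 1, af (k0 t) t.1.2 = 0 & af (k0 t) t.2 = 0] /\
  [/\ af (k1 t) t.1.1 = 0, af (k1 t) t.1.2 = 1 & af (k1 t) t.2 = 0] /\
  [/\ af (k2 t) t.1.1 = 0, af (k2 t) t.1.2 = 0 & af (k2 t) t.2 = 1].
Proof.
case: t => -[a b] c; rewrite /nd /k0 /k1 /k2 /kb /= => n.
rewrite !af_sck !af_kcr /=.
have e1 : cr b c a = cr a b c by rewrite /cr; ring.
have e2 : cr c a b = cr a b c by rewrite /cr; ring.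
have z1 u v : cr u v u = 0 by rewrite /cr; ring.
have z2 u v : cr u v v = 0 by rewrite /cr; ring.
by rewrite e1 e2 !z1 !z2 !mulr0 mulVf.
Qed.

Lemma kb_sum t x : nd t -> af (k0 t) x + af (k1 t) x + af (k2 t) x = 1.
Proof.
case: t => -[a b] c; rewrite /nd /k0 /k1 /k2 /kb /= => n.
rewrite !af_sck !af_kcr -!mulrDr -[RHS](mulVf n); congr (_ * _).
by rewrite /cr; ring.
Qed.

Lemma kb_comb t x : nd t -> x = comb (af (k0 t) x) (af (k1 t) x) (af (k2 t) x) t.
Proof.
case: t => -[a b] c; rewrite /nd /k0 /k1 /k2 /kb /= => n.
rewrite !af_sck !af_kcr /comb /= -!mulrA -!mulrDr.
case: x => x1 x2; congr (_, _); apply: (mulfI n); rewrite mulrA divff// mul1r.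
  by rewrite /cr /=; ring.
by rewrite /cr /=; ring.
Qed.

Lemma inTP t x : nd t -> inT t x <->
  [/\ 0 <= af (k0 t) x, 0 <= af (k1 t) x & 0 <= af (k2 t) x].
Proof.
move=> n; have [[a0 b0 c0] [[a1 b1 c1] [a2 b2 c2]]] := kbE n.
split=> [tx|[p0 p1 p2]].
  by split; apply: tx; apply/nneg3; rewrite ?(a0, a1, a2, b0, b1, b2, c0, c1, c2).
by rewrite (kb_comb x n); apply: inT_comb; rewrite // kb_sum.
Qed.

Lemma af_ext t k x : nd t ->
  af k x = af (k0 t) x * af k t.1.1 + af (k1 t) x * af k t.1.2
           + af (k2 t) x * af k t.2.
Proof. by move=> n; rewrite {1}(kb_comb x n) af_comb// kb_sum. Qed.

Lemma dis_bisect v x y z : nd (v, x, y) -> onE z x y ->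
  dis (v, x, y) [:: (v, x, z); (v, z, y)].
Proof.
move=> n [r /andP[r0 r1] zE].
have r1' : 0 < 1 - r by rewrite subr_gt0.
have e1 : cr v x z = r * cr v x y by rewrite zE /cr /lerp /=; ring.
have e2 : cr v z y = (1 - r) * cr v x y by rewrite zE /cr /lerp /=; ring.
have n1 : nd (v, x, z) by rewrite /nd /= e1 mulf_neq0// gt_eqF.
have n2 : nd (v, z, y) by rewrite /nd /= e2 mulf_neq0// gt_eqF.
have zc : z = comb 0 (1 - r) r (v, x, y).
  by rewrite zE /lerp /comb /=; congr (_, _); ring.
have zt : inT (v, x, y) z by rewrite zc; apply: inT_comb; lra.
split.
- by move=> t'; rewrite !inE => /orP[]/eqP->; split=> //; apply/in3; split=> //;
    apply: inT_mem; rewrite !inE eqxx ?orbT.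
- split=> // t'; rewrite inE => /eqP->.
  have [[p0 p1 p2] [[q0 q1 q2] [s0 s1 s2]]] := kbE n.
  set A := k1 _ in q0 q1 q2; set B := k2 _ in s0 s1 s2.
  (* This functional vanishes at [v] and at [z]: its zero line carries the cut. Its sign also
     decides below which half contains a given point. *)
  pose k := ((r * A.1.1 - (1 - r) * B.1.1, r * A.1.2 - (1 - r) * B.1.2),
             r * A.2 - (1 - r) * B.2) : pt R * R.
  have kE w : af k w = r * af A w - (1 - r) * af B w by rewrite /af /k /=; ring.
  have kv : af k v = 0 by rewrite kE q0 s0 !mulr0 subr0.
  have kx : af k x = r by rewrite kE q1 s1 mulr0 subr0 mulr1.
  have ky : af k y = - (1 - r) by rewrite kE q2 s2 mulr0 mulr1 sub0r.
  have kz : af k z = 0 by rewrite zE af_lerp kx ky; ring.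
  exists k; split.
  + apply: contraTneq r0 => k0E; have: af k x = af k v by rewrite /af k0E /= !mul0r.
    by rewrite kx kv => ->; rewrite ltxx.
  + by apply/nneg3; rewrite /= kv kx kz; split=> //; apply: ltW.
  + by apply/nneg3; rewrite /= !af_opk kv ky kz oppr0 opprK; split=> //; apply: ltW.
- move=> w /(inTP _ n); set l0 := af _ w; set l1 := af _ w; set l2 := af _ w.
  move=> [p0 p1 p2]; have := kb_sum w n; have := kb_comb w n.
  rewrite -/l0 -/l1 -/l2 => wE sE.
  have [h|h] := leP (l1 * r) ((1 - r) * l2).
    exists (v, z, y); first by rewrite !inE eqxx orbT.
    have -> : w = comb l0 (l1 / (1 - r)) (l2 - l1 * r / (1 - r)) (v, z, y).
      rewrite [LHS]wE zE /comb /lerp /=; congr (_, _); field; exact: lt0r_neq0.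
    apply: inT_comb => //; first by rewrite divr_ge0// ltW.
      by rewrite subr_ge0 ler_pdivrMr// [l2 * _]mulrC.
    by rewrite -[RHS]sE; field; exact: lt0r_neq0.
  exists (v, x, z); first by rewrite !inE eqxx.
  have -> : w = comb l0 (l1 - l2 * (1 - r) / r) (l2 / r) (v, x, z).
    rewrite [LHS]wE zE /comb /lerp /=; congr (_, _); field; exact: lt0r_neq0.
  apply: inT_comb => //; last by rewrite -[RHS]sE; field; exact: lt0r_neq0.
    by rewrite subr_ge0 ler_pdivrMr// [l2 * _]mulrC ltW.
  by rewrite divr_ge0// ltW.
Qed.

End RawTriangles.

(** * Cutting along lines and red refinement *)

Section Subdivision.
Variable R : realType.
Implicit Types (x y z v w a b c : pt R) (t u : tri R) (k : pt R * R) (s : seq (tri R)).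

Lemma mem_verts x a b c : (x \in verts (a, b, c)) = [|| x == a, x == b | x == c].
Proof. by rewrite /verts /= !inE. Qed.

Lemma bisect_edge t x y z : nd t -> x \in verts t -> y \in verts t -> x != y ->
  onE z x y -> exists v, [/\ nd (v, x, y), verts t =i [:: v; x; y] &
    dis t [:: (v, x, z); (v, z, y)]].
Proof.
move=> n xt yt xy zE; have [v [n' e]] := edge_view n xt yt xy.
by exists v; split=> //; apply: (@dis_eqi _ t (v, x, y) _ e); apply: dis_bisect.
Qed.

Definition unif k t := nneg k (verts t) \/ nneg (opk k) (verts t).

Lemma unif_or k t :
  unif k t \/ exists y z, [/\ y \in verts t, z \in verts t & af k y < 0 < af k z].
Proof.
have [h|/existsNP[y /not_implyP[yt /negP]]] := pselect (nneg k (verts t)).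
  by left; left.
rewrite -ltNge => ky.
have [h|/existsNP[z /not_implyP[zt /negP]]] := pselect (nneg (opk k) (verts t)).
  by left; right.
rewrite af_opk oppr_ge0 -ltNge => kz; right; exists y, z; split=> //.
by rewrite ky.
Qed.

Lemma zero_pt k y z : af k y < 0 < af k z -> exists2 w, onE w y z & af k w = 0.
Proof.
move=> /andP[ky kz]; pose r := af k y / (af k y - af k z).
have d0 : af k y - af k z < 0 by lra.
have r0 : 0 < r by rewrite /r -mulrNN mulr_gt0 ?oppr_gt0 ?invr_lt0.
have r1 : r < 1.
  by rewrite /r ltr_ndivrMr// mul1r; lra.
exists (lerp r y z); first by exists r; rewrite ?r0.
by rewrite af_lerp /r; field; exact: ltr0_neq0.
Qed.

Lemma unif_sub k t t' : sub t' t -> unif k t -> unif k t'.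
Proof. by move=> s' [h|h]; [left|right] => x /s'; apply. Qed.

Lemma cut0 k t x : nd t -> x \in verts t -> af k x = 0 ->
  exists cs, [/\ dis t cs, (size cs <= 2)%N & forall u, u \in cs -> unif k u].
Proof.
move=> n xt kx; have [h|[y [z [yt zt kyz]]]] := unif_or k t.
  by exists [:: t]; split=> //; [exact: dis1|move=> u; rewrite inE => /eqP->].
have [w wE kw] := zero_pt kyz; have /andP[ky kz] := kyz.
have yz : y != z by apply: contraTneq ky => ->; rewrite -leNgt ltW.
have [v [n' e d]] := bisect_edge n yt zt yz wE.
exists [:: (v, y, w); (v, w, z)]; split=> // u.
have kv : af k v = 0.
  move: xt; rewrite e !inE => /or3P[]/eqP xE; move: kx; rewrite xE //.
    by move=> k0; move: ky; rewrite k0 ltxx.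
  by move=> k0; move: kz; rewrite k0 ltxx.
rewrite !inE => /orP[]/eqP->; [right|left]; apply/nneg3; rewrite ?af_opk /= kv kw.
  by rewrite oppr0; split=> //; rewrite oppr_ge0 ltW.
by split=> //; rewrite ltW.
Qed.

Lemma size_flatten_le (T S : eqType) (l : seq T) (f : T -> seq S) n :
  (forall i, i \in l -> (size (f i) <= n)%N) ->
  (size (flatten [seq f i | i <- l]) <= n * size l)%N.
Proof.
elim: l => [|i l IH] H //=; rewrite size_cat mulnS leq_add ?H ?mem_head//.
by apply: IH => j jl; apply: H; rewrite inE jl orbT.
Qed.

(** Bisecting at a zero of [k] on an edge makes that zero a vertex of both halves, and a line
    through a vertex cuts a triangle into at most two ([cut0]). *)
Lemma cut k t : nd t ->
  exists cs, [/\ dis t cs, (size cs <= 4)%N & forall u, u \in cs -> unif k u].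
Proof.
move=> n; have [h|[y [z [yt zt kyz]]]] := unif_or k t.
  by exists [:: t]; split=> //; [exact: dis1|move=> u; rewrite inE => /eqP->].
have [w wE kw] := zero_pt kyz; have /andP[ky kz] := kyz.
have yz : y != z by apply: contraTneq ky => ->; rewrite -leNgt ltW.
have [v [n' e d]] := bisect_edge n yt zt yz wE.
have /choose_list[f Hf] : forall u, u \in [:: (v, y, w); (v, w, z)] ->
    exists g : seq (tri R),
    [/\ dis u g, (size g <= 2)%N & forall u', u' \in g -> unif k u'].
  move=> u us; have [H _ _] := d; have [nu _] := H _ us.
  apply: (cut0 nu _ kw).
  by move: us; rewrite !inE => /orP[]/eqP-> /=; rewrite eqxx ?orbT.
exists (flatten [seq f u | u <- [:: (v, y, w); (v, w, z)]]); split.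
- by apply: dis_flatten => // u /Hf[].
- by apply: (leq_trans (size_flatten_le (n := 2) _)) => // u /Hf[].
- by move=> u /flatten_mapP[u' /Hf[_ _ H]]; apply: H.
Qed.

Lemma cuts (l : seq (pt R * R)) t : nd t ->
  exists cs, [/\ dis t cs, (size cs <= 4 ^ size l)%N &
    forall u, u \in cs -> forall k, k \in l -> unif k u].
Proof.
move=> n; elim: l => [|k l [cs [d sc uc]]]; first by exists [:: t]; split=> //; apply: dis1.
have /choose_list[f Hf] : forall u, u \in cs -> exists g : seq (tri R),
    [/\ dis u g, (size g <= 4)%N & forall u', u' \in g -> unif k u'].
  by move=> u us; apply: cut; have [H _ _] := d; have [] := H _ us.
exists (flatten [seq f u | u <- cs]); split.
- by apply: dis_flatten => // u /Hf[].
- apply: (leq_trans (size_flatten_le (n := 4) _)) => [u /Hf[]//|].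
  by rewrite expnS leq_mul2l sc orbT.
- move=> u /flatten_mapP[u' u'c uf] k'; have [du _ H] := Hf _ u'c.
  rewrite inE => /orP[/eqP->|k'l]; first exact: H.
  by apply: unif_sub (uc _ u'c _ k'l); case: du => du _ _; have [] := du _ uf.
Qed.

Definition mid a b : pt R := lerp (2^-1) a b.

(** Red refinement: the cuts are the lines where a barycentric coordinate is 1/2. A point with a
    coordinate at least 1/2 lies in that corner, any other point in the medial triangle. *)
Lemma red t : nd t -> let: (a, b, c) := t in
  dis t [:: (a, mid a b, mid a c); (b, mid a b, mid b c); (c, mid a c, mid b c);
            (mid b c, mid a c, mid a b)].
Proof.
case: t => -[a b] c n.
have [[a0 b0 c0] [[a1 b1 c1] [a2 b2 c2]]] := kbE n.
pose hk k : pt R * R := (k.1, k.2 - 2^-1).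
have hkE k x : af (hk k) x = af k x - 2^-1 by rewrite /af /hk /=; ring.
have hk0 k x y : af k x = 0 -> af k y = 1 -> (hk k).1 != 0.
  move=> kx ky; apply: contraTneq (@oner_neq0 R) => k00.
  have : af (hk k) x = af (hk k) y by rewrite /af k00 /= !mul0r.
  by rewrite !hkE kx ky => /addIr <-; rewrite eqxx.
have mE k x y : af k (mid x y) = 2^-1 * (af k x + af k y).
  by rewrite /mid af_lerp; lra.
have sm x y : inT (a, b, c) x -> inT (a, b, c) y -> inT (a, b, c) (mid x y).
  move=> tx ty k /[dup] /tx kx /ty ky; rewrite mE mulr_ge0// addr_ge0//.
have ta : inT (a, b, c) a by apply: inT_mem; rewrite !inE eqxx.
have tb : inT (a, b, c) b by apply: inT_mem; rewrite !inE eqxx orbT.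
have tc : inT (a, b, c) c by apply: inT_mem; rewrite !inE eqxx !orbT.
move: (n); rewrite /nd /= => n'.
split.
- move=> t'; rewrite !inE => /or4P[]/eqP->; (split; last by apply/in3; split=> /=;
    first [assumption|exact: sm]);
  rewrite /nd /=.
  + rewrite (_ : cr _ _ _ = 4^-1 * cr a b c) ?mulf_neq0 ?invr_eq0//.
    by rewrite /cr /mid /lerp /=; field.
  + rewrite (_ : cr _ _ _ = - 4^-1 * cr a b c) ?mulf_neq0 ?oppr_eq0 ?invr_eq0//.
    by rewrite /cr /mid /lerp /=; field.
  + rewrite (_ : cr _ _ _ = 4^-1 * cr a b c) ?mulf_neq0 ?invr_eq0//.
    by rewrite /cr /mid /lerp /=; field.
  + rewrite (_ : cr _ _ _ = 4^-1 * cr a b c) ?mulf_neq0 ?invr_eq0//.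
    by rewrite /cr /mid /lerp /=; field.
- split; [|split; [|split; [|by split]]] => t'; rewrite !inE.
  + move=> H; exists (hk (k0 (a, b, c))); split; first exact: hk0 b0 a0.
      by apply/nneg3; rewrite /= !hkE !mE a0 b0 c0; split; lra.
    by case/or3P: H => /eqP->; apply/nneg3; rewrite !af_opk !hkE !mE a0 b0 c0;
      split; lra.
  + move=> H; exists (hk (k1 (a, b, c))); split; first exact: hk0 a1 b1.
      by apply/nneg3; rewrite /= !hkE !mE a1 b1 c1; split; lra.
    by case/orP: H => /eqP->; apply/nneg3; rewrite !af_opk !hkE !mE a1 b1 c1;
      split; lra.
  + move=> /eqP->; exists (hk (k2 (a, b, c))); split; first exact: hk0 a2 c2.
      by apply/nneg3; rewrite /= !hkE !mE a2 b2 c2; split; lra.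
    by apply/nneg3; rewrite !af_opk !hkE !mE a2 b2 c2; split; lra.
- move=> w /(inTP _ n); have := kb_sum w n; have := kb_comb w n.
  set l0 := af _ w; set l1 := af _ w; set l2 := af _ w => wE sE [p0 p1 p2].
  have [h0|h0] := leP 2^-1 l0.
    exists (a, mid a b, mid a c); first by rewrite !inE eqxx.
    have -> : w = comb (2 * l0 - 1) (2 * l1) (2 * l2) (a, mid a b, mid a c).
      rewrite [LHS]wE /comb /mid /lerp /=; congr (_, _).
        by rewrite (_ : l0 = 1 - l1 - l2); [field|rewrite -sE; ring].
      by rewrite (_ : l0 = 1 - l1 - l2); [field|rewrite -sE; ring].
    by apply: inT_comb; clear -sE p0 p1 p2 h0; lra.
  have [h1|h1] := leP 2^-1 l1.
    exists (b, mid a b, mid b c); first by rewrite !inE eqxx orbT.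
    have -> : w = comb (2 * l1 - 1) (2 * l0) (2 * l2) (b, mid a b, mid b c).
      rewrite [LHS]wE /comb /mid /lerp /=; congr (_, _).
        by rewrite (_ : l0 = 1 - l1 - l2); [field|rewrite -sE; ring].
      by rewrite (_ : l0 = 1 - l1 - l2); [field|rewrite -sE; ring].
    by apply: inT_comb; clear -sE p0 p1 p2 h1; lra.
  have [h2|h2] := leP 2^-1 l2.
    exists (c, mid a c, mid b c); first by rewrite !inE eqxx !orbT.
    have -> : w = comb (2 * l2 - 1) (2 * l0) (2 * l1) (c, mid a c, mid b c).
      rewrite [LHS]wE /comb /mid /lerp /=; congr (_, _).
        by rewrite (_ : l0 = 1 - l1 - l2); [field|rewrite -sE; ring].
      by rewrite (_ : l0 = 1 - l1 - l2); [field|rewrite -sE; ring].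
    by apply: inT_comb; clear -sE p0 p1 p2 h2; lra.
  exists (mid b c, mid a c, mid a b); first by rewrite !inE eqxx !orbT.
  have -> : w = comb (1 - 2 * l0) (1 - 2 * l1) (1 - 2 * l2)
                     (mid b c, mid a c, mid a b).
    rewrite [LHS]wE /comb /mid /lerp /=; congr (_, _).
      by rewrite (_ : l0 = 1 - l1 - l2); [field|rewrite -sE; ring].
    by rewrite (_ : l0 = 1 - l1 - l2); [field|rewrite -sE; ring].
  by apply: inT_comb; clear -sE p0 p1 p2 h0 h1 h2; lra.
Qed.

Lemma spread_corner (d p q r x y : R) : `|p - q| <= d -> `|q - r| <= d -> `|p - r| <= d ->
  x \in [:: p; (1 - 2^-1) * p + 2^-1 * q; (1 - 2^-1) * p + 2^-1 * r] ->
  y \in [:: p; (1 - 2^-1) * p + 2^-1 * q; (1 - 2^-1) * p + 2^-1 * r] -> `|x - y| <= d / 2.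
Proof.
rewrite !ler_norml => /andP[? ?] /andP[? ?] /andP[? ?].
by rewrite !inE => /or3P[]/eqP-> /or3P[]/eqP->; apply/andP; split; lra.
Qed.

Lemma spread_medial (d p q r x y : R) : `|p - q| <= d -> `|q - r| <= d -> `|p - r| <= d ->
  x \in [:: (1 - 2^-1) * q + 2^-1 * r; (1 - 2^-1) * p + 2^-1 * r; (1 - 2^-1) * p + 2^-1 * q] ->
  y \in [:: (1 - 2^-1) * q + 2^-1 * r; (1 - 2^-1) * p + 2^-1 * r; (1 - 2^-1) * p + 2^-1 * q] ->
  `|x - y| <= d / 2.
Proof.
rewrite !ler_norml => /andP[? ?] /andP[? ?] /andP[? ?].
by rewrite !inE => /or3P[]/eqP-> /or3P[]/eqP->; apply/andP; split; lra.
Qed.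

Lemma wide_red d a b c t : wide d (a, b, c) ->
  t \in [:: (a, mid a b, mid a c); (b, mid a b, mid b c); (c, mid a c, mid b c);
            (mid b c, mid a c, mid a b)] -> wide (d / 2) t.
Proof.
move=> W.
have av : a \in verts (a, b, c) by rewrite !inE eqxx.
have bv : b \in verts (a, b, c) by rewrite !inE eqxx orbT.
have cv : c \in verts (a, b, c) by rewrite !inE eqxx !orbT.
have [ab1 ab2] := W _ _ av bv; have [bc1 bc2] := W _ _ bv cv.
have [ac1 ac2] := W _ _ av cv; have [aa _] := W _ _ av av.
have d0 : 0 <= d by apply: le_trans aa.
have midC (x y : pt R) : mid x y = mid y x by rewrite /mid /lerp; congr (_, _); clear; lra.
have W' (f : pt R -> R) (x y z : pt R) : (x, y, z) \in [:: (a, b, c); (b, a, c); (c, a, b)] ->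
    (f = fst \/ f = snd) -> [/\ `|f x - f y| <= d, `|f y - f z| <= d & `|f x - f z| <= d].
  rewrite !inE => /or3P[]/eqP[-> -> ->] [->|->]; split=> //; by rewrite distrC.
rewrite !inE => /or4P[]/eqP-> x y xv yv.
- split; [have [h1 h2 h3] := W' fst a b c (mem_head _ _) (or_introl erefl)
         |have [h1 h2 h3] := W' snd a b c (mem_head _ _) (or_intror erefl)];
  apply: (spread_corner h1 h2 h3); [exact: map_f xv|exact: map_f yv|exact: map_f xv|exact: map_f yv].
- have m : (b, a, c) \in [:: (a, b, c); (b, a, c); (c, a, b)] by rewrite !inE eqxx orbT.
  rewrite (midC a) in xv yv.
  split; [have [h1 h2 h3] := W' fst b a c m (or_introl erefl)
         |have [h1 h2 h3] := W' snd b a c m (or_intror erefl)];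
  apply: (spread_corner h1 h2 h3); [exact: map_f xv|exact: map_f yv|exact: map_f xv|exact: map_f yv].
- have m : (c, a, b) \in [:: (a, b, c); (b, a, c); (c, a, b)] by rewrite !inE eqxx !orbT.
  rewrite (midC a) (midC b) in xv yv.
  split; [have [h1 h2 h3] := W' fst c a b m (or_introl erefl)
         |have [h1 h2 h3] := W' snd c a b m (or_intror erefl)];
  apply: (spread_corner h1 h2 h3); [exact: map_f xv|exact: map_f yv|exact: map_f xv|exact: map_f yv].
- split; [have [h1 h2 h3] := W' fst a b c (mem_head _ _) (or_introl erefl)
         |have [h1 h2 h3] := W' snd a b c (mem_head _ _) (or_intror erefl)];
  apply: (spread_medial h1 h2 h3); [exact: map_f xv|exact: map_f yv|exact: map_f xv|exact: map_f yv].
Qed.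

Lemma subdiv r d t : nd t -> wide d t ->
  exists cs, [/\ dis t cs, (size cs <= 4 ^ r)%N &
    forall u, u \in cs -> wide (d / 2 ^+ r) u].
Proof.
move=> n w; elim: r => [|r [cs [dc sc wc]]].
  by exists [:: t]; split=> //; [exact: dis1|
    move=> u; rewrite inE => /eqP->; rewrite expr0 divr1].
have /choose_list[f Hf] : forall u, u \in cs -> exists g : seq (tri R),
    [/\ dis u g, (size g <= 4)%N & forall u', u' \in g -> wide (d / 2 ^+ r.+1) u'].
  move=> u us; have [H _ _] := dc; have [nu _] := H _ us.
  have := wc _ us; have := red nu; case: u us {nu} => -[a b] c us dr wr.
  eexists; split; first exact: dr; first by [].
  by move=> u' /(wide_red wr); rewrite exprS [2 * _]mulrC invfM mulrA mulrAC.
exists (flatten [seq f u | u <- cs]); split.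
- by apply: dis_flatten => // u /Hf[].
- apply: (leq_trans (size_flatten_le (n := 4) _)) => [u /Hf[]//|].
  by rewrite expnS leq_mul2l sc orbT.
- by move=> u /flatten_mapP[u' u'c uf]; have [_ _ H] := Hf _ u'c; apply: H.
Qed.

End Subdivision.

(** * Hanging vertices *)

Section Hanging.
Variable R : realType.
Implicit Types (t : tri R) (k : pt R * R).

Lemma vert_view t (x : pt R) : nd t -> x \in verts t ->
  exists y z, [/\ nd (x, y, z), verts t =i [:: x; y; z], y != z,
    y \in verts t & z \in verts t].
Proof.
case: t => -[a b] c n; have nab : a != b.
  by apply: contraNneq n => ->; apply/eqP; rewrite /cr /=; ring.
have nbc : b != c.
  by apply: contraNneq n => ->; apply/eqP; rewrite /cr /=; ring.
have nac : a != c.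
  by apply: contraNneq n => ->; apply/eqP; rewrite /cr /=; ring.
have av : a \in verts (a, b, c) by rewrite mem_verts eqxx.
have bv : b \in verts (a, b, c) by rewrite mem_verts eqxx orbT.
have cv : c \in verts (a, b, c) by rewrite mem_verts eqxx !orbT.
rewrite mem_verts => /or3P[]/eqP->.
- have [v [n' e]] := edge_view n bv cv nbc.
  exists b, c; split=> //.
- exists a, c; split=> //; last by move=> w; rewrite mem_verts !inE orbCA.
  by move: n; rewrite /nd /= => n; rewrite (_ : cr _ _ _ = - cr a b c) ?oppr_eq0// /cr; ring.
- exists a, b; split=> //; last by move=> w; rewrite mem_verts !inE orbA orbC.
  by move: n; rewrite /nd /= => n; rewrite (_ : cr _ _ _ = cr a b c)// /cr; ring.
Qed.

Lemma af_const t k : nd t -> (forall x, x \in verts t -> af k x = 0) -> k.1 = 0.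
Proof.
case: t => -[a b] c n H.
have kE x : af k x = 0.
  by rewrite (af_ext k x n) /= !H ?mulr0 ?addr0// mem_verts eqxx ?orbT.
have e0 := kE (0, 0); have e1 := kE (1, 0); have e2 := kE (0, 1).
move: e0 e1 e2; case: k {H kE} => -[k1 k2] k3; rewrite /af /=.
rewrite !mulr0 !mulr1 !add0r !addr0 => ->; rewrite !addr0 => -> ->.
by [].
Qed.

(** A vertex is an extreme point: its own coordinate equals 1 there and is at most 1 on [s], so both
    ends of an open edge of [s] through [z] would have coordinate 1 and coincide with [z]. *)
Lemma not_hang_self t s (z : pt R) : nd t -> sub s t -> z \in verts t -> ~ hang z s.
Proof.
move=> n st /(vert_view n)[x [y [n' e xy _ _]]] [p [q [ps qs pq [r /andP[r0 r1] zE]]]].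
have T w : inT t w -> inT (z, x, y) w.
  by apply: inT_sub => v; rewrite e => h; apply: inT_mem.
have [[a0 b0 c0] [_ _]] := kbE n'.
have tp := T _ (st _ ps); have tq := T _ (st _ qs).
have [p0 p1 p2] := (inTP p n').1 tp; have [q0 q1 q2] := (inTP q n').1 tq.
have sp := kb_sum p n'; have sq := kb_sum q n'.
have : af (k0 (z, x, y)) z = 1 by [].
rewrite {2}zE af_lerp => e1.
set A := af (k0 _) p in p0 sp e1; set B := af (k0 _) q in q0 sq e1.
have A1 : A <= 1 by lra.
have B1 : B <= 1 by lra.
have Ae : A = 1 by nra.
have Be : B = 1 by nra.
move/eqP: pq; apply.
have zeq w : inT (z, x, y) w -> af (k0 (z, x, y)) w = 1 -> w = z.
  move=> /(inTP w n')[w0 w1 w2] we; rewrite (kb_comb w n').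
  have := kb_sum w n'; rewrite we => sw.
  have -> : af (k1 (z, x, y)) w = 0 by lra.
  have -> : af (k2 (z, x, y)) w = 0 by lra.
  by rewrite /comb /= !mul1r !mul0r !addr0; case: (z).
by rewrite (zeq p)// (zeq q).
Qed.

(** In the barycentric expansion of [af k z] every term is nonnegative, so [z] has coordinate zero
    at each vertex where [k] is positive, and there is such a vertex. *)
Lemma face t k (z : pt R) : nd t -> k.1 != 0 -> nneg k (verts t) -> inT t z -> af k z = 0 ->
  z \in verts t \/ exists x y, [/\ x \in verts t, y \in verts t, x != y,
    onE z x y & af k x = 0 /\ af k y = 0].
Proof.
move=> n kn kt tz kz.
have [w wt kw] : exists2 w, w \in verts t & 0 < af k w.
  apply: contrapT => H; move/eqP: kn; apply; apply: (af_const n) => x xt.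
  have := kt _ xt; rewrite le_eqVlt => /orP[/eqP//|h].
  by exfalso; apply: H; exists x.
have [x [y [n' e xy xt yt]]] := vert_view n wt.
have tz' : inT (w, x, y) z.
  by apply: inT_sub tz => v; rewrite e => h; apply: inT_mem.
have [z0 z1 z2] := (inTP z n').1 tz'; have sz := kb_sum z n'.
have := af_ext k z n'; rewrite kz /= => E.
have kx := kt _ xt; have ky := kt _ yt; have zE := kb_comb z n'.
set l0 := af (k0 _) z in z0 sz E zE; set l1 := af (k1 _) z in z1 sz E zE.
set l2 := af (k2 _) z in z2 sz E zE.
have h0 : 0 <= l0 * af k w by rewrite mulr_ge0// ltW.
have h1 : 0 <= l1 * af k x by rewrite mulr_ge0.
have h2 : 0 <= l2 * af k y by rewrite mulr_ge0.
have l00 : l0 = 0.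
  have /eqP : l0 * af k w = 0 by lra.
  by rewrite mulf_eq0 (gt_eqF kw) orbF => /eqP.
rewrite l00 add0r in sz.
have [l10|l10] := eqVneq l1 0.
  left; rewrite zE l00 l10 (_ : l2 = 1); last by lra.
  by rewrite /comb /= !mul0r !mul1r !add0r; case: (y) yt.
have [l20|l20] := eqVneq l2 0.
  left; rewrite zE l00 l20 (_ : l1 = 1); last by lra.
  by rewrite /comb /= !mul0r !mul1r !add0r !addr0; case: (x) xt.
right; exists x, y; split=> //.
  have p1 : 0 < l1 by rewrite lt0r l10.
  have p2 : 0 < l2 by rewrite lt0r l20.
  exists l2; first by apply/andP; split; lra.
  by rewrite zE l00 /comb /lerp /= !mul0r !add0r (_ : l1 = 1 - l2)//; lra.
split; first by apply/eqP; have /eqP : l1 * af k x = 0 by [lra];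
  rewrite mulf_eq0 (negPf l10).
by apply/eqP; have /eqP : l2 * af k y = 0 by [lra]; rewrite mulf_eq0 (negPf l20).
Qed.

Lemma sep_hang t t' (z : pt R) : nd t -> sep t t' -> z \in verts t' -> inT t z ->
  z \in verts t \/ hang z t.
Proof.
move=> n [k [k0 kt kt']] zt' tz.
have kz : af k z = 0.
  apply/eqP; rewrite eq_le (tz _ kt) andbT -oppr_ge0 -af_opk; exact: kt'.
have [|[x [y [xt yt xy zE _]]]] := face n k0 kt tz kz; first by left.
by right; exists x, y.
Qed.

Lemma count_split (T : eqType) (a1 a2 a3 : pred T) (z : T) (l : seq T) :
  (forall x, x \in l -> (a1 x + a2 x + (x == z) <= a3 x)%N) -> z \in l ->
  (count a1 l + count a2 l < count a3 l)%N.
Proof.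
move=> H zl; have : (0 < count (pred1 z) l)%N by rewrite -has_count has_pred1.
suff : (count a1 l + count a2 l + count (pred1 z) l <= count a3 l)%N by lia.
elim: l H {zl} => // x l IH H /=.
have := H x (mem_head _ _); have := IH (fun y yl => H y (mem_behead (s := x :: l) yl)).
by lia.
Qed.

Definition hangs t : pred (pt R) := fun z => `[< hang z t >].

(** Bisect from the opposite vertex at a hanging point [z] and recurse. Points of [V] in [t] are all
    on its boundary, so the new edge carries none of them in its interior and no vertex outside [V]
    is created. *)
Lemma close_tri (V : seq (pt R)) t : nd t -> {subset verts t <= V} ->
  (forall z, z \in V -> inT t z -> z \in verts t \/ hang z t) ->
  exists c : seq (tri R), [/\ dis t c, forall t', t' \in c -> {subset verts t' <= V},
    forall t' z, t' \in c -> z \in V -> ~ hang z t',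
    (size c <= (count (hangs t) V).+1)%N &
    ((forall z, z \in V -> ~ hang z t) -> c = [:: t])].
Proof.
have [m] := ubnP (count (hangs t) V); elim: m t => // m IH t hm n tV intV.
have [/hasP[z zV /asboolP hz]|/hasPn nh] := boolP (has (hangs t) V); last first.
  exists [:: t]; split=> //; first exact: dis1.
  + by move=> t'; rewrite inE => /eqP->.
  + by move=> t' z; rewrite inE => /eqP-> /nh /negP h; apply: contra_not h => /asboolP.
have [x [y [xt yt xy zE]]] := hz.
have [v [n' e d]] := bisect_edge n xt yt xy zE.
have eT w : inT t w -> inT (v, x, y) w.
  by apply: inT_sub => u; rewrite e => h; apply: inT_mem.
have [r /andP[r0 r1] zr] := zE.
have [[a0 b0 c0] [[a1 b1 c1] [a2 b2 c2]]] := kbE n'.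
rewrite /= in a0 b0 c0 a1 b1 c1 a2 b2 c2.
have z0 : af (k0 (v, x, y)) z = 0 by rewrite zr af_lerp b0 c0 !mulr0 addr0.
have z1 : af (k1 (v, x, y)) z = 1 - r by rewrite zr af_lerp b1 c1; ring.
have z2 : af (k2 (v, x, y)) z = r by rewrite zr af_lerp b2 c2; ring.
have [dn dp _] := d.
have [n1 s1] : nd (v, x, z) /\ sub (v, x, z) t by apply: dn; rewrite mem_head.
have [n2 s2] : nd (v, z, y) /\ sub (v, z, y) t by apply: dn; rewrite !inE eqxx orbT.
have vV : v \in V by apply: tV; rewrite e mem_head.
have xV : x \in V by apply: tV.
have yV : y \in V by apply: tV.
have kneq k p q : af k p = 0 -> af k q = 1 -> k.1 != 0.
  move=> kp kq; apply: contraTneq (@oner_neq0 R) => k00.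
  have : af k p = af k q by rewrite /af k00 /= !mul0r.
  by rewrite kp kq => <-; rewrite eqxx.
(* Points of [V] in [t] lie on a side, which both halves inherit as hypothesis of the recursion. *)
have bary0 w : w \in V -> inT t w ->
    [\/ af (k0 (v, x, y)) w = 0, af (k1 (v, x, y)) w = 0 | af (k2 (v, x, y)) w = 0].
  move=> wV tw; case: (intV w wV tw) => [|[p [q [pt' qt' pq [rho _ wE]]]]].
    rewrite e !inE => /or3P[]/eqP->; rewrite ?b0 ?a1 ?b2.
    - by constructor 2. - by constructor 1. - by rewrite c0; constructor 1.
  move: pt' qt' pq; rewrite !e !inE wE !af_lerp => /or3P[]/eqP-> /or3P[]/eqP->;
    rewrite ?eqxx// => _.
  - by constructor 3; rewrite a2 b2 !mulr0 addr0.
  - by constructor 2; rewrite a1 c1 !mulr0 addr0.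
  - by constructor 3; rewrite a2 b2 !mulr0 addr0.
  - by constructor 1; rewrite b0 c0 !mulr0 addr0.
  - by constructor 2; rewrite a1 c1 !mulr0 addr0.
  - by constructor 1; rewrite b0 c0 !mulr0 addr0.
have int' t' : nd t' -> sub t' t -> forall w, w \in V -> inT t' w ->
    w \in verts t' \/ hang w t'.
  move=> nt' st' w wV tw; have tw' : inT t w by apply: inT_sub tw.
  have st'' : sub t' (v, x, y) by move=> u /st' /eT.
  have F k p q : af k p = 0 -> af k q = 1 -> nneg k (verts (v, x, y)) ->
      af k w = 0 -> w \in verts t' \/ hang w t'.
    move=> kp kq kn kw.
    have [|[p' [q' [? ? ? ? _]]]] := face nt' (kneq _ _ _ kp kq)
      (nneg_sub st'' kn) tw kw; first by left.
    by right; exists p', q'.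
  case: (bary0 w wV tw').
  - by apply: (F _ x v) => //; apply/nneg3; rewrite /= a0 b0 c0.
  - by apply: (F _ v x) => //; apply/nneg3; rewrite /= a1 b1 c1.
  - by apply: (F _ v y) => //; apply/nneg3; rewrite /= a2 b2 c2.
(* [K] vanishes on the cut and takes opposite signs on the two halves, so no point hangs in both. *)
pose K w := r * af (k1 (v, x, y)) w - (1 - r) * af (k2 (v, x, y)) w.
have nvz w : w \in V -> inT t w -> ~ onE w v z.
  move=> wV tw [rho /andP[h0 h1] wE]; have := bary0 w wV tw.
  rewrite wE !af_lerp a0 a1 a2 z0 z1 z2 => -[] /eqP.
  + by rewrite mulr1 mulr0 addr0 subr_eq0 => /eqP h; move: h1; rewrite h ltxx.
  + rewrite mulr0 add0r mulf_eq0 subr_eq0 => /orP[]/eqP h.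
      by move: h0; rewrite h ltxx.
    by move: r1; rewrite h ltxx.
  + rewrite mulr0 add0r mulf_eq0 => /orP[]/eqP h.
      by move: h0; rewrite h ltxx.
    by move: r0; rewrite h ltxx.
have onEC w p q : onE w p q -> onE w q p.
  move=> [rho /andP[h0 h1] ->]; exists (1 - rho); first by clear -h0 h1; apply/andP; split; lra.
  by rewrite /lerp; congr (_, _); ring.
have Kl rho p q : K (lerp rho p q) = (1 - rho) * K p + rho * K q.
  by rewrite /K !af_lerp; ring.
have Kv : K v = 0 by rewrite /K a1 a2; ring.
have Kz : K z = 0 by rewrite /K z1 z2; ring.
have Kx : K x = r by rewrite /K b1 b2; ring.
have Ky : K y = - (1 - r) by rewrite /K c1 c2; ring.
have inh t' w : sub t' t -> hang w t' -> inT t w.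
  move=> st' [p [q [pt' qt' _ [rho /andP[h0 h1] ->]]]] k kt.
  rewrite af_lerp addr_ge0// mulr_ge0 ?subr_ge0 ?(ltW h0) ?(ltW h1)//.
    exact: (st' _ pt' k kt).
  exact: (st' _ qt' k kt).
have K1 w : w \in V -> hang w (v, x, z) -> 0 < K w.
  move=> wV /[dup] /(inh _ _ s1) tw [p [q [+ + + wE]]]; have nv := nvz w wV tw.
  move: (wE) => [rho /andP[h0 h1] wr]; rewrite !mem_verts wr Kl.
  move=> /or3P[]/eqP E1 /or3P[]/eqP E2;
    rewrite E1 E2 ?eqxx// ?Kv ?Kz ?Kx => _; try (by clear -r0 r1 h0 h1; nra).
    by case: nv; rewrite E1 E2 in wE.
  by case: nv; rewrite E1 E2 in wE; apply: onEC.
have K2 w : w \in V -> hang w (v, z, y) -> K w < 0.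
  move=> wV /[dup] /(inh _ _ s2) tw [p [q [+ + + wE]]]; have nv := nvz w wV tw.
  move: (wE) => [rho /andP[h0 h1] wr]; rewrite !mem_verts wr Kl.
  move=> /or3P[]/eqP E1 /or3P[]/eqP E2;
    rewrite E1 E2 ?eqxx// ?Kv ?Kz ?Ky => _; try (by clear -r0 r1 h0 h1; nra).
    by case: nv; rewrite E1 E2 in wE.
  by case: nv; rewrite E1 E2 in wE; apply: onEC.
have hsub t' w : sub t' t -> w \in V -> hang w t' -> hang w t.
  move=> st' wV h; have [wt|//] := intV w wV (inh _ _ st' h).
  by case: (not_hang_self n st' wt).
(* The point [z] hangs in [t] and has become a vertex of both halves; hence the strict inequality,
   which gives both termination and the bound on the number of pieces. *)
have cnt : (count (hangs (v, x, z)) V + count (hangs (v, z, y)) V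
            < count (hangs t) V)%N.
  apply: (@count_split _ _ _ _ z) => // w wV; have [->|_] := eqVneq w z.
    rewrite /hangs asboolF; last first.
      by apply: (not_hang_self n1 (@sub_refl R _)); rewrite mem_verts eqxx !orbT.
    rewrite asboolF; last first.
      by apply: (not_hang_self n2 (@sub_refl R _)); rewrite mem_verts eqxx !orbT.
    by rewrite asboolT.
  rewrite addn0 /hangs; case: (asboolP (hang w (v, x, z))) => h1.
    rewrite (asboolT (hsub _ _ s1 wV h1)) asboolF// => /(K2 _ wV).
    by rewrite ltNge (ltW (K1 _ wV h1)).
  by case: asboolP => // h2; rewrite (asboolT (hsub _ _ s2 wV h2)).
have zV' : {subset verts (v, x, z) <= V}.
  by move=> w; rewrite mem_verts => /or3P[]/eqP->.
have zV'' : {subset verts (v, z, y) <= V}.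
  by move=> w; rewrite mem_verts => /or3P[]/eqP->.
have m1 : (count (hangs (v, x, z)) V < m)%N by clear -cnt hm; lia.
have m2 : (count (hangs (v, z, y)) V < m)%N by clear -cnt hm; lia.
have [c1' [d1 V1 h1 sz1 _]] := IH (v, x, z) m1 n1 zV' (int' _ n1 s1).
have [c2' [d2 V2 h2 sz2 _]] := IH (v, z, y) m2 n2 zV'' (int' _ n2 s2).
exists (c1' ++ c2'); split.
- have nxy : (v, x, z) != (v, z, y).
    apply/eqP => -[xz _]; move: Kx; rewrite xz Kz => r00.
    by move: r0; rewrite -r00 ltxx.
  have := dis_flatten (f := fun u => if u == (v, x, z) then c1' else c2') d.
  rewrite /= eqxx eq_sym (negPf nxy) cats0; apply => t'.
  rewrite !inE => /orP[]/eqP->; first by rewrite eqxx.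
  by rewrite eq_sym (negPf nxy).
- by move=> t'; rewrite mem_cat => /orP[/V1|/V2].
- by move=> t' w; rewrite mem_cat => /orP[/h1|/h2]; apply.
- by rewrite size_cat; clear -sz1 sz2 cnt; lia.
- by move=> nh; case: (nh z zV).
Qed.

Lemma pw_filter (s : seq (tri R)) (P : pred (tri R)) : pw s -> pw [seq t <- s | P t].
Proof.
elim: s => // t s IH /= [H /IH ps]; case: (P t) => //=; split=> // t'.
by rewrite mem_filter => /andP[_ /H].
Qed.

(** A separating functional vanishes at [z], hence along both edges through [z]: these lie on one
    line, with the apexes strictly on opposite sides. *)
Lemma hang_sep (z v1 x1 y1 v2 x2 y2 : pt R) :
  nd (v1, x1, y1) -> nd (v2, x2, y2) -> sep (v1, x1, y1) (v2, x2, y2) ->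
  onE z x1 y1 -> onE z x2 y2 ->
  let K := af (k0 (v1, x1, y1)) in [/\ K x2 = 0, K y2 = 0 & K v2 < 0].
Proof.
move=> n1 n2 [k [kn /nneg3[kv1 kx1 ky1] /nneg3[kv2 kx2 ky2]]] zE1 zE2 K.
rewrite /= in kv1 kx1 ky1; rewrite !af_opk /= !oppr_ge0 in kv2 kx2 ky2.
have := zE1 => -[r1 /andP[p1 q1] e1]; have := zE2 => -[r2 /andP[p2 q2] e2].
have kz1 : 0 <= af k z by rewrite e1 af_lerp addr_ge0// mulr_ge0// ?subr_ge0 ltW.
have kz2 : af k z <= 0.
  rewrite e2 af_lerp -oppr_ge0 opprD -!mulrN addr_ge0// mulr_ge0 ?oppr_ge0//.
    by rewrite subr_ge0 ltW.
  by rewrite ltW.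
have kz : af k z = 0 by apply/eqP; rewrite eq_le kz1 kz2.
have kx1e : af k x1 = 0.
  move: kz; rewrite e1 af_lerp => kz; clear -kz kx1 ky1 p1 q1; nra.
have ky1e : af k y1 = 0.
  move: kz; rewrite e1 af_lerp => kz; clear -kz kx1 ky1 p1 q1; nra.
have kx2e : af k x2 = 0.
  move: kz; rewrite e2 af_lerp => kz; clear -kz kx2 ky2 p2 q2; nra.
have ky2e : af k y2 = 0.
  move: kz; rewrite e2 af_lerp => kz; clear -kz kx2 ky2 p2 q2; nra.
have kE w : af k w = K w * af k v1 by rewrite (af_ext k w n1) /= kx1e ky1e !mulr0 !addr0.
have kv10 : 0 < af k v1.
  rewrite lt0r kv1 andbT; apply: contraNneq kn => k00; apply/eqP; apply: (af_const n1).
  by move=> w _; rewrite kE k00 mulr0.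
have Kx : K x2 = 0 by apply/eqP; have /eqP := kx2e; rewrite kE mulf_eq0 (gt_eqF kv10) orbF.
have Ky : K y2 = 0 by apply/eqP; have /eqP := ky2e; rewrite kE mulf_eq0 (gt_eqF kv10) orbF.
split=> //; rewrite lt_neqAle; apply/andP; split; last by move: kv2; rewrite kE pmulr_lle0.
apply: contraNneq kn => K0; apply/eqP; apply: (af_const n2) => w.
by rewrite kE mem_verts => /or3P[]/eqP->; rewrite ?K0 ?Kx ?Ky mul0r.
Qed.

(** The edges through [z] are collinear and the apexes are pairwise on opposite sides of the common
    line; a line has only two sides. *)
Lemma hang_count (s : seq (tri R)) (z : pt R) : (forall t, t \in s -> nd t) -> pw s ->
  (count (hangs^~ z) s <= 2)%N.
Proof.
move=> ns ps; rewrite -size_filter leqNgt; apply/negP.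
have : forall t, t \in [seq t <- s | hangs t z] ->
    exists v x y, [/\ nd (v, x, y), sub (v, x, y) t, sub t (v, x, y) & onE z x y].
  move=> t; rewrite mem_filter => /andP[/asboolP[x [y [xt yt xy zE]]] ts].
  have [v [n e]] := edge_view (ns _ ts) xt yt xy.
  exists v, x, y; split=> //.
    by move=> u ut; apply: inT_mem; rewrite e.
  by move=> u; rewrite e => ut; apply: inT_mem.
have := pw_filter (hangs^~ z) ps.
case: [seq t <- s | _] => [//|t1 [//|t2 [//|t3 l]]] /= [H1 [H2 _]] V _.
have [v1 [x1 [y1 [n1 s1 _ e1]]]] := V t1 (mem_head _ _).
have [|v2 [x2 [y2 [n2 s2 s2' e2]]]] := V t2 _; first by rewrite !inE eqxx orbT.
have [|v3 [x3 [y3 [n3 s3 _ e3]]]] := V t3 _; first by rewrite !inE eqxx !orbT.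
have S12 : sep (v1, x1, y1) (v2, x2, y2).
  by apply: (sep_sub s1 s2); apply: H1; rewrite mem_head.
have S13 : sep (v1, x1, y1) (v3, x3, y3).
  by apply: (sep_sub s1 s3); apply: H1; rewrite !inE eqxx orbT.
have S23 : sep (v2, x2, y2) (v3, x3, y3).
  by apply: (sep_sub s2 s3); apply: H2; rewrite mem_head.
have /= [a2 b2 c2] := hang_sep n1 n2 S12 e1 e2.
have /= [a3 b3 c3] := hang_sep n1 n3 S13 e1 e3.
have /= [a4 b4 c4] := hang_sep n2 n3 S23 e2 e3.
(* Expanded in the second triangle, the first functional at [v3] is a product of two negative
   numbers, yet it is negative. *)
move: c3; rewrite (af_ext _ v3 n2) /= a2 b2 !mulr0 !addr0 => c3.
by clear -c3 c4 c2; nra.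
Qed.

Lemma onE_line k (z x y : pt R) (t : tri R) : onE z x y -> 0 <= af k x -> 0 <= af k y ->
  af k z = 0 -> af k x = 0 /\ af k y = 0.
Proof.
move=> [r /andP[r0 r1] ->]; rewrite af_lerp => kx ky kz; clear t.
by split; clear -kx ky kz r0 r1; nra.
Qed.

Lemma line_lerp k (x y z : pt R) : k.1 != 0 -> x != y -> af k x = 0 -> af k y = 0 -> af k z = 0 ->
  exists r, z = lerp r x y.
Proof.
case: k x y z => -[k1 k2] k3 [x1 x2] [y1 y2] [z1 z2]; rewrite /af /=.
rewrite -pair_eqE /= negb_and => kn xy hx hy hz.
rewrite negb_and in xy.
have [e1|n1] := eqVneq x1 y1.
  rewrite e1 eqxx /= in xy.
  have n2 : y2 - x2 != 0 by rewrite subr_eq0 eq_sym.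
  have k20 : k2 = 0.
    apply: (mulIf n2); rewrite mul0r; rewrite e1 in hx; clear -hx hy; lra.
  rewrite k20 eqxx orbF in kn; rewrite k20 !mul0r !addr0 in hx hy hz.
  exists ((z2 - x2) / (y2 - x2)); rewrite /lerp /=; congr (_, _).
    rewrite e1; apply: (mulfI kn); rewrite [k1 * (_ + _)](_ : _ = k1 * y1); last by ring.
    by clear -hy hz; lra.
  by field.
have n2 : y1 - x1 != 0 by rewrite subr_eq0 eq_sym.
have k20 : k2 != 0.
  apply: contraTneq kn => k20; rewrite k20 eqxx orbF negbK; rewrite k20 in hx hy.
  by apply/eqP; apply: (mulIf n2); rewrite mul0r; clear -hx hy; lra.
exists ((z1 - x1) / (y1 - x1)); rewrite /lerp /=; congr (_, _); first by field.
apply: (mulfI k20); apply: (mulfI n2).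
rewrite [RHS](_ : _ = (y1 - z1) * (k2 * x2) + (z1 - x1) * (k2 * y2)); last by field.
have -> : k2 * x2 = - k1 * x1 - k3 by clear -hx; lra.
have -> : k2 * y2 = - k1 * y1 - k3 by clear -hy; lra.
have -> : k2 * z2 = - k1 * z1 - k3 by clear -hz; lra.
by ring.
Qed.

Definition mesh (s : seq (tri R)) := (forall t, t \in s -> nd t) /\ pw s.

Definition nohang (s : seq (tri R)) := forall t t' z,
  t \in s -> t' \in s -> z \in verts t' -> ~ hang z t.

(** Two overlapping segments on a line coincide as soon as neither has an endpoint in the interior
    of the other. The proof compares the parameters of [x'] and [y'] along [x], [y] with 0 and 1. *)
Lemma same_edge (x y x' y' z : pt R) k : k.1 != 0 -> x != y ->
  af k x = 0 -> af k y = 0 -> af k x' = 0 -> af k y' = 0 ->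
  onE z x y -> onE z x' y' ->
  ~ onE x' x y -> ~ onE y' x y -> ~ onE x x' y' -> ~ onE y x' y' ->
  (x = x' /\ y = y') \/ (x = y' /\ y = x').
Proof.
move=> k0 xy kx ky kx' ky' [r /andP[r0 r1] zE] [r' /andP[r0' r1'] zE'].
have [a x'E] := line_lerp k0 xy kx ky kx'; have [b y'E] := line_lerp k0 xy kx ky ky'.
have lerp_inj c d : lerp c x y = lerp d x y -> c = d.
  rewrite /lerp => -[e1 e2]; apply/eqP; apply: contraNT xy => cd.
  have cd' : c - d != 0 by rewrite subr_eq0.
  case: (x) (y) e1 e2 => x1 x2 [y1 y2] /= e1 e2; apply/eqP; congr (_, _);
    by apply: (mulfI cd'); clear -e1 e2; lra.
have rE : r = (1 - r') * a + r' * b.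
  apply: lerp_inj; rewrite -zE zE' x'E y'E /lerp /=; congr (_, _); ring.
have l0 : lerp 0 x y = x by rewrite /lerp subr0 !mul1r !mul0r !addr0; case: (x).
have l1 : lerp 1 x y = y by rewrite /lerp subrr !mul1r !mul0r !add0r; case: (y).
have onI c : 0 < c < 1 -> onE (lerp c x y) x y by exists c.
have onI' c : (a < c < b) || (b < c < a) -> onE (lerp c x y) x' y'.
  move=> H; exists ((c - a) / (b - a)).
    case/orP: H => /andP[h1 h2].
      by rewrite divr_gt0 ?subr_gt0 ?(lt_trans h1 h2)//= ltr_pdivrMr ?mul1r ?ltrD2r
        // subr_gt0 (lt_trans h1 h2).
    rewrite -mulrNN -invrN !opprB divr_gt0 ?subr_gt0 ?(lt_trans h1 h2)//=.
    by rewrite ltr_pdivrMr ?mul1r ?ler_ltD ?ltrN2// ?subr_gt0 ?(lt_trans h1 h2).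
  have n : b - a != 0.
    by rewrite subr_eq0; case/orP: H => /andP[h1 h2]; have h := lt_trans h1 h2;
      [rewrite gt_eqF|rewrite lt_eqF].
  by rewrite x'E y'E /lerp /=; congr (_, _); field.
move=> m1 m2 m3 m4.
have A : ~~ (0 < a < 1) by apply/negP => /onI; rewrite -x'E.
have B : ~~ (0 < b < 1) by apply/negP => /onI; rewrite -y'E.
have C : ~~ ((a < 0 < b) || (b < 0 < a)) by apply/negP => /onI'; rewrite l0.
have D : ~~ ((a < 1 < b) || (b < 1 < a)) by apply/negP => /onI'; rewrite l1.
have : (a = 0 /\ b = 1) \/ (a = 1 /\ b = 0).
  move: A B C D; rewrite !negb_or !negb_and -!leNgt.
  clear -rE r0 r1 r0' r1'.
  have [ab|ab] := ltP a b.
    have ar : a < r by rewrite rE; nra.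
    have rb : r < b by rewrite rE; nra.
    move=> /orP[a0|a1] /orP[b0|b1] /andP[/orP[h1|h1] _] /andP[/orP[h2|h2] _];
      by [exfalso; lra|left; split; lra].
  have ar : r <= a by rewrite rE; nra.
  have rb : b <= r by rewrite rE; nra.
  move=> /orP[a0|a1] /orP[b0|b1] /andP[_ /orP[h1|h1]] /andP[_ /orP[h2|h2]];
    by [exfalso; lra|right; split; lra].
by rewrite x'E y'E => -[[-> ->]|[-> ->]]; rewrite l0 l1; [left|right].
Qed.

(** On the separating line the face of [t'] through [z] can only be an edge, as a vertex there would
    hang in [t]; without hanging vertices the two overlapping edges are equal. *)
Lemma share_edge s (t t' : tri R) (x y z : pt R) : mesh s -> nohang s ->
  t \in s -> t' \in s -> x \in verts t -> y \in verts t -> x != y -> onE z x y ->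
  inT t' z -> x \in verts t' /\ y \in verts t'.
Proof.
move=> [ns ps] nh ts t's xt yt xy zE tz'.
have [<-//|tt'] := eqVneq t t'.
have [k [kn kt kt']] := pw_sep ps ts t's tt'.
have kz0 : af k z <= 0 by rewrite -oppr_ge0 -af_opk; apply: tz'.
have kz1 : 0 <= af k z.
  by case: zE => r /andP[? ?] ->; rewrite af_lerp addr_ge0// mulr_ge0 ?subr_ge0 ?kt// ltW.
have kz : af k z = 0 by apply/eqP; rewrite eq_le kz0 kz1.
have [kx ky] := onE_line t zE (kt _ xt) (kt _ yt) kz.
have okz : af (opk k) z = 0 by rewrite af_opk kz oppr0.
have [zt'|[x' [y' [xt' yt' xy' zE' [kx' ky']]]]] := face (ns _ t's) (opk_neq0 kn) kt' tz' okz.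
  by case: (nh _ _ _ ts t's zt'); exists x, y.
have hx : af k x' = 0 by apply/eqP; rewrite -oppr_eq0 -af_opk kx'.
have hy : af k y' = 0 by apply/eqP; rewrite -oppr_eq0 -af_opk ky'.
have := same_edge kn xy kx ky hx hy zE zE'; case=> [||||[-> ->]//|[-> ->]//].
- by move=> h; apply: (nh _ _ x' ts t's) => //; exists x, y.
- by move=> h; apply: (nh _ _ y' ts t's) => //; exists x, y.
- by move=> h; apply: (nh _ _ x t's ts) => //; exists x', y'.
- by move=> h; apply: (nh _ _ y t's ts) => //; exists x', y'.
Qed.

End Hanging.

(** * Conforming meshes *)

Section Closure.
Variable R : realType.
Implicit Types (t : tri R) (k : pt R * R) (s : seq (tri R)).

Definition allv s : seq (pt R) := flatten [seq verts t | t <- s].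

Definition covers s (x : pt R) := exists2 t, t \in s & inT t x.

Lemma allvP s (z : pt R) : reflect (exists2 t, t \in s & z \in verts t) (z \in allv s).
Proof. exact: flatten_mapP. Qed.

Lemma onE_inT t (x y z : pt R) : x \in verts t -> y \in verts t -> onE z x y -> inT t z.
Proof.
move=> xt yt [r /andP[r0 r1] ->] k kt.
by rewrite af_lerp addr_ge0// mulr_ge0 ?subr_ge0 ?(ltW r0) ?(ltW r1) ?kt.
Qed.

Lemma hang_inT t (z : pt R) : hang z t -> inT t z.
Proof. by move=> [x [y [xt yt _ h]]]; apply: onE_inT xt yt h. Qed.

Lemma mesh_inT s t (z : pt R) : mesh s -> t \in s -> z \in allv s -> inT t z ->
  z \in verts t \/ hang z t.
Proof.
move=> [ns ps] ts /allvP[t' t's zt'] tz; have [tt'|tt'] := eqVneq t t'.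
  by left; rewrite tt'.
exact: sep_hang (ns _ ts) (pw_sep ps ts t's tt') zt' tz.
Qed.

Lemma mesh_flatten s (f : tri R -> seq (tri R)) : mesh s ->
  (forall t, t \in s -> dis t (f t)) -> mesh (flatten [seq f t | t <- s]).
Proof.
move=> [ns ps] df; split.
  by move=> t' /flatten_mapP[t /df[H _ _] /H[]].
by apply: pw_flatten => // [t /df[]//|t t' /df[H _ _] /H[]].
Qed.

Lemma cover_flatten s (f : tri R -> seq (tri R)) :
  (forall t, t \in s -> dis t (f t)) ->
  forall x, covers (flatten [seq f t | t <- s]) x <-> covers s x.
Proof.
move=> df x; split=> [[t' /flatten_mapP[t ts t'f] t'x]|[t ts tx]].
  exists t => //; have [H _ _] := df _ ts; have [_ st] := H _ t'f.
  exact: inT_sub t'x.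
have [_ _ H] := df _ ts; have [t' t'f t'x] := H _ tx.
by exists t' => //; apply/flatten_mapP; exists t.
Qed.

(** Each triangle is closed with respect to the same set of vertices, so neighbours cut a common
    edge at the same points. Only points of [W] hang, each in at most two triangles, whence the
    increase by at most [2 * size W]. The last clause tracks each piece to its parent and shows that
    a triangle without hanging points is left intact. *)
Lemma mesh_close s (W : seq (pt R)) : mesh s ->
  (forall t z, t \in s -> z \in allv s -> hang z t -> z \in W) ->
  exists s', [/\ mesh s', nohang s', forall x, covers s' x <-> covers s x,
    (size s' <= size s + 2 * size W)%N &
    forall t', t' \in s' -> exists t, [/\ t \in s, sub t' t,
      {subset verts t' <= allv s}, forall z, z \in allv s -> ~ hang z t' &
      (forall z, z \in allv s -> ~ hang z t) -> t' = t]].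
Proof.
move=> ms hW; have [ns ps] := ms; pose V := undup (allv s).
have VE z : (z \in V) = (z \in allv s) by rewrite mem_undup.
have /choose_list[f Hf] : forall t, t \in s -> exists c : seq (tri R),
   [/\ dis t c, forall t', t' \in c -> {subset verts t' <= V},
    forall t' z, t' \in c -> z \in V -> ~ hang z t',
    (size c <= (count (hangs t) V).+1)%N &
    ((forall z, z \in V -> ~ hang z t) -> c = [:: t])].
  move=> t ts; apply: close_tri; first exact: ns.
    by move=> z zt; rewrite VE; apply/allvP; exists t.
  by move=> z; rewrite VE; apply: mesh_inT.
exists (flatten [seq f t | t <- s]); split.
- by apply: mesh_flatten => // t /Hf[].
- move=> t t' z /flatten_mapP[u us tu] /flatten_mapP[u' us' tu'] zt'.
  have [_ _ H _ _] := Hf _ us; have [_ H' _ _ _] := Hf _ us'.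
  by apply: H tu _; apply: H' zt'.
- by apply: cover_flatten => t /Hf[].
- rewrite size_flatten /shape -map_comp sumnE big_map.
  apply: (@leq_trans (\sum_(t <- s) (1 + count (hangs t) V))).
    by rewrite big_seq [X in (_ <= X)%N]big_seq; apply: leq_sum => t /Hf[].
  rewrite big_split /= sum1_size leq_add2l.
  under eq_bigr do rewrite -sum1_count big_mkcond /=.
  rewrite exchange_big /= big_seq.
  apply: (@leq_trans (\sum_(z <- V | z \in W) 2)).
    rewrite [X in (_ <= X)%N]big_mkcond /= [X in (_ <= X)%N]big_seq.
    apply: leq_sum => z zV; rewrite -big_mkcond sum1_count.
    case: ifPn => [_|zW]; first exact: hang_count.
    rewrite leqn0 eqn0Ngt -has_count; apply/negP => /hasP[t ts /asboolP h].
    by move: zW; rewrite (hW t)// -VE.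
  rewrite big_const_seq iter_addn_0 leq_mul2l /= -size_filter.
  apply: uniq_leq_size; first by rewrite filter_uniq// undup_uniq.
  by move=> z; rewrite mem_filter => /andP[].
- move=> t' /flatten_mapP[t ts tf]; have [[H _ _] H1 H2 _ H4] := Hf _ ts.
  have [_ st] := H _ tf; exists t; split=> //.
  + by move=> z /(H1 _ tf); rewrite VE.
  + by move=> z; rewrite -VE; apply: H2.
  + move=> nh; have fE : f t = [:: t] by apply: H4 => z; rewrite VE; apply: nh.
    by move: tf; rewrite fE inE => /eqP.
Qed.

Lemma list_max (T : eqType) (l : seq T) (r : T -> T -> Prop) :
  (forall x y, x \in l -> y \in l -> r x y \/ r y x) ->
  (forall x y z, x \in l -> y \in l -> z \in l -> r x y -> r y z -> r x z) ->
  l != [::] -> exists2 m, m \in l & forall x, x \in l -> r m x.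
Proof.
elim: l => // a [|b l] IH tot tr _.
  exists a; first exact: mem_head.
  by move=> x; rewrite inE => /eqP->; case: (tot a a); rewrite ?mem_head.
have sb : {subset b :: l <= a :: b :: l} by move=> x xl; rewrite inE xl orbT.
have [|||m ml mm] := IH => //.
- by move=> x y /sb xl /sb yl; apply: tot.
- by move=> x y z /sb xl /sb yl /sb zl; apply: tr.
have [am|ma] := tot a m (mem_head _ _) (sb _ ml).
  exists a; first exact: mem_head.
  move=> x; rewrite inE => /orP[/eqP->|xl].
    by case: (tot a a); rewrite ?mem_head.
  by apply: (tr _ m) (mm _ xl); rewrite ?mem_head ?sb.
exists m; first exact: sb.
by move=> x; rewrite inE => /orP[/eqP->//|/mm].
Qed.

Definition lexlt (p q : pt R) := p.1 < q.1 \/ (p.1 = q.1 /\ p.2 < q.2).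

Lemma lexlt_total (p q : pt R) : p != q -> lexlt p q \/ lexlt q p.
Proof.
case: p q => p1 p2 [q1 q2] /=; rewrite /lexlt /= => n.
have [h|h|h] := ltgtP p1 q1; [by left; left|by right; left|].
have [h'|h'|h'] := ltgtP p2 q2; [by left; right|by right; right|].
by rewrite h h' eqxx in n.
Qed.

Lemma lexlt_irr (p : pt R) : ~ lexlt p p.
Proof. by case=> [|[_]]; rewrite ltxx. Qed.

Lemma lexlt_trans (p q r : pt R) : lexlt p q -> lexlt q r -> lexlt p r.
Proof.
rewrite /lexlt => -[h1|[h1 h1']] [h2|[h2 h2']].
- by left; apply: lt_trans h2.
- by left; rewrite -h2.
- by left; rewrite h1.
- by right; rewrite h1 h2; split=> //; apply: lt_trans h2'.
Qed.

(* Below a lexicographically maximal point, directions are totally ordered by slope. *)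
Lemma slope_trans (a b c d : pt R) : lexlt b a -> lexlt c a -> lexlt d a ->
  0 <= cr a b c -> 0 <= cr a c d -> 0 <= cr a b d.
Proof.
case: a b c d => a1 a2 [b1 b2] [c1 c2] [d1 d2]; rewrite /lexlt /cr /=.
set ub := b1 - a1; set vb := b2 - a2; set uc := c1 - a1; set vc := c2 - a2.
set ud := d1 - a1; set vd := d2 - a2 => hb hc hd.
have {}hb : ub < 0 \/ ub = 0 /\ vb < 0.
  by rewrite /ub /vb !subr_lt0; case: hb => [|[-> ?]]; [left|right; rewrite subrr].
have {}hc : uc < 0 \/ uc = 0 /\ vc < 0.
  by rewrite /uc /vc !subr_lt0; case: hc => [|[-> ?]]; [left|right; rewrite subrr].
have {}hd : ud < 0 \/ ud = 0 /\ vd < 0.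
  by rewrite /ud /vd !subr_lt0; case: hd => [|[-> ?]]; [left|right; rewrite subrr].
have ub0 : ub <= 0 by case: hb => [/ltW//|[-> _]].
have ud0 : ud <= 0 by case: hd => [/ltW//|[-> _]].
move: ub vb uc vc ud vd hb hc hd ub0 ud0 => ub vb uc vc ud vd hb hc hd ub0 ud0 h1 h2.
case: hc => [hc|[hc hc']].
  have E : (ub * vd - ud * vb) * uc = (uc * vd - ud * vc) * ub + (ub * vc - uc * vb) * ud.
    by ring.
  have : (ub * vd - ud * vb) * uc <= 0.
    by rewrite E -oppr_ge0 opprD addr_ge0// oppr_ge0 mulr_ge0_le0.
  by rewrite nmulr_lle0.
have ud1 : ud = 0.
  apply/eqP; rewrite eq_le ud0 /=; move: h2; rewrite hc mul0r sub0r oppr_ge0.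
  by rewrite nmulr_lle0.
case: hd => [|[_ vd0]]; first by rewrite ud1 ltxx.
by rewrite ud1 mul0r subr0 mulr_le0// ltW.
Qed.

Lemma sep_nd t : nd t -> ~ sep t t.
Proof.
move=> n [k [k0 k1 k2]]; move/eqP: k0; apply; apply: (af_const n) => x xt.
by apply/eqP; rewrite eq_le (k1 _ xt) -oppr_ge0 -af_opk (k2 _ xt).
Qed.

Lemma mesh_uniq s : mesh s -> uniq s.
Proof.
move=> [ns ps]; elim: s ns ps => //= t s IH ns [H ps].
rewrite IH// ?andbT => [|t' t's]; last by apply: ns; rewrite inE t's orbT.
by apply/negP => /H; apply: sep_nd; apply: ns; rewrite mem_head.
Qed.

(** At the lexicographically largest vertex [a] all edges point into a half-plane, so there is an
    edge of extreme slope; it is on the boundary and can be bisected safely. Its triangle satisfies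
    [P], since the other alternative of the hypothesis would give a vertex beyond [a]. *)
Lemma fill1 (P : tri R -> Prop) s : mesh s -> nohang s -> s != [::] ->
  (forall t t', P t -> sub t' t -> P t') ->
  (forall t, t \in s ->
     P t \/ forall z, z \in verts t -> exists2 w, w \in allv s & lexlt z w) ->
  exists s', [/\ mesh s' /\ nohang s', forall x, covers s' x <-> covers s x,
    size s' = (size s).+1, {subset allv s <= allv s'} &
    forall t', t' \in s' -> t' \in s \/ P t'].
Proof.
move=> ms nh s0 subP bd; have [ns ps] := ms.
have [a aV am] : exists2 a, a \in allv s & forall z, z \in allv s -> z = a \/ lexlt z a.
  apply: (@list_max _ _ (fun a z => z = a \/ lexlt z a)).
  + move=> x y _ _; have [->|/lexlt_total[]] := eqVneq x y; [by left; left| |]; by auto.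
  + move=> x y z _ _ _ [->|h1] [->|h2]; [by left|by right|by right|right].
    exact: lexlt_trans h2 h1.
  + by case: s s0 {ms nh bd ns ps}.
(* The neighbours of [a]; the minimal one for the slope order gives the edge to bisect. *)
pose E := [seq b <- allv s | (b != a) && has (fun t => (a \in verts t) && (b \in verts t)) s].
have EP b : b \in E -> [/\ b \in allv s, lexlt b a &
    exists t, [/\ t \in s, a \in verts t, b \in verts t & b != a]].
  rewrite mem_filter => /andP[/andP[ba /hasP[t ts /andP[at_ bt]]] bV].
  split=> //; last by exists t.
  by case: (am _ bV) => // h; rewrite h eqxx in ba.
have EI b t : t \in s -> a \in verts t -> b \in verts t -> b != a -> b \in E.
  move=> ts at_ bt ba; rewrite mem_filter ba /=; apply/andP; split.
    by apply/hasP; exists t; rewrite ?at_.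
  by apply/allvP; exists t.
have [b bE bm] : exists2 b, b \in E & forall b', b' \in E -> 0 <= cr a b b'.
  apply: (@list_max _ _ (fun b b' => 0 <= cr a b b')).
  + move=> x y _ _; have [h|h] := leP 0 (cr a x y); [by left|right].
    by rewrite (_ : cr a y x = - cr a x y) ?oppr_ge0 ?ltW// /cr; ring.
  + move=> x y z /EP[_ hx _] /EP[_ hy _] /EP[_ hz _]; exact: slope_trans.
  + have /allvP[t ts at_] := aV; have [y [z [n _ _ yt _]]] := vert_view (ns _ ts) at_.
    have ya : y != a.
      by apply: contraNneq n => ->; apply/eqP; rewrite /cr /=; ring.
    by have := EI _ _ ts at_ yt ya; case: (E).
have [_ _ [t [ts at_ bt ba]]] := EP _ bE.
have ab : a != b by rewrite eq_sym.
have mE : onE (mid a b) a b by exists 2^-1 => //; lra.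
have [v [n e d]] := bisect_edge (ns _ ts) at_ bt ab mE.
set m := mid a b in mE d.
have vt : v \in verts t by rewrite e mem_head.
have crv x : nd (x, a, b) -> x \in E -> 0 < cr a b x.
  move=> nx /bm h; rewrite lt0r h andbT; move: nx; rewrite /nd /=.
  by rewrite (_ : cr x a b = cr a b x)// /cr; ring.
have nda x : nd (x, a, b) -> x != a.
  by move=> nx; apply: contraNneq nx => ->; apply/eqP; rewrite /cr /=; ring.
(* A second triangle containing the midpoint would share the edge and have its apex on the other
   side, against the extremality of the slope. *)
have alone t' : t' \in s -> inT t' m -> t' = t.
  move=> t's tm; apply/eqP; apply: contraT => tt'.
  have [at' bt'] := share_edge ms nh ts t's at_ bt ab mE tm.
  have [v' [n' e']] := edge_view (ns _ t's) at' bt' ab.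
  have vt' : v' \in verts t' by rewrite e' mem_head.
  have := pw_sep ps ts t's; rewrite eq_sym => /(_ tt') sp.
  have sp' : sep (v, a, b) (v', a, b).
    apply: sep_sub sp; first by move=> x xt; apply: inT_mem; rewrite e.
    by move=> x xt; apply: inT_mem; rewrite e'.
  have /= [_ _] := hang_sep n n' sp' mE mE.
  rewrite /k0 /kb /= af_sck af_kcr (_ : cr v a b = cr a b v); last by rewrite /cr; ring.
  rewrite ltNge mulr_ge0// ?invr_ge0 ltW//.
    by apply: (crv _ n); apply: (EI _ t) => //; apply: (nda _ n).
  by apply: (crv _ n'); apply: (EI _ t') => //; apply: (nda _ n').
have Pt : P t.
  case: (bd _ ts) => // /(_ _ at_)[w wV aw].
  by case: (am _ wV) => [h|h]; case: (@lexlt_irr a); [rewrite -{2}h|apply: lexlt_trans h].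
pose f u := if u == t then [:: (v, a, m); (v, m, b)] else [:: u].
have df u : u \in s -> dis u (f u).
  by rewrite /f; case: eqP => [->//|_] us; apply: dis1; apply: ns.
have [dn _ _] := d.
have [n1 s1] : nd (v, a, m) /\ sub (v, a, m) t by apply: dn; rewrite mem_head.
have [n2 s2] : nd (v, m, b) /\ sub (v, m, b) t by apply: dn; rewrite !inE eqxx orbT.
have vs z u : u \in s -> z \in allv (f u) -> z = m \/ z \in allv s.
  move=> us /allvP[t']; rewrite /f; case: eqP => [_|_].
    have H w : w \in verts t -> w = m \/ w \in allv s.
      by move=> wt; right; apply/allvP; exists t.
    by rewrite in_cons mem_seq1 => /orP[]/eqP->; rewrite mem_verts => /or3P[]/eqP->; auto.
  by rewrite inE => /eqP-> zt; right; apply/allvP; exists u.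
exists (flatten [seq f u | u <- s]); split.
- split; first exact: mesh_flatten.
  move=> t1 t2 z /flatten_mapP[u1 u1s t1f] /flatten_mapP[u2 u2s t2f] zt2.
  have zV : z = m \/ z \in allv s by apply: (vs z _ u2s); apply/allvP; exists t2.
  have key t0 : sub t0 t -> nd t0 -> m \in verts t0 -> ~ hang z t0.
    move=> st0 n0 mt0 h; case: zV => zV.
      by apply: (not_hang_self n0 (@sub_refl _ t0)) h; rewrite zV.
    have tz : inT t z by apply: inT_sub st0 _; apply: hang_inT.
    have [zt|h'] := mesh_inT ms ts zV tz.
      exact: (not_hang_self (ns _ ts) st0 zt h).
    by have /allvP[t3 t3s zt3] := zV; apply: (nh _ _ _ ts t3s zt3).
  move: t1f; rewrite /f; case: eqP => [_|nt].
    rewrite in_cons mem_seq1 => /orP[]/eqP->; apply: key => //; by rewrite mem_verts eqxx !orbT.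
  rewrite inE => /eqP-> h; case: zV => zV.
    by apply: nt; apply: alone => //; rewrite -zV; apply: hang_inT.
  by have /allvP[t3 t3s zt3] := zV; apply: (nh _ _ _ u1s t3s zt3).
- exact: cover_flatten.
- rewrite size_flatten /shape -map_comp sumnE big_map.
  rewrite (eq_bigr (fun u => 1 + (u == t))%N); last by move=> u _; rewrite /f /=; case: eqP.
  rewrite big_split /= sum1_size -big_mkcond /= sum1_count.
  by rewrite (count_uniq_mem _ (mesh_uniq ms)) ts addn1.
- move=> z /allvP[u us zu]; apply/allvP.
  have [ut|ut] := eqVneq u t; last first.
    by exists u => //; apply/flatten_mapP; exists u => //; rewrite /f (negPf ut) mem_head.
  move: zu; rewrite ut e !inE => /or3P[]/eqP->.
  + exists (v, a, m); last by rewrite mem_verts eqxx.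
    by apply/flatten_mapP; exists t; rewrite // /f eqxx mem_head.
  + exists (v, a, m); last by rewrite mem_verts eqxx orbT.
    by apply/flatten_mapP; exists t; rewrite // /f eqxx mem_head.
  + exists (v, m, b); last by rewrite mem_verts eqxx !orbT.
    by apply/flatten_mapP; exists t; rewrite // /f eqxx !inE eqxx orbT.
- move=> t' /flatten_mapP[u us]; rewrite /f; case: eqP => [_|_].
    by rewrite !inE => /orP[]/eqP->; right; apply: (subP t).
  by rewrite inE => /eqP->; left.
Qed.

Lemma fill (P : tri R -> Prop) n s : mesh s -> nohang s -> s != [::] ->
  (forall t t', P t -> sub t' t -> P t') ->
  (forall t, t \in s ->
     P t \/ forall z, z \in verts t -> exists2 w, w \in allv s & lexlt z w) ->
  exists s', [/\ mesh s' /\ nohang s', forall x, covers s' x <-> covers s x,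
    size s' = (size s + n)%N & forall t', t' \in s' -> t' \in s \/ P t'].
Proof.
elim: n s => [|n IH] s ms nh s0 subP bd.
  by exists s; rewrite addn0; split=> // t ts; left.
have [s1 [[ms1 nh1] c1 z1 v1 H1]] := fill1 ms nh s0 subP bd.
have s10 : s1 != [::] by rewrite -size_eq0 z1.
have [t /H1[ts|Pt]|s2 [h2 c2 z2 H2]] := IH _ ms1 nh1 s10 subP.
- case: (bd _ ts) => [|H]; [by left|right=> z /H[w wV zw]].
  by exists w => //; apply: v1.
- by left.
exists s2; split=> //.
- by move=> x; rewrite c2 c1.
- by rewrite z2 z1 addSnnS.
- by move=> t /H2[/H1|]; [|right].
Qed.

End Closure.

(** * Unions and clipping of triangles *)

Section Clipping.
Variable R : realType.
Implicit Types (t : tri R) (k : pt R * R) (s : seq (tri R)).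

Lemma kb_neq0 t k : nd t -> k \in kb t -> k.1 != 0.
Proof.
case: t => -[a b] c n; have [[a0 b0 c0] [[a1 b1 c1] [a2 b2 c2]]] := kbE n.
have H q (x y : pt R) : af q x = 0 -> af q y = 1 -> q.1 != 0.
  move=> qx qy; apply: contraTneq (@oner_neq0 R) => k00.
  have : af q x = af q y by rewrite /af k00 /= !mul0r.
  by rewrite qx qy => <-; rewrite eqxx.
rewrite -[kb _]/[:: k0 (a, b, c); k1 (a, b, c); k2 (a, b, c)] !inE.
by move=> /or3P[]/eqP->; [apply: H b0 a0|apply: H a1 b1|apply: H a2 c2].
Qed.

Lemma kb_nneg t k : nd t -> k \in kb t -> nneg k (verts t).
Proof.
move=> n; have [[a0 b0 c0] [[a1 b1 c1] [a2 b2 c2]]] := kbE n.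
rewrite -[kb _]/[:: k0 t; k1 t; k2 t] !inE => /or3P[]/eqP->; apply/nneg3.
- by rewrite a0 b0 c0.
- by rewrite a1 b1 c1.
- by rewrite a2 b2 c2.
Qed.

Lemma inT_kb t (x : pt R) : nd t -> (forall k, k \in kb t -> 0 <= af k x) -> inT t x.
Proof.
move=> n H; apply/(inTP _ n); split; apply: H;
  by rewrite -[kb _]/[:: k0 t; k1 t; k2 t] !inE eqxx ?orbT.
Qed.

Definition inI t (x : pt R) := forall k, k \in kb t -> 0 < af k x.

Lemma inI_inT t (x : pt R) : nd t -> inI t x -> inT t x.
Proof. by move=> n H; apply: inT_kb => // k /H /ltW. Qed.

Lemma sub_or_sep t u : nd t -> (forall k, k \in kb t -> unif k u) ->
  sub u t \/ exists2 k, k \in kb t & nneg (opk k) (verts u).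
Proof.
move=> n H; have [h|/existsNP[k /not_implyP[kt h]]] :=
    pselect (forall k, k \in kb t -> nneg k (verts u)).
  by left => x xu; apply: inT_kb => // k /h; apply.
by right; exists k => //; case: (H _ kt).
Qed.

(** Cut [t] along the sides of all triangles of [s]: each piece is then contained in one of them,
    and dropped, or separated from all of them, and added. This resolves the overlaps in the given
    description of the domain. *)
Lemma add_tri s t : mesh s -> nd t -> exists s', mesh s' /\
  forall x, covers s' x <-> covers s x \/ inT t x.
Proof.
move=> ms n; have [ns ps] := ms.
have [c [[dn dp dc] _ uc]] := cuts (flatten [seq kb u | u <- s]) n.
pose P u := `[< forall t', t' \in s -> sep t' u >].
have PN u : u \in c -> ~~ P u -> exists2 t', t' \in s & sub u t'.
  move=> uc' /asboolPn /existsNP[t' /not_implyP[t's h]]; exists t' => //.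
  case: (@sub_or_sep t' u (ns _ t's)) => // [k kt'|[k kt' ku]].
    by apply: (uc _ uc'); apply/flatten_mapP; exists t'.
  by case: h; exists k; split=> //; [exact: (kb_neq0 (ns _ t's) kt')|exact: (kb_nneg (ns _ t's) kt')].
exists (s ++ [seq u <- c | P u]); split.
  split; first by move=> u; rewrite mem_cat mem_filter => /orP[/ns//|/andP[_ /dn[]]].
  apply/pw_cat; split=> //; first exact: pw_filter.
  by move=> t1 t2 t1s; rewrite mem_filter => /andP[/asboolP H _]; apply: H.
move=> x; split.
  move=> [u]; rewrite mem_cat mem_filter => /orP[us ux|/andP[_ /dn[_ ut]] ux].
    by left; exists u.
  by right; apply: inT_sub ux.
move=> [[u us ux]|/dc[u uc' ux]]; first by exists u; rewrite // mem_cat us.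
have [Pu|/(PN _ uc')[t' t's ut']] := boolP (P u).
  by exists u; rewrite // mem_cat mem_filter Pu uc' orbT.
by exists t'; [rewrite mem_cat t's|apply: inT_sub ux].
Qed.

Lemma union_mesh (l : seq (tri R)) : (forall t, t \in l -> nd t) ->
  exists s, mesh s /\ forall x, covers s x <-> covers l x.
Proof.
elim: l => [|t l IH] nl; first by exists [::]; split.
have [s [ms cs]] := IH (fun t' h => nl t' (mem_behead (s := t :: l) h)).
have [s' [ms' cs']] := add_tri ms (nl _ (mem_head _ _)).
exists s'; split=> // x; rewrite cs' cs; split.
  move=> [[u ul ux]|tx]; last by exists t; rewrite ?mem_head.
  by exists u; rewrite // inE ul orbT.
by move=> [u]; rewrite inE => /orP[/eqP->|ul ux]; [right|left; exists u].
Qed.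

Lemma mesh_subdiv s (d e : R) : mesh s -> (forall t, t \in s -> wide d t) -> 0 < e ->
  exists s', [/\ mesh s', forall x, covers s' x <-> covers s x &
    forall t, t \in s' -> wide e t].
Proof.
move=> ms wd e0; have [ns _] := ms.
have [r dr] : exists r : nat, d / 2 ^+ r <= e.
  have [r dr] : exists r : nat, d / e <= r%:R.
    have [h|h] := ltP (d / e) 0; first by exists 0%N; apply: ltW.
    by exists (Num.truncn (d / e)).+1; apply/ltW/truncnS_gt.
  exists r; rewrite ler_pdivrMr ?exprn_gt0// mulrC -ler_pdivrMr//.
  apply: (le_trans dr); by rewrite -natrX ler_nat; apply/ltnW/ltn_expl.
have /choose_list[f Hf] : forall t, t \in s -> exists c : seq (tri R),
    [/\ dis t c, (size c <= 4 ^ r)%N & forall u, u \in c -> wide (d / 2 ^+ r) u].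
  by move=> t ts; apply: subdiv; [exact: ns|exact: wd].
exists (flatten [seq f t | t <- s]); split.
- by apply: mesh_flatten => // t /Hf[].
- by apply: cover_flatten => // t /Hf[].
- move=> t /flatten_mapP[u us tu] x y xt yt; have [_ _ H] := Hf _ us.
  by have [h1 h2] := H _ tu x y xt yt; split; apply: le_trans dr.
Qed.

(** A finite union of triangles is closed: a half-plane that misses [x] still misses the points near
    [x] on the segment to [g], and there are finitely many triangles. *)
Lemma cover_closure s (x g : pt R) :
  (forall e, 0 < e < 1 -> covers s (lerp e x g)) -> covers s x.
Proof.
move=> H; apply: contrapT => nc.
suff [e [/andP[e0 e1] he]] : exists e, 0 < e < 1 /\
    forall e', 0 < e' <= e -> ~ covers s (lerp e' x g).
  by apply: (he e); [rewrite e0 lexx|apply: H; rewrite e0].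
elim: s nc {H} => [|t s IH] nc.
  by exists 2^-1; split=> [|e' _ []//]; lra.
have [|e [/andP[e0 e1] he]] := IH.
  by move=> [u us ux]; apply: nc; exists u; rewrite // inE us orbT.
have /existsNP[k /not_implyP[kt /negP]] : ~ inT t x.
  by move=> tx; apply: nc; exists t; rewrite ?mem_head.
rewrite -ltNge => kx.
have [d [d0 hd]] : exists d, 0 < d /\ forall e', 0 < e' <= d -> af k (lerp e' x g) < 0.
  exists (- af k x / (1 + `|af k g - af k x|)); split.
    by rewrite divr_gt0 ?oppr_gt0// ltr_pwDl.
  move=> e' /andP[e'0]; rewrite ler_pdivlMr ?ltr_pwDl// => h.
  rewrite af_lerp (_ : _ + _ = af k x + e' * (af k g - af k x)); last by ring.
  have h1 : e' * (af k g - af k x) <= e' * `|af k g - af k x|.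
    by apply: ler_wpM2l; [exact: ltW|exact: ler_norm].
  by clear -h h1 e'0; lra.
exists (Num.min e d); split; first by rewrite lt_min e0 d0 /= gt_min e1.
move=> e'; rewrite le_min => /and3P[e'0 h1 h2] [u]; rewrite inE => /orP[/eqP->|us ux].
  by move=> /(_ _ kt); rewrite leNgt hd// e'0.
by apply: (he e'); [rewrite e'0|exists u].
Qed.

(** Cutting along the three sides of [B] gives at most 4 ^ 3 = 64 pieces. Only the part of [t] in
    the interior of [B] is claimed to be covered, since a piece may touch [B] from outside. *)
Lemma clip (B : tri R) t : nd B -> nd t -> exists c : seq (tri R),
  [/\ pw c, forall u, u \in c -> [/\ nd u, sub u t & sub u B], (size c <= 64)%N &
    forall x, inT t x -> inI B x -> covers c x].
Proof.
move=> nB n; have [c [[dn dp dc] sc uc]] := cuts (kb B) n.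
exists [seq u <- c | `[< sub u B >]]; split.
- exact: pw_filter.
- by move=> u; rewrite mem_filter => /andP[/asboolP uB /dn[]].
- by rewrite size_filter; apply: leq_trans (count_size _ _) sc.
- move=> x /dc[u uc' ux] xB; case: (sub_or_sep nB (uc _ uc')) => [uB|[k kB ku]].
    by exists u; rewrite // mem_filter uc' asboolT.
  have := ux _ ku; rewrite af_opk oppr_ge0 leNgt; case/negP; exact: xB.
Qed.

Lemma vertex_only (x y z w : pt R) k : nd (x, y, z) -> inT (x, y, z) w ->
  af k x = 0 -> 0 < af k y -> 0 < af k z -> af k w = 0 -> w = x.
Proof.
move=> n tw kx ky kz; rewrite (af_ext k w n) /= kx mulr0 add0r.
have [p0 p1 p2] := (inTP w n).1 tw; have sw := kb_sum w n; have wE := kb_comb w n.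
move: p1 p2 sw wE; set l1 := af (k1 _) w; set l2 := af (k2 _) w => p1 p2 sw wE kw.
have l10 : l1 = 0 by clear -p1 p2 ky kz kw; nra.
have l20 : l2 = 0 by clear -p1 p2 ky kz kw; nra.
rewrite l10 l20 !addr0 in sw wE; rewrite sw in wE; rewrite wE /comb /=.
by rewrite !mul1r !mul0r !addr0; case: (x).
Qed.

Lemma dis_cat3 t t1 t2 t3 (c1 c2 c3 : seq (tri R)) : dis t [:: t1; t2; t3] ->
  dis t1 c1 -> dis t2 c2 -> dis t3 c3 -> dis t (c1 ++ c2 ++ c3).
Proof.
move=> d d1 d2 d3; have [dn dp _] := d.
have : uniq [:: t1; t2; t3] by apply: mesh_uniq; split=> // u /dn[].
rewrite /= !inE !negb_or andbT => /andP[/andP[n12 n13] n23].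
have := dis_flatten (f := fun u => if u == t1 then c1 else if u == t2 then c2 else c3) d.
rewrite /= eqxx (eq_sym t2) (negPf n12) eqxx (eq_sym t3) (negPf n13) eq_sym (negPf n23) cats0.
apply => u; rewrite !inE => /or3P[]/eqP->; rewrite ?eqxx//.
  by rewrite eq_sym (negPf n12).
by rewrite eq_sym (negPf n13) eq_sym (negPf n23).
Qed.

Lemma wide_inT t (d : R) (x y : pt R) : wide d t -> inT t x -> inT t y ->
  `|x.1 - y.1| <= d /\ `|x.2 - y.2| <= d.
Proof.
move=> w tx ty.
have H q : (forall z z', z \in verts t -> z' \in verts t -> af (q, 0) z - af (q, 0) z' <= d) ->
    af (q, 0) x - af (q, 0) y <= d.
  move=> h.
  have A z' : z' \in verts t -> af (q, 0) x - af (q, 0) z' <= d.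
    move=> z't; have : 0 <= af (opk (q, 0)) x + (d + af (q, 0) z').
      have -> : af (opk (q, 0)) x + (d + af (q, 0) z') =
          af ((opk (q, 0)).1, d + af (q, 0) z') x by rewrite /af /=; ring.
      apply: tx => z zt; have := h z z' zt z't; rewrite /af /=; clear; lra.
    by rewrite af_opk; clear; lra.
  have : 0 <= af (q, d - af (q, 0) x) y.
    by apply: ty => z zt; have := A z zt; rewrite /af /=; clear; lra.
  by rewrite /af /=; clear; lra.
have W z z' : z \in verts t -> z' \in verts t -> [/\ z.1 - z'.1 <= d, z'.1 - z.1 <= d,
    z.2 - z'.2 <= d & z'.2 - z.2 <= d].
  move=> zt z't; have [] := w z z' zt z't; rewrite !ler_norml.
  by move=> /andP[? ?] /andP[? ?]; split; lra.
rewrite !ler_norml; split; apply/andP; split.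
- suff : -1 * x.1 + 0 * x.2 + 0 - (-1 * y.1 + 0 * y.2 + 0) <= d by clear; lra.
  by apply: (H (-1, 0)) => z z' zt z't; have [] := W z z' zt z't; rewrite /af /=; clear; lra.
- suff : 1 * x.1 + 0 * x.2 + 0 - (1 * y.1 + 0 * y.2 + 0) <= d by clear; lra.
  by apply: (H (1, 0)) => z z' zt z't; have [] := W z z' zt z't; rewrite /af /=; clear; lra.
- suff : 0 * x.1 + -1 * x.2 + 0 - (0 * y.1 + -1 * y.2 + 0) <= d by clear; lra.
  by apply: (H (0, -1)) => z z' zt z't; have [] := W z z' zt z't; rewrite /af /=; clear; lra.
- suff : 0 * x.1 + 1 * x.2 + 0 - (0 * y.1 + 1 * y.2 + 0) <= d by clear; lra.
  by apply: (H (0, 1)) => z z' zt z't; have [] := W z z' zt z't; rewrite /af /=; clear; lra.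
Qed.

(** The relative width of a thin triangle: below 2 ^ -r, to match the tiny triangles, and at most
    1/4, so that the two thin triangles of a tile do not overlap. *)
Definition shield r : R := (2 ^+ r.+2)^-1.

Lemma shield_bounds r : 0 < shield r <= 4^-1.
Proof.
rewrite /shield invr_gt0 exprn_gt0//= lef_pV2 ?posrE ?exprn_gt0//.
rewrite !exprS mulrA (_ : 2 * 2 = 4 :> R); last by lra.
by rewrite ler_peMr// exprn_ege1// ler1n.
Qed.

Lemma dis_split r (v a b : pt R) : nd (v, a, b) ->
  let c := lerp (shield r) a b in let d := lerp (shield r) b a in
  dis (v, a, b) [:: (v, a, c); (v, c, d); (v, d, b)].
Proof.
move=> n c d; have /andP[s0 s1] := shield_bounds r.
have cE : onE c a b by exists (shield r) => //; apply/andP; split; lra.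
have d1 := dis_bisect n cE; have [dn _ _] := d1.
have [n1 _] : nd (v, a, c) /\ sub (v, a, c) (v, a, b) by apply: dn; rewrite mem_head.
have [n2 _] : nd (v, c, b) /\ sub (v, c, b) (v, a, b) by apply: dn; rewrite !inE eqxx orbT.
have dE : onE d c b.
  have q : 0 < 1 - shield r by lra.
  exists ((1 - 2 * shield r) / (1 - shield r)).
    by rewrite divr_gt0//=; [rewrite ltr_pdivrMr//; lra|lra].
  by rewrite /d /c /lerp /=; congr (_, _); field; rewrite gt_eqF.
have d2 := dis_bisect n2 dE.
have nq : (v, a, c) != (v, c, b).
  apply: contraNneq n1 => -[-> _]; apply/eqP; rewrite /cr /=; ring.
have := dis_flatten (f := fun u => if u == (v, a, c) then [:: u] else
   [:: (v, c, d); (v, d, b)]) d1.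
rewrite /= eqxx eq_sym (negPf nq); apply => u; rewrite !inE => /orP[]/eqP->.
  by rewrite eqxx; apply: dis1.
by rewrite eq_sym (negPf nq).
Qed.

(** Subdividing the core [(v, c, d)] and the edge [ab] puts vertices on [vc] and [vd], not on [va]
    or [vb], which stay whole when they must be kept. The last clause records the fine mesh along
    [vc] and [vd], used later to bound the slivers. *)
Lemma split_tile r (D : R) (v a b : pt R) (keepA keepB : bool) : nd (v, a, b) ->
  wide D (v, a, b) ->
  let c := lerp (shield r) a b in let d := lerp (shield r) b a in
  exists l : seq (tri R), [/\ dis (v, a, b) l, (size l <= 3 * 4 ^ r)%N,
    forall u, u \in l -> [\/ keepA /\ u = (v, a, c), keepB /\ u = (v, d, b) |
      wide (D / 2 ^+ r) u],
    (keepA -> forall z, z \in allv l -> ~ onE z v a) /\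
    (keepB -> forall z, z \in allv l -> ~ onE z v b) &
    forall x, inT (v, c, d) x -> exists u,
      [/\ u \in l, wide (D / 2 ^+ r) u, sub u (v, c, d) & inT u x]].
Proof.
move=> n w c d; have /andP[s0 s1] := shield_bounds r.
have ds := dis_split r n; have [dn _ _] := ds.
have [n1 b1] : nd (v, a, c) /\ sub (v, a, c) (v, a, b) by apply: dn; rewrite mem_head.
have [n2 b2] : nd (v, c, d) /\ sub (v, c, d) (v, a, b) by apply: dn; rewrite !inE eqxx orbT.
have [n3 b3] : nd (v, d, b) /\ sub (v, d, b) (v, a, b) by apply: dn; rewrite !inE eqxx !orbT.
have wsub u : sub u (v, a, b) -> wide D u.
  by move=> su x y /su ux /su uy; apply: wide_inT w ux uy.
have fine u : nd u -> sub u (v, a, b) -> exists l, [/\ dis u l, (size l <= 4 ^ r)%N &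
    forall u', u' \in l -> wide (D / 2 ^+ r) u'].
  by move=> nu su; apply: subdiv => //; apply: wsub.
(* A thin triangle whose outer edge is not kept protects nothing and is subdivided like the core. *)
have keep (kp : bool) u : nd u -> sub u (v, a, b) -> exists l, [/\ dis u l, (size l <= 4 ^ r)%N,
    forall u', u' \in l -> (kp /\ u' = u) \/ wide (D / 2 ^+ r) u' & kp -> l = [:: u]].
  move=> nu su; case: kp.
    exists [:: u]; split=> //; [exact: dis1|by rewrite expn_gt0|].
    by move=> u'; rewrite inE => /eqP->; left.
  by have [l [dl sl wl]] := fine u nu su; exists l; split=> // u' /wl; right.
have [l1 [e1 z1 w1 k1']] := keep keepA _ n1 b1.
have [l2 [e2 z2 w2]] := fine _ n2 b2.
have [l3 [e3 z3 w3 k3']] := keep keepB _ n3 b3.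
exists (l1 ++ l2 ++ l3); split.
- exact: dis_cat3 e1 e2 e3.
- by rewrite !size_cat; clear -z1 z2 z3; lia.
- move=> u; rewrite !mem_cat => /or3P[/w1[]|/w2|/w3[]]; by [constructor 1|constructor 2|constructor 3].
- have [[a0 b0 c0] [[a1 b1' c1] [a2 b2' c2]]] := kbE n.
  rewrite /= in a0 b0 c0 a1 b1' c1 a2 b2' c2.
  have subl (u : tri R) (l : seq (tri R)) : dis u l -> forall u' z, u' \in l -> z \in verts u' -> inT u z.
    by move=> [H _ _] u' z /H[_ h] /h.
  have onz k x y z : af k x = 0 -> af k y = 0 -> onE z x y -> af k z = 0.
    by move=> kx ky [rho _ ->]; rewrite af_lerp kx ky !mulr0 addr0.
  have nend x y : nd (v, x, y) -> onE v v x -> False.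
    move=> nx [rho /andP[r0 r1] h].
    have : af (k0 (v, x, y)) v = 1 - rho.
      rewrite {2}h af_lerp; have [[h0 h1 _] _] := kbE nx.
      by rewrite /= in h0 h1; rewrite h0 h1; ring.
    by have [[h0 _ _] _] := kbE nx; rewrite /= in h0; rewrite h0 => h'; clear -h' r0; lra.
  have ca : af (k2 (v, a, b)) c = shield r by rewrite /c af_lerp b2' c2; ring.
  have cb : af (k1 (v, a, b)) c = 1 - shield r by rewrite /c af_lerp b1' c1; ring.
  have da : af (k2 (v, a, b)) d = 1 - shield r by rewrite /d af_lerp b2' c2; ring.
  have db : af (k1 (v, a, b)) d = shield r by rewrite /d af_lerp b1' c1; ring.
  have nba : nd (v, b, a).
    by move: n; rewrite /nd /= (_ : cr v b a = - cr v a b) ?oppr_eq0// /cr; ring.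
  have ndv x y : nd (v, x, y) -> ~ onE x v x.
    move=> nx [rho /andP[r0 r1] h].
    move: nx; rewrite (_ : x = v).
      by rewrite /nd /cr /= !subrr !mul0r mulr0 subrr eqxx.
    have q : 1 - rho != 0 by rewrite subr_eq0 gt_eqF.
    case: (x) (v) h => x1 x2 [v1 v2] [h1 h2]; congr (_, _); apply: (mulfI q).
      by rewrite /lerp /= in h1; clear -h1; lra.
    by rewrite /lerp /= in h2; clear -h2; lra.
  split=> [kA|kB] z /allvP[u].
  + rewrite !mem_cat => /or3P[ul|ul|ul] zu zE.
    * move: ul; rewrite (k1' kA) mem_seq1 => /eqP uE; move: zu zE; rewrite uE mem_verts.
      move=> /or3P[]/eqP->; [exact: nend n|exact: ndv n|move=> h].
      by have := onz _ _ _ _ a2 b2' h; rewrite ca; clear -s0; lra.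
    * have zv : z = v.
        apply: (vertex_only n2 (subl _ _ e2 _ _ ul zu) a2 _ _ (onz _ _ _ _ a2 b2' zE)).
          by rewrite ca.
        by rewrite da; clear -s1; lra.
      by move: zE; rewrite zv; apply: nend n.
    * have zv : z = v.
        apply: (vertex_only n3 (subl _ _ e3 _ _ ul zu) a2 _ _ (onz _ _ _ _ a2 b2' zE)).
          by rewrite da; clear -s1; lra.
        by rewrite c2.
      by move: zE; rewrite zv; apply: nend n.
  + rewrite !mem_cat => /or3P[ul|ul|ul] zu zE.
    * have zv : z = v.
        apply: (vertex_only n1 (subl _ _ e1 _ _ ul zu) a1 _ _ (onz _ _ _ _ a1 c1 zE)).
          by rewrite b1'.
        by rewrite cb; clear -s1; lra.
      by move: zE; rewrite zv; apply: nend nba.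
    * have zv : z = v.
        apply: (vertex_only n2 (subl _ _ e2 _ _ ul zu) a1 _ _ (onz _ _ _ _ a1 c1 zE)).
          by rewrite cb; clear -s1; lra.
        by rewrite db.
      by move: zE; rewrite zv; apply: nend nba.
    * move: ul; rewrite (k3' kB) mem_seq1 => /eqP uE; move: zu zE; rewrite uE mem_verts.
      move=> /or3P[]/eqP->; [exact: nend nba|move=> h|exact: ndv nba].
      by have := onz _ _ _ _ a1 c1 h; rewrite db; clear -s0; lra.
- move=> x; have [dn2 _ dc2] := e2; move=> /dc2[u ul ux]; exists u; split=> //.
  + by rewrite !mem_cat ul orbT.
  + exact: w2.
  + by have [] := dn2 _ ul.
Qed.

End Clipping.

(** * The tiles of one cell and its transition layer *)

Section TilePieces.
Variable R : realType.
Variables (B : tri R) (W : seq (tri R)) (D : R) (r : nat).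
Implicit Types (t : tri R) (k : pt R * R).

Definition inn t := forall x, x \in verts t -> inI B x.

(** All tiles at this edge are interior to the cell, so none of them is clipped and the edge may be
    left whole on both sides. *)
Definition kept (x y : pt R) :=
  forall t, t \in W -> x \in verts t -> y \in verts t -> inn t.

(** The tiles that survive in the final mesh. An interior tile next to a clipped one is not good: it
    carries the transition. *)
Definition good t := inn t /\
  forall x y, x \in verts t -> y \in verts t -> x != y -> kept x y.

Definition meets t := exists2 x, inT t x & inT B x.

Definition goods := [seq t <- W | `[< good t >]].

Definition bads := [seq t <- W | `[< ~ good t /\ meets t >]].

(* [u = (v, a, c)] is the thin triangle shielding the kept edge [va] of a tile
   [(v, a, b)] whose edge [ab] is subdivided; the core [(v, c, d)] is subdivided. *)
Definition thin (s : seq (tri R)) u := exists v a b t,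
  [/\ t \in W, inn t, verts t =i [:: v; a; b], nd (v, a, b) & kept v a] /\
  let c := lerp (shield R r) a b in let d := lerp (shield R r) b a in
  verts u =i [:: v; a; c] /\
  forall x, inT (v, c, d) x -> exists f,
    [/\ f \in s, wide (D / 2 ^+ r) f, sub f (v, c, d) & inT f x].

Hypotheses (nB : nd B) (mW : mesh W) (hW : nohang W)
  (cW : forall x, inT B x -> covers W x) (wW : forall t, t \in W -> wide D t).

Lemma kept_sym x y : kept x y -> kept y x.
Proof. by move=> h t tW yt xt; apply: h. Qed.

Lemma inn_sub t : inn t -> sub t B.
Proof. by move=> h x /h; apply: inI_inT. Qed.

Lemma inI_lerp x g (e : R) : inT B x -> inI B g -> 0 < e < 1 -> inI B (lerp e x g).
Proof.
move=> Bx Bg /andP[e0 e1] k kB; have kg := Bg _ kB.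
have kx : 0 <= af k x by apply: Bx; apply: kb_nneg.
by rewrite af_lerp ltr_wpDl ?mulr_gt0 ?mulr_ge0// subr_ge0 ltW.
Qed.

Lemma inI_sub t x : inn t -> inT t x -> inI B x.
Proof.
move=> ht tx k kB; pose m := Num.min (af k t.1.1) (Num.min (af k t.1.2) (af k t.2)).
have m0 : 0 < m by rewrite !lt_min !(ht _ _ _ kB)// /verts !inE eqxx ?orbT.
apply: lt_le_trans m0 _; rewrite -subr_ge0.
have -> : af k x - m = af (k.1, k.2 - m) x by rewrite /af /=; ring.
apply: tx; apply/nneg3; rewrite /af /= !addrA !subr_ge0 -/(af k _) -/(af k t.1.2) -/(af k t.2).
by split; rewrite /m !ge_min lexx ?orbT.
Qed.

Lemma inI_exists : exists g, inI B g.
Proof.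
exists (comb 3^-1 3^-1 3^-1 B) => k.
have [[a0 b0 c0] [[a1 b1 c1] [a2 b2 c2]]] := kbE nB.
rewrite -[kb _]/[:: k0 B; k1 B; k2 B] !inE => /or3P[]/eqP->; rewrite af_comb; try lra.
Qed.

Definition pieces_spec t (l : seq (tri R)) :=
  [/\ pw l, forall u, u \in l -> [/\ nd u, sub u t & sub u B],
    (size l <= 64 * 4 ^ r)%N,
    forall x, inT t x -> inI B x -> covers l x &
    good t -> l = [:: t]] /\
  (forall u, u \in l -> [\/ good t /\ u = t, thin l u | wide (D / 2 ^+ r) u]) /\
  forall z x y, z \in allv l -> x \in verts t -> y \in verts t -> x != y -> kept x y ->
    ~ onE z x y.

(** Three cases: a good tile is left alone; an interior tile with an edge [pq] that is not kept is
    split from the vertex opposite to [pq]; a tile reaching the boundary is clipped to [B] and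
    subdivided. In the last case none of its edges is kept, the tile itself being a witness. *)
Lemma pieces t : t \in W -> exists l, pieces_spec t l.
Proof.
move=> tW; have [nW pW] := mW; have nt := nW _ tW.
have [gt|ngt] := pselect (good t).
  exists [:: t]; split; [split=> //|split].
  - by move=> u; rewrite mem_seq1 => /eqP->; split=> //; [exact: sub_refl|apply: inn_sub gt.1].
  - by rewrite muln_gt0 expn_gt0.
  - by move=> x tx _; exists t; rewrite ?mem_head.
  - by move=> u; rewrite mem_seq1 => /eqP->; constructor 1.
  - move=> z x y /allvP[u]; rewrite mem_seq1 => /eqP-> zt xt yt xy _ zE.
    by apply: (not_hang_self nt (@sub_refl _ t) zt); exists x, y.
have [it|nit] := pselect (inn t).
  have [p [q [pt' qt pq npq]]] : exists p q, [/\ p \in verts t, q \in verts t, p != q & ~ kept p q].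
    apply: contrapT => h; apply: ngt; split=> // x y xt yt xy.
    by apply: contrapT => kxy; apply: h; exists x, y.
  have [v [n e]] := edge_view nt pt' qt pq.
  have wv : wide D (v, p, q).
    by move=> x y xv yv; apply: (wW tW); rewrite e.
  have [l [dl sl wl [kA kB'] ch]] := split_tile r `[< kept v p >] `[< kept v q >] n wv.
  have st : sub (v, p, q) t by move=> x xv; apply: inT_mem; rewrite e.
  have ts : sub t (v, p, q) by move=> x; rewrite e => xv; apply: inT_mem.
  have [dn dp dc] := dl.
  exists l; split; [split=> //|split].
  - move=> u /dn[nu su]; have su' := sub_trans su st; split=> //.
    exact: sub_trans su' (inn_sub it).
  - by apply: leq_trans sl _; rewrite leq_mul2r orbC.
  - by move=> x tx _; apply: dc; apply: inT_sub tx.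
  - move=> u ul; have [] := wl u ul.
    + move=> [/asboolP k uE]; constructor 2; exists v, p, q, t; split; first by split.
      by rewrite uE; split=> // x /ch[f [fl wf sf fx]]; exists f.
    + move=> [/asboolP k uE]; constructor 2; exists v, q, p, t; split.
        split=> //.
          by move=> x; rewrite e !inE (orbC (x == p)).
        by move: n; rewrite /nd /= (_ : cr v q p = - cr v p q) ?oppr_eq0// /cr; ring.
      rewrite uE; split=> [x|x].
        by rewrite mem_verts !inE (orbC (x == q)).
      have sw a b c d : inT (a, b, c) d -> inT (a, c, b) d.
        apply: inT_sub => w; rewrite mem_verts => wv'; apply: inT_mem.
        by rewrite mem_verts (orbC (w == c)).
      move=> /sw /ch[f [fl wf sf fx]]; exists f; split=> // w /sf; exact: sw.
    + by constructor 3.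
  - move=> z x y zl; rewrite !e !inE => /or3P[]/eqP-> /or3P[]/eqP->; rewrite ?eqxx// => _ k zE.
    + by apply: (kA _ z zl zE); apply/asboolP.
    + by apply: (kB' _ z zl zE); apply/asboolP.
    + have k' := kept_sym k; apply: (kA _ z zl); first exact/asboolP.
      case: zE => rho /andP[h0 h1] ->; exists (1 - rho); first by apply/andP; split; lra.
      by rewrite /lerp; congr (_, _); ring.
    + have k' := kept_sym k; apply: (kB' _ z zl); first exact/asboolP.
      case: zE => rho /andP[h0 h1] ->; exists (1 - rho); first by apply/andP; split; lra.
      by rewrite /lerp; congr (_, _); ring.
    + by case: npq; apply: kept_sym.
have [c [pc nc sc cc]] := clip nB nt.
have /choose_list[f Hf] : forall u, u \in c -> exists l : seq (tri R),
    [/\ dis u l, (size l <= 4 ^ r)%N & forall u', u' \in l -> wide (D / 2 ^+ r) u'].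
  move=> u uc; have [nu ut uB] := nc _ uc; apply: subdiv => // x y /ut tx /ut ty.
  exact: wide_inT (wW tW) tx ty.
exists (flatten [seq f u | u <- c]); split; [split|split].
- by apply: pw_flatten => // [u /Hf[[_ ? _]]//|u u' /Hf[[H _ _] _ _] /H[]].
- move=> u' /flatten_mapP[u uc uf]; have [[H _ _] _ _] := Hf _ uc; have [nu' su'] := H _ uf.
  have [_ ut uB] := nc _ uc; split=> //; exact: sub_trans su' _.
- apply: (leq_trans (size_flatten_le (n := 4 ^ r) _)) => [u /Hf[]//|].
  by rewrite mulnC leq_mul2r sc orbT.
- move=> x tx Bx; have [u uc ux] := cc _ tx Bx; have [[_ _ H] _ _] := Hf _ uc.
  by have [u' uf u'x] := H _ ux; exists u' => //; apply/flatten_mapP; exists u.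
- by move=> gt; case: ngt.
- by move=> u' /flatten_mapP[u uc uf]; constructor 3; have [_ _ H] := Hf _ uc; apply: H.
- by move=> z x y _ xt yt _ k; case: nit; apply: k xt yt.
Qed.

Lemma tile_mesh : exists F,
  [/\ mesh (goods ++ F), forall x, covers (goods ++ F) x <-> inT B x,
   (size F <= 64 * 4 ^ r * size bads)%N,
   forall u, u \in goods ++ F -> (exists2 t, t \in W & sub u t) /\
     [\/ u \in goods, thin (goods ++ F) u | wide (D / 2 ^+ r) u] &
   forall t z x y, t \in W -> z \in allv (goods ++ F) -> x \in verts t -> y \in verts t ->
     x != y -> kept x y -> ~ onE z x y].
Proof.
have [nW pW] := mW; have /choose_list[f Hf] := pieces.
have gbW t : t \in goods ++ bads -> t \in W.
  by rewrite mem_cat !mem_filter => /orP[]/andP[].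
have gP t : t \in goods -> good t by rewrite mem_filter => /andP[/asboolP].
have pgb : pw (goods ++ bads).
  apply/pw_cat; split; [exact: pw_filter|exact: pw_filter|move=> t1 t2 t1g t2b].
  apply: (pw_sep pW); rewrite ?gbW ?mem_cat ?t1g ?t2b ?orbT//.
  apply: contraTneq t1g => ->; rewrite mem_filter; move: t2b.
  by rewrite mem_filter => /andP[/asboolP[h _] _]; rewrite asboolF.
have fg : flatten [seq f t | t <- goods] = goods.
  have : forall t, t \in goods -> f t = [:: t].
    by move=> t tg; have [[_ _ _ _ h] _] := Hf _ (gbW t ltac:(by rewrite mem_cat tg)); apply: h; apply: gP.
  elim: goods => //= t l IH h; rewrite h ?mem_head//= IH// => u ul.
  by apply: h; rewrite inE ul orbT.
pose F := flatten [seq f t | t <- bads].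
have sE : goods ++ F = flatten [seq f t | t <- goods ++ bads].
  by rewrite map_cat flatten_cat fg.
have inS u : u \in goods ++ F -> exists t, [/\ t \in W, t \in goods ++ bads & u \in f t].
  by rewrite sE => /flatten_mapP[t tg tf]; exists t; split=> //; apply: gbW.
have Sin t u : t \in goods ++ bads -> u \in f t -> u \in goods ++ F.
  by move=> tg uf; rewrite sE; apply/flatten_mapP; exists t.
exists F; split.
- split=> [u /inS[t [tW _ uf]]|]; first by have [[_ h _ _ _] _] := Hf _ tW; have [] := h _ uf.
  rewrite sE; apply: pw_flatten => // [t /gbW tW|t u /gbW tW uf].
    by have [[]] := Hf _ tW.
  by have [[_ h _ _ _] _] := Hf _ tW; have [] := h _ uf.
- move=> x; split=> [[u /inS[t [tW _ uf]] ux]|Bx].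
    by have [[_ h _ _ _] _] := Hf _ tW; have [_ _ uB] := h _ uf; apply: inT_sub ux.
  (* Clipping only covers interior points of [B]; boundary points are limits of these along a
     segment to the interior point [g]. *)
  have [g Bg] := inI_exists; apply: (@cover_closure _ _ _ g) => e e01.
  have Ie := inI_lerp Bx Bg e01; have Te := inI_inT nB Ie.
  have [t tW tx] := cW Te; have [[_ _ _ h _] _] := Hf _ tW.
  have [u uf ux] := h _ tx Ie; exists u => //; apply: (Sin t) => //.
  rewrite mem_cat !mem_filter tW !andbT.
  have [gt|ngt] := pselect (good t); first by rewrite asboolT.
  by apply/orP; right; apply/asboolP; split=> //; exists (lerp e x g).
- apply: (leq_trans (size_flatten_le (n := 64 * 4 ^ r) _)) => // t tb.
  by have [[]] := Hf _ (gbW t ltac:(by rewrite mem_cat tb orbT)).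
- move=> u /inS[t [tW tg uf]]; have [[_ h _ _ _] [cl _]] := Hf _ tW.
  have [_ ut _] := h _ uf; split; first by exists t.
  case: (cl _ uf) => [[gt ->]|[v [a [b [t' [H [uE ch]]]]]]|]; last by constructor 3.
    by constructor 1; rewrite mem_filter tW asboolT.
  constructor 2; exists v, a, b, t'; split=> //; split=> // x /ch[f' [f'l wf sf fx]].
  by exists f'; split=> //; apply: Sin f'l.
- move=> t z x y tW /allvP[u /inS[t' [t'W tg uf]] zu] xt yt xy k zE.
  have [[_ h _ _ _] [_ nk]] := Hf _ t'W; have [_ ut _] := h _ uf.
  have t'z : inT t' z := ut _ zu.
  have [xt' yt'] := share_edge mW hW tW t'W xt yt xy zE t'z.
  by apply: (nk z x y _ xt' yt' xy k zE); apply/allvP; exists u.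
Qed.

End TilePieces.

(** * Slivers and the conforming mesh over all cells *)

Section ConformingMesh.
Variable R : realType.
Implicit Types (t : tri R) (k : pt R * R).

Definition near_pt (d : R) (x y : pt R) := `|x.1 - y.1| <= d /\ `|x.2 - y.2| <= d.

(** Up to [d], the triangle is a segment parallel to [va] and no longer than it: [y] and [y'] nearly
    coincide, and [rho] is the signed ratio of lengths. *)
Definition sliver (d : R) (v a : pt R) t := exists x y y' (rho : R),
  [/\ verts t =i [:: x; y; y'], `|rho| <= 1, near_pt d y y' &
   near_pt d (y.1 - x.1, y.2 - x.2) (rho * (a.1 - v.1), rho * (a.2 - v.2))].

Lemma inT_lerp t x y (rho : R) : 0 <= rho <= 1 -> inT t x -> inT t y -> inT t (lerp rho x y).
Proof.
move=> /andP[r0 r1] tx ty k kt.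
by rewrite af_lerp addr_ge0// mulr_ge0 ?subr_ge0 ?tx ?ty.
Qed.

Lemma nd_collinear p q w k : k.1 != 0 -> nd (p, q, w) -> af k p = 0 -> af k q = 0 ->
  af k w = 0 -> False.
Proof.
move=> k0 n kp kq kw; move/eqP: k0; apply; apply: (af_const n) => x.
by rewrite mem_verts => /or3P[]/eqP->.
Qed.

Lemma kcr_neq0 (a b c : pt R) : nd (a, b, c) -> (kcr a b).1 != 0.
Proof.
move=> n; apply: contraNneq n => k0; apply/eqP.
have E x : af (kcr a b) x = (kcr a b).2 by rewrite /af k0 /= !mul0r !add0r.
have := E c; rewrite -(E a) !af_kcr /= => ->; rewrite /cr; ring.
Qed.

(** The fine triangle of the core at the midpoint of [pq] has an edge along [vc] through that
    midpoint. Its ends are not inside [pq], as nothing hangs there, so it contains [pq] and bounds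
    its length. *)
Lemma chain_near (d : R) (V : seq (pt R)) (v c e p q : pt R) t :
  nd (v, c, e) ->
  (forall x, inT (v, c, e) x -> exists f, [/\ nd f, wide d f, {subset verts f <= V},
     sub f (v, c, e) & inT f x]) ->
  p \in verts t -> q \in verts t -> p != q -> (forall z, z \in V -> ~ hang z t) ->
  (exists2 r : R, 0 <= r <= 1 & p = lerp r v c) ->
  (exists2 r : R, 0 <= r <= 1 & q = lerp r v c) -> near_pt d p q.
Proof.
move=> n ch pt' qt pq nh [r1 r1b pE] [r2 r2b qE].
have [_ [_ [kv kc ke]]] := kbE n; rewrite /= in kv kc ke.
set k := k2 _ in kv kc ke.
have tv : inT (v, c, e) v by apply: inT_mem; rewrite mem_verts eqxx.
have tc : inT (v, c, e) c by apply: inT_mem; rewrite mem_verts eqxx orbT.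
have tp : inT (v, c, e) p by rewrite pE; apply: inT_lerp.
have tq : inT (v, c, e) q by rewrite qE; apply: inT_lerp.
have kp : af k p = 0 by rewrite pE af_lerp kv kc !mulr0 addr0.
have kq : af k q = 0 by rewrite qE af_lerp kv kc !mulr0 addr0.
have kn : k.1 != 0 by apply: (kb_neq0 n); rewrite !inE eqxx !orbT.
have [|f [nf wf fV sf fm]] := ch (mid p q).
  by apply: inT_lerp => //; apply/andP; split; lra.
have kf : nneg k (verts f).
  by apply: (nneg_sub sf); apply/nneg3; rewrite /= kv kc ke.
have km : af k (mid p q) = 0 by rewrite /mid af_lerp kp kq !mulr0 addr0.
have nhl a : lerp a p q \in V -> ~~ (0 < a < 1).
  by move=> aV; apply/negP => a01; apply: (nh _ aV); exists p, q; split=> //; exists a.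
have [mf|[x [y [xf yf xy mE [kx ky]]]]] := face nf kn kf fm km.
  have := nhl _ (fV _ mf); case/negP; lra.
have [a xE] := line_lerp kn pq kp kq kx; have [b yE] := line_lerp kn pq kp kq ky.
have ha : ~~ (0 < a < 1) by apply: nhl; rewrite -xE fV.
have hb : ~~ (0 < b < 1) by apply: nhl; rewrite -yE fV.
have [rho /andP[h0 h1] mE'] := mE.
have lerp_inj a' b' : lerp a' p q = lerp b' p q -> a' = b'.
  rewrite /lerp => -[e1 e2]; apply/eqP; apply: contraNT pq => cd.
  have cd' : a' - b' != 0 by rewrite subr_eq0.
  case: (p) (q) e1 e2 => x1 x2 [y1 y2] /= e1 e2; apply/eqP; congr (_, _);
    by apply: (mulfI cd'); clear -e1 e2; lra.
have e2 : 2^-1 = (1 - rho) * a + rho * b.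
  by apply: lerp_inj; rewrite -/(mid p q) mE' xE yE /lerp /=; congr (_, _); ring.
have [d1 d2] := wf _ _ xf yf.
have ab : 1 <= `|a - b|.
  move: ha hb; rewrite !negb_and -!leNgt => /orP[a0|a1] /orP[b0|b1].
  - by exfalso; clear -e2 a0 b0 h0 h1; nra.
  - by rewrite distrC (le_trans _ (ler_norm _))//; clear -a0 b1; lra.
  - by rewrite (le_trans _ (ler_norm _))//; clear -a1 b0; lra.
  - by exfalso; clear -e2 a1 b1 h0 h1; nra.
have le_ab z : `|z| <= `|(a - b) * z| by rewrite normrM ler_peMl.
have e3 : x.1 - y.1 = - ((a - b) * (p.1 - q.1)) by rewrite xE yE /lerp /=; ring.
have e4 : x.2 - y.2 = - ((a - b) * (p.2 - q.2)) by rewrite xE yE /lerp /=; ring.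
split; first by apply: le_trans (le_ab _) _; rewrite -normrN -e3.
by apply: le_trans (le_ab _) _; rewrite -normrN -e4.
Qed.

(** Closing a thin triangle only uses points of [vc] and [ac]. A piece has two vertices on one of
    these lines and the third on the other: two on [ac] are close because [ac] is short, two on [vc]
    because of [chain_near]. *)
Lemma thin_sliver (d : R) (V : seq (pt R)) (v a c e : pt R) u t :
  nd (v, a, c) -> nd (v, c, e) -> near_pt d a c ->
  (forall x, inT (v, c, e) x -> exists f, [/\ nd f, wide d f, {subset verts f <= V},
     sub f (v, c, e) & inT f x]) ->
  verts u =i [:: v; a; c] ->
  (forall z, z \in V -> inT u z -> [\/ z \in [:: v; a; c], onE z a c | onE z v c]) ->
  nd t -> sub t u -> {subset verts t <= V} -> (forall z, z \in V -> ~ hang z t) ->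
  sliver d v a t.
Proof.
move=> n1 n2 [ac1 ac2] ch uE intV nt tu tV nh.
pose P1 w := exists2 r : R, 0 <= r <= 1 & w = lerp r v c.
pose P2 w := exists2 r : R, 0 <= r <= 1 & w = lerp r a c.
have l0 x y : lerp 0 x y = x :> pt R by rewrite /lerp subr0 !mul1r !mul0r !addr0; case: (x).
have l1 x y : lerp 1 x y = y :> pt R by rewrite /lerp subrr !mul1r !mul0r !add0r; case: (y).
have P12 w : w \in verts t -> P1 w \/ P2 w.
  move=> wt; case: (intV w (tV _ wt) (tu _ wt)).
  - rewrite !inE => /or3P[]/eqP->; [left|right|left].
    + by exists 0; rewrite ?lexx ?ler01 ?l0.
    + by exists 0; rewrite ?lexx ?ler01 ?l0.
    + by exists 1; rewrite ?lexx ?ler01 ?l1.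
  - by move=> [r /andP[h0 h1] ->]; right; exists r; rewrite ?ltW.
  - by move=> [r /andP[h0 h1] ->]; left; exists r; rewrite ?ltW.
have kz k x y w r : af k x = 0 -> af k y = 0 -> w = lerp r x y -> af k w = 0.
  by move=> kx ky ->; rewrite af_lerp kx ky !mulr0 addr0.
have c0 x y : af (kcr x y) x = 0 :> R by rewrite af_kcr /cr; ring.
have c1 x y : af (kcr x y) y = 0 :> R by rewrite af_kcr /cr; ring.
have kac : (kcr a c).1 != 0.
  apply: (@kcr_neq0 _ _ v); move: n1; rewrite /nd /=.
  by rewrite (_ : cr v a c = cr a c v)// /cr; ring.
have kvc : (kcr v c).1 != 0 by apply: kcr_neq0 n2.
have d0 : 0 <= d by apply: le_trans ac1.
have err (x y z w : R) : 0 <= x <= 1 -> 0 <= y <= 1 -> `|z - w| <= d -> `|(x - y) * (w - z)| <= d.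
  move=> /andP[x0 x1] /andP[y0 y1] h; rewrite normrM distrC -[d]mul1r.
  rewrite [`|w - z|]distrC ler_pM ?normr_ge0//.
  by rewrite ler_norml; apply/andP; split; lra.
(* With [w] at parameter [r3] on [vc], the vector from [w] to [ac] is [1 - r3] times that from [v]
   to [a], up to a multiple of [c - a]. *)
have A p q w : nd (p, q, w) -> verts t =i [:: w; p; q] -> P2 p -> P2 q -> sliver d v a t.
  move=> n E P2p P2q; have wt : w \in verts t by rewrite E mem_head.
  have [P1w|P2w] := P12 _ wt; last first.
    have [r1 _ h1] := P2p; have [r2 _ h2] := P2q; have [r3 _ h3] := P2w.
    by case: (nd_collinear kac n); [apply: kz h1|apply: kz h2|apply: kz h3].
  have [r1 r1b pE] := P2p; have [r2 r2b qE] := P2q; have [r3 r3b wE] := P1w.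
  exists w, p, q, (1 - r3); split=> //.
  - by move: r3b => /andP[? ?]; rewrite ler_norml; apply/andP; split; lra.
  - split; rewrite pE qE /lerp /=.
      by rewrite (_ : _ - _ = (r1 - r2) * (c.1 - a.1)); [exact: err|ring].
    by rewrite (_ : _ - _ = (r1 - r2) * (c.2 - a.2)); [exact: err|ring].
  - split; rewrite pE wE /lerp /=.
      by rewrite (_ : _ - _ = (r1 - r3) * (c.1 - a.1)); [exact: err|ring].
    by rewrite (_ : _ - _ = (r1 - r3) * (c.2 - a.2)); [exact: err|ring].
(* Here the vector runs from [ac] back to [vc], so the ratio [r1 - 1] is negative. *)
have Bc p q w : nd (p, q, w) -> verts t =i [:: w; p; q] -> P1 p -> P1 q -> sliver d v a t.
  move=> n E P1p P1q; have wt : w \in verts t by rewrite E mem_head.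
  have [P1w|P2w] := P12 _ wt.
    have [r1 _ h1] := P1p; have [r2 _ h2] := P1q; have [r3 _ h3] := P1w.
    by case: (nd_collinear kvc n); [apply: kz h1|apply: kz h2|apply: kz h3].
  have pq : p != q by apply: contraNneq n => ->; apply/eqP; rewrite /cr /=; ring.
  have npq : near_pt d p q.
    apply: (chain_near n2 ch _ _ pq nh) => //; by rewrite E !inE eqxx ?orbT.
  have [r1 r1b pE] := P1p; have [r2 r2b qE] := P1q; have [r3 r3b wE] := P2w.
  exists w, p, q, (r1 - 1); split=> //.
  - by move: r1b => /andP[? ?]; rewrite ler_norml; apply/andP; split; lra.
  - split; rewrite pE wE /lerp /=.
      by rewrite (_ : _ - _ = (r1 - r3) * (c.1 - a.1)); [exact: err|ring].
    by rewrite (_ : _ - _ = (r1 - r3) * (c.2 - a.2)); [exact: err|ring].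
case: t nt tu tV nh P12 A Bc => -[p q] w nt tu tV nh P12 A Bc.
have n3 : nd (q, w, p).
  by move: nt; rewrite /nd /= (_ : cr q w p = cr p q w)// /cr; ring.
have n4 : nd (p, w, q).
  by move: nt; rewrite /nd /= (_ : cr p w q = - cr p q w) ?oppr_eq0// /cr; ring.
have e1 : verts (p, q, w) =i [:: w; p; q].
  by move=> x; rewrite mem_verts !inE orbA orbC.
have e2 : verts (p, q, w) =i [:: p; q; w] by [].
have e3 : verts (p, q, w) =i [:: q; p; w].
  by move=> x; rewrite mem_verts !inE orbCA.
have pP := P12 p ltac:(by rewrite mem_verts eqxx).
have qP := P12 q ltac:(by rewrite mem_verts eqxx orbT).
have wP := P12 w ltac:(by rewrite mem_verts eqxx !orbT).
case: pP => pP; case: qP => qP.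
- exact: (Bc p q w).
- by case: wP => wP; [apply: (Bc p w q)|apply: (A q w p)].
- by case: wP => wP; [apply: (Bc q w p)|apply: (A p w q)].
- exact: (A p q w).
Qed.

(** If [k] vanished at a point with positive coordinates it would vanish at every vertex. *)
Lemma inI_pos (B : tri R) z k : nd B -> inI B z -> nneg k (verts B) -> k.1 != 0 -> 0 < af k z.
Proof.
move=> n Bz kB kn; rewrite lt0r (inI_inT n Bz kB) andbT; apply: contraNneq kn => kz.
apply/eqP; apply: (af_const n) => x xB.
have [p0 p1 p2] : [/\ 0 < af (k0 B) z, 0 < af (k1 B) z & 0 < af (k2 B) z].
  by split; apply: Bz; rewrite !inE eqxx ?orbT.
have [q0 q1 q2] : [/\ 0 <= af k B.1.1, 0 <= af k B.1.2 & 0 <= af k B.2].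
  by split; apply: kB; rewrite !inE eqxx ?orbT.
move: kz; rewrite (af_ext k z n).
set l0 := af (k0 B) z in p0 *; set l1 := af (k1 B) z in p1 *; set l2 := af (k2 B) z in p2 *.
set A0 := af k _ in q0 *; set A1 := af k B.1.2 in q1 *; set A2 := af k B.2 in q2 *.
move=> kz; have m0 : 0 <= l0 * A0 by rewrite mulr_ge0// ltW.
have m1 : 0 <= l1 * A1 by rewrite mulr_ge0// ltW.
have m2 : 0 <= l2 * A2 by rewrite mulr_ge0// ltW.
have z0 : l0 * A0 = 0 by clear -kz m0 m1 m2; lra.
have z1 : l1 * A1 = 0 by clear -kz m0 m1 m2; lra.
have z2 : l2 * A2 = 0 by clear -kz m0 m1 m2; lra.
have mz (l A : R) : 0 < l -> l * A = 0 -> A = 0.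
  by move=> l_gt0 /eqP; rewrite mulf_eq0 gt_eqF//= => /eqP.
have e0 := mz _ _ p0 z0; have e1 := mz _ _ p1 z1; have e2 := mz _ _ p2 z2.
by move: xB; rewrite !inE => /or3P[]/eqP->.
Qed.

Variables (bs : seq (tri R)) (Wf : tri R -> seq (tri R)) (Df : tri R -> R) (r : nat).

(** The factor is 7 = 1 + 2 * 3: the new triangles themselves, plus two for each of their three
    vertices, which may hang. Each bad tile has at most [64 * 4 ^ r] pieces. *)
Definition mesh_bound : nat := \sum_(B <- bs) size (goods B (Wf B)) +
  7 * (64 * 4 ^ r) * \sum_(B <- bs) size (bads B (Wf B)).

Definition mesh_spec (s : seq (tri R)) := forall u, u \in s -> exists B, [/\ B \in bs, sub u B &
  [\/ u \in Wf B /\ inn B u,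
      exists t v a, [/\ t \in Wf B /\ inn B t, sub u t, v \in verts t, a \in verts t &
        sliver (Df B / 2 ^+ r) v a u] |
      wide (Df B / 2 ^+ r) u]].

(** The cells are dissected independently and the union is closed once. The closure leaves good
    tiles intact, since no vertex lies inside a kept edge, and cuts thin triangles into slivers. *)
Lemma conforming_mesh : mesh bs ->
  (forall B, B \in bs -> [/\ mesh (Wf B), nohang (Wf B),
     forall x, inT B x -> covers (Wf B) x & forall t, t \in Wf B -> wide (Df B) t]) ->
  exists s, [/\ mesh s, nohang s, forall x, covers s x <-> covers bs x,
    (size s <= mesh_bound)%N & mesh_spec s].
Proof.
move=> mb HB; have [nb pb] := mb.
have /choose_list[F HF] : forall B, B \in bs -> exists F,
  [/\ mesh (goods B (Wf B) ++ F), forall x, covers (goods B (Wf B) ++ F) x <-> inT B x,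
   (size F <= 64 * 4 ^ r * size (bads B (Wf B)))%N,
   forall u, u \in goods B (Wf B) ++ F -> (exists2 t, t \in Wf B & sub u t) /\
     [\/ u \in goods B (Wf B), thin B (Wf B) (Df B) r (goods B (Wf B) ++ F) u |
         wide (Df B / 2 ^+ r) u] &
   forall t z x y, t \in Wf B -> z \in allv (goods B (Wf B) ++ F) ->
     x \in verts t -> y \in verts t ->
     x != y -> kept B (Wf B) x y -> ~ onE z x y].
  by move=> B Bb; have [m1 m2 m3 m4] := HB _ Bb; apply: tile_mesh => //; apply: nb.
pose f B := goods B (Wf B) ++ F B; pose S := flatten [seq f B | B <- bs].
have SP u : u \in S -> exists2 B, B \in bs & u \in f B by move=> /flatten_mapP.
have fS B u : B \in bs -> u \in f B -> u \in S by move=> Bb ub; apply/flatten_mapP; exists B.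
have fB B u : B \in bs -> u \in f B -> sub u B.
  move=> Bb uf x xu; have [_ h _ _ _] := HF _ Bb; apply/h; exists u => //.
  exact: inT_mem.
have df B : B \in bs -> dis B (f B).
  move=> Bb; have [[h1 h2] h3 _ _ _] := HF _ Bb; split=> //.
    by move=> u uf; split; [exact: h1|exact: fB uf].
  by move=> x /h3[u uf ux]; exists u.
have mS : mesh S by apply: mesh_flatten.
have goodP B t : t \in goods B (Wf B) -> t \in Wf B /\ good B (Wf B) t.
  by rewrite mem_filter => /andP[/asboolP].
have uniqB B B' z : B \in bs -> B' \in bs -> inI B z -> inT B' z -> B' = B.
  move=> Bb Bb' Bz Bz'; apply/eqP; apply: contraT => nBB.
  rewrite eq_sym in nBB; have [k [kn kB kB']] := pw_sep pb Bb Bb' nBB.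
  have := inI_pos (nb _ Bb) Bz kB kn; have := Bz' _ kB'.
  by rewrite af_opk oppr_ge0 => h1 h2; move: (lt_le_trans h2 h1); rewrite ltxx.
(* A vertex interior to a cell can only hang in a piece of that cell, hence in the tile containing
   the piece; the tiling has no hanging vertices, and a vertex of that tile is extreme. *)
have free B t z : B \in bs -> t \in Wf B -> inn B t -> z \in verts t ->
    forall u, u \in S -> ~ hang z u.
  move=> Bb tW it zt u /SP[B' Bb' uf] hz.
  have Bz := it _ zt; have uz := hang_inT hz.
  have E := uniqB _ _ _ Bb Bb' Bz (inT_sub (fB _ _ Bb' uf) uz).
  rewrite {}E in uf; have [mW hW _ _] := HB _ Bb.
  have [_ _ _ h4 _] := HF _ Bb; have [[t' t'W ut'] _] := h4 _ uf.
  have zV : z \in allv (Wf B) by apply/allvP; exists t.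
  have [zt'|hz'] := mesh_inT mW t'W zV (inT_sub ut' uz).
    exact: (not_hang_self (mW.1 _ t'W) ut' zt' hz).
  exact: (hW _ _ _ t'W tW zt hz').
pose Wh := allv (flatten [seq F B | B <- bs]).
have szW : size Wh = (3 * \sum_(B <- bs) size (F B))%N.
  rewrite /Wh /allv size_flatten /shape -map_comp sumnE big_map.
  rewrite (eq_bigr (fun=> 3)%N)// big_const_seq count_predT iter_addn_0.
  by rewrite size_flatten /shape -map_comp sumnE big_map.
have hWh t z : t \in S -> z \in allv S -> hang z t -> z \in Wh.
  move=> tS /allvP[u /SP[B Bb]]; rewrite mem_cat => /orP[/goodP[uW [iu _]]|uF] zu hz.
    by case: (free _ _ _ Bb uW iu zu _ tS).
  by apply/allvP; exists u => //; apply/flatten_mapP; exists B.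
have [s [ms nhs cs ss Ps]] := mesh_close mS hWh.
(* An edge of an interior tile is in the interior of the cell, so vertices of other cells cannot
   reach it either. *)
have keptV B t x y z : B \in bs -> t \in Wf B -> inn B t -> x \in verts t -> y \in verts t ->
    x != y -> kept B (Wf B) x y -> z \in allv S -> ~ onE z x y.
  move=> Bb tW it xt yt xy kxy /allvP[u /SP[B' Bb' uf] zu] zE.
  have tz := onE_inT xt yt zE; have Bz := inI_sub it tz.
  have E := uniqB _ _ _ Bb Bb' Bz (fB _ _ Bb' uf _ zu).
  rewrite {}E in uf; have [_ _ _ _ h] := HF _ Bb.
  by apply: (h t z x y) zE => //; apply/allvP; exists u.
exists s; split=> //.
- by move=> x; rewrite cs /S; apply: cover_flatten.
- apply: (leq_trans ss); rewrite szW.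
  have -> : size S = (\sum_(B <- bs) size (goods B (Wf B)) + \sum_(B <- bs) size (F B))%N.
    rewrite /S size_flatten /shape -map_comp sumnE big_map -big_split /=.
    by apply: eq_bigr => B _; rewrite size_cat.
  have : (\sum_(B <- bs) size (F B) <= 64 * 4 ^ r * \sum_(B <- bs) size (bads B (Wf B)))%N.
    rewrite big_distrr /= big_seq [X in (_ <= X)%N]big_seq.
    by apply: leq_sum => B /HF[].
  rewrite /mesh_bound; move: (64 * 4 ^ r)%N (\sum_(B <- bs) size (F B))%N => M sF.
  by move: (\sum_(B <- bs) size (bads B (Wf B)))%N => sb; clear; nia.
- move=> u us; have [t [tS ut uV unh tnh]] := Ps _ us.
  have [B Bb tf] := SP _ tS; exists B; split=> //; first exact: sub_trans (fB _ _ Bb tf).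
  have [_ _ _ h4 _] := HF _ Bb; have [_ cl] := h4 _ tf; have [mW hW _ wW] := HB _ Bb.
  case: cl => [/goodP[tW [it kt]]|[v [a [b [t' [[t'W it' e n kva] [tE ch]]]]]]|wt].
  + constructor 1; rewrite tnh// => z zV [x [y [xt yt xy zE]]].
    by apply: (keptV _ _ _ _ _ Bb tW it xt yt xy (kt _ _ xt yt xy) zV zE).
  + set c := lerp (shield R r) a b in tE ch; set d := lerp (shield R r) b a in tE ch.
    have vt : v \in verts t' by rewrite e !inE eqxx.
    have at' : a \in verts t' by rewrite e !inE eqxx orbT.
    have bt : b \in verts t' by rewrite e !inE eqxx !orbT.
    have va : v != a by apply: contraNneq n => ->; apply/eqP; rewrite /cr /=; ring.
    have [dn _ _] := dis_split r n.
    have [n1 s1] : nd (v, a, c) /\ sub (v, a, c) (v, a, b) by apply: dn; rewrite mem_head.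
    have [n2 _] : nd (v, c, d) /\ sub (v, c, d) (v, a, b) by apply: dn; rewrite !inE eqxx orbT.
    have tt' : sub t t'.
      have s2 : sub (v, a, b) t' by move=> w wv; apply: inT_mem; rewrite e.
      by apply: (@sub_trans _ (v, a, c)); [move=> w; rewrite tE => wv; apply: inT_mem|
         apply: sub_trans s2].
    constructor 2; exists t', v, a; split=> //; first exact: sub_trans tt'.
    apply: (@thin_sliver _ (allv S) v a c d t) => //.
    * have [h1 h2] := wW _ t'W _ _ at' bt; have /andP[sh0 _] := shield_bounds R r.
      have shr : shield R r <= (2 ^+ r)^-1.
        rewrite /shield lef_pV2 ?posrE ?exprn_gt0// !exprS mulrA ler_peMl ?exprn_ge0//; lra.
      have key (p q : R) : `|p - q| <= Df B ->
          `|p - ((1 - shield R r) * p + shield R r * q)| <= Df B / 2 ^+ r.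
        move=> h; rewrite (_ : _ - _ = shield R r * (p - q)); last by ring.
        by rewrite normrM (gtr0_norm sh0) mulrC ler_pM// ltW.
      by split; rewrite /c /lerp /=; apply: key.
    * move=> x /ch[g [gf wg sg gx]]; exists g; split=> //.
        by apply: mS.1; apply: (fS B).
      by move=> w wg'; apply/allvP; exists g => //; apply: (fS B).
    * move=> z zV tz; have [|[x [y [xt yt xy zE]]]] := mesh_inT mS tS zV tz.
        by rewrite tE; constructor 1.
      have onEC w p q : onE w p q -> onE w q p :> Prop.
        move=> [rho /andP[h0 h1] ->]; exists (1 - rho); first by apply/andP; split; clear -h0 h1; lra.
        by rewrite /lerp; congr (_, _); ring.
      have nva : ~ onE z v a by apply: (keptV B t').
      move: xt yt xy zE; rewrite !tE !inE => /or3P[]/eqP-> /or3P[]/eqP->;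
        rewrite ?eqxx// => _ zE; try (by case: nva; first [exact: zE|apply: onEC]);
        by [constructor 2|constructor 3|constructor 2; apply: onEC|constructor 3; apply: onEC].
    * exact: ms.1.
  + constructor 3 => x y xu yu; exact: (wide_inT wt (ut _ xu) (ut _ yu)).
Qed.

End ConformingMesh.

(** * Lattices of homothetic tiles *)

Section Lattice.
Variable R : realType.
Implicit Types (t : tri R) (k : pt R * R).

Definition hpt (l : R) (c x : pt R) : pt R := (l * x.1 + c.1, l * x.2 + c.2).

Definition htri (l : R) (c : pt R) t : tri R :=
  (hpt l c t.1.1, hpt l c t.1.2, hpt l c t.2).

Lemma cr_htri l c t :
  cr (htri l c t).1.1 (htri l c t).1.2 (htri l c t).2 = l ^+ 2 * cr t.1.1 t.1.2 t.2.
Proof. by rewrite /cr /htri /hpt /=; ring. Qed.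

Lemma nd_htri l c t : l != 0 -> nd t -> nd (htri l c t).
Proof. by move=> l0 n; rewrite /nd cr_htri mulf_neq0 ?expf_neq0. Qed.

Lemma verts_htri l c t : verts (htri l c t) = map (hpt l c) (verts t).
Proof. by []. Qed.

Lemma wide_htri l c t (d : R) : wide d t -> wide (`|l| * d) (htri l c t).
Proof.
move=> w x y; rewrite !verts_htri => /mapP[x' x't ->] /mapP[y' y't ->].
have [h1 h2] := w _ _ x't y't; rewrite /hpt /=.
split; rewrite opprD addrACA subrr addr0 -mulrBr normrM ler_wpM2l//.
Qed.

Lemma pw_map (T : eqType) (f : T -> tri R) (l : seq T) : uniq l ->
  (forall p q, p \in l -> q \in l -> p != q -> sep (f p) (f q)) -> pw (map f l).
Proof.
elim: l => // a l IH /= /andP[al ul] H; split; last first.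
  by apply: IH => // p q pl ql; apply: H; rewrite inE ?pl ?ql orbT.
move=> t /mapP[q ql ->]; apply: H; rewrite ?mem_head ?inE ?ql ?orbT//.
by apply: contraNneq al => ->.
Qed.

Variable T : tri R.
Hypothesis nT : nd T.

Let gp (x y : R) : pt R := comb (1 - x - y) x y T.
Let xi z := af (k1 T) z.
Let eta z := af (k2 T) z.

Let xi_gp x y : xi (gp x y) = x.
Proof.
have [_ [[a1 b1 c1] _]] := kbE nT.
by rewrite /xi /gp af_comb; [rewrite a1 b1 c1; ring|ring].
Qed.

Let eta_gp x y : eta (gp x y) = y.
Proof.
have [_ [_ [a1 b1 c1]]] := kbE nT.
by rewrite /eta /gp af_comb; [rewrite a1 b1 c1; ring|ring].
Qed.

Let gpK z : z = gp (xi z) (eta z).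
Proof.
rewrite {1}(kb_comb z nT) /gp; have := kb_sum z nT; rewrite -/(xi z) -/(eta z) => <-.
by congr (comb _ _ _ _); ring.
Qed.

(** Each parallelogram spanned by two edges of [T] is halved into a translate of [T] and one of its
    point reflection. The shift by [K] lets natural numbers index the coordinates from -[K] on. *)
Let tile (K : nat) (p : bool * (nat * nat)) : tri R :=
  let i := p.2.1%:R - K%:R in let j := p.2.2%:R - K%:R in
  if p.1 then (gp i j, gp (i + 1) j, gp i (j + 1))
  else (gp (i + 1) (j + 1), gp i (j + 1), gp (i + 1) j).

Let tileP K b i j z : z \in verts (tile K (b, (i, j))) -> exists x y : nat,
  [/\ z = gp (i%:R - K%:R + x%:R) (j%:R - K%:R + y%:R), (x <= 1)%N, (y <= 1)%N &
   if b then (x + y <= 1)%N else (1 <= x + y)%N].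
Proof.
rewrite /tile /=; case: b; rewrite mem_verts => /or3P[]/eqP->.
- by exists 0%N, 0%N; rewrite !addr0.
- by exists 1%N, 0%N; rewrite !addr0.
- by exists 0%N, 1%N; rewrite !addr0.
- by exists 1%N, 1%N.
- by exists 0%N, 1%N; rewrite !addr0.
- by exists 1%N, 0%N; rewrite !addr0.
Qed.

Let shk k (c : R) : pt R * R := (k.1, k.2 + c).

Let af_shk k c z : af (shk k c) z = af k z + c.
Proof. by rewrite /af /shk /=; ring. Qed.

Let k1_neq0 : (k1 T).1 != 0.
Proof. by apply: (kb_neq0 nT); rewrite !inE eqxx orbT. Qed.
Let k2_neq0 : (k2 T).1 != 0.
Proof. by apply: (kb_neq0 nT); rewrite !inE eqxx !orbT. Qed.
Let k0_neq0 : (k0 T).1 != 0.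
Proof. by apply: (kb_neq0 nT); rewrite !inE eqxx. Qed.

Let sep_i K b i j b' i' j' : (i < i')%N ->
  sep (tile K (b, (i, j))) (tile K (b', (i', j'))).
Proof.
move=> ii; exists (shk (opk (k1 T)) (i%:R - K%:R + 1)).
have iiR : i%:R + 1 <= i'%:R :> R by rewrite natr1 ler_nat.
split; first exact: opk_neq0.
- move=> z /tileP[x [y [-> x1 _ _]]]; rewrite af_shk af_opk -/(xi _) xi_gp.
  have : x%:R <= 1 :> R by rewrite lern1.
  by lra.
- move=> z /tileP[x [y [-> _ _ _]]]; rewrite af_opk af_shk af_opk -/(xi _) xi_gp.
  have : 0 <= x%:R :> R by rewrite ler0n.
  by lra.
Qed.

Let sep_j K b i j b' i' j' : (j < j')%N ->
  sep (tile K (b, (i, j))) (tile K (b', (i', j'))).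
Proof.
move=> ii; exists (shk (opk (k2 T)) (j%:R - K%:R + 1)).
have iiR : j%:R + 1 <= j'%:R :> R by rewrite natr1 ler_nat.
split; first exact: opk_neq0.
- move=> z /tileP[x [y [-> _ x1 _]]]; rewrite af_shk af_opk -/(eta _) eta_gp.
  have : y%:R <= 1 :> R by rewrite lern1.
  by lra.
- move=> z /tileP[x [y [-> _ _ _]]]; rewrite af_opk af_shk af_opk -/(eta _) eta_gp.
  have : 0 <= y%:R :> R by rewrite ler0n.
  by lra.
Qed.

Let sep_b K i j : sep (tile K (true, (i, j))) (tile K (false, (i, j))).
Proof.
exists (shk (k0 T) (i%:R + j%:R - 2 * K%:R)).
have k0E z : af (k0 T) z = 1 - xi z - eta z.
  by rewrite -(kb_sum z nT) -/(xi z) -/(eta z); ring.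
split=> //.
- move=> z /tileP[x [y [-> _ _ xy]]]; rewrite af_shk k0E xi_gp eta_gp.
  have : x%:R + y%:R <= 1 :> R by rewrite -natrD lern1.
  by lra.
- move=> z /tileP[x [y [-> _ _ xy]]]; rewrite af_opk af_shk k0E xi_gp eta_gp.
  have : 1 <= x%:R + y%:R :> R by rewrite -natrD ler1n.
  by lra.
Qed.

Let tile_sep K p q : p != q -> sep (tile K p) (tile K q).
Proof.
case: p q => b [i j] [b' [i' j']] pq.
have [h|h|h] := ltngtP i i'; [exact: sep_i|by apply: sep_sym; apply: sep_i|].
have [h'|h'|h'] := ltngtP j j'; [exact: sep_j|by apply: sep_sym; apply: sep_j|].
move: pq; rewrite h h' xpair_eqE eqxx andbT.
case: b; case: b' => // _; last by apply: sep_sym; exact: sep_b.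
Qed.

Let tile_htri K p : exists c, tile K p = htri 1 c T \/ tile K p = htri (-1) c T.
Proof.
case: p => b [i j]; rewrite /tile /=.
set a := i%:R - K%:R; set d := j%:R - K%:R.
case: b; last first.
  exists (gp (a + 1) (d + 1) + T.1.1); right.
  by rewrite /htri /hpt /gp /comb /=; congr (_, _, _); congr (_, _); ring.
exists (gp a d - T.1.1); left.
by rewrite /htri /hpt /gp /comb /=; congr (_, _, _); congr (_, _); ring.
Qed.

(** In the coordinates [xi], [eta] all vertices are integral, and the ends of an edge differ by at
    most 1 in each coordinate, so no vertex lies inside an edge. *)
Lemma lattice (B : tri R) : exists W, [/\ mesh W, nohang W,
  forall x, inT B x -> covers W x &
  forall t, t \in W -> exists c, t = htri 1 c T \/ t = htri (-1) c T].
Proof.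
have [K hK] : exists K : nat, forall z, z \in verts B ->
    `|xi z| <= K%:R /\ `|eta z| <= K%:R.
  pose M := \sum_(z <- verts B) (`|xi z| + `|eta z|).
  exists (Num.truncn M).+1 => z zB.
  have h : `|xi z| + `|eta z| <= M.
    by rewrite /M (big_rem z zB) /= lerDl; apply: sumr_ge0 => i _; rewrite addr_ge0.
  have h2 : M <= (Num.truncn M).+1%:R by apply/ltW/truncnS_gt.
  by split; apply: le_trans h2; apply: le_trans h; rewrite ?lerDl ?lerDr.
(* The extreme coordinate [K] falls into the parallelogram of index [2 * K], hence the successor. *)
pose n := (2 * K).+1.
pose l := [seq (b, p) | b <- [:: true; false], p <- [seq (i, j) | i <- iota 0 n, j <- iota 0 n]].
have ul : uniq l.
  apply: allpairs_uniq => //; last by move=> [? ?] [? ?] _ _ [-> ->].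
  by apply: allpairs_uniq; rewrite ?iota_uniq// => -[? ?] [? ?] _ _ [-> ->].
have lP b i j : (i < n)%N -> (j < n)%N -> (b, (i, j)) \in l.
  move=> il jl; apply: allpairs_f; first by case: b.
  by apply: allpairs_f; rewrite mem_iota.
exists (map (tile K) l); split.
- split; last by apply: pw_map => // p q _ _; apply: tile_sep.
  by move=> t /mapP[p _ ->]; have [c [->|->]] := tile_htri K p; apply: nd_htri.
- move=> t t' z /mapP[[b [i j]] _ ->] /mapP[[b' [i' j']] _ ->] /tileP[x [y [-> _ _ _]]].
  move=> [p [q [/tileP[xp [yp [-> xp1 yp1 _]]] /tileP[xq [yq [-> xq1 yq1 _]]] pq]]].
  move=> [rho /andP[r0 r1] /[dup]].
  (* Where the ends differ, a point inside the edge has a coordinate strictly between consecutive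
     integers. *)
  have key (a c : nat) (s : nat) (e : nat) : (a <= 1)%N -> (c <= 1)%N -> a <> c ->
      s%:R = e%:R + (1 - rho) * a%:R + rho * c%:R -> False.
    move=> a1 c1 ac E.
    have : e%:R < s%:R :> R /\ s%:R < e.+1%:R :> R.
      rewrite E -natr1; move: a1 c1 ac {E}.
      by case: a => [|[|//]] _; case: c => [|[|//]] _ // _; split; lra.
    by rewrite !ltr_nat => -[h1 h2]; move: (leq_trans h2 h1); rewrite ltnn.
  move=> /(congr1 xi) + /(congr1 eta).
  have xil u v : xi (lerp rho u v) = (1 - rho) * xi u + rho * xi v by exact: af_lerp.
  have etal u v : eta (lerp rho u v) = (1 - rho) * eta u + rho * eta v by exact: af_lerp.
  rewrite !xil !etal.
  rewrite !xi_gp !eta_gp => E1 E2.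
  have [xpq|xpq] := eqVneq xp xq; last first.
    apply: (@key xp xq (i' + x)%N i xp1 xq1); first exact/eqP.
    by rewrite natrD; lra.
  have [ypq|ypq] := eqVneq yp yq; last first.
    apply: (@key yp yq (j' + y)%N j yp1 yq1); first exact/eqP.
    by rewrite natrD; lra.
  by rewrite xpq ypq eqxx in pq.
- move=> z Bz.
  have hx : - K%:R <= xi z <= K%:R.
    have H1 : 0 <= af (shk (k1 T) K%:R) z.
      by apply: Bz => w /hK[]; rewrite af_shk ler_norml => /andP[h1 h2] _; rewrite /xi in h1 h2; lra.
    have H2 : 0 <= af (shk (opk (k1 T)) K%:R) z.
      by apply: Bz => w /hK[]; rewrite af_shk af_opk ler_norml => /andP[h1 h2] _; rewrite /xi in h1 h2; lra.
    by move: H1 H2; rewrite !af_shk af_opk /xi => H1 H2; apply/andP; split; lra.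
  have hy : - K%:R <= eta z <= K%:R.
    have H1 : 0 <= af (shk (k2 T) K%:R) z.
      by apply: Bz => w /hK[] _; rewrite af_shk ler_norml => /andP[h1 h2]; rewrite /eta in h1 h2; lra.
    have H2 : 0 <= af (shk (opk (k2 T)) K%:R) z.
      by apply: Bz => w /hK[] _; rewrite af_shk af_opk ler_norml => /andP[h1 h2]; rewrite /eta in h1 h2; lra.
    by move: H1 H2; rewrite !af_shk af_opk /eta => H1 H2; apply/andP; split; lra.
  have fl (w : R) : - K%:R <= w <= K%:R -> exists i : nat, (i < n)%N /\
      i%:R - K%:R <= w < i%:R - K%:R + 1.
    move=> /andP[w0 w1]; have w0' : 0 <= w + K%:R by lra.
    have /andP[h1 h2] := truncn_itv w0'; exists (Num.truncn (w + K%:R)); split.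
      rewrite -(ltr_nat R); apply: (le_lt_trans h1); rewrite /n -natr1 natrM; lra.
    by rewrite -natr1 in h2; apply/andP; split; lra.
  have [i [il /andP[i0 i1]]] := fl _ hx; have [j [jl /andP[j0 j1]]] := fl _ hy.
  have zE := gpK z; set u := xi z in zE i0 i1; set v := eta z in zE j0 j1.
  have [h|h] := leP ((u - (i%:R - K%:R)) + (v - (j%:R - K%:R))) 1.
    exists (tile K (true, (i, j))); first by apply: map_f; apply: lP.
    have -> : z = comb (1 - (u - (i%:R - K%:R)) - (v - (j%:R - K%:R)))
       (u - (i%:R - K%:R)) (v - (j%:R - K%:R)) (tile K (true, (i, j))).
      by rewrite zE /tile /gp /comb /=; congr (_, _); ring.
    by apply: inT_comb; lra.
  exists (tile K (false, (i, j))); first by apply: map_f; apply: lP.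
  have -> : z = comb (u + v - (i%:R - K%:R) - (j%:R - K%:R) - 1)
     ((i%:R - K%:R) + 1 - u) ((j%:R - K%:R) + 1 - v) (tile K (false, (i, j))).
    by rewrite zE /tile /gp /comb /=; congr (_, _); ring.
  by apply: inT_comb; lra.
- by move=> t /mapP[p _ ->]; apply: tile_htri.
Qed.

End Lattice.

(** * Measure and areas in the plane *)

Notation plane R := (measurableTypeR R * measurableTypeR R)%type.

Section PlaneMeasure.
Variable R : realType.
Notation mu := (@plane_measure R).
Notation leb := (@lebesgue_measure R).
Implicit Types (A : set (plane R)) (t : tri R).

Lemma measurable_aff1 (l c : R) :
  measurable_fun setT (fun x : measurableTypeR R => l * x + c : measurableTypeR R).
Proof. exact: measurable_funD. Qed.

(** The scaled image measure agrees with Lebesgue measure on half-open intervals, and uniqueness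
    concludes. For negative [l] the preimage is half-open on the other side. *)
Lemma leb_aff1 (l c : R) (A : set (measurableTypeR R)) : l != 0 -> measurable A ->
  (leb A = `|l|%:E * leb ((fun x : measurableTypeR R => (l * x + c)%R) @^-1` A))%E.
Proof.
move=> l0 mA; have lp : 0 <= `|l| by [].
pose pm := measure_function_pushforward__canonical__measure_function_Measure
  leb (measurable_aff1 l c).
pose nu : {measure set _ -> \bar R} := mscale (NngNum lp) pm.
have := @lebesgue_measure_unique R nu _ A mA; apply => X [[a b] _ <-] /=.
rewrite /mscale /= /pushforward.
have [lgt|llt|l00] := ltgtP l 0; last by rewrite l00 eqxx in l0.
- have -> : (fun x : measurableTypeR R => l * x + c) @^-1` `]a, b] =
      `[(b - c) / l, (a - c) / l[%classic.
    apply/seteqP; split=> x /=; rewrite !in_itv /=.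
      by move=> /andP[h1 h2]; rewrite ler_ndivrMr// ltr_ndivlMr//; lra.
    by rewrite ler_ndivrMr// ltr_ndivlMr// => /andP[h1 h2]; lra.
  rewrite !lebesgue_measure_itv /= !lte_fin ltr_nM2r ?invr_lt0// ltrD2r.
  case: ifP => _; last by rewrite mule0.
  rewrite -!EFinB -EFinM ltr0_norm//; congr (_%:E); field; exact: ltr0_neq0.
- have -> : (fun x : measurableTypeR R => l * x + c) @^-1` `]a, b] =
      `](a - c) / l, (b - c) / l]%classic.
    apply/seteqP; split=> x /=; rewrite !in_itv /=.
      by move=> /andP[h1 h2]; rewrite ltr_pdivrMr// ler_pdivlMr//; lra.
    by rewrite ltr_pdivrMr// ler_pdivlMr// => /andP[h1 h2]; lra.
  rewrite !lebesgue_measure_itv /= !lte_fin ltr_pM2r ?invr_gt0// ltrD2r.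
  case: ifP => _; last by rewrite mule0.
  rewrite -!EFinB -EFinM gtr0_norm//; congr (_%:E); field; exact: lt0r_neq0.
Qed.

Lemma measurable_hpt (l : R) (c : pt R) : measurable_fun setT (hpt l c : plane R -> plane R).
Proof.
apply: measurable_fun_pair.
  exact: (measurableT_comp (measurable_aff1 l c.1) measurable_fst).
exact: (measurableT_comp (measurable_aff1 l c.2) measurable_snd).
Qed.

Lemma plane_hpt (l : R) (c : pt R) A : l != 0 -> measurable A ->
  (mu A = (l ^+ 2)%:E * mu (hpt l c @^-1` A))%E.
Proof.
move=> l0 mA; have lp : 0 <= l ^+ 2 by rewrite sqr_ge0.
pose pm := measure_function_pushforward__canonical__measure_function_Measure
  [the measure _ _ of mu] (measurable_hpt l c).
pose nu : {measure set (plane R) -> \bar R} := mscale (NngNum lp) pm.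
have := @product_measure_unique _ _ _ _ R leb leb nu _ A mA; apply => X Y mX mY /=.
rewrite /mscale /= /pushforward.
have -> : hpt l c @^-1` (X `*` Y) =
   ((fun x : measurableTypeR R => l * x + c.1) @^-1` X) `*`
   ((fun x : measurableTypeR R => l * x + c.2) @^-1` Y) by [].
rewrite [X in (_ * X)%E]product_measure1E; last 2 first.
- by rewrite -[X in measurable X]setTI; apply: measurable_aff1.
- by rewrite -[X in measurable X]setTI; apply: measurable_aff1.
rewrite (leb_aff1 c.1 l0 mX) (leb_aff1 c.2 l0 mY).
by rewrite -real_normK ?num_real// expr2 EFinM muleACA.
Qed.

Lemma measurable_af (k : pt R * R) : measurable_fun setT (fun x : plane R => af k x).
Proof.
rewrite /af; apply: measurable_funD => //; apply: measurable_funD.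
  by apply: measurableT_comp => //; exact: measurable_fst.
by apply: measurableT_comp => //; exact: measurable_snd.
Qed.

Lemma measurable_half (k : pt R * R) : measurable [set x : plane R | 0 <= af k x].
Proof.
have := measurable_af k measurableT (measurable_itv `[0, +oo[).
rewrite setTI; congr measurable; apply/seteqP; split=> x /=;
  by rewrite in_itv /= andbT.
Qed.

Definition bdy t : set (plane R) := [set x | inT t x].

Lemma bdyE t : nd t -> bdy t = [set x | 0 <= af (k0 t) x] `&`
  [set x | 0 <= af (k1 t) x] `&` [set x | 0 <= af (k2 t) x].
Proof.
move=> n; apply/seteqP; split=> x.
  by move=> /(inTP x n)[].
by move=> [[h0 h1] h2]; apply/(inTP x n).
Qed.

Lemma measurable_bdy t : nd t -> measurable (bdy t).
Proof.
move=> n; rewrite bdyE//; apply: measurableI; last exact: measurable_half.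
by apply: measurableI; exact: measurable_half.
Qed.

Lemma line_solve (a b c x y : R) : b != 0 -> a * x + b * y + c = 0 <-> y = - (a * x + c) / b.
Proof.
move=> b0; split=> [h|->]; last by field.
by apply: (mulfI b0); rewrite mulrCA divff// mulr1; lra.
Qed.

(** The vertical sections of a non-vertical line are points; those of a vertical line are empty
    except at one abscissa. *)
Lemma line_null (k : pt R * R) : k.1 != 0 -> mu [set x | af k x = 0] = 0%E.
Proof.
move=> kn; have mL : measurable [set x : plane R | af k x = 0].
  have := measurable_af k measurableT (measurable_set1 0).
  by rewrite setTI; congr measurable.
rewrite /plane_measure /product_measure1.
have [k20|k20] := eqVneq k.1.2 0; last first.
  rewrite integral0_eq// => x _ /=.
  suff -> : xsection [set y | af k y = 0] x = [set - (k.1.1 * x + k.2) / k.1.2].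
    exact: lebesgue_measure_set1.
  by apply/seteqP; split=> y /=; rewrite /xsection /= inE /af /=;
    rewrite (@line_solve _ _ _ x y k20).
have k10 : k.1.1 != 0.
  by apply: contraNneq kn => k10; move: k10 k20; case: (k.1) => ? ? /= -> ->.
pose x0 := - k.2 / k.1.1.
have E : {in ~` [set x0], forall x, leb (xsection [set y | af k y = 0] x) = 0%E}.
  move=> x; rewrite inE => nx; suff -> : xsection [set y | af k y = 0] x = set0.
    exact: measure0.
  apply/seteqP; split=> y //=; rewrite /xsection /= inE /af /= k20 mul0r addr0 => h.
  by apply: nx; rewrite /x0 /=; have := @line_solve 0 k.1.1 k.2 0 x k10; rewrite !mul0r !add0r => <-.
have m0 : measurable_fun (setT : set (measurableTypeR R)) (leb \o xsection [set y | af k y = 0]).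
  exact: measurable_fun_xsection.
rewrite (@ge0_negligible_integral _ (measurableTypeR R) R leb setT [set x0])//.
- by rewrite setTD integral0_eq// => x nx; apply: E; rewrite inE.
- exact: lebesgue_measure_set1.
Qed.

Definition itr t : set (plane R) := [set x | inI t x].

Lemma itrE t : itr t = [set x | 0 < af (k0 t) x] `&`
  [set x | 0 < af (k1 t) x] `&` [set x | 0 < af (k2 t) x].
Proof.
apply/seteqP; split=> x.
  by move=> h; split; [split|]; apply: h; rewrite !inE eqxx ?orbT.
by move=> [[h0 h1] h2] k; rewrite -[kb t]/[:: k0 t; k1 t; k2 t] !inE => /or3P[]/eqP->.
Qed.

Lemma measurable_itr t : measurable (itr t).
Proof.
have H (k : pt R * R) : measurable [set x : plane R | 0 < af k x].
  have := measurable_af k measurableT (measurable_itv `]0, +oo[).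
  rewrite setTI; congr measurable; apply/seteqP; split=> x /=;
    by rewrite in_itv /= andbT.
by rewrite itrE; apply: measurableI => //; apply: measurableI.
Qed.

Definition rim t : set (plane R) := [set x | af (k0 t) x = 0] `|`
  [set x | af (k1 t) x = 0] `|` [set x | af (k2 t) x = 0].

Lemma measurable_line (k : pt R * R) : measurable [set x : plane R | af k x = 0].
Proof.
have := measurable_af k measurableT (measurable_set1 0).
by rewrite setTI; congr measurable.
Qed.

Lemma rim_null t : nd t -> measurable (rim t) /\ mu (rim t) = 0%E.
Proof.
move=> n; split; first by apply: measurableU; [apply: measurableU|]; exact: measurable_line.
have H k : k \in kb t -> mu [set x | af k x = 0] = 0%E.
  by move=> kt; apply: line_null; apply: kb_neq0 kt.
have U (A B : set (plane R)) : measurable A -> measurable B -> mu A = 0%E -> mu B = 0%E ->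
    mu (A `|` B) = 0%E.
  by move=> mA mB A0 B0; rewrite /plane_measure measureU0.
apply: (U _ _); [by apply: measurableU; exact: measurable_line|exact: measurable_line| |].
  by apply: (U _ _); [exact: measurable_line|exact: measurable_line|
    by apply: H; rewrite !inE eqxx|by apply: H; rewrite !inE eqxx orbT].
by apply: H; rewrite !inE eqxx !orbT.
Qed.

Lemma bdy_itr t : nd t -> bdy t `\` rim t = itr t.
Proof.
move=> n; rewrite bdyE// itrE; apply/seteqP; split=> x.
  move=> [[[/= h0 h1] h2] /not_orP[/not_orP[/= e0 e1] e2]].
  by split; [split|]; rewrite /= lt_neqAle eq_sym ?h0 ?h1 ?h2 andbT; apply/eqP.
move=> [[/= h0 h1] h2]; split; first by split; [split|]; apply: ltW.
by move=> [[|]|] /= e; [move: h0|move: h1|move: h2]; rewrite e ltxx.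
Qed.

Local Open Scope ereal_scope.

Lemma integral_itr t (g : plane R -> \bar R) : nd t -> measurable_fun (bdy t) g ->
  (forall x, bdy t x -> 0 <= g x) ->
  \int[mu]_(x in bdy t) g x = \int[mu]_(x in itr t) g x.
Proof.
move=> n mg g0; have [mr r0] := rim_null n.
by rewrite (ge0_negligible_integral mr _ mg)// ?bdy_itr//; exact: measurable_bdy.
Qed.

(** The closed triangles overlap, but only in their null rims, while their interiors are
    disjoint. *)
Lemma mesh_integral (s : seq (tri R)) A (g : plane R -> \bar R) : mesh s -> measurable A ->
  (forall t, t \in s -> bdy t `<=` A) ->
  measurable_fun A g -> (forall x, A x -> 0 <= g x) ->
  \sum_(t <- s) \int[mu]_(x in bdy t) g x <= \int[mu]_(x in A) g x.
Proof.
move=> ms mA sA mg g0; have [ns ps] := ms.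
have sB t : t \in s -> itr t `<=` A.
  by move=> ts x h; apply: (sA _ ts); apply: inI_inT => //; exact: ns.
have -> : \sum_(t <- s) \int[mu]_(x in bdy t) g x = \sum_(t <- s) \int[mu]_(x in itr t) g x.
  rewrite big_seq [RHS]big_seq; apply: eq_bigr => t ts; apply: integral_itr; first exact: ns.
    by apply: measurable_funS mg; [|exact: sA].
  by move=> x tx; apply: g0; apply: sA tx.
have UA : \big[setU/set0]_(t <- s) itr t `<=` A.
  by rewrite -bigcup_seq => x [t /= ts]; exact: sB.
have mU : measurable (\big[setU/set0]_(t <- s) itr t).
  by apply: bigsetU_measurable => t _; exact: measurable_itr.
rewrite -ge0_integral_bigsetU//.
- exact: ge0_subset_integral.
- by move=> t; exact: measurable_itr.
- exact: mesh_uniq.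
- move=> t t' /= ts t's [x [hx hx']]; apply/eqP; apply: contraT => tt'.
  have [k [kn kt kt']] := pw_sep ps ts t's tt'.
  have := inI_pos (ns _ ts) hx kt kn.
  have := inI_inT (ns _ t's) hx' kt'; rewrite af_opk oppr_ge0 => h1 h2.
  by move: (lt_le_trans h2 h1); rewrite ltxx.
- by apply: measurable_funS mg.
- by move=> x /UA; exact: g0.
Qed.

Lemma mesh_area (s : seq (tri R)) A : mesh s -> measurable A ->
  (forall t, t \in s -> bdy t `<=` A) -> \sum_(t <- s) mu (bdy t) <= mu A.
Proof.
move=> ms mA sA.
have := mesh_integral (g := cst 1) ms mA sA; rewrite integral_cst// mul1e => H.
have := H (measurable_cst _) (fun _ _ => lee01); congr (_ <= _).
rewrite big_seq [RHS]big_seq; apply: eq_bigr => t ts.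
by rewrite integral_cst ?mul1e//; apply: measurable_bdy; apply: ms.1.
Qed.

Lemma bdy_htri t (l : R) (c : pt R) : l != 0%R ->
  hpt l c @^-1` bdy (htri l c t) = bdy t.
Proof.
move=> l0.
have H k x : af k (hpt l c x) = af ((l * k.1.1, l * k.1.2)%R, (k.1.1 * c.1 + k.1.2 * c.2 + k.2)%R) x.
  by rewrite /af /hpt /=; ring.
have H' k x : af k x = af ((k.1.1 / l, k.1.2 / l)%R, (k.2 - (k.1.1 * c.1 + k.1.2 * c.2) / l)%R) (hpt l c x).
  by rewrite /af /hpt /=; field.
apply/seteqP; split=> x /= hx k kt.
  rewrite H'; apply: hx => y; rewrite verts_htri => /mapP[z zt ->].
  by rewrite -H'; apply: kt.
rewrite H; apply: hx => y yt; rewrite -H; apply: kt; rewrite verts_htri.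
exact: map_f.
Qed.

Lemma mu_htri t (l : R) (c : pt R) : l != 0%R -> nd t ->
  mu (bdy (htri l c t)) = (l ^+ 2)%:E * mu (bdy t).
Proof.
move=> l0 n; rewrite (plane_hpt c l0) ?bdy_htri//.
by apply: measurable_bdy; exact: nd_htri.
Qed.

Lemma mu_box (a b : pt R) (d : R) : (0 <= d)%R ->
  mu (`[a.1, (a.1 + d)%R] `*` `[a.2, (a.2 + d)%R]) = (d ^+ 2)%:E.
Proof.
move=> d0; rewrite /plane_measure product_measure1E; [|exact: measurable_itv..].
have H x : leb `[x, (x + d)%R] = d%:E.
  rewrite lebesgue_measure_itv /= lte_fin ltrDl; case: ltP => h.
    by rewrite -EFinB addrC addKr.
  by congr (_%:E); apply/eqP; rewrite eq_le d0 h.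
by rewrite [X in X * _]H [X in _ * X]H -EFinM expr2.
Qed.

Lemma bdy_box t (d : R) : wide d t -> bdy t `<=`
  `[(t.1.1.1 - d)%R, (t.1.1.1 - d + (2 * d))%R] `*` `[(t.1.1.2 - d)%R, (t.1.1.2 - d + (2 * d))%R].
Proof.
move=> w x tx; have [] := wide_inT w tx (inT_mem (mem_head _ _ : t.1.1 \in verts t)).
rewrite !ler_norml => /andP[h1 h2] /andP[h3 h4].
by split; rewrite /= in_itv /=; apply/andP; split; lra.
Qed.

Lemma mu_wide t (d : R) : nd t -> wide d t -> mu (bdy t) <= (4 * d ^+ 2)%:E.
Proof.
move=> n w; have [h _] := w _ _ (mem_head _ _ : t.1.1 \in verts t) (mem_head _ _).
have d0 : (0 <= d)%R by apply: le_trans h.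
have d20 : (0 <= 2 * d)%R by rewrite mulr_ge0.
pose a : pt R := (t.1.1.1 - d, t.1.1.2 - d)%R.
have := mu_box a a d20; rewrite exprMn /= (_ : 2 ^+ 2 = 4 :> R)%R; last by rewrite expr2; lra.
move=> <-; apply: le_measure; rewrite ?inE; last exact: bdy_box.
  exact: measurable_bdy.
by apply: measurableX; exact: measurable_itv.
Qed.

Lemma mu_fin t : nd t -> mu (bdy t) \is a fin_num.
Proof.
move=> n; have [d w] : exists d, wide d t.
  exists (\sum_(x <- verts t) \sum_(y <- verts t) (`|x.1 - y.1| + `|x.2 - y.2|))%R => x y xt yt.
  have h : (`|x.1 - y.1| + `|x.2 - y.2| <= \sum_(x <- verts t) \sum_(y <- verts t)
      (`|x.1 - y.1| + `|x.2 - y.2|))%R.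
    rewrite (big_rem x xt) /= (big_rem y yt) /= -addrA lerDl addr_ge0//.
      by apply: sumr_ge0 => i _; rewrite addr_ge0.
    by apply: sumr_ge0 => i _; apply: sumr_ge0 => j _; rewrite addr_ge0.
  by split; apply: le_trans h; rewrite ?lerDl ?lerDr.
rewrite ge0_fin_numE ?measure_ge0//; apply: le_lt_trans (mu_wide n w) _.
exact: ltry.
Qed.

Definition ar t : R := fine (mu (bdy t)).

Lemma arE t : nd t -> mu (bdy t) = (ar t)%:E.
Proof. by move=> n; rewrite /ar fineK// mu_fin. Qed.

Lemma ar_ge0 t : (0 <= ar t)%R.
Proof. by rewrite /ar fine_ge0// measure_ge0. Qed.

Lemma ar_htri t (l : R) (c : pt R) : l != 0%R -> nd t -> ar (htri l c t) = (l ^+ 2 * ar t)%R.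
Proof. by move=> l0 n; rewrite /ar mu_htri// fineM// mu_fin. Qed.

End PlaneMeasure.

(** * Counting the tiles of a cell *)

Section Counting.
Variable R : realType.
Implicit Types (t : tri R) (k : pt R * R).

Lemma af_lip k : exists2 c, 0 < c & forall x y (d : R),
  `|x.1 - y.1| <= d -> `|x.2 - y.2| <= d -> `|af k x - af k y| <= c * d.
Proof.
exists (1 + `|k.1.1| + `|k.1.2|); first by rewrite -addrA ltr_wpDr// addr_ge0.
move=> x y d hx hy; have d0 : 0 <= d by apply: le_trans hx.
have -> : af k x - af k y = k.1.1 * (x.1 - y.1) + k.1.2 * (x.2 - y.2).
  by rewrite /af; ring.
apply: (le_trans (ler_normD _ _)); rewrite !normrM !mulrDl mul1r -addrA.
by rewrite ler_wpDl// lerD// ler_wpM2l.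
Qed.

Lemma kb_lip B : exists2 c, 0 < c & forall k, k \in kb B -> forall x y (d : R),
  `|x.1 - y.1| <= d -> `|x.2 - y.2| <= d -> `|af k x - af k y| <= c * d.
Proof.
have [c0' p0 h0] := af_lip (k0 B); have [c1' p1 h1] := af_lip (k1 B).
have [c2' p2 h2] := af_lip (k2 B).
exists (c0' + c1' + c2'); first by rewrite !addr_gt0.
move=> k kB x y d hx hy; have d0 : 0 <= d by apply: le_trans hx.
move: kB; rewrite -[kb B]/[:: k0 B; k1 B; k2 B] !inE => /or3P[]/eqP->.
- by apply: le_trans (h0 _ _ _ hx hy) _; rewrite ler_wpM2r//; lra.
- by apply: le_trans (h1 _ _ _ hx hy) _; rewrite ler_wpM2r//; lra.
- by apply: le_trans (h2 _ _ _ hx hy) _; rewrite ler_wpM2r//; lra.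
Qed.

Definition ctr B : pt R := comb 3^-1 3^-1 3^-1 B.

Lemma af_ctr B k : nd B -> k \in kb B -> af k (ctr B) = 3^-1.
Proof.
move=> n; have [[a0 b0 c0] [[a1 b1 c1] [a2 b2 c2]]] := kbE n.
rewrite -[kb B]/[:: k0 B; k1 B; k2 B] !inE => /or3P[]/eqP->; rewrite af_comb; try lra.
Qed.

(** The homothety about the centroid: the image is where all barycentric coordinates of [B] are at
    least (1 - s) / 3. *)
Definition shrink (s : R) B : tri R := htri s ((1 - s) * (ctr B).1, (1 - s) * (ctr B).2) B.

Lemma af_shrink s B k x : nd B -> k \in kb B ->
  af k (hpt s ((1 - s) * (ctr B).1, (1 - s) * (ctr B).2) x) = s * af k x + (1 - s) / 3.
Proof. by move=> n kB; rewrite -(af_ctr n kB) /af /hpt /=; ring. Qed.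

Lemma inT_shrink s B y : nd B -> 0 < s ->
  (forall k, k \in kb B -> (1 - s) / 3 <= af k y) -> inT (shrink s B) y.
Proof.
move=> n s0 H; set c := ((1 - s) * (ctr B).1, (1 - s) * (ctr B).2) : pt R.
pose x : pt R := ((y.1 - c.1) / s, (y.2 - c.2) / s).
have sn : s != 0 by rewrite gt_eqF.
have yE : y = hpt s c x.
  by rewrite /hpt /x /=; case: (y) => y1 y2 /=; congr (_, _); field.
have := bdy_htri B c sn; move=> /(congr1 (fun A : set (plane R) => A x)) /= E.
have {}E : inT (htri s c B) (hpt s c x) = inT B x := E.
suff : inT (htri s c B) (hpt s c x) by rewrite -yE.
rewrite E; apply: inT_kb => // k kB.
have := H _ kB; rewrite {1}yE af_shrink// => h.
have : 0 <= s * af k x by lra.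
by rewrite pmulr_rge0.
Qed.

Variables (B T : tri R) (d : R).
Hypotheses (nB : nd B) (nT : nd T) (aT : ar T = 1) (wT : wide d T).

(** Tiles of size [l] have area [l ^+ 2]. The good ones are packed in [B]; the bad ones are packed
    in a frame along its boundary, of width and area O(l), hence number O(1/l). *)
Lemma lattice_count : exists C l0 : R, [/\ 0 < l0, 0 <= C & forall l, 0 < l <= l0 ->
  exists W, [/\ mesh W, nohang W, forall x, inT B x -> covers W x,
    forall t, t \in W -> wide (l * d) t &
    forall t, t \in W -> exists l' c, `|l'| = l /\ t = htri l' c T] /\
   (size (goods B W))%:R * l ^+ 2 <= ar B /\ (size (bads B W))%:R * l <= C].
Proof.
have [K K0 HK] := kb_lip B.
have [h _] := wT (mem_head _ _ : T.1.1 \in verts T) (mem_head _ _).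
have d0 : 0 <= d by apply: le_trans h.
(* The bound on [l] keeps the variation [e] of a coordinate over a tile below 1/6. The frame has
   area at most [18 * e * ar B], because (1 + 3e) ^ 2 - (1 - 6e) ^ 2 = 18e - 27e ^ 2. *)
exists (18 * K * d * ar B), (7 * K * (d + 1))^-1.
split; first by rewrite invr_gt0 !mulr_gt0// ltr_wpDl.
  by rewrite !mulr_ge0 ?ar_ge0// ltW.
move=> l /andP[l0 l1].
have ln0 : l != 0 by rewrite gt_eqF.
have nT' : nd (htri l (0, 0) T) by apply: nd_htri.
have [W [mW hW cW tW]] := lattice nT' B.
have tE t : t \in W -> exists l' c, `|l'| = l /\ t = htri l' c T.
  move=> /tW[c [|]] ->.
    exists l, c; split; first by rewrite gtr0_norm.
    by rewrite /htri /hpt /=; congr (_, _, _); congr (_, _); ring.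
  exists (- l), c; split; first by rewrite normrN gtr0_norm.
  by rewrite /htri /hpt /=; congr (_, _, _); congr (_, _); ring.
have wt t : t \in W -> wide (l * d) t.
  by move=> /tE[l' [c [<- ->]]]; apply: wide_htri.
have [nW pW] := mW.
exists W; split; first by split.
have sumA (s : seq (tri R)) : {subset s <= W} ->
    (\sum_(t <- s) @plane_measure R (bdy t) = ((size s)%:R * l ^+ 2)%:E)%E.
  move=> sW; rewrite big_seq (eq_bigr (fun=> (l ^+ 2)%:E)).
    by rewrite -big_seq sumEFin big_const_seq count_predT iter_addr_0 mulr_natl.
  move=> t /sW ts; rewrite arE; last exact: nW.
  have [l' [c [ll ->]]] := tE _ ts; have l'0 : l' != 0 by rewrite -normr_eq0 ll.
  by rewrite ar_htri// aT mulr1 -ll real_normK// num_real.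
split.
  have gW : {subset goods B W <= W} by move=> t; rewrite mem_filter => /andP[].
  rewrite -lee_fin -sumA// -arE//; apply: mesh_area.
  - by split=> [t /gW|]; [exact: nW|exact: pw_filter].
  - exact: measurable_bdy.
  - move=> t; rewrite mem_filter => /andP[/asboolP[it _] _] x; exact: inT_sub (inn_sub nB it).
pose e := K * (l * d).
have e0 : 0 <= e by rewrite /e !mulr_ge0// ltW.
have e1 : e < 6^-1.
  have : l * (7 * K * (d + 1)) <= 1.
    by rewrite -ler_pdivlMr ?mul1r// !mulr_gt0// ltr_wpDl.
  rewrite /e; have : 0 < l * K by rewrite mulr_gt0.
  by move: l1 => _; nra.
have bW : {subset bads B W <= W} by move=> t; rewrite mem_filter => /andP[].
have lip t x y k : k \in kb B -> t \in W -> inT t x -> inT t y -> af k x <= af k y + e.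
  move=> kB ts tx ty; have [h1 h2] := wide_inT (wt _ ts) tx ty.
  have := HK _ kB _ _ _ h1 h2; rewrite -/e ler_norml => /andP[_]; lra.
have s1 : 0 < 1 + 3 * e by lra.
have s2 : 0 < 1 - 6 * e by lra.
have nS : nd (shrink (1 - 6 * e) B) by apply: nd_htri => //; rewrite gt_eqF.
have nS' : nd (shrink (1 + 3 * e) B) by apply: nd_htri => //; rewrite gt_eqF.
have : (\sum_(t <- shrink (1 - 6 * e) B :: bads B W) @plane_measure R (bdy t) <=
    @plane_measure R (bdy (shrink (1 + 3 * e) B)))%E.
  apply: mesh_area; last first.
  - move=> t; rewrite inE => /orP[/eqP->|tb] y ty; apply: inT_shrink => // k kB.
      have : 0 <= af (k.1, k.2 - 2 * e) y.
        apply: ty => z; rewrite verts_htri => /mapP[x xB ->].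
        have -> : af (k.1, k.2 - 2 * e) (hpt (1 - 6 * e) ((1 - (1 - 6 * e)) * (ctr B).1,
           (1 - (1 - 6 * e)) * (ctr B).2) x) = af k (hpt (1 - 6 * e) ((1 - (1 - 6 * e)) * (ctr B).1,
           (1 - (1 - 6 * e)) * (ctr B).2) x) - 2 * e by rewrite /af /=; ring.
        rewrite af_shrink//; have := kb_nneg nB kB xB => h'.
        have : 0 <= (1 - 6 * e) * af k x by rewrite mulr_ge0// ltW.
        lra.
      have -> : af (k.1, k.2 - 2 * e) y = af k y - 2 * e by rewrite /af /=; ring.
      lra.
    move: (tb); rewrite mem_filter => /andP[/asboolP[_ [x tx Bx]] _].
    have := Bx _ (kb_nneg nB kB); have := lip _ _ _ _ kB (bW _ tb) tx ty; lra.
  - exact: measurable_bdy.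
  split=> [t|]; first by rewrite inE => /orP[/eqP->//|/bW]; exact: nW.
  split; last exact: pw_filter.
  move=> t tb; have tWt := bW _ tb.
  (* A bad tile is not interior itself, or meets a tile that is not: some coordinate is at most 0 at
     a vertex of the latter, at most [e] on the common points and at most [2 * e] on the bad tile.
     This separates it from the triangle shrunk by [1 - 6 * e]. *)
  have [k kB kt] : exists2 k, k \in kb B & forall y, inT t y -> af k y <= 2 * e.
    have ninn u : u \in W -> ~ inn B u -> (exists2 x, inT u x & inT t x) ->
        exists2 k, k \in kb B & forall y, inT t y -> af k y <= 2 * e.
      move=> uW /existsNP[x /not_implyP[xu /existsNP[k /not_implyP[kB /negP]]]].
      rewrite -leNgt => kx [z uz tz]; exists k => // y ty.
      have := lip _ _ _ _ kB tWt ty tz; have := lip _ _ _ _ kB uW uz (inT_mem xu); lra.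
    move: (tb); rewrite mem_filter => /andP[/asboolP[ng _] _].
    have [it|nit] := pselect (inn B t); last first.
      by apply: (ninn t) => //; exists t.1.1; apply: inT_mem; rewrite mem_head.
    have /existsNP[x /existsNP[y /not_implyP[xt /not_implyP[yt /not_implyP[xy nk]]]]] :
        ~ forall x y, x \in verts t -> y \in verts t -> x != y -> kept B W x y.
      by move=> h'; apply: ng.
    have /existsNP[u /not_implyP[uW /not_implyP[xu /not_implyP[yu nu]]]] := nk.
    by apply: (ninn u) => //; exists x; apply: inT_mem.
  exists (k.1, k.2 - 2 * e); split; first exact: (kb_neq0 nB kB).
  - move=> z; rewrite verts_htri => /mapP[x xB ->].
    set w := hpt _ _ _; have -> : af (k.1, k.2 - 2 * e) w = af k w - 2 * e by rewrite /af /=; ring.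
    rewrite /w af_shrink//; have := kb_nneg nB kB xB => h'.
    have : 0 <= (1 - 6 * e) * af k x by rewrite mulr_ge0// ltW.
    lra.
  - move=> z zt; rewrite af_opk; have := kt _ (inT_mem zt).
    have -> : af (k.1, k.2 - 2 * e) z = af k z - 2 * e by rewrite /af /=; ring.
    lra.
rewrite big_cons sumA// !arE// /shrink !ar_htri ?gt_eqF// -EFinD lee_fin => hle.
have l2 : (size (bads B W))%:R * l ^+ 2 <= 18 * e * ar B.
  have := ar_ge0 B => aB; have : 0 <= e ^+ 2 * ar B by rewrite mulr_ge0// sqr_ge0.
  rewrite (_ : 18 * e * ar B = (1 + 3 * e) ^+ 2 * ar B - (1 - 6 * e) ^+ 2 * ar B
     + 27 * (e ^+ 2 * ar B)); last by ring.
  have key (X Y S q : R) : Y + S <= X -> 0 <= q -> S <= X - Y + 27 * q by lra.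
  exact: key.
rewrite -(ler_pM2r l0) (_ : _ * l * l = (size (bads B W))%:R * l ^+ 2); last by ring.
by rewrite (_ : 18 * K * d * ar B * l = 18 * e * ar B)// /e; ring.
Qed.

End Counting.

(** * Meshes with a prescribed number of triangles *)

Section MeshTheorem.
Variable R : realType.
Implicit Types (t : tri R) (k : pt R * R).

(** Averaging: the barycentric combination forces equality of first, then of second coordinates at
    every vertex of positive weight. *)
Lemma lex_extreme t x : nd t -> inT t x ->
  (forall w, w \in verts t -> w = x \/ lexlt w x) ->
  [/\ 0 < af (k0 t) x -> t.1.1 = x, 0 < af (k1 t) x -> t.1.2 = x & 0 < af (k2 t) x -> t.2 = x].
Proof.
move=> n tx H; have [p0 p1 p2] := (inTP x n).1 tx; have := kb_sum x n.
have := kb_comb x n; move: p0 p1 p2.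
set l0 := af (k0 t) x; set l1 := af (k1 t) x; set l2 := af (k2 t) x => p0 p1 p2 xE sE.
have /in3[] : forall w, w \in [:: t.1.1; t.1.2; t.2] ->
    w.1 <= x.1 /\ (w.1 = x.1 -> w.2 <= x.2).
  move=> w /H[->//|[h|[h1 h2]]]; first by split; [exact: ltW|move=> e; rewrite e ltxx in h].
  by rewrite h1; split=> // _; apply: ltW.
set a := t.1.1; set b := t.1.2; set c := t.2 => -[a1 a2] [b1 b2] [c1 c2].
have E1 : l0 * (x.1 - a.1) + l1 * (x.1 - b.1) + l2 * (x.1 - c.1) = 0.
  rewrite (_ : _ + _ = (l0 + l1 + l2) * x.1 - (comb l0 l1 l2 t).1); last first.
    by rewrite /comb /=; ring.
  by rewrite sE -xE mul1r subrr.
have E2 : l0 * (x.2 - a.2) + l1 * (x.2 - b.2) + l2 * (x.2 - c.2) = 0.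
  rewrite (_ : _ + _ = (l0 + l1 + l2) * x.2 - (comb l0 l1 l2 t).2); last first.
    by rewrite /comb /=; ring.
  by rewrite sE -xE mul1r subrr.
have z3 (p q r u v w : R) : 0 <= p -> 0 <= q -> 0 <= r -> 0 <= u -> 0 <= v -> 0 <= w ->
    p * u + q * v + r * w = 0 -> [/\ p * u = 0, q * v = 0 & r * w = 0].
  clear; move=> ? ? ? ? ? ? E; have ? : 0 <= p * u by rewrite mulr_ge0.
  have ? : 0 <= q * v by rewrite mulr_ge0.
  have ? : 0 <= r * w by rewrite mulr_ge0.
  by split; lra.
have [] := z3 _ _ _ _ _ _ p0 p1 p2 _ _ _ E1; rewrite ?subr_ge0// => A1 B1 C1.
have sg (l u : R) (w : pt R) : l * (x.1 - w.1) = 0 -> (w.1 = x.1 -> w.2 <= x.2) -> 0 <= l ->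
    0 <= l * (x.2 - w.2).
  move=> /eqP; rewrite mulf_eq0 => /orP[/eqP->|]; first by rewrite mul0r.
  rewrite subr_eq0 => /eqP e h l_ge0; rewrite mulr_ge0// subr_ge0 h//.
have A2 := sg _ 0 _ A1 a2 p0; have B2 := sg _ 0 _ B1 b2 p1; have C2 := sg _ 0 _ C1 c2 p2.
have A3 : l0 * (x.2 - a.2) = 0 by clear -A2 B2 C2 E2; lra.
have B3 : l1 * (x.2 - b.2) = 0 by clear -A2 B2 C2 E2; lra.
have C3 : l2 * (x.2 - c.2) = 0 by clear -A2 B2 C2 E2; lra.
have fin (l : R) (w : pt R) : l * (x.1 - w.1) = 0 -> l * (x.2 - w.2) = 0 -> 0 < l -> w = x.
  move=> /eqP + /eqP + l_gt0; rewrite !mulf_eq0 (gt_eqF l_gt0) /= !subr_eq0 => /eqP e1 /eqP e2.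
  by case: (w) (x) e1 e2 => ? ? [? ?] /= -> ->.
by split=> h; [exact: fin A1 A3 h|exact: fin B1 B3 h|exact: fin C1 C3 h].
Qed.

Lemma lex_vertex t x : nd t -> inT t x -> exists2 w, w \in verts t & w = x \/ lexlt x w.
Proof.
move=> n tx; apply: contrapT => h.
have H w : w \in verts t -> lexlt w x.
  move=> wt; have [e|/lexlt_total[//|h']] := eqVneq w x; last by case: h; exists w; auto.
  by case: h; exists w; auto.
have [e0 e1 e2] := lex_extreme n tx (fun w wt => or_intror (H w wt)).
have [p0 p1 p2] := (inTP x n).1 tx; have sE := kb_sum x n.
have : 0 < af (k0 t) x \/ 0 < af (k1 t) x \/ 0 < af (k2 t) x.
  apply: contrapT => /not_orP[/negP + /not_orP[/negP + /negP +]].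
  by rewrite -!leNgt => q0 q1 q2; clear -p0 p1 p2 sE q0 q1 q2; lra.
by move=> [/e0|[/e1|/e2]] e; apply: (@lexlt_irr _ x); rewrite -{1}e; apply: H;
  rewrite !inE eqxx ?orbT.
Qed.

Lemma lex_interior t x : nd t -> inI t x -> exists2 w, w \in verts t & lexlt x w.
Proof.
move=> n tx; apply: contrapT => h.
have H w : w \in verts t -> w = x \/ lexlt w x.
  move=> wt; have [e|/lexlt_total[|h']] := eqVneq w x; [by left|by right|].
  by case: h; exists w.
have [e0 e1 e2] := lex_extreme n (inI_inT n tx) H.
move/eqP: n; apply; rewrite e0 ?e1 ?e2; last first.
- by apply: tx; rewrite !inE eqxx.
- by apply: tx; rewrite !inE eqxx orbT.
- by apply: tx; rewrite !inE eqxx !orbT.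
by rewrite /cr; ring.
Qed.

Variables (bs : seq (tri R)) (TB : tri R -> tri R) (rho : tri R -> R) (d tau x0 : R).
Hypotheses (mb : mesh bs) (b0 : bs != [::])
  (nT : forall B, B \in bs -> [/\ nd (TB B), ar (TB B) = 1, wide d (TB B) & 0 < rho B])
  (tau0 : 0 < tau) (hx : \sum_(B <- bs) ar B / rho B ^+ 2 < x0).

(** At scale [h] the cell [B] is tiled by copies of [TB B] of area [(h * rho B) ^+ 2]; slivers and
    tiny triangles are thin or small relative to [h] by the factor [tau]. *)
Definition cell (h : R) u := exists B, [/\ B \in bs, sub u B &
  [\/ exists l c, `|l| = h * rho B /\ u = htri l c (TB B),
      exists l c v a, [/\ `|l| = h * rho B, sub u (htri l c (TB B)),
        v \in verts (htri l c (TB B)), a \in verts (htri l c (TB B)) &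
        sliver (tau * h) v a u] |
      wide (tau * h) u]].

(** With [h ^+ 2 = x0 / N] the good tiles number at most S0 / h ^ 2, a fraction S0 / x0 of [N],
    where S0 is the sum of [ar B / rho B ^+ 2]. The strict inequality [hx] leaves a fixed fraction
    of [N] for the O(1/h) other triangles; bisections then use up what remains. *)
Lemma mesh_theorem : exists N0 : nat, forall N : nat, (N0 <= N)%N -> (0 < N)%N ->
  exists s, [/\ mesh s, nohang s, forall x, covers s x <-> covers bs x, size s = N &
    forall u, u \in s -> cell (Num.sqrt (x0 / N%:R)) u].
Proof.
have x0p : 0 < x0.
  apply: le_lt_trans hx; rewrite big_seq; apply: sumr_ge0 => B Bb.
  by rewrite divr_ge0 ?ar_ge0// sqr_ge0.
have rhop B : B \in bs -> 0 < rho B by move=> /nT[].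
have d0 : 0 <= d.
  case: (bs) b0 nT => // B l _ /(_ B (mem_head _ _))[_ _ w _].
  by have [h _] := w _ _ (mem_head _ _ : (TB B).1.1 \in verts _) (mem_head _ _); apply: le_trans h.
(* The depth of refinement depends on [tau] but not on [N], so the number of pieces per bad tile is
   a constant. *)
have [r hr] : exists r : nat, forall B, B \in bs -> rho B * d / 2 ^+ r <= tau.
  pose M := \sum_(B <- bs) rho B * d / tau.
  exists (Num.truncn M).+1 => B Bb.
  rewrite ler_pdivrMr ?exprn_gt0// [leRHS]mulrC -ler_pdivrMr//.
  have h1 : rho B * d / tau <= M.
    rewrite /M (big_rem B Bb) /= lerDl big_seq; apply: sumr_ge0 => C /mem_rem Cb.
    by rewrite divr_ge0 ?mulr_ge0// ltW// rhop.
  apply: (le_trans h1); apply: (@le_trans _ _ (Num.truncn M).+1%:R); first exact/ltW/truncnS_gt.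
  by rewrite -natrX ler_nat; apply/ltnW/ltn_expl.
pose P B (L : R) (W : seq (tri R)) := [/\ mesh W, nohang W, forall x, inT B x -> covers W x,
    forall t, t \in W -> wide (L * d) t &
    forall t, t \in W -> exists l' c, `|l'| = L /\ t = htri l' c (TB B)] /\
   (size (goods B W))%:R * L ^+ 2 <= ar B.
have [C [C0 HC]] : exists C : R, 0 <= C /\ exists2 h0, 0 < h0 & forall h, 0 < h <= h0 ->
    forall B, B \in bs -> exists2 W, P B (h * rho B) W & (size (bads B W))%:R * (h * rho B) <= C * rho B.
  have H B : B \in bs -> exists CB, 0 <= CB /\ exists2 h0, 0 < h0 & forall h, 0 < h <= h0 ->
     exists2 W, P B (h * rho B) W & (size (bads B W))%:R * (h * rho B) <= CB * rho B.
    move=> Bb; have [n1 a1 w1 r1] := nT Bb.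
    have [CB [l0 [l0p CB0 HB]]] := lattice_count (mb.1 _ Bb) n1 a1 w1.
    exists (CB / rho B); split; first by rewrite divr_ge0// ltW.
    exists (l0 / rho B); first by rewrite divr_gt0.
    move=> h /andP[hp hl]; have [|W [H1 [H2 H3]]] := HB (h * rho B).
      by rewrite mulr_gt0//= -ler_pdivlMr.
    by exists W => //; rewrite divfK// gt_eqF.
  have : forall l : seq (tri R), {subset l <= bs} ->
    exists C : R, 0 <= C /\ exists2 h0, 0 < h0 & forall h, 0 < h <= h0 ->
    forall B, B \in l -> exists2 W, P B (h * rho B) W & (size (bads B W))%:R * (h * rho B) <= C * rho B.
    elim=> [|B l IH] sl; first by exists 0; split=> //; exists 1.
    have [|C1 [C10 [h1 h1p H1]]] := IH; first by move=> x xl; apply: sl; rewrite inE xl orbT.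
    have [C2 [C20 [h2 h2p H2]]] := H _ (sl _ (mem_head _ _)).
    exists (C1 + C2); split; first by rewrite addr_ge0.
    exists (Num.min h1 h2); first by rewrite lt_min h1p.
    move=> h /andP[hp]; rewrite le_min => /andP[hh1 hh2] B'.
    rewrite inE => B'l; have rB' : 0 < rho B' by apply/rhop/sl; rewrite inE.
    case/orP: B'l => [/eqP E|B'l].
      have [|W HW hW] := H2 h; first by rewrite hp.
      rewrite E; exists W => //; apply: (le_trans hW).
      by rewrite ler_wpM2r ?lerDr// ltW// -E.
    have [|W HW hW] := H1 h _ B' B'l; first by rewrite hp.
    by exists W => //; apply: (le_trans hW); rewrite ler_wpM2r ?lerDl// ltW.
  by move=> /(_ bs (fun _ h => h)).
have [h0 h0p Hh] := HC.
pose S0 := \sum_(B <- bs) ar B / rho B ^+ 2.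
pose M : nat := (7 * (64 * 4 ^ r) * size bs)%N.
(* The fraction of the budget left to the transition layers. *)
pose a := (x0 - S0) / x0.
have ap : 0 < a by rewrite divr_gt0// subr_gt0.
have [N0 HN0] : exists N0 : nat, forall N : nat, (N0 <= N)%N -> (0 < N)%N ->
    Num.sqrt (x0 / N%:R) <= h0 /\ M%:R * C <= a * x0 / Num.sqrt (x0 / N%:R).
  pose e := Num.min h0 (a * x0 / (M%:R * C + 1)).
  have q0 : 0 < M%:R * C + 1 by rewrite ltr_wpDl// mulr_ge0.
  have e0 : 0 < e by rewrite lt_min h0p /= divr_gt0// mulr_gt0.
  exists (Num.truncn (x0 / e ^+ 2)).+1 => N hN Np.
  have NR : 0 < N%:R :> R by rewrite ltr0n.
  have he : Num.sqrt (x0 / N%:R) <= e.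
    rewrite -[leRHS]ger0_norm ?(ltW e0)// -sqrtr_sqr ler_wsqrtr//.
    rewrite ler_pdivrMr// mulrC -ler_pdivrMr ?exprn_gt0//.
    by apply: (le_trans (ltW (truncnS_gt _))); rewrite ler_nat.
  split; first by apply: (le_trans he); rewrite ge_min lexx.
  have hp : 0 < Num.sqrt (x0 / N%:R) by rewrite sqrtr_gt0 divr_gt0.
  rewrite ler_pdivlMr//; apply: (@le_trans _ _ ((M%:R * C + 1) * e)).
    by apply: ler_pM; rewrite ?he ?mulr_ge0 ?lerDl ?ler01 ?(ltW hp).
  rewrite mulrC -ler_pdivlMr//; rewrite /e ge_min lexx orbT//.
exists N0 => N hN Np; have [hh0 hM] := HN0 _ hN Np.
set h := Num.sqrt _ in hh0 hM *.
have NR : 0 < N%:R :> R by rewrite ltr0n.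
have hp : 0 < h by rewrite sqrtr_gt0 divr_gt0.
have h2 : h ^+ 2 = x0 / N%:R by rewrite sqr_sqrtr// divr_ge0// ltW.
have [|Wf HW] := @choose_list _ bs (fun B W => P B (h * rho B) W /\
   (size (bads B W))%:R * (h * rho B) <= C * rho B).
  by move=> B Bb; have [|W ? ?] := Hh h _ B Bb; [rewrite hp|exists W].
have [|s [ms nhs cs ss spec]] := @conforming_mesh _ bs Wf (fun B => h * rho B * d) r mb.
  by move=> B Bb; have [[[]]] := HW _ Bb.
have sN : (size s <= N)%N.
  apply: (leq_trans ss); rewrite -(ler_nat R) /mesh_bound natrD natrM !natr_sum.
  have H1 : \sum_(B <- bs) (size (goods B (Wf B)))%:R <= S0 / h ^+ 2.
    rewrite /S0 mulr_suml big_seq [leRHS]big_seq; apply: ler_sum => B Bb.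
    have [[_ hg] _] := HW _ Bb; rewrite ler_pdivlMr ?exprn_gt0// ler_pdivlMr ?exprn_gt0 ?rhop//.
    by rewrite -mulrA -exprMn.
  have H2 : \sum_(B <- bs) (size (bads B (Wf B)))%:R <= (size bs)%:R * (C / h).
    apply: (@le_trans _ _ (\sum_(B <- bs) C / h)).
      rewrite big_seq [leRHS]big_seq; apply: ler_sum => B Bb.
      have [_ hb] := HW _ Bb; rewrite ler_pdivlMr//.
      by rewrite -(ler_pM2r (rhop _ Bb)) -mulrA.
    by rewrite big_const_seq count_predT iter_addr_0 mulr_natl.
  have H3 : (7 * (64 * 4 ^ r))%:R * \sum_(B <- bs) (size (bads B (Wf B)))%:R <= a * x0 / h ^+ 2.
    apply: (@le_trans _ _ (M%:R * C / h)).
      have -> : M%:R = (7 * (64 * 4 ^ r))%:R * (size bs)%:R :> R by rewrite -natrM.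
      by rewrite -!mulrA; apply: ler_wpM2l.
    by rewrite expr2 invfM mulrA ler_wpM2r// invr_ge0 ltW.
  apply: (le_trans (lerD H1 H3)); rewrite -mulrDl /a divfK ?gt_eqF// addrC subrK.
  by rewrite h2 invf_div mulrA mulrC mulrA mulVf ?mul1r ?gt_eqF.
(* Only tiny triangles may be bisected, as tiles and slivers would lose their shape. The vertices of
   tiles and slivers are interior to a cell, so they never contain the lexicographically largest
   vertex. *)
pose Pf u := exists B, [/\ B \in bs, sub u B & wide (tau * h) u].
have sne : s != [::].
  case: (bs) b0 mb cs => // B l _ _ cs.
  have [t ts _] := (cs B.1.1).2 (ex_intro2 _ _ B (mem_head _ _) (inT_mem (mem_head _ _))).
  by move: ts; case: (s).
have subPf t t' : Pf t -> sub t' t -> Pf t'.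
  move=> [B [Bb tB w]] st; exists B; split=> //; first exact: sub_trans tB.
  by move=> x y xt yt; apply: (wide_inT w); [exact: st|exact: st].
have wtau B u : B \in bs -> wide (h * rho B * d / 2 ^+ r) u -> wide (tau * h) u.
  move=> Bb w x y xt yt; have [? ?] := w _ _ xt yt.
  have le : h * rho B * d / 2 ^+ r <= tau * h.
    rewrite (_ : _ / _ = rho B * d / 2 ^+ r * h); last by ring.
    by rewrite ler_wpM2r ?hr// ltW.
  by split; apply: le_trans le.
have lexs B z : B \in bs -> inI B z -> exists2 w, w \in allv s & lexlt z w.
  move=> Bb Bz; have [b bB zb] := lex_interior (mb.1 _ Bb) Bz.
  have [t ts tb] : covers s b by apply/cs; exists B => //; apply: inT_mem.
  have [w wt wb] := lex_vertex (ms.1 _ ts) tb; exists w; first by apply/allvP; exists t.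
  by case: wb => [->//|]; apply: lexlt_trans zb.
have bd t : t \in s -> Pf t \/ forall z, z \in verts t -> exists2 w, w \in allv s & lexlt z w.
  move=> ts; have [B [Bb tB [[tW it]|[t' [v [a' [[t'W it'] tt' _ _ _]]]]|w]]] := spec _ ts.
  - by right=> z /it; exact: lexs.
  - by right=> z /tt'; move/(inI_sub it'); exact: lexs.
  - by left; exists B; split=> //; exact: wtau w.
have [s' [[ms' nhs'] cs' ss' Hs']] := @fill _ Pf (N - size s) s ms nhs sne subPf bd.
exists s'; split=> //; first by move=> x; rewrite cs' cs.
  by rewrite ss' subnKC.
move=> u /Hs'[/spec[B [Bb uB cl]]|[B [Bb uB w]]]; last by exists B; split=> //; constructor 3.
exists B; split=> //; have [[[_ _ _ _ tE] _] _] := HW _ Bb.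
case: cl => [[uW _]|[t [v [a' [[tW _] ut vt a't sl]]]]|w].
- by constructor 1; apply: tE.
- constructor 2; have [l [c [lE tEq]]] := tE _ tW; exists l, c, v, a'; rewrite -tEq; split=> //.
  have [x [y [y' [rh [e1 e2 [e3 e4] [e5 e6]]]]]] := sl.
  have le : h * rho B * d / 2 ^+ r <= tau * h.
    rewrite (_ : _ / _ = rho B * d / 2 ^+ r * h); last by ring.
    by rewrite ler_wpM2r ?hr// ltW.
  by exists x, y, y', rh; split=> //; split; apply: le_trans le.
- by constructor 3; exact: wtau w.
Qed.

End MeshTheorem.

(** * Lagrange interpolation *)

Section Polynomials.
Variable R : realType.
Implicit Types (g : pt R -> R) (d : nat).

(** The degree is strictly less than [d], so that [isL m] matches interpolation of degree m - 1 and
    [isL 0] is the zero function. *)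
Definition isL d g := exists P : {poly {poly R}},
  (forall i j, (d <= i + j)%N -> P`_i`_j = 0) /\ forall z, poly_fun P z = g z.

Lemma isL_ext d g g' : (forall z, g z = g' z) -> isL d g -> isL d g'.
Proof. by move=> e [P [h1 h2]]; exists P; split=> // z; rewrite h2. Qed.

Lemma isL0 d : isL d (fun=> 0).
Proof.
exists 0; split=> [i j _|z]; first by rewrite !coef0.
by rewrite /poly_fun !horner0.
Qed.

Lemma isLD d g g' : isL d g -> isL d g' -> isL d (fun z => g z + g' z).
Proof.
move=> [P [h1 h2]] [Q [h3 h4]]; exists (P + Q); split=> [i j ij|z].
  by rewrite !coefD h1// h3// addr0.
by rewrite /poly_fun !hornerD -h2 -h4.
Qed.

Lemma isLZ d g (c : R) : isL d g -> isL d (fun z => c * g z).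
Proof.
move=> [P [h1 h2]]; exists (c%:P%:P * P); split=> [i j ij|z].
  by rewrite coefCM coefCM h1// mulr0.
by rewrite /poly_fun !hornerE -h2.
Qed.

Lemma isL_cst d (c : R) : isL d.+1 (fun=> c).
Proof.
exists c%:P%:P; split=> [i j|z]; last by rewrite /poly_fun !hornerE.
by rewrite coefC; case: i => [|i] /=; rewrite ?coef0// coefC; case: j.
Qed.

Lemma isL_mulx d g : isL d g -> isL d.+1 (fun z => z.1 * g z).
Proof.
move=> [P [h1 h2]]; exists ('X * P); split=> [[|i] j ij|z].
- by rewrite coefXM eqxx coef0.
- by rewrite coefXM /= h1.
- by rewrite /poly_fun !hornerE -h2.
Qed.

Lemma isL_muly d g : isL d g -> isL d.+1 (fun z => z.2 * g z).
Proof.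
move=> [P [h1 h2]]; exists ('X%:P * P); split=> [i [|j] ij|z].
- by rewrite coefCM coefXM eqxx.
- by rewrite coefCM coefXM /= h1// -ltnS -addnS.
- by rewrite /poly_fun !hornerE -h2.
Qed.

Lemma isL_le d d' g : (d <= d')%N -> isL d g -> isL d' g.
Proof.
by move=> dd [P [h1 h2]]; exists P; split=> // i j ij; rewrite h1// (leq_trans dd).
Qed.

Lemma isL_af d g (k : pt R * R) : isL d g -> isL d.+1 (fun z => af k z * g z).
Proof.
move=> h; apply: (@isL_ext _ (fun z => k.1.1 * (z.1 * g z) + k.1.2 * (z.2 * g z) + k.2 * g z)).
  by move=> z; rewrite /af; ring.
apply: isLD; [apply: isLD|].
- by apply: isLZ; apply: isL_mulx.
- by apply: isLZ; apply: isL_muly.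
- by apply: isLZ; apply: isL_le h.
Qed.

Lemma isL_sum (I : finType) (A : pred I) d (F : I -> pt R -> R) :
  (forall i, A i -> isL d (F i)) -> isL d (fun z => \sum_(i | A i) F i z).
Proof.
move=> H; elim: (index_enum I) => [|i s IH].
  by apply: isL_ext (isL0 d) => z; rewrite big_nil.
case Ai: (A i); last by apply: isL_ext IH => z; rewrite big_cons Ai.
by apply: isL_ext (isLD (H _ Ai) IH) => z; rewrite big_cons Ai.
Qed.

Lemma isL_expand d g : isL d g -> exists c : nat -> nat -> R,
  (forall i j, (d <= i + j)%N -> c i j = 0) /\
  forall z, g z = \sum_(i < d) \sum_(j < d) c i j * (z.1 ^+ i * z.2 ^+ j).
Proof.
move=> [P [h1 h2]]; exists (fun i j => P`_i`_j); split=> // z; rewrite -h2 /poly_fun.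
have sP : (size P <= d)%N.
  apply/leq_sizeP => i di; apply/polyP => j; rewrite coef0 h1//.
  by rewrite (leq_trans di)// leq_addr.
have sPi i : (size (P`_i)%R <= d)%N.
  apply/leq_sizeP => j dj; rewrite h1// (leq_trans dj)// leq_addl//.
rewrite (horner_coef_wide _ sP) horner_sum; apply: eq_bigr => i _.
rewrite -polyC_exp hornerM hornerC (horner_coef_wide _ (sPi i)) mulr_suml.
by apply: eq_bigr => j _; ring.
Qed.

Lemma isL_mono i j : isL (i + j).+1 (fun z => z.1 ^+ i * z.2 ^+ j).
Proof.
elim: i => [|i IH].
  elim: j => [|j IH]; first by apply: isL_ext (isL_cst 0 1) => z; rewrite !expr0 mulr1.
  by apply: isL_ext (isL_muly IH) => z; rewrite !expr0 !mul1r exprS.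
by apply: isL_ext (isL_mulx IH) => z; rewrite exprS mulrA.
Qed.

End Polynomials.

(** * The nodal basis and the interpolation operator *)

Section Interpolation.
Variables (R : realType) (m1 : nat).
Hypothesis m1p : (0 < m1)%N.
Local Notation m := m1.+1.
Implicit Types (t : tri R) (v g : pt R -> R).

(** The node of index (k1, k2) has barycentric coordinates (m1 - k1 - k2, k1, k2) / m1, with [m1]
    the degree; the condition makes the truncated subtraction exact. *)
Definition idx : {set 'I_m * 'I_m} := [set k : 'I_m * 'I_m | (k.1 + k.2 < m)%N].

Definition node t (k : 'I_m * 'I_m) : pt R :=
  comb ((m1 - k.1 - k.2)%:R / m1%:R) (k.1%:R / m1%:R) (k.2%:R / m1%:R) t.

(** The factor of degree [i] that is 1 at i / m1 and 0 at the earlier nodes only; nothing is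
    required at the later ones. *)
Definition lag (i : nat) (s : R) : R := \prod_(j < i) ((m1%:R * s - j%:R) / (i%:R - j%:R)).

Definition bas t (k : 'I_m * 'I_m) (z : pt R) : R :=
  lag (m1 - k.1 - k.2) (af (k0 t) z) * (lag k.1 (af (k1 t) z) * lag k.2 (af (k2 t) z)).

Definition LI t v z := \sum_(k in idx) v (node t k) * bas t k z.

Definition Err t v z := v z - LI t v z.

Lemma idxP k : k \in idx -> (k.1 + k.2 <= m1)%N.
Proof. by rewrite inE ltnS. Qed.

Lemma m1R : m1%:R != 0 :> R.
Proof. by rewrite pnatr_eq0 -lt0n. Qed.

Lemma node_sum k : k \in idx ->
  (m1 - k.1 - k.2)%:R / m1%:R + k.1%:R / m1%:R + k.2%:R / m1%:R = 1 :> R.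
Proof.
move=> /idxP h; rewrite -!mulrDl -!natrD -subnDA -addnA subnK// divff//; exact: m1R.
Qed.

Lemma node_inT t k : k \in idx -> inT t (node t k).
Proof. by move=> kA; apply: inT_comb; rewrite ?divr_ge0// node_sum. Qed.

Lemma lag_nat i (a : nat) : (a <= i)%N -> lag i (a%:R / m1%:R) = (a == i)%:R.
Proof.
move=> ai; rewrite /lag mulrCA divff ?m1R// mulr1.
have [->|ne] := eqVneq a i.
  by rewrite big1// => j _; rewrite divff// subr_eq0 eqr_nat gtn_eqF.
have ai' : (a < i)%N by rewrite ltn_neqAle ne.
by rewrite (bigD1 (Ordinal ai'))//= subrr !mul0r.
Qed.

(** Barycentric indices have the same sum, so two distinct ones differ by a decrease in some
    coordinate, where the corresponding factor vanishes. *)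
Lemma bas_node t k k' : nd t -> k \in idx -> k' \in idx ->
  bas t k (node t k') = (k == k')%:R.
Proof.
move=> n kA k'A; have [[a0 b0 c0] [[a1 b1 c1] [a2 b2 c2]]] := kbE n.
rewrite /bas /node !af_comb ?node_sum// a0 b0 c0 a1 b1 c1 a2 b2 c2.
rewrite !mulr1 !mulr0 !addr0 !add0r.
have := idxP kA; have := idxP k'A; case: k kA => k1' k2' _; case: k' k'A => l1 l2 _ /= h h'.
have [e|ne] := eqVneq (k1', k2') (l1, l2).
  by case: e => -> ->; rewrite !lag_nat// !eqxx !mulr1.
have : (l1 < k1')%N || ((l2 < k2')%N || (m1 - l1 - l2 < m1 - k1' - k2')%N).
  apply: contraNT ne; rewrite !negb_or -!leqNgt => /and3P[x y z].
  rewrite xpair_eqE -!val_eqE /=; have e1 : k1' = l1 :> nat by lia.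
  have e2 : k2' = l2 :> nat by lia.
  by rewrite e1 e2 !eqxx.
move=> /or3P[] lt; first by rewrite (lag_nat (ltnW lt)) (ltn_eqF lt) mul0r mulr0.
  by rewrite [lag k2' _](lag_nat (ltnW lt)) (ltn_eqF lt) !mulr0.
by rewrite (lag_nat (ltnW lt)) (ltn_eqF lt) mul0r.
Qed.

Lemma isL_lag d g i (k : pt R * R) : isL d g -> isL (d + i) (fun z => lag i (af k z) * g z).
Proof.
move=> h; rewrite /lag.
have H : forall n, isL (d + n) (fun z => (\prod_(j < n) ((m1%:R * af k z - j%:R) / (i%:R - j%:R))) * g z).
  elim=> [|n IH]; first by rewrite addn0; apply: isL_ext h => z; rewrite big_ord0 mul1r.
  rewrite addnS; pose q : pt R * R := ((m1%:R * k.1.1 / (i%:R - n%:R), m1%:R * k.1.2 / (i%:R - n%:R)),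
    (m1%:R * k.2 - n%:R) / (i%:R - n%:R)).
  apply: isL_ext (isL_af q IH) => z; rewrite big_ord_recr /= mulrA; congr (_ * _).
  by rewrite mulrC; congr (_ * _); rewrite /af /q /=; ring.
exact: H.
Qed.

Lemma isL_bas t k : k \in idx -> isL m (bas t k).
Proof.
move=> /idxP h; have := isL_lag k.2 (k2 t) (isL_cst 0 1).
move=> /(isL_lag k.1 (k1 t)) /(isL_lag (m1 - k.1 - k.2) (k0 t)).
have -> : (1 + k.2 + k.1 + (m1 - k.1 - k.2) = m)%N by lia.
by apply: isL_ext => z; rewrite /bas mulr1.
Qed.

Lemma isL_LI t v : isL m (LI t v).
Proof. by apply: isL_sum => k kA; apply: isLZ; apply: isL_bas. Qed.

(* The nodal basis is dual to the nodes, so it spans the polynomials of degree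
   < m by equality of dimensions: a one-sided matrix inverse is two-sided. *)
Lemma LI_id t g z : nd t -> isL m g -> LI t g z = g z.
Proof.
move=> n.
pose mono (k : 'I_m * 'I_m) (z : pt R) := z.1 ^+ k.1 * z.2 ^+ k.2.
have expand g' : isL m g' -> exists c : 'I_m * 'I_m -> R,
    forall z, g' z = \sum_(k in idx) c k * mono k z.
  move=> /isL_expand[c [c0' cE]]; exists (fun k : 'I_m * 'I_m => c k.1 k.2) => w; rewrite cE pair_big /=.
  rewrite [LHS](bigID (mem idx)) /= [X in _ + X]big1 ?addr0// => k.
  by rewrite inE -leqNgt => h; rewrite c0'// mul0r.
have [C HC] : exists C : 'I_m * 'I_m -> 'I_m * 'I_m -> R, forall l, l \in idx ->
    forall z, bas t l z = \sum_(k in idx) C l k * mono k z.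
  have H l : exists c : 'I_m * 'I_m -> R, l \in idx -> forall z, bas t l z = \sum_(k in idx) c k * mono k z.
    have [lA|lA] := boolP (l \in idx); last by exists (fun=> 0).
    by have [c Hc] := expand _ (isL_bas t lA); exists c.
  by have [C HC] := choice H; exists C.
pose e := @enum_val _ (mem idx).
pose CM : 'M[R]_#|idx| := \matrix_(i, j) C (e i) (e j).
pose MM : 'M[R]_#|idx| := \matrix_(i, j) mono (e i) (node t (e j)).
have eA i : e i \in idx by apply: enum_valP.
have CM1 : CM *m MM = 1%:M.
  apply/matrixP => i j; rewrite !mxE -(inj_eq enum_val_inj) -(bas_node n (eA i) (eA j)).
  rewrite HC// (big_enum_val (fun k => C (e i) k * mono k (node t (e j)))).
  by apply: eq_bigr => k _; rewrite !mxE.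
have MC1 := mulmx1C CM1.
have monoE k w : k \in idx -> mono k w = \sum_(l in idx) mono k (node t l) * bas t l w.
  move=> kA; pose i := enum_rank_in kA k; have ei : e i = k by rewrite /e enum_rankK_in.
  rewrite (eq_bigr (fun l => \sum_(k' in idx) mono k (node t l) * C l k' * mono k' w)); last first.
    by move=> l lA; rewrite HC// mulr_sumr; apply: eq_bigr => k' _; rewrite mulrA.
  rewrite exchange_big /= (big_enum_val (fun k' => \sum_(l in idx) mono k (node t l) * C l k' * mono k' w)).
  rewrite (eq_bigr (fun j : 'I_#|idx| => (MM *m CM) i j * mono (e j) w)); last first.
    move=> j _; rewrite !mxE mulr_suml (big_enum_val (fun l => mono k (node t l) * C l (e j) * mono (e j) w)).
    by apply: eq_bigr => l _; rewrite !mxE ei.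
  rewrite MC1 (bigD1 i)//= mxE eqxx mul1r ei big1 ?addr0// => j ji.
  by rewrite mxE eq_sym (negPf ji) mul0r.
move=> /expand[c gE]; rewrite gE /LI.
rewrite (eq_bigr (fun l => \sum_(k in idx) c k * (mono k (node t l) * bas t l z))); last first.
  by move=> l _; rewrite gE mulr_suml; apply: eq_bigr => k _; rewrite mulrA.
by rewrite exchange_big /=; apply: eq_bigr => k kA; rewrite -mulr_sumr -monoE.
Qed.

Lemma LI_ext t v v' z : (forall k, k \in idx -> v (node t k) = v' (node t k)) ->
  LI t v z = LI t v' z.
Proof. by move=> h; apply: eq_bigr => k kA; rewrite h. Qed.

Lemma LID t v v' z : LI t (fun w => v w + v' w) z = LI t v z + LI t v' z.
Proof. by rewrite -big_split; apply: eq_bigr => k _; rewrite mulrDl. Qed.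

Lemma LIZ t v (c : R) z : LI t (fun w => c * v w) z = c * LI t v z.
Proof. by rewrite mulr_sumr; apply: eq_bigr => k _; rewrite mulrA. Qed.

Lemma ErrD t v v' z : Err t (fun w => v w + v' w) z = Err t v z + Err t v' z.
Proof. by rewrite /Err LID; ring. Qed.

Lemma ErrZ t v (c : R) z : Err t (fun w => c * v w) z = c * Err t v z.
Proof. by rewrite /Err LIZ; ring. Qed.

Lemma Err_isL t g z : nd t -> isL m g -> Err t g z = 0.
Proof. by move=> n h; rewrite /Err LI_id// subrr. Qed.

(** A bound for the norm of the error operator in the sup norm, uniform in the triangle: each of the
    three factors of a basis function is at most m ^ m. *)
Definition Lam : R := 1 + \sum_(k in idx) (m%:R ^+ m) ^+ 3.

Lemma Lam_ge1 : 1 <= Lam.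
Proof. by rewrite /Lam lerDl; apply: sumr_ge0 => k _; rewrite !exprn_ge0. Qed.

Lemma bas_bound t k z : nd t -> k \in idx -> inT t z -> `|bas t k z| <= (m%:R ^+ m) ^+ 3.
Proof.
move=> n kA tz; have [p0 p1 p2] := (inTP z n).1 tz; have sz := kb_sum z n.
have H i (s : R) : (i <= m1)%N -> 0 <= s <= 1 -> `|lag i s| <= m%:R ^+ m.
  move=> im /andP[s0 s1]; rewrite /lag normr_prod.
  apply: (@le_trans _ _ (\prod_(j < i) m%:R)); last first.
    by rewrite prodr_const card_ord ler_weXn2l ?ler1n// (leq_trans im).
  apply: ler_prod => j _; rewrite normr_ge0 /= normrM normfV.
  have ji : (j < i)%N by [].
  have d1 : 1 <= i%:R - j%:R :> R by rewrite lerBrDr addrC natr1 ler_nat.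
  rewrite [`|i%:R - _|]ger0_norm; last by lra.
  rewrite ler_pdivrMr; last by lra.
  have h1 : `|m1%:R * s - j%:R| <= m%:R.
    have hj : j%:R <= m1%:R :> R by rewrite ler_nat (leq_trans (ltnW ji)).
    have hm : 0 <= m1%:R * s <= m1%:R.
      by rewrite mulr_ge0//= ler_piMr.
    have j0 : 0 <= j%:R :> R by [].
    by rewrite -natr1 ler_norml; apply/andP; split; lra.
  apply: (le_trans h1); rewrite ler_peMr//.
have hk := idxP kA.
rewrite /bas !normrM [_ ^+ 3]exprS expr2; apply: ler_pM => //.
  by apply: H; first [lia|lra].
have [l1 l2] : (k.1 <= m1)%N /\ (k.2 <= m1)%N by lia.
by apply: ler_pM; rewrite ?normr_ge0//; apply: H => //; apply/andP; split; lra.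
Qed.

Lemma Err_bound t v z (M : R) : nd t -> (forall w, inT t w -> `|v w| <= M) -> inT t z ->
  `|Err t v z| <= Lam * M.
Proof.
move=> n h tz; rewrite /Err (le_trans (ler_normB _ _))// /Lam mulrDl mul1r lerD ?h//.
rewrite (le_trans (ler_norm_sum _ _ _))// mulr_suml; apply: ler_sum => k kA.
by rewrite normrM mulrC ler_pM// ?h ?bas_bound//; apply: node_inT.
Qed.

Lemma node_htri l c t k : k \in idx -> node (htri l c t) k = hpt l c (node t k).
Proof.
move=> kA; have := node_sum kA; rewrite /node /htri /hpt /comb /=.
move: (_ / _) (_ / _) (_ / _) => a b d s.
have -> : a = 1 - d - b by rewrite -s; ring.
by congr (_, _); ring.
Qed.

Lemma kb_htri l c t z : l != 0 -> nd t ->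
  [/\ af (k0 (htri l c t)) (hpt l c z) = af (k0 t) z,
      af (k1 (htri l c t)) (hpt l c z) = af (k1 t) z &
      af (k2 (htri l c t)) (hpt l c z) = af (k2 t) z].
Proof.
move=> l0 n; have n' := nd_htri c l0 n.
have crh x y w : cr (hpt l c x) (hpt l c y) (hpt l c w) = l ^+ 2 * cr x y w.
  by rewrite /cr /hpt /=; ring.
have l20 : l ^+ 2 != 0 by rewrite expf_neq0.
by split; rewrite /k0 /k1 /k2 /kb /= !af_sck !af_kcr !crh invfM mulrACA mulVf// mul1r.
Qed.

Lemma Err_htri l c t v z : l != 0 -> nd t ->
  Err (htri l c t) v (hpt l c z) = Err t (fun w => v (hpt l c w)) z.
Proof.
move=> l0 n; rewrite /Err /LI; congr (_ - _); apply: eq_bigr => k kA.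
by have [e0 e1 e2] := kb_htri c z l0 n; rewrite node_htri// /bas e0 e1 e2.
Qed.

Definition hp (a : nat -> R) (z : pt R) : R := \sum_(k < m.+1) a k * (z.1 ^+ k * z.2 ^+ (m - k)).

Lemma isL_hp a : isL m.+1 (hp a).
Proof.
apply: isL_sum => k _; apply: isLZ.
by have := @isL_mono R k (m - k); rewrite subnKC// -ltnS.
Qed.

Lemma mono_hpt l (c : pt R) i j :
  isL (i + j) (fun z => (hpt l c z).1 ^+ i * (hpt l c z).2 ^+ j - l ^+ (i + j) * (z.1 ^+ i * z.2 ^+ j)).
Proof.
elim: i => [|i IH].
  elim: j => [|j IH].
    by apply: isL_ext (isL0 _ 0) => z; rewrite !expr0 !mulr1 subrr.
  rewrite add0n in IH *.
  have h1 := isL_af ((0, l), c.2) IH; have h2 := isLZ (c.2 * l ^+ j) (@isL_mono R 0 j).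
  apply: isL_ext (isLD h1 h2) => z.
  by rewrite /af /hpt /= !exprS !expr0; ring.
have h1 := isL_af ((l, 0), c.1) IH; have h2 := isLZ (c.1 * l ^+ (i + j)) (@isL_mono R i j).
rewrite addSn; apply: isL_ext (isLD h1 h2) => z.
by rewrite /af /hpt /= !exprS; ring.
Qed.

Lemma hp_hpt l (c : pt R) a : isL m (fun z => hp a (hpt l c z) - l ^+ m * hp a z).
Proof.
have H : isL m (fun z => \sum_(k < m.+1) a k * ((hpt l c z).1 ^+ k * (hpt l c z).2 ^+ (m - k)
    - l ^+ m * (z.1 ^+ k * z.2 ^+ (m - k)))).
  apply: isL_sum => k _; apply: isLZ; have := mono_hpt l c k (m - k).
  by rewrite subnKC// -ltnS.
apply: isL_ext H => z; rewrite /hp mulr_sumr -sumrB; apply: eq_bigr => k _; ring.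
Qed.

(** A translation alters a homogeneous polynomial of degree m only in degree less than m, which
    interpolation reproduces. *)
Lemma Err_hp_htri l c t a z : l != 0 -> nd t ->
  Err (htri l c t) (hp a) (hpt l c z) = l ^+ m * Err t (hp a) z.
Proof.
move=> l0 n; rewrite Err_htri//.
have -> : (fun w => hp a (hpt l c w)) = (fun w => (hp a (hpt l c w) - l ^+ m * hp a w) + l ^+ m * hp a w).
  by apply/funext => w; rewrite subrK.
by rewrite ErrD Err_isL ?add0r ?ErrZ//; exact: hp_hpt.
Qed.

End Interpolation.

(** * Error norms and the shape function *)

Section Continuity.
Variable R : realType.
Notation mu := (@plane_measure R).
Implicit Types (A : set (pt R)) (g : pt R -> R).

Definition near (d : R) (z w : pt R) := `|w.1 - z.1| < d /\ `|w.2 - z.2| < d.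

Definition cont_on A g := forall z, A z -> forall e, 0 < e ->
  exists2 d, 0 < d & forall w, A w -> near d z w -> `|g w - g z| < e.

Lemma cont_onP A g : {within A, continuous g} -> cont_on A g.
Proof.
move=> cg z Az e e0; have /cvgrPdist_lt/(_ e e0) := cg z.
rewrite /prop_near1 /= /nbhs /= -nbhs_subspace_in// => /nbhs_ballP[d /= d0 H].
exists d => // w Aw [h1 h2]; rewrite distrC; apply: (H w) => //.
by split; rewrite /ball /= distrC.
Qed.

Lemma cont_onS A B g : B `<=` A -> cont_on A g -> cont_on B g.
Proof.
by move=> BA H z /BA Az e /(H z Az)[d d0 Hd]; exists d => // w /BA; apply: Hd.
Qed.

Definition rbox (i : rat * rat * nat) : set (plane R) :=
  `](ratr i.1.1 - i.2.+1%:R^-1), (ratr i.1.1 + i.2.+1%:R^-1)[ `*`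
  `](ratr i.1.2 - i.2.+1%:R^-1), (ratr i.1.2 + i.2.+1%:R^-1)[.

Lemma measurable_rbox i : measurable (rbox i).
Proof. by apply: measurableX; exact: measurable_itv. Qed.

Lemma rbox_near (z : pt R) d : 0 < d -> exists2 i, rbox i z & forall w, rbox i w -> near d z w.
Proof.
move=> d0; have h0 : 0 < d / 2 by rewrite divr_gt0.
have [n _ /(_ n (leqnn n)) /= hn] := near_infty_natSinv_lt (PosNum h0).
have n0 : 0 < n.+1%:R^-1 :> R by rewrite invr_gt0.
set r := n.+1%:R^-1 in hn n0.
have H (x : R) : exists a : rat, x - r < ratr a < x + r.
  have lt : x - r < x + r by lra.
  by have [a ha] := rat_in_itvoo lt; exists a; rewrite in_itv /= in ha.
have [a /andP[a1 a2]] := H z.1; have [b /andP[b1 b2]] := H z.2.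
exists (a, b, n); rewrite /rbox /near /=.
  by rewrite !in_itv /= -/r; split; apply/andP; split; lra.
move=> w /=; rewrite !in_itv /= -/r => -[/andP[u1 u2] /andP[u3 u4]].
by rewrite !ltr_norml; split; apply/andP; split; lra.
Qed.

(** Superlevel sets are relatively open, hence traces on [A] of countable unions of rational
    boxes. *)
Lemma measurable_cont (A : set (plane R)) (g : plane R -> R) :
  measurable A -> cont_on A g -> measurable_fun A g.
Proof.
move=> mA cg; apply: (measurability (RGenOInfty.G (R:=R))).
  exact: RGenOInfty.measurableE.
move=> _ [_ [a ->] <-].
pose S := [set i | forall w, A w -> rbox i w -> a < g w].
have -> : A `&` g @^-1` `]a, +oo[ = A `&` \bigcup_(i in S) rbox i.
  apply/seteqP; split=> [z [Az /=]|z [Az [i Si iz]]].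
    rewrite in_itv /= andbT => az; split=> //.
    have e0 : 0 < g z - a by rewrite subr_gt0.
    have [d d0 Hd] := cg z Az _ e0.
    have [i iz Hi] := rbox_near z d0; exists i => // w Aw iw.
    by have := Hd w Aw (Hi _ iw); rewrite ltr_norml => /andP[+ _]; lra.
  by split=> //=; rewrite in_itv /= andbT; apply: Si.
apply: measurableI => //.
have -> : \bigcup_(i in S) rbox i = \bigcup_i (if i \in S then rbox i else set0).
  apply/seteqP; split=> [z [i Si iz]|z [i _]].
    by exists i => //; rewrite mem_set.
  by case: ifPn => // /set_mem Si iz; exists i.
apply: countable_bigcupT_measurable; first exact: countableP.
by move=> i; case: ifP => _ //; exact: measurable_rbox.
Qed.

Lemma measurable_isL d (g : plane R -> R) : isL d g -> measurable_fun setT g.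
Proof.
move=> /isL_expand[c [_ gE]].
have -> : g = fun z => \sum_(i < d) \sum_(j < d) c i j * (z.1 ^+ i * z.2 ^+ j).
  exact/funext.
apply: measurable_sum => i; apply: measurable_sum => j.
apply: measurable_funM => //; apply: measurable_funM; apply: measurable_funX.
  exact: measurable_fst.
exact: measurable_snd.
Qed.

End Continuity.

(** * Norms over triangles *)

Section Norms.
Variables (R : realType) (p : \bar R).
Hypothesis p1 : (1 <= p)%E.
Notation mu := (@plane_measure R).
Implicit Types (A : set (plane R)) (g : plane R -> R) (t : tri R).

Definition Nt A g : \bar R := LpNorm p A (EFin \o g).
(** The exponent 1/p as a real number, 0 for infinite p. With it both cases share the same scaling
    formulas. *)
Definition ip : R := fine p^-1.

Lemma p_cases : p = +oo%E \/ exists2 r, p = r%:E & 1 <= r.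
Proof. by move: p1; case: p => [r||]//; [right; exists r|left]. Qed.

Lemma ip_ge0 : 0 <= ip.
Proof.
rewrite /ip; case: p_cases => [->|[r -> r1]]; first by rewrite invey.
have r0 : r != 0 by lra.
by rewrite inver (negPf r0) /= invr_ge0; lra.
Qed.

Lemma NtE A g : Nt A g = ('N[mu]_p [EFin \o g \_ A])%E.
Proof. by rewrite /Nt /LpNorm restrict_EFin. Qed.

Lemma Nt_ge0 A g : (0 <= Nt A g)%E.
Proof. exact: Lnorm_ge0. Qed.

Lemma Nt_ext A g g' : (forall z, A z -> g z = g' z) -> Nt A g = Nt A g'.
Proof.
move=> h; rewrite !NtE; congr Lnorm; apply/funext => z /=; congr EFin.
by rewrite !patchE; case: ifPn => // /set_mem /h.
Qed.

(** The norm for infinite p is the essential supremum only over a space of positive measure. *)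
Lemma muT_gt0 : (0 < mu [set: plane R])%E.
Proof.
apply: (@lt_le_trans _ _ (mu (`[0, 0 + 1] `*` `[0, 0 + 1]))).
  have -> := mu_box (0, 0) (0, 0) (ler01 : 0 <= 1 :> R).
  by rewrite lte_fin expr1n.
by apply: le_measure => //; rewrite inE; [apply: measurableX; exact: measurable_itv|].
Qed.

Lemma Nt_fin_pE A g (r : R) : p = r%:E -> measurable A -> measurable_fun A g -> r != 0 ->
  Nt A g = ((\int[mu]_(z in A) (`|g z| `^ r)%:E) `^ r^-1)%E.
Proof.
move=> pr mA mg rn; rewrite NtE pr Lnorm.unlock.
apply: (congr1 (fun x : \bar R => poweR x r^-1)); rewrite [RHS]integral_mkcond.
apply: eq_integral => z _ /=.
rewrite !patchE; case: ifPn => // _.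
by rewrite -[point]/(0 : R) normr0 powR0.
Qed.

Lemma Nt_bound A g (c : R) : measurable A -> mu A \is a fin_num -> measurable_fun A g -> 0 <= c ->
  (forall z, A z -> `|g z| <= c) -> (Nt A g <= (c * fine (mu A) `^ ip)%:E)%E.
Proof.
move=> mA fA mg c0 h; have [pE|[r pE r1]] := p_cases.
  rewrite NtE pE Lnorm.unlock muT_gt0 /ip pE invey /= powRr0 mulr1.
  apply/ess_supP; apply: nearW => z /=; rewrite lee_fin.
  by rewrite patchE; case: ifPn => [/set_mem/h//|]; rewrite normr0.
have r0 : 0 < r by lra.
have rn : r != 0 by rewrite gt_eqF.
rewrite (Nt_fin_pE pE)// /ip pE inver gt_eqF//=.
have -> : (c * fine (mu A) `^ r^-1)%:E = (((c `^ r)%:E * mu A) `^ r^-1)%E.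
  rewrite -[in RHS](fineK fA) -EFinM poweR_EFin powRM ?powR_ge0//; last exact: fine_ge0.
  by rewrite -powRrM mulfV ?gt_eqF// powRr1.
have rV : 0 <= r^-1 by rewrite invr_ge0; lra.
apply: gt0_ler_poweR => //.
- by rewrite in_itv /= leey andbT; apply: integral_ge0 => z _; rewrite lee_fin powR_ge0.
- by rewrite in_itv /= leey andbT mule_ge0// lee_fin powR_ge0.
rewrite -[leRHS](integral_cst mu mA (c `^ r)%:E); apply: ge0_le_integral => //.
- apply/measurable_EFinP; apply: (measurableT_comp (measurable_powR _)).
  exact: measurableT_comp.
- by move=> z Az; rewrite lee_fin ge0_ler_powR ?nnegrE//; [lra|exact: h].
Qed.

Lemma Nt_D A g g' : measurable A -> measurable_fun A g -> measurable_fun A g' ->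
  (Nt A (fun z => (g z + g' z)%R) <= Nt A g + Nt A g')%E.
Proof.
move=> mA mg mg'; rewrite !NtE.
have -> : (fun z => g z + g' z) \_ A = (g \_ A \+ g' \_ A)%R.
  by apply/funext => z /=; rewrite !patchE; case: ifP; rewrite ?addr0.
by apply: eminkowski => //; apply/(measurable_restrictT _ mA).
Qed.

Lemma Nt_near A g g' (c : R) : measurable A -> mu A \is a fin_num ->
  measurable_fun A g -> measurable_fun A g' -> 0 <= c ->
  (forall z, A z -> `|g z - g' z| <= c) ->
  (Nt A g <= Nt A g' + (c * fine (mu A) `^ ip)%:E)%E.
Proof.
move=> mA fA mg mg' c0 h.
have -> : Nt A g = Nt A (fun z => g' z + (g z - g' z)) by apply: Nt_ext => z _; ring.
apply: (le_trans (Nt_D _ _ _)) => //; first exact: measurable_funB.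
by rewrite leeD2l// Nt_bound//; exact: measurable_funB.
Qed.

(** Change of variables. One inequality is enough, since the inverse homothety gives the other; for
    infinite p it is a transport of null sets. *)
Lemma Nt_htri t (l : R) (c : pt R) g : l != 0 -> nd t ->
  measurable_fun (bdy (htri l c t)) g ->
  (Nt (bdy (htri l c t)) g <= ((l ^+ 2) `^ ip)%:E * Nt (bdy t) (g \o hpt l c))%E.
Proof.
move=> l0 n mg; have n' := nd_htri c l0 n.
have mg' : measurable_fun (bdy t) (g \o hpt l c).
  rewrite -(bdy_htri t c l0); apply: (measurable_comp (F := bdy (htri l c t))) => //.
  - exact: measurable_bdy.
  - by move=> _ [z hz <-].
  - by apply: measurable_funTS; exact: measurable_hpt.
have l2 : 0 <= l ^+ 2 by rewrite sqr_ge0.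
have [pE|[r pE r1]] := p_cases.
  rewrite !NtE pE Lnorm.unlock muT_gt0 /ip pE invey /= powRr0 mul1e.
  apply/ess_supP; have [N [mN N0 HN]] := ess_sup_ge mu (abse \o (EFin \o (g \o hpt l c) \_ (bdy t))).
  exists (hpt l^-1 (- (l^-1 * c.1), - (l^-1 * c.2)) @^-1` N).
  have li : l^-1 != 0 by rewrite invr_eq0.
  have mh := measurable_hpt l^-1 (- (l^-1 * c.1), - (l^-1 * c.2)).
  split.
  - by rewrite -[X in measurable X]setTI; apply: mh.
  - have E := plane_hpt (- (l^-1 * c.1), - (l^-1 * c.2)) li mN.
    have := etrans (esym E) N0 => /eqP; rewrite mule_eq0 => /orP[|/eqP//].
    by rewrite eqe expf_eq0 (negPf li) andbF.
  - move=> z /= hz; apply: HN => /= h; apply: hz; move: h.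
    set w := hpt _ _ z; have <- : hpt l c w = z.
      by rewrite /w /hpt; case: (z) => a b /=; congr (_, _); field.
    rewrite !patchE -(bdy_htri t c l0).
    have -> : (w \in hpt l c @^-1` bdy (htri l c t)) = (hpt l c w \in bdy (htri l c t)).
      by apply/idP/idP => /set_mem h; apply/mem_set.
    by [].
have r0 : 0 < r by lra.
have mpow (h : plane R -> R) (D : set (plane R)) : measurable_fun D h ->
  measurable_fun D (fun z => (`|h z| `^ r)%:E).
  move=> mh; apply/measurable_EFinP; apply: (measurableT_comp (measurable_powR _)).
  exact: measurableT_comp.
have rn : r != 0 by rewrite gt_eqF.
rewrite !(Nt_fin_pE pE)//; [|exact: measurable_bdy..].
rewrite /ip pE inver gt_eqF//= -poweR_EFin -poweRM//; last first.
  by apply: integral_ge0 => z _; rewrite lee_fin powR_ge0.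
have -> // : (\int[mu]_(z in bdy (htri l c t)) (`|g z| `^ r)%:E =
  (l ^+ 2)%:E * \int[mu]_(z in bdy t) (`|g (hpt l c z)| `^ r)%:E)%E.
pose pm := measure_function_pushforward__canonical__measure_function_Measure
  [the measure _ _ of mu] (measurable_hpt l c).
rewrite (@eq_measure_integral _ _ _ _ (mscale (NngNum l2) pm)); last first.
  by move=> X mX _; exact: (plane_hpt c l0 mX).
have nn z : bdy (htri l c t) z -> (0 <= (`|g z| `^ r)%:E)%E by rewrite lee_fin powR_ge0.
apply: (etrans (@ge0_integral_mscale _ _ _ pm _ (measurable_bdy n') (NngNum l2) _ (mpow _ _ mg) nn)).
apply: (congr1 (fun x => (l ^+ 2)%:E * x)%E).
apply: (etrans (@ge0_integral_pushforward _ _ _ _ R _ (measurable_hpt l c) mu _ _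
  (measurable_bdy n') (mpow _ _ mg) _)); last by rewrite bdy_htri.
by move=> z _; rewrite lee_fin powR_ge0.
Qed.

End Norms.

(** * Local errors and their scaling *)

Section LocalError.
Variables (R : realType) (m1 : nat) (p : \bar R).
Hypotheses (m1p : (0 < m1)%N) (p1 : (1 <= p)%E).
Local Notation m := m1.+1.
Notation mu := (@plane_measure R).
Implicit Types (t : tri R) (v g : plane R -> R).

(** This is 1/q. It is at least 1 because m is at least 2, so the power [q] is subadditive. *)
Definition iq : R := m%:R / 2 + ip p.

Lemma iq_gt0 : 0 < iq.
Proof. by rewrite ltr_pwDl ?ip_ge0// divr_gt0. Qed.

Lemma iq_ge1 : 1 <= iq.
Proof.
have h : 1 <= m%:R / 2 :> R by rewrite ler_pdivlMr// mul1r ler_nat.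
by rewrite (le_trans h)// lerDl ip_ge0.
Qed.

Lemma Nt_Z A g (c : R) : measurable A -> measurable_fun A g ->
  (Nt p A (fun z => (c * g z)%R) <= `|c|%:E * Nt p A g)%E.
Proof.
move=> mA mg; have [pE|[r pE r1]] := p_cases p1.
  rewrite !NtE pE Lnorm.unlock muT_gt0 -ess_supZl//; last exact: muT_gt0.
  apply: le_ess_sup; apply: nearW => z /=; rewrite -EFinM -normrM lee_fin !patchE.
  by case: ifP => // _; rewrite -[point]/(0 : R) mulr0.
have r0 : 0 < r by lra.
have rn : r != 0 by rewrite gt_eqF.
have mcg : measurable_fun A (fun z => c * g z) by exact: measurable_funM.
rewrite !(Nt_fin_pE pE)//.
have mpow (h : plane R -> R) : measurable_fun A h -> measurable_fun A (fun z => (`|h z| `^ r)%:E).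
  move=> mh; apply/measurable_EFinP; apply: (measurableT_comp (measurable_powR _)).
  exact: measurableT_comp.
have cE : `|c|%:E = (((`|c| `^ r)%:E) `^ r^-1)%E.
  by rewrite poweR_EFin -powRrM mulfV ?gt_eqF// powRr1.
rewrite cE -poweRM ?lee_fin ?powR_ge0//; last first.
  by apply: integral_ge0 => z _; rewrite lee_fin powR_ge0.
rewrite le_eqVlt; apply/orP; left; apply/eqP.
apply: (congr1 (fun x : \bar R => poweR x r^-1)).
rewrite -(ge0_integralZl _ mA (mpow _ mg)); last 2 first.
- by move=> z _; rewrite lee_fin powR_ge0.
- by rewrite lee_fin powR_ge0.
by apply: eq_integral => z _; rewrite normrM powRM.
Qed.

Lemma measurable_Err t v : measurable_fun (bdy t) v -> measurable_fun (bdy t) (Err m1 t v).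
Proof.
move=> mv; apply: measurable_funB => //; apply: measurable_funTS.
exact: (measurable_isL (isL_LI m1p t v)).
Qed.

(** Enough for the local error to be finite, hence to be handled as the real number [en t v]. *)
Definition nice t v := measurable_fun (bdy t) v /\ exists M, forall z, inT t z -> `|v z| <= M.

Lemma niceB t v v' : nice t v -> nice t v' -> nice t (fun z => v z - v' z).
Proof.
move=> [h1 [M hM]] [h2 [M' hM']]; split; first exact: measurable_funB.
by exists (M + M') => z tz; rewrite (le_trans (ler_normB _ _))// lerD ?hM ?hM'.
Qed.

Lemma inT_box t : nd t -> exists2 D : R, 0 <= D & forall z, inT t z -> `|z.1| <= D /\ `|z.2| <= D.
Proof.
move=> n; exists (`|t.1.1.1| + `|t.1.2.1| + `|t.2.1| + (`|t.1.1.2| + `|t.1.2.2| + `|t.2.2|)).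
  by rewrite !addr_ge0.
move=> z tz; have [a b c] := (inTP z n).1 tz; have s := kb_sum z n.
have H (x y w : R) (u : R) : `|af (k0 t) z * x + af (k1 t) z * y + af (k2 t) z * w| <=
    `|x| + `|y| + `|w|.
  rewrite (le_trans (ler_normD _ _))// lerD//.
    by rewrite (le_trans (ler_normD _ _))// lerD// normrM ger0_norm// ler_piMl//; lra.
  by rewrite normrM ger0_norm// ler_piMl//; lra.
by rewrite {1 2}(kb_comb z n) /comb /=; split; rewrite (le_trans (H _ _ _ 0))// ?lerDl ?lerDr !addr_ge0.
Qed.

Lemma nice_isL t d g : nd t -> isL d g -> nice t g.
Proof.
move=> n gL; split; first by apply: measurable_funTS; apply: measurable_isL gL.
have [D D0 HD] := inT_box n; have [c [_ gE]] := isL_expand gL.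
exists (\sum_(i < d) \sum_(j < d) `|c i j| * (D ^+ i * D ^+ j)) => z /HD[h1 h2].
rewrite gE (le_trans (ler_norm_sum _ _ _))//; apply: ler_sum => i _.
rewrite (le_trans (ler_norm_sum _ _ _))//; apply: ler_sum => j _.
by rewrite !normrM !normrX ler_wpM2l// ler_pM ?exprn_ge0// lerXn2r// nnegrE.
Qed.

Definition en t v : R := fine (Nt p (bdy t) (Err m1 t v)).

Lemma Nt_Err_bound t v (M : R) : nd t -> measurable_fun (bdy t) v ->
  (forall z, inT t z -> `|v z| <= M) -> (Nt p (bdy t) (Err m1 t v) <= (Lam R m1 * M * ar t `^ ip p)%:E)%E.
Proof.
move=> n mv hM; apply: Nt_bound => //.
- exact: measurable_bdy.
- exact: mu_fin.
- exact: measurable_Err.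
- rewrite mulr_ge0//; first exact: le_trans ler01 (Lam_ge1 _ _).
  by apply: le_trans (hM t.1.1 _) => //; apply: inT_mem; rewrite in_cons eqxx.
- by move=> z tz; apply: Err_bound.
Qed.

Lemma enE t v : nd t -> nice t v -> Nt p (bdy t) (Err m1 t v) = (en t v)%:E.
Proof.
move=> n [mv [M hM]]; rewrite fineK// ge0_fin_numE ?Nt_ge0//.
by apply: le_lt_trans (Nt_Err_bound n mv hM) _; exact: ltry.
Qed.

Lemma en_ge0 t v : 0 <= en t v.
Proof. by apply: fine_ge0; exact: Nt_ge0. Qed.

(** The polynomial [g] of degree less than m does not contribute to the error, so [v] and [v'] need
    only be close modulo such polynomials. *)
Lemma en_near t v v' g (c : R) : nd t -> nice t v -> nice t v' -> isL m g ->
  (forall z, inT t z -> `|v z - v' z - g z| <= c) ->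
  en t v <= en t v' + Lam R m1 * c * ar t `^ ip p.
Proof.
move=> n nv nv' gL h; rewrite -lee_fin EFinD -!enE//.
have c0 : 0 <= c.
  by apply: le_trans (h t.1.1 _) => //; apply: inT_mem; rewrite in_cons eqxx.
apply: Nt_near => //.
- exact: measurable_bdy.
- exact: mu_fin.
- by apply: measurable_Err; case: nv.
- by apply: measurable_Err; case: nv'.
- by rewrite mulr_ge0//; exact: le_trans ler01 (Lam_ge1 _ _).
move=> z tz.
have -> : Err m1 t v z - Err m1 t v' z = Err m1 t (fun w => v w - v' w - g w) z.
  have -> : Err m1 t v z = Err m1 t (fun w => (v w - v' w - g w) + (v' w + g w)) z.
    by congr Err; apply/funext => w; ring.
  by rewrite ErrD (ErrD m1 t v' g) (Err_isL m1p z n gL); ring.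
exact: Err_bound.
Qed.

Lemma en_bound t v g (c : R) : nd t -> nice t v -> isL m g ->
  (forall z, inT t z -> `|v z - g z| <= c) -> en t v <= Lam R m1 * c * ar t `^ ip p.
Proof.
move=> n nv gL h; rewrite -lee_fin -enE//.
have -> : Nt p (bdy t) (Err m1 t v) = Nt p (bdy t) (Err m1 t (fun z => v z - g z)).
  apply: Nt_ext => z tz.
  have -> : Err m1 t v z = Err m1 t (fun w => (v w - g w) + g w) z.
    by congr Err; apply/funext => w; ring.
  by rewrite ErrD (Err_isL m1p z n gL) addr0.
apply: Nt_Err_bound => //; have [mv _] := nv.
by have [] := niceB nv (nice_isL n gL).
Qed.

Lemma sqr_iq (l : R) : l != 0 -> (l ^+ 2) `^ iq = `|l| ^+ m * (l ^+ 2) `^ ip p.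
Proof.
move=> l0; have l2 : l ^+ 2 != 0 by rewrite expf_neq0.
rewrite powRD ?l2 ?implybT//; congr (_ * _).
have -> : m%:R / 2 = 2^-1 * m%:R :> R by rewrite mulrC.
by rewrite powRrM powR12_sqrt ?sqr_ge0// sqrtr_sqr powR_mulrn.
Qed.

(** Homogeneity contributes |l| ^ m and the norm contributes (l ^ 2) ^ (1/p): together the ratio of
    areas to the power 1/q ([sqr_iq]). *)
Lemma en_htri t (l : R) (c : pt R) a : l != 0 -> nd t ->
  en (htri l c t) (hp m1 a) <= (l ^+ 2) `^ iq * en t (hp m1 a).
Proof.
move=> l0 n; have n' := nd_htri c l0 n.
have nh := nice_isL n (isL_hp m1 a); have nh' := nice_isL n' (isL_hp m1 a).
rewrite -lee_fin EFinM -!enE// sqr_iq// mulrC EFinM -muleA.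
apply: (le_trans (Nt_htri p1 l0 n (measurable_Err nh'.1))).
apply: lee_pmul => //; rewrite ?lee_fin ?powR_ge0 ?Nt_ge0//.
rewrite -normrX.
have -> : Nt p (bdy t) (Err m1 (htri l c t) (hp m1 a) \o hpt l c) =
    Nt p (bdy t) (fun z => l ^+ m * Err m1 t (hp m1 a) z).
  by apply: Nt_ext => z _ /=; rewrite Err_hp_htri.
by apply: Nt_Z; [exact: measurable_bdy|exact: measurable_Err nh.1].
Qed.

Lemma hp_bound a (M D : R) (z : pt R) : (forall k, (k <= m)%N -> `|a k| <= M) ->
  `|z.1| <= D -> `|z.2| <= D -> `|hp m1 a z| <= m.+1%:R * (M * D ^+ m).
Proof.
move=> ha h1 h2; rewrite /hp (le_trans (ler_norm_sum _ _ _))//.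
have -> : m.+1%:R * (M * D ^+ m) = \sum_(k < m.+1) M * D ^+ m.
  by rewrite sumr_const card_ord mulr_natl.
apply: ler_sum => k _; rewrite normrM; have km : (k <= m)%N by rewrite -ltnS.
apply: ler_pM => //; first exact: ha.
rewrite -[X in D ^+ X](subnKC km) exprD normrM !normrX.
by apply: ler_pM; rewrite ?exprn_ge0//; apply: lerXn2r; rewrite ?nnegrE// (le_trans _ h1).
Qed.

Lemma hpD (a b : nat -> R) z : hp m1 a z - hp m1 b z = hp m1 (fun k => a k - b k) z.
Proof. by rewrite /hp -sumrB; apply: eq_bigr => k _; rewrite mulrBl. Qed.

Lemma lip_pow (D e x y : R) k : 1 <= D -> `|x| <= D -> `|y| <= D -> `|x - y| <= e ->
  `|x ^+ k - y ^+ k| <= k%:R * D ^+ k * e.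
Proof.
move=> D1 hx hy h; elim: k => [|k IH]; first by rewrite !expr0 subrr normr0 !mul0r.
have e0 : 0 <= e by apply: le_trans h.
have D0 : 0 <= D by lra.
have -> : x ^+ k.+1 - y ^+ k.+1 = x * (x ^+ k - y ^+ k) + (x - y) * y ^+ k.
  by rewrite !exprS; ring.
have -> : k.+1%:R * D ^+ k.+1 * e = k%:R * D ^+ k.+1 * e + D ^+ k.+1 * e by rewrite -natr1; ring.
rewrite (le_trans (ler_normD _ _))// lerD//.
  by rewrite normrM exprS; rewrite (le_trans (ler_pM _ _ hx IH))//;
    rewrite le_eqVlt; apply/orP; left; apply/eqP; ring.
rewrite normrM mulrC ler_pM// normrX exprS.
rewrite (@le_trans _ _ (D ^+ k))//; first by rewrite lerXn2r// nnegrE.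
by rewrite ler_peMl// exprn_ge0.
Qed.

Lemma hp_lip a (M D e : R) (z w : pt R) : 1 <= D -> (forall k, (k <= m)%N -> `|a k| <= M) ->
  `|z.1| <= D -> `|z.2| <= D -> `|w.1| <= D -> `|w.2| <= D ->
  `|z.1 - w.1| <= e -> `|z.2 - w.2| <= e ->
  `|hp m1 a z - hp m1 a w| <= m.+1%:R * (M * (m%:R * D ^+ m * e)).
Proof.
move=> D1 ha z1 z2 w1 w2 h1 h2; rewrite /hp -sumrB (le_trans (ler_norm_sum _ _ _))//.
have -> : m.+1%:R * (M * (m%:R * D ^+ m * e)) = \sum_(k < m.+1) M * (m%:R * D ^+ m * e).
  by rewrite sumr_const card_ord mulr_natl.
apply: ler_sum => k _; rewrite -mulrBr normrM; have km : (k <= m)%N by rewrite -ltnS.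
apply: ler_pM => //; first exact: ha.
have D0 : 0 <= D by lra.
have -> : z.1 ^+ k * z.2 ^+ (m - k) - w.1 ^+ k * w.2 ^+ (m - k) =
  (z.1 ^+ k - w.1 ^+ k) * z.2 ^+ (m - k) + w.1 ^+ k * (z.2 ^+ (m - k) - w.2 ^+ (m - k)) by ring.
have -> : m%:R * D ^+ m * e = (k%:R * D ^+ k * e) * D ^+ (m - k) + D ^+ k * ((m - k)%:R * D ^+ (m - k) * e).
  by rewrite -[in LHS](subnKC km) natrD exprD; ring.
rewrite (le_trans (ler_normD _ _))// lerD// normrM; apply: ler_pM => //.
- exact: lip_pow.
- by rewrite normrX lerXn2r// nnegrE.
- by rewrite normrX lerXn2r// nnegrE.
- exact: lip_pow.
Qed.

End LocalError.

(** * Interior points and positivity of the area *)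

Section Interior.
Variable R : realType.
Notation mu := (@plane_measure R).
Implicit Types (t : tri R).

Lemma af_near_pos (k : pt R * R) (e : R) : 0 < e ->
  exists2 r, 0 < r & forall x w, e <= af k x -> near r x w -> 0 < af k w.
Proof.
move=> e0; pose S := 1 + `|k.1.1| + `|k.1.2|.
have S1 : 1 <= S by rewrite /S -addrA lerDl addr_ge0.
have S0 : 0 < S by lra.
exists (e / S); first by rewrite divr_gt0.
move=> x w ex [h1 h2]; set r := e / S in h1 h2.
have rE : r * S = e by rewrite /r divfK// gt_eqF.
have -> : af k w = af k x + (k.1.1 * (w.1 - x.1) + k.1.2 * (w.2 - x.2)) by rewrite /af; ring.
have r0 : 0 < r by rewrite divr_gt0.
have : `|k.1.1 * (w.1 - x.1) + k.1.2 * (w.2 - x.2)| <= (`|k.1.1| + `|k.1.2|) * r.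
  by rewrite mulrDl (le_trans (ler_normD _ _))// lerD// normrM ler_wpM2l// ltW.
rewrite ler_norml => /andP[+ _]; have : r * S = r + (`|k.1.1| + `|k.1.2|) * r by rewrite /S; ring.
lra.
Qed.

Lemma near_min (r r' : R) (x w : pt R) : near (Num.min r r') x w -> near r x w /\ near r' x w.
Proof. by rewrite /near !lt_min => -[/andP[? ?] /andP[? ?]]. Qed.

Lemma inI_near t (x : pt R) : inI t x -> exists2 r, 0 < r & forall w, near r x w -> inI t w.
Proof.
move=> h; have H k : k \in kb t -> exists2 r, 0 < r & forall w, near r x w -> 0 < af k w.
  by move=> /h kx; have [r r0 Hr] := af_near_pos k kx; exists r => // w; apply: Hr.
have [|r0 p0 h0] := H (k0 t); first by rewrite !in_cons eqxx.
have [|r1 p1 h1] := H (k1 t); first by rewrite !in_cons eqxx orbT.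
have [|r2 p2 h2] := H (k2 t); first by rewrite !in_cons eqxx !orbT.
exists (Num.min r0 (Num.min r1 r2)); first by rewrite !lt_min p0 p1 p2.
move=> w /near_min[n0 /near_min[n1 n2]] k; rewrite !in_cons in_nil orbF => /or3P[]/eqP->.
- exact: h0.
- exact: h1.
- exact: h2.
Qed.

Lemma inI_comb t (a b c : R) : nd t -> 0 < a -> 0 < b -> 0 < c -> a + b + c = 1 -> inI t (comb a b c t).
Proof.
move=> n a0 b0 c0 s k; have [[x0 y0 z0] [[x1 y1 z1] [x2 y2 z2]]] := kbE n.
rewrite !in_cons in_nil orbF => /or3P[]/eqP->; rewrite af_comb//.
- by rewrite x0 y0 z0; lra.
- by rewrite x1 y1 z1; lra.
- by rewrite x2 y2 z2; lra.
Qed.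

Lemma inI_ctr t : nd t -> inI t (ctr t).
Proof. by move=> n; apply: inI_comb => //; field. Qed.

Lemma ar_gt0 t : nd t -> 0 < ar t.
Proof.
move=> n; have [r r0 hr] := inI_near (inI_ctr n).
rewrite -lte_fin -arE//; move: (ctr t) hr => x hr.
have hb := mu_box (x.1 - r / 2, x.2 - r / 2) (0, 0) (ltW r0).
apply: (@lt_le_trans _ _ (r ^+ 2)%:E); first by rewrite lte_fin exprn_gt0.
rewrite -hb; apply: le_measure; rewrite ?inE.
- by apply: measurableX; exact: measurable_itv.
- exact: measurable_bdy.
move=> w /=; rewrite !in_itv /= => -[/andP[a1 a2] /andP[a3 a4]].
apply: inI_inT => //; apply: hr; rewrite /near !ltr_norml.
by split; apply/andP; split; lra.
Qed.

Lemma isL_continuous d (g : pt R -> R) : isL d g -> continuous g.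
Proof.
move=> /isL_expand[c [_ gE]].
have -> : g = fun z => \sum_(i < d) \sum_(j < d) c i j * (z.1 ^+ i * z.2 ^+ j) by exact/funext.
have S n (F : 'I_n -> pt R -> R) : (forall i, continuous (F i)) ->
    continuous (fun z => \sum_(i < n) F i z).
  elim: n F => [|n IH] F cF.
    have -> : (fun z => \sum_(i < 0) F i z) = fun=> 0 by apply/funext => z; rewrite big_ord0.
    exact: cst_continuous.
  have -> : (fun z => \sum_(i < n.+1) F i z) = fun z => \sum_(i < n) F (widen_ord (leqnSn n) i) z
    + F ord_max z.
    by apply/funext => z; rewrite big_ord_recr.
  by move=> z; apply: cvgD; [apply: IH|apply: cF].
have X (h : pt R -> R) n : continuous h -> continuous (fun z => h z ^+ n).
  move=> ch; elim: n => [|n IH]; first exact: cst_continuous.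
  by under eq_fun do rewrite exprS; move=> z; apply: cvgM; [apply: ch|apply: IH].
apply: (S d) => i; apply: (S d) => j z; apply: cvgM; first exact: cvg_cst.
apply: cvgM; apply: X => w; [exact: cvg_fst|exact: cvg_snd].
Qed.

Lemma isL_cont_on d (g : pt R -> R) A : isL d g -> cont_on A g.
Proof. by move=> /isL_continuous cg; apply: cont_onP; apply: continuous_subspaceT. Qed.

End Interior.

(** * The shape function *)

Section Shape.
Variables (R : realType) (m1 : nat) (p : \bar R).
Hypotheses (m1p : (0 < m1)%N) (p1 : (1 <= p)%E).
Local Notation m := m1.+1.
Notation mu := (@plane_measure R).
Implicit Types (t : tri R) (a b : nat -> R).
Local Notation en := (en m1 p).
Local Notation hp := (hp m1).
Local Notation iq := (iq m1 p).

(* The essential supremum of a continuous function is its supremum. *)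
Lemma en_sup t g d (z : pt R) : p = +oo%E -> nd t -> isL d g -> inT t z -> `|Err m1 t g z| <= en t g.
Proof.
move=> pE n gL tz; rewrite leNgt; apply/negP => lt.
have eL : isL (maxn d m) (Err m1 t g).
  apply: (@isL_ext _ _ (fun w => g w + (-1) * LI m1 t g w)); first by move=> w; rewrite /Err; ring.
  apply: isLD; first exact: isL_le (leq_maxl _ _) gL.
  by apply: isLZ; exact: isL_le (leq_maxr _ _) (isL_LI m1p t g).
have e0 : 0 < `|Err m1 t g z| - en t g by rewrite subr_gt0.
have [r r0 Hr] := @isL_cont_on _ _ _ setT eL z I _ e0.
have [D D0 HD] := inT_box n.
pose s := Num.min 1 (r / (2 * D + 1)).
have D1 : 0 < 2 * D + 1 by lra.
have s0 : 0 < s by rewrite lt_min ltr01 divr_gt0.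
have s1 : s <= 1 by rewrite ge_min lexx.
have sr : s * (2 * D + 1) <= r by rewrite -ler_pdivlMr// ge_min lexx orbT.
(* Contracting [t] towards [z] gives a triangle of positive area inside [t] on which the error still
   exceeds [en t g]. *)
pose t' := htri s ((1 - s) * z.1, (1 - s) * z.2) t.
have n' : nd t' by apply: nd_htri => //; rewrite gt_eqF.
have sub' : bdy t' `<=` [set w | inT t w /\ en t g < `|Err m1 t g w|].
  move=> w; rewrite /bdy /= => tw.
  have [x tx wE] : exists2 x, inT t x & w = hpt s ((1 - s) * z.1, (1 - s) * z.2) x.
    have s0' : s != 0 by rewrite gt_eqF.
    pose x : pt R := ((w.1 - (1 - s) * z.1) / s, (w.2 - (1 - s) * z.2) / s).
    have wE : w = hpt s ((1 - s) * z.1, (1 - s) * z.2) x.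
      by rewrite /hpt /x /=; case: (w) => w1 w2 /=; congr (_, _); field.
    exists x => //; have := bdy_htri t ((1 - s) * z.1, (1 - s) * z.2) s0'.
    by move/seteqP => [+ _] => /(_ x); apply; rewrite /bdy /= -wE.
  have wL : w = lerp s z x by rewrite wE /hpt /lerp; congr (_, _) => /=; ring.
  split.
    move=> k hk; rewrite wL af_lerp addr_ge0// mulr_ge0 ?subr_ge0//; first exact: tz.
      exact: ltW.
    exact: tx.
  have [zx1 zx2] := HD z tz; have [xx1 xx2] := HD x tx.
  have b (u v : R) : `|u| <= D -> `|v| <= D -> `|(1 - s) * u + s * v - u| < r.
    move=> hu hv; have -> : (1 - s) * u + s * v - u = s * (v - u) by ring.
    rewrite normrM (gtr0_norm s0); apply: lt_le_trans sr; rewrite ltr_pM2l//.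
    by rewrite (le_lt_trans (ler_normB _ _))//; lra.
  have hw : `|Err m1 t g w - Err m1 t g z| < `|Err m1 t g z| - en t g.
    by apply: Hr => //; rewrite wL /near /lerp /=; split; apply: b.
  have := ler_normB (Err m1 t g w) (Err m1 t g w - Err m1 t g z).
  rewrite opprB addrC subrK; lra.
have ng := nice_isL n gL.
have [N [mN N0 HN]] := ess_sup_ge mu (abse \o (EFin \o (Err m1 t g) \_ (bdy t))).
have enE' : ess_sup mu (abse \o (EFin \o (Err m1 t g) \_ (bdy t))) = (en t g)%:E.
  have <- := enE m1p p1 n ng; rewrite NtE pE Lnorm.unlock muT_gt0//.
have : (mu (bdy t') <= mu N)%E.
  apply: le_measure; rewrite ?inE//; first exact: measurable_bdy.
  move=> w /sub'[tw ew]; apply: HN => /=; rewrite enE' lee_fin patchE mem_set//.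
  by apply/negP; rewrite -ltNge.
rewrite (N0 : mu N = 0%E) arE// lee_fin leNgt => /negP; apply; exact: ar_gt0.
Qed.

Definition tiles (P : tri R -> Prop) a : set R :=
  [set e | exists t, [/\ nd t, ar t = 1, P t & e = en t (hp a)]].

Definition Kr a : R := inf (tiles (fun=> True) a).
(** Bounding the tiles makes [en] equi-Lipschitz in the coefficients, hence [Kn n] too, while [Kr]
    is only its decreasing limit. For small [n] there may be no tile at all and the infimum is then
    0 by convention; this explains the recurrent hypothesis that some tile exists. *)
Definition Kn (n : nat) a : R := inf (tiles (wide n%:R) a).

Lemma tiles_lb P a : lbound (tiles P a) 0.
Proof. by move=> _ [t [_ _ _ ->]]; exact: en_ge0. Qed.

Lemma tiles_le P t a : nd t -> ar t = 1 -> P t -> inf (tiles P a) <= en t (hp a).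
Proof.
by move=> n a1 Pt; apply: ge_inf; [exists 0; exact: tiles_lb|exists t].
Qed.

Lemma wide_fin t : nd t -> exists n : nat, wide n%:R t.
Proof.
move=> n; have [D D0 HT] := inT_box n.
have HD x : x \in verts t -> `|x.1| <= D /\ `|x.2| <= D by move=> /inT_mem/HT.
exists (Num.truncn (2 * D)).+1 => x y /HD[x1 x2] /HD[y1 y2].
have h : 2 * D <= (Num.truncn (2 * D)).+1%:R by apply: ltW; exact: truncnS_gt.
by split; rewrite (le_trans (ler_normB _ _))//; lra.
Qed.

Lemma tile_ex : exists n t, [/\ nd t, ar t = 1 & wide (n : nat)%:R t].
Proof.
pose t0 : tri R := ((0, 0), (1, 0), (0, 1)).
have n0 : nd t0 by rewrite /nd /cr /= !subr0 mulr0 subr0 mulr1 oner_neq0.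
have a0 := ar_gt0 n0; pose l := (Num.sqrt (ar t0))^-1.
have l0 : l != 0 by rewrite invr_eq0 sqrtr_eq0 -ltNge.
pose t := htri l (0, 0) t0; have n := nd_htri (0, 0) l0 n0.
have [k wk] := wide_fin n; exists k, t; split=> //.
by rewrite ar_htri// exprVn sqr_sqrtr ?mulVf ?gt_eqF// ltW.
Qed.

Lemma Kn_near n a s : (exists t, [/\ nd t, ar t = 1 & wide (n : nat)%:R t]) -> 0 < s ->
  exists t, [/\ nd t, ar t = 1, wide n%:R t & en t (hp a) < Kn n a + s].
Proof.
move=> [t [n1 n2 n3]] s0.
have [_ [t' [h1 h2 h3 ->]] h] := inf_adherent s0 (conj (ex_intro _ _ (ex_intro _ t (And4 n1 n2 n3 erefl)))
   (ex_intro _ 0 (@tiles_lb (wide n%:R) a))).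
by exists t'.
Qed.

Lemma Kr_near a s : 0 < s -> exists2 t, nd t /\ ar t = 1 & en t (hp a) < Kr a + s.
Proof.
move=> s0; have [n [t [n1 n2 _]]] := tile_ex.
have [_ [t' [h1 h2 h3 ->]] h] := inf_adherent s0 (conj (ex_intro _ _ (ex_intro _ t (And4 n1 n2 Logic.I
  erefl)))
   (ex_intro _ 0 (@tiles_lb (fun=> True) a))).
by exists t'.
Qed.

Lemma Kr_ge0 a : 0 <= Kr a.
Proof.
have [n [t [n1 n2 _]]] := tile_ex; apply: lb_le_inf; last exact: tiles_lb.
by exists (en t (hp a)); exists t.
Qed.

Lemma Kn_ge0 n a : 0 <= Kn n a.
Proof.
rewrite /Kn; have [[e ee]|] := pselect (tiles (wide n%:R) a !=set0).
  by apply: lb_le_inf; [exists e|exact: tiles_lb].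
by rewrite -forallNE => h; rewrite inf_out//; case=> -[e /h].
Qed.

(** Rescale [t] to unit area. This is the only property of optimal triangles that the lower bound
    uses. *)
Lemma Kr_scale t a : nd t -> Kr a * ar t `^ iq <= en t (hp a).
Proof.
move=> n; have a0 := ar_gt0 n; pose l := (Num.sqrt (ar t))^-1.
have l0 : l != 0 by rewrite invr_eq0 sqrtr_eq0 -ltNge.
have l2 : l ^+ 2 = (ar t)^-1 by rewrite exprVn sqr_sqrtr// ltW.
have a1 : ar (htri l (0, 0) t) = 1 by rewrite ar_htri// l2 mulVf// gt_eqF.
have h1 := @tiles_le (fun=> True) _ a (nd_htri (0, 0) l0 n) a1 Logic.I.
have h2 := en_htri m1p p1 (0, 0) a l0 n.
rewrite -ler_pdivlMr ?powR_gt0// mulrC (le_trans h1)// (le_trans h2)// l2.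
by rewrite -powR_inv1 ?(ltW a0)// -powRrM mulN1r powRN.
Qed.

(* The error of a homogeneous polynomial of degree m is translation invariant,
   so the tile can be moved next to the origin. *)
Lemma en_move t a : nd t -> exists c, [/\ nd (htri 1 c t), ar (htri 1 c t) = ar t,
  en (htri 1 c t) (hp a) = en t (hp a) & (htri 1 c t).1.1 = (0, 0)].
Proof.
move=> n; pose c : pt R := (- t.1.1.1, - t.1.1.2); exists c.
have o0 : (1 : R) != 0 by exact: oner_neq0.
have n' := nd_htri c o0 n; split.
- exact: n'.
- by rewrite ar_htri// expr1n mul1r.
- apply/eqP; rewrite eq_le; have := en_htri m1p p1 c a o0 n.
  rewrite expr1n powR1 mul1r => -> /=.
  have := en_htri m1p p1 (- c.1, - c.2) a o0 n'; rewrite expr1n powR1 mul1r.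
  suff -> : htri 1 (- c.1, - c.2) (htri 1 c t) = t by [].
  rewrite /htri /hpt /=; case: (t) => -[[a1 a2] [b1 b2]] [c1 c2] /=.
  by rewrite !mul1r !opprK !subrK.
- by rewrite /htri /hpt /c /= !mul1r !subrr.
Qed.

(** Once a vertex is moved to the origin, [n] bounds the coordinates and hence all monomials. *)
Lemma en_lip n t a b e : nd t -> ar t = 1 -> wide n%:R t -> (forall k, (k <= m)%N -> `|a k - b k| <= e) ->
  en t (hp a) <= en t (hp b) + Lam R m1 * (m.+1%:R * (e * n%:R ^+ m)).
Proof.
move=> nt a1 w he; have [c [n' a' ea t0]] := en_move a nt.
have [c2 [_ _ eb _]] := en_move b nt.
have -> : en t (hp b) = en (htri 1 c t) (hp b).
  apply/eqP; rewrite eq_le; have o0 : (1 : R) != 0 by exact: oner_neq0.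
  have := en_htri m1p p1 c b o0 nt; rewrite expr1n powR1 mul1r => ->; rewrite andbT.
  have := en_htri m1p p1 (- c.1, - c.2) b o0 n'; rewrite expr1n powR1 mul1r.
  suff -> : htri 1 (- c.1, - c.2) (htri 1 c t) = t by [].
  rewrite /htri /hpt /=; case: (t) => -[[x1 x2] [y1 y2]] [z1 z2] /=.
  by rewrite !mul1r !addrK.
rewrite -ea; set t' := htri 1 c t in n' a' t0 *.
have w' : wide n%:R t' by have := @wide_htri _ 1 c t _ w; rewrite normr1 mul1r; apply.
have := @en_near _ _ _ m1p p1 t' (hp a) (hp b) (fun=> 0) (m.+1%:R * (e * n%:R ^+ m)) n'.
rewrite a' a1 powR1 mulr1; apply.
- exact: nice_isL (isL_hp _ _).
- exact: nice_isL (isL_hp _ _).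
- exact: isL0.
move=> z tz; rewrite subr0 hpD; apply: hp_bound; first exact: he.
  have t0T : inT t' (0, 0) by rewrite -t0; apply: inT_mem; rewrite in_cons eqxx.
  by have [] := wide_inT w' tz t0T; rewrite !subr0.
have t0T : inT t' (0, 0) by rewrite -t0; apply: inT_mem; rewrite in_cons eqxx.
by have [] := wide_inT w' tz t0T; rewrite !subr0.
Qed.

Lemma Kn_lip n a b e : (exists t, [/\ nd t, ar t = 1 & wide (n : nat)%:R t]) ->
  (forall k, (k <= m)%N -> `|a k - b k| <= e) ->
  Kn n a <= Kn n b + Lam R m1 * (m.+1%:R * (e * n%:R ^+ m)).
Proof.
move=> tn he; apply/ler_addgt0Pr => s s0.
have [t [n1 n2 n3 h]] := Kn_near b tn s0.
have := en_lip n1 n2 n3 he; have := tiles_le a n1 n2 n3; rewrite -/(Kn n a).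
set L := Lam R m1 * _; lra.
Qed.

Lemma Kr_le_Kn n a : (exists t, [/\ nd t, ar t = 1 & wide (n : nat)%:R t]) -> Kr a <= Kn n a.
Proof.
move=> tn; apply/ler_addgt0Pr => s s0; have [t [n1 n2 n3 h]] := Kn_near a tn s0.
by rewrite (le_trans _ (ltW h))//; exact: tiles_le.
Qed.

Lemma Kn_cvg a s : 0 < s -> exists n0, forall n, (n0 <= n)%N -> Kn n a <= Kr a + s.
Proof.
move=> s0; have [t [n1 n2] h] := Kr_near a s0; have [n0 w] := wide_fin n1.
exists n0 => n nn; rewrite (le_trans _ (ltW h))//; apply: tiles_le => // x y xt yt.
by have [h1 h2] := w x y xt yt; split; [apply: (le_trans h1)|apply: (le_trans h2)]; rewrite ler_nat.
Qed.

Lemma Kn_mono n n' a : (exists t, [/\ nd t, ar t = 1 & wide (n : nat)%:R t]) -> (n <= n')%N ->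
  Kn n' a <= Kn n a.
Proof.
move=> tn nn; apply/ler_addgt0Pr => s s0; have [t [n1 n2 n3 h]] := Kn_near a tn s0.
rewrite (le_trans _ (ltW h))//; apply: tiles_le => // x y xt yt.
by have [h1 h2] := n3 x y xt yt; split; [apply: (le_trans h1)|apply: (le_trans h2)]; rewrite ler_nat.
Qed.

End Shape.

(** * Taylor's formula *)

Section Taylor.
Variable R : realType.
Implicit Types (t : tri R).

Lemma mvt_bound (f df : R -> R) (a b L : R) :
  (forall s, Num.min a b <= s <= Num.max a b -> is_derive s 1 f (df s)) ->
  (forall s, Num.min a b <= s <= Num.max a b -> `|df s| <= L) ->
  `|f b - f a| <= L * `|b - a|.
Proof.
wlog ab : a b / a <= b => [H|].
  case/orP: (le_total a b) => [/H//|ba]; rewrite minC maxC => h1 h2.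
  by rewrite distrC (distrC b); apply: H.
rewrite (min_idPl ab) (max_idPr ab) => h1 h2.
move: ab; rewrite le_eqVlt => /predU1P[->|ab]; first by rewrite !subrr normr0 mulr0.
have [c cab ->] : exists2 c, c \in `]a, b[%R & f b - f a = df c * (b - a).
  apply: MVT => // [x|].
    by rewrite in_itv /= => /andP[/ltW xa /ltW xb]; apply: h1; rewrite xa.
  by apply: derivable_within_continuous => x; rewrite in_itv /= => /h1[].
rewrite normrM ler_wpM2r//; apply: h2; move: cab; rewrite in_itv /= => /andP[/ltW ca /ltW cb].
by rewrite ca.
Qed.

(* Partial derivatives, written as derivatives of the two restrictions to the
   coordinate lines through z. *)
Definition partials (H Hx Hy : pt R -> R) (z : pt R) :=
  is_derive z.1 1 (fun s => H (s, z.2)) (Hx z) /\ is_derive z.2 1 (fun s => H (z.1, s)) (Hy z).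

Lemma partials_of_is_derive (H Hx Hy : pt R -> R) (z : pt R) :
  is_derive z (1, 0) H (Hx z) -> is_derive z (0, 1) H (Hy z) -> partials H Hx Hy z.
Proof.
move=> h1 h2; split.
  have E : (fun h : R => h^-1 *: (((fun s => H (s, z.2)) \o shift z.1) (h *: 1) - H (z.1, z.2))) =
           (fun h : R => h^-1 *: ((H \o shift z) (h *: (1, 0)) - H z)).
    apply/funext => h /=; congr (_ *: (H _ - H _)); last by case: (z).
    by rewrite /shift /=; case: (z) => z1 z2; congr (_, _); rewrite /= scaler0 add0r.
  by apply: DeriveDef; [have := @ex_derive _ _ _ _ _ _ _ h1|have := @derive_val _ _ _ _ _ _ _ h1];
    rewrite /derivable /derive /= E.
have E : (fun h : R => h^-1 *: (((fun s => H (z.1, s)) \o shift z.2) (h *: 1) - H (z.1, z.2))) =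
         (fun h : R => h^-1 *: ((H \o shift z) (h *: (0, 1)) - H z)).
  apply/funext => h /=; congr (_ *: (H _ - H _)); last by case: (z).
  by rewrite /shift /=; case: (z) => z1 z2; congr (_, _); rewrite /= scaler0 add0r.
by apply: DeriveDef; [have := @ex_derive _ _ _ _ _ _ _ h2|have := @derive_val _ _ _ _ _ _ _ h2];
  rewrite /derivable /derive /= E.
Qed.

(** Only partial derivatives are available: the increment is taken along an axis-parallel path with
    one corner, which stays in the box. *)
Lemma lip_box (H Hx Hy : pt R -> R) (L r : R) (z w : pt R) :
  (forall u, near r z u -> [/\ partials H Hx Hy u, `|Hx u| <= L & `|Hy u| <= L]) -> near r z w ->
  `|H w - H z| <= L * (`|w.1 - z.1| + `|w.2 - z.2|).
Proof.
move=> h [h1 h2]; have r0 : 0 < r by apply: le_lt_trans h1.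
have B (a b s : R) : Num.min a b <= s <= Num.max a b -> `|b - a| < r -> `|s - a| < r.
  by rewrite ge_min le_max !ltr_norml => /andP[/orP[] ? /orP[] ?] /andP[? ?]; apply/andP; split; lra.
have -> : H w - H z = (H (w.1, w.2) - H (w.1, z.2)) + (H (w.1, z.2) - H (z.1, z.2)).
  by case: (w); case: (z) => /= *; ring.
rewrite (le_trans (ler_normD _ _))// mulrDr addrC lerD//.
  apply: (@mvt_bound (fun s => H (s, z.2)) (fun s => Hx (s, z.2))) => s /B/(_ h1) sr.
    by have [] := h (s, z.2); [split=> //=; rewrite subrr normr0|case].
  by have [] := h (s, z.2); [split=> //=; rewrite subrr normr0|].
apply: (@mvt_bound (fun s => H (w.1, s)) (fun s => Hy (w.1, s))) => s /B/(_ h2) sr.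
  by have [] := h (w.1, s) => // -[].
by have [] := h (w.1, s).
Qed.

Lemma inI_seg t (z w : pt R) : inI t z -> inI t w ->
  exists2 r, 0 < r & forall s u, 0 <= s <= 1 -> near r (lerp s z w) u -> inI t u.
Proof.
move=> hz hw; have H k : k \in kb t -> exists2 r, 0 < r &
    forall s u, 0 <= s <= 1 -> near r (lerp s z w) u -> 0 < af k u.
  move=> hk; pose e := Num.min (af k z) (af k w).
  have e0 : 0 < e by rewrite lt_min hz ?hw.
  have [r r0 Hr] := af_near_pos k e0; exists r => // s u /andP[s0 s1].
  apply: Hr; rewrite af_lerp.
  have [h1 h2] : e <= af k z /\ e <= af k w by rewrite !ge_min !lexx orbT.
  have := ler_wpM2l s0 h2; have s1' : 0 <= 1 - s by lra.
  by have := ler_wpM2l s1' h1; lra.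
have [|r0 p0 h0] := H (k0 t); first by rewrite !in_cons eqxx.
have [|r1 p1 h1] := H (k1 t); first by rewrite !in_cons eqxx orbT.
have [|r2 p2 h2] := H (k2 t); first by rewrite !in_cons eqxx !orbT.
exists (Num.min r0 (Num.min r1 r2)); first by rewrite !lt_min p0 p1 p2.
move=> s u s01 /near_min[n0 /near_min[n1 n2]] k; rewrite !in_cons in_nil orbF => /or3P[]/eqP->.
- exact: h0 n0.
- exact: h1 n1.
- exact: h2 n2.
Qed.

(** The axis-parallel path from [z] to [w] may leave the triangle. The segment has a neighbourhood
    of uniform size [r] inside it, so it is divided into steps shorter than [r] and the bounds are
    added. *)
Lemma lip_inI t (H Hx Hy : pt R -> R) (L : R) (z w : pt R) :
  (forall u, inI t u -> [/\ partials H Hx Hy u, `|Hx u| <= L & `|Hy u| <= L]) ->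
  inI t z -> inI t w ->
  `|H w - H z| <= L * (`|w.1 - z.1| + `|w.2 - z.2|).
Proof.
move=> h iz iw; have [r r0 Hr] := inI_seg iz iw.
pose n := (Num.truncn ((`|w.1 - z.1| + `|w.2 - z.2|) / r)).+1.
have hn : (`|w.1 - z.1| + `|w.2 - z.2|) / r < n%:R by exact: truncnS_gt.
have n0 : 0 < n%:R :> R by [].
have hn' : (`|w.1 - z.1| + `|w.2 - z.2|) / n%:R < r.
  by rewrite ltr_pdivrMr// mulrC -ltr_pdivrMr.
have S i : (i <= n)%N -> `|H (lerp (i%:R / n%:R) z w) - H z| <=
    (i%:R / n%:R) * (L * (`|w.1 - z.1| + `|w.2 - z.2|)).
  elim: i => [|i IH] iN.
    rewrite mul0r mul0r; have -> : lerp 0 z w = z; last by rewrite subrr normr0.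
    by rewrite /lerp; case: (z) => z1 z2 /=; congr (_, _); ring.
  set u := lerp (i%:R / n%:R) z w; set v := lerp _ z w.
  have vu1 : v.1 - u.1 = (w.1 - z.1) / n%:R.
    by rewrite /u /v /lerp /= -natr1; field; rewrite pnatr_eq0.
  have vu2 : v.2 - u.2 = (w.2 - z.2) / n%:R.
    by rewrite /u /v /lerp /= -natr1; field; rewrite pnatr_eq0.
  have nV : `|n%:R^-1| = n%:R^-1 :> R by rewrite ger0_norm// invr_ge0.
  have -> : H v - H z = (H u - H z) + (H v - H u) by ring.
  have -> : i.+1%:R / n%:R * (L * (`|w.1 - z.1| + `|w.2 - z.2|)) =
    i%:R / n%:R * (L * (`|w.1 - z.1| + `|w.2 - z.2|)) + L * (`|v.1 - u.1| + `|v.2 - u.2|).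
    by rewrite vu1 vu2 !normrM nV -natr1; ring.
  rewrite (le_trans (ler_normD _ _))// lerD ?IH 1?ltnW//.
  apply: (@lip_box H Hx Hy L r).
    move=> x nx; apply: h; apply: (Hr _ _ _ nx).
    by rewrite divr_ge0//= ler_pdivrMr// mul1r ler_nat ltnW.
  rewrite /near vu1 vu2 !normrM nV; split; apply: le_lt_trans hn'; rewrite ler_wpM2r ?invr_ge0//.
    by rewrite lerDl.
  by rewrite lerDr.
have := S n (leqnn n); rewrite divff ?pnatr_eq0// mul1r.
have -> // : lerp 1 z w = w by rewrite /lerp; case: (w) => w1 w2 /=; congr (_, _); ring.
Qed.

Lemma is_derive_bigsum n (F : 'I_n -> R -> R) (dF : 'I_n -> R) (x : R) :
  (forall i, is_derive x 1 (F i) (dF i)) ->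
  is_derive x 1 (fun s => \sum_(i < n) F i s) (\sum_(i < n) dF i).
Proof.
elim: n F dF => [|n IH] F dF h.
  have -> : (fun s => \sum_(i < 0) F i s) = cst 0 by apply/funext => s; rewrite big_ord0.
  by rewrite big_ord0; exact: is_derive_cst.
have -> : (fun s => \sum_(i < n.+1) F i s) =
    (fun s => \sum_(i < n) F (widen_ord (leqnSn n) i) s) + F ord_max.
  by apply/funext => s; rewrite big_ord_recr.
have h1 := IH (fun i => F (widen_ord (leqnSn n) i)) _ (fun i => h (widen_ord (leqnSn n) i)).
by rewrite big_ord_recr; exact: is_deriveD h1 (h ord_max).
Qed.

Definition qm (k : nat) (s : R) : R := s ^+ k / k`!%:R.

Lemma qm_derive k (x0 x : R) : is_derive x 1 (fun s => qm k.+1 (s - x0)) (qm k (x - x0)).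
Proof.
have h : is_derive x 1 (fun s : R => s - x0) 1.
  have -> : (fun s : R => s - x0) = id + cst (- x0) by apply/funext.
  by have := is_deriveD (is_derive_id x (1 : R)) (is_derive_cst (- x0) x (1 : R)); rewrite addr0.
have -> : (fun s => qm k.+1 (s - x0)) = (k.+1`!%:R^-1 : R) *: ((fun s : R => s - x0) ^+ k.+1).
  apply/funext => s; rewrite /qm mulrC; congr (_ * _).
  elim: (k.+1) => [|j IH]; first by rewrite !expr0.
  by rewrite !exprS IH.
apply: is_derive_eq.
rewrite /qm /= factS natrM; rewrite -[_ *: 1]/(_ * 1) mulr1 -[_ *: _]/(_ * _).
rewrite -mulr_natl; field.
by rewrite pnatr_eq0 -lt0n fact_gt0 /= addrC natr1 pnatr_eq0.
Qed.

Lemma qm0_derive (x0 x : R) : is_derive x 1 (fun s => qm 0 (s - x0)) 0.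
Proof.
have -> : (fun s => qm 0 (s - x0)) = cst (0`!%:R^-1 : R).
  by apply/funext => s; rewrite /qm expr0 mul1r.
exact: is_derive_cst.
Qed.

(** The Taylor polynomial at [z0], of total degree less than [j], with prescribed derivatives
    [c k l]; differentiating it shifts [c]. *)
Definition TP (j : nat) (c : nat -> nat -> R) (z0 z : pt R) :=
  \sum_(k < j) qm k (z.1 - z0.1) * \sum_(l < j - k) c k l * qm l (z.2 - z0.2).

Lemma is_derive_mulr (f : R -> R) (df x c : R) : is_derive x 1 f df ->
  is_derive x 1 (fun s => f s * c) (df * c).
Proof.
move=> h; have -> : (fun s => f s * c) = c *: f by apply/funext => s; rewrite mulrC.
by rewrite mulrC; apply: is_deriveZ.
Qed.

Lemma is_derive_mull (f : R -> R) (df x c : R) : is_derive x 1 f df ->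
  is_derive x 1 (fun s => c * f s) (c * df).
Proof. by move=> h; apply: is_deriveZ. Qed.

Lemma TP_partials j c (z0 z : pt R) :
  partials (TP j.+1 c z0) (TP j (fun k l => c k.+1 l) z0) (TP j (fun k l => c k l.+1) z0) z.
Proof.
split.
  pose F (k : 'I_j.+1) (s : R) := qm k (s - z0.1) * \sum_(l < j.+1 - k) c k l * qm l (z.2 - z0.2).
  pose dF (k : 'I_j.+1) := (if k : nat is k'.+1 then qm k' (z.1 - z0.1) else 0) *
    \sum_(l < j.+1 - k) c k l * qm l (z.2 - z0.2).
  have -> : TP j (fun k l => c k.+1 l) z0 z = \sum_k dF k.
    rewrite big_ord_recl /dF /= mul0r add0r; apply: eq_bigr => k _.
    by rewrite /bump /= add1n subSS.
  apply: (@is_derive_bigsum _ F dF) => k; rewrite /F /dF.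
  apply: (@is_derive_mulr (fun s => qm k (s - z0.1))).
  by case: k => -[|k] kj; [exact: qm0_derive|exact: qm_derive].
pose F (k : 'I_j.+1) (s : R) := qm k (z.1 - z0.1) * \sum_(l < j.+1 - k) c k l * qm l (s - z0.2).
pose dF (k : 'I_j.+1) := qm k (z.1 - z0.1) *
  \sum_(l < j.+1 - k) c k l * (if l : nat is l'.+1 then qm l' (z.2 - z0.2) else 0).
have -> : TP j (fun k l => c k l.+1) z0 z = \sum_k dF k.
  rewrite big_ord_recr /dF /= subSn// subnn big_ord_recl big_ord0 /= mulr0 addr0 mulr0 addr0.
  apply: eq_bigr => k _; congr (_ * _); rewrite subSn 1?ltnW// big_ord_recl /= mulr0 add0r.
  by apply: eq_bigr => l _; rewrite /bump /= add1n.
apply: (@is_derive_bigsum _ F dF) => k; rewrite /F /dF.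
apply: (@is_derive_mull (fun s => \sum_(l < j.+1 - k) c k l * qm l (s - z0.2))).
apply: (@is_derive_bigsum _ (fun (l : 'I_(j.+1 - k)) s => c k l * qm l (s - z0.2))) => l.
apply: (@is_derive_mull (fun s => qm l (s - z0.2))).
by case: l => -[|l] lj; [exact: qm0_derive|exact: qm_derive].
Qed.

Lemma TP_base j c (z0 : pt R) : TP j.+1 c z0 z0 = c 0%N 0%N.
Proof.
have q0 : qm 0 0 = 1 by rewrite /qm expr0 divff.
rewrite /TP !subrr big_ord_recl /= q0 mul1r [X in _ + X]big1 ?addr0; last first.
  by move=> k _; rewrite /qm /bump /= add1n expr0n /= !mul0r.
rewrite subSn// big_ord_recl /= q0 mulr1 [X in _ + X]big1 ?addr0// => l _.
by rewrite /qm /bump /= add1n expr0n /= mul0r mulr0.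
Qed.

Lemma partialsB (H Hx Hy G Gx Gy : pt R -> R) z : partials H Hx Hy z -> partials G Gx Gy z ->
  partials (fun u => H u - G u) (fun u => Hx u - Gx u) (fun u => Hy u - Gy u) z.
Proof. by move=> [h1 h2] [g1 g2]; split; apply: is_deriveB. Qed.

(** Induction on [j]: the partial derivatives of the remainder are remainders of lower order for the
    shifted families, and the remainder vanishes at [z0]. Each order costs a factor [2 * d], the
    bound on the sum of the two coordinate increments. The top coefficients need only be within [w]
    of the derivatives. *)
Lemma taylor_inI t (z0 : pt R) (d w : R) j : nd t -> inI t z0 -> wide d t -> 0 <= w ->
  forall (G : nat -> nat -> pt R -> R) (c : nat -> nat -> R),
  (forall k l, (k + l < j)%N -> forall z, inI t z -> partials (G k l) (G k.+1 l) (G k l.+1) z) ->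
  (forall k l, (k + l < j)%N -> c k l = G k l z0) ->
  (forall k l, (k + l = j)%N -> forall z, inI t z -> `|G k l z - c k l| <= w) ->
  forall z, inI t z -> `|G 0%N 0%N z - TP j.+1 c z0 z| <= (2 * d) ^+ j * w.
Proof.
move=> n iz0 wd w0; have d0 : 0 <= d.
  have m0 : t.1.1 \in verts t by rewrite in_cons eqxx.
  by have [+ _] := wd _ _ m0 m0; apply: le_trans.
elim: j => [|j IH] G c hD hc hw z iz.
  rewrite expr0 mul1r /TP big_ord_recl big_ord0 addr0 /= subn0 big_ord_recl big_ord0 addr0 /=.
  by rewrite /qm !expr0 divr1 mulr1 mul1r; exact: hw.
pose H u := G 0%N 0%N u - TP j.+2 c z0 u.
have Hz0 : H z0 = 0 by rewrite /H TP_base hc// subrr.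
have := @lip_inI t H (fun u => G 1%N 0%N u - TP j.+1 (fun k l => c k.+1 l) z0 u)
  (fun u => G 0%N 1%N u - TP j.+1 (fun k l => c k l.+1) z0 u) ((2 * d) ^+ j * w) z0 z.
rewrite Hz0 subr0 => /(_ _ iz0 iz) HH; apply: le_trans (HH _) _.
  move=> u iu; split.
  - by apply: partialsB; [apply: hD|exact: TP_partials].
  - apply: (IH (fun k l => G k.+1 l) (fun k l => c k.+1 l)) => // k l kl.
    + by apply: hD; rewrite addSn ltnS.
    + by rewrite hc// addSn ltnS.
    + by apply: hw; rewrite addSn kl.
  - apply: (IH (fun k l => G k l.+1) (fun k l => c k l.+1)) => // k l kl.
    + by apply: hD; rewrite addnS ltnS.
    + by rewrite hc// addnS ltnS.
    + by apply: hw; rewrite addnS kl.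
have [h1 h2] := wide_inT wd (inI_inT n iz) (inI_inT n iz0).
have -> : (2 * d) ^+ j.+1 * w = ((2 * d) ^+ j * w) * (2 * d) by rewrite exprS; ring.
by rewrite ler_wpM2l; [|rewrite mulr_ge0// exprn_ge0// mulr_ge0|lra].
Qed.

Lemma isL_qm k l (z0 : pt R) (e : nat) : isL (k + l)
  (fun z => qm k (z.1 - z0.1) * qm l (z.2 - z0.2) - (z.1 ^+ k * z.2 ^+ l) / (k`! * l`!)%:R).
Proof.
have := isLZ ((k`! * l`!)%:R^-1) (mono_hpt 1 (- z0.1, - z0.2) k l).
apply: isL_ext => z; rewrite /hpt /= expr1n /qm natrM invfM !mul1r; ring.
Qed.

(** Recentring from [z0] to the origin leaves the top-degree part unchanged, so only degrees below m
    remain. *)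
Lemma isL_TP m (A : nat -> R) c (z0 : pt R) : (forall k, (k <= m.+1)%N -> c k (m.+1 - k)%N = A k) ->
  isL m.+1 (fun z => TP m.+2 c z0 z - hp m (fun k => A k / (k`! * (m.+1 - k)`!)%:R) z).
Proof.
move=> hc; apply: (@isL_ext _ _ (fun z => \sum_(k < m.+2)
    (\sum_(l < m.+1 - k) c k l * (qm k (z.1 - z0.1) * qm l (z.2 - z0.2)) +
     A k * (qm k (z.1 - z0.1) * qm (m.+1 - k) (z.2 - z0.2) -
        (z.1 ^+ k * z.2 ^+ (m.+1 - k)) / (k`! * (m.+1 - k)`!)%:R)))).
  move=> z; rewrite /TP /hp -sumrB; apply: eq_bigr => k _.
  have km : (k <= m.+1)%N by rewrite -ltnS.
  have E : (m.+2 - k = (m.+1 - k).+1)%N by rewrite subSn.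
  rewrite E big_ord_recr /= hc// [in RHS]mulrDr mulr_sumr -addrA; congr (_ + _).
    by apply: eq_bigr => l _; ring.
  by ring.
apply: isL_sum => k _; have km : (k <= m.+1)%N by rewrite -ltnS.
apply: isLD; last first.
  by apply: isLZ; have := isL_qm k (m.+1 - k) z0 0; rewrite subnKC.
apply: isL_sum => l _; apply: isLZ.
have kl : (k + l < m.+1)%N by have := ltn_ord l; lia.
have h1 := isLZ ((k`! * l`!)%:R^-1) (@isL_mono R k l).
have h2 := isL_le (leqnSn _) (isL_qm k l z0 0).
by apply: isL_le kl _; apply: isL_ext (isLD h2 h1) => z; ring.
Qed.

(** Derivatives are known in the interior only; the estimate is proved there and extended to the
    closed triangle by continuity, moving slightly towards the centroid. *)
Lemma taylor t m (d w : R) (D : nat -> nat -> pt R -> R) (f : pt R -> R) (A : nat -> R) :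
  nd t -> wide d t -> 0 <= w ->
  (forall k l, (k + l < m.+1)%N -> forall z, inI t z -> partials (D k l) (D k.+1 l) (D k l.+1) z) ->
  (forall k, (k <= m.+1)%N -> forall z, inI t z -> `|D k (m.+1 - k)%N z - A k| <= w) ->
  cont_on (bdy t) f -> (forall z, inT t z -> D 0%N 0%N z = f z) ->
  exists2 Q, isL m.+1 Q & forall z, inT t z ->
    `|f z - hp m (fun k => A k / (k`! * (m.+1 - k)`!)%:R) z - Q z| <= (2 * d) ^+ m.+1 * w.
Proof.
move=> n wd w0 hD hA cf Df; have ic := inI_ctr n; set z0 := ctr t in ic.
(* Lower-order coefficients are exact; those of order m are the constants [A], so that the
   homogeneous part does not depend on the triangle. *)
pose c k l := if (k + l < m.+1)%N then D k l z0 else A k.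
have hc k : (k <= m.+1)%N -> c k (m.+1 - k)%N = A k by move=> km; rewrite /c subnKC// ltnn.
exists (fun z => TP m.+2 c z0 z - hp m (fun k => A k / (k`! * (m.+1 - k)`!)%:R) z).
  exact: isL_TP.
have HI z : inI t z -> `|D 0%N 0%N z - TP m.+2 c z0 z| <= (2 * d) ^+ m.+1 * w.
  apply: (taylor_inI n ic wd w0) => // k l kl; first by rewrite /c kl.
  have km : (k <= m.+1)%N by rewrite -kl leq_addr.
  have lE : l = (m.+1 - k)%N by rewrite -kl addKn.
  by move=> u iu; rewrite {1 2}lE hc//; apply: hA.
move=> z tz; set hpz := hp _ _ _; have -> : f z - hpz - (TP m.+2 c z0 z - hpz) = f z - TP m.+2 c z0 z by ring.
apply/ler_addgt0Pr => e e0; have e2 : 0 < e / 2 by rewrite divr_gt0.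
have TL : isL m.+2 (TP m.+2 c z0).
  have h1 := isL_le (leqnSn _) (isL_TP z0 hc).
  by apply: isL_ext (isLD h1 (isL_hp m (fun k => A k / (k`! * (m.+1 - k)`!)%:R))) => u; rewrite subrK.
have [r1 r10 H1] := cf z tz _ e2.
have [r2 r20 H2] := @isL_cont_on _ _ _ setT TL z Logic.I _ e2.
pose r := Num.min r1 r2; have r0 : 0 < r by rewrite lt_min r10.
have d0 : 0 <= d.
  have m0 : t.1.1 \in verts t by rewrite in_cons eqxx.
  by have [+ _] := wd _ _ m0 m0; apply: le_trans.
pose s := Num.min 2^-1 (r / (2 * (d + 1))); have d1 : 0 < 2 * (d + 1) by lra.
have s0 : 0 < s by rewrite lt_min invr_gt0 ltr0n divr_gt0.
have s1 : s <= 2^-1 by rewrite ge_min lexx.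
have sr : s * (2 * (d + 1)) <= r by rewrite -ler_pdivlMr// ge_min lexx orbT.
pose u := lerp s z z0; have iu : inI t u.
  move=> k hk; rewrite af_lerp; have := mulr_gt0 s0 (ic k hk).
  have := tz k (kb_nneg n hk) => h; have s1' : 0 <= 1 - s by lra.
  by have := mulr_ge0 s1' h; lra.
have [a1 a2] := wide_inT wd (inI_inT n ic) tz.
have b (x y : R) : `|y - x| <= d -> `|(1 - s) * x + s * y - x| < r.
  move=> h; have -> : (1 - s) * x + s * y - x = s * (y - x) by ring.
  rewrite normrM (gtr0_norm s0); apply: lt_le_trans sr; rewrite ltr_pM2l//.
  by rewrite (le_lt_trans h)//; lra.
have [n1 n2] : near r1 z u /\ near r2 z u.
  by apply: near_min; rewrite /u /near /lerp /=; split; apply: b.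
have c1 := H1 u (inI_inT n iu) n1; have c2 := H2 u Logic.I n2.
have c3 := HI u iu; rewrite Df in c3; last exact: inI_inT.
have -> : f z - TP m.+2 c z0 z = (f u - TP m.+2 c z0 u) +
   (- (f u - f z) + (TP m.+2 c z0 u - TP m.+2 c z0 z)) by ring.
rewrite (le_trans (ler_normD _ _))// lerD//.
by rewrite (le_trans (ler_normD _ _))// normrN; lra.
Qed.

End Taylor.

(** * Slivers *)

Section Slivers.
Variables (R : realType) (m1 : nat).
Hypothesis m1p : (0 < m1)%N.
Local Notation m := m1.+1.
Notation mu := (@plane_measure R).
Implicit Types (t u T : tri R).
Local Notation hp := (hp m1).
Local Notation idx := (idx m1).

Lemma dist_shift (y y' x t d : R) : `|y - x - t| <= d -> `|y - y'| <= d -> `|y' - x - t| <= 2 * d.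
Proof. by rewrite !ler_norml => /andP[? ?] /andP[? ?]; apply/andP; split; lra. Qed.

Lemma norm_shift (a b D d : R) : d <= 1 -> `|a| <= D -> `|a - b| <= 2 * d -> `|b| <= D + 2.
Proof. by rewrite !ler_norml => ? /andP[? ?] /andP[? ?]; apply/andP; split; lra. Qed.

(** At interpolation nodes this coordinate is a multiple of 1 / m1; hence collapsing the triangle
    onto an edge along it sends nodes to nodes. *)
Lemma bary u (x : pt R) : nd u -> x \in verts u -> exists kx, [/\ af kx x = 1,
  forall w, w \in verts u -> w != x -> af kx w = 0 &
  forall k, k \in idx -> exists2 i, (i <= m1)%N & af kx (node u k) = i%:R / m1%:R].
Proof.
move=> n; have [[a0 b0 c0] [[a1 b1 c1] [a2 b2 c2]]] := kbE n.
rewrite mem_verts => /or3P[]/eqP->; [exists (k0 u)|exists (k1 u)|exists (k2 u)]; split=> //.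
- by move=> w; rewrite mem_verts => /or3P[]/eqP->; rewrite ?eqxx.
- move=> k kA; exists (m1 - k.1 - k.2)%N; first lia.
  by rewrite /node af_comb ?node_sum// a0 b0 c0; ring.
- by move=> w; rewrite mem_verts => /or3P[]/eqP->; rewrite ?eqxx.
- move=> k kA; exists k.1; first by rewrite -ltnS.
  by rewrite /node af_comb ?node_sum// a1 b1 c1; ring.
- by move=> w; rewrite mem_verts => /or3P[]/eqP->; rewrite ?eqxx.
- move=> k kA; exists k.2; first by rewrite -ltnS.
  by rewrite /node af_comb ?node_sum// a2 b2 c2; ring.
Qed.

Lemma edge_node T (v a : pt R) i : v \in verts T -> a \in verts T -> (i <= m1)%N ->
  exists2 k, k \in idx & lerp (1 - i%:R / m1%:R) v a = node T k.
Proof.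
move=> vT aT im; have m0 := m1R R m1p.
have N c0 c1 c2 : (c0 + c1 + c2 = m1)%N -> exists2 k, k \in idx &
    comb (c0%:R / m1%:R) (c1%:R / m1%:R) (c2%:R / m1%:R) T = node T k.
  move=> s; have h1 : (c1 < m)%N by lia.
  have h2 : (c2 < m)%N by lia.
  exists (Ordinal h1, Ordinal h2); first by rewrite inE /=; lia.
  by rewrite /node /=; have -> : (m1 - c1 - c2 = c0)%N by lia.
have mi : (m1 - i)%:R / m1%:R = 1 - i%:R / m1%:R :> R by rewrite natrB// mulrBl divff.
have mm : m1%:R / m1%:R = 1 :> R by rewrite divff.
have o : 0%:R / m1%:R = 0 :> R by rewrite mul0r.
have S (s : nat) : (s = m1)%N -> s%:R / m1%:R = 1 :> R by move=> ->.
move: vT aT; rewrite !mem_verts => /or3P[]/eqP-> /or3P[]/eqP->.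
- have [|k kA kE] := N m1 0%N 0%N; first lia.
  by exists k => //; rewrite -kE mm o /lerp /comb; congr (_, _); ring.
- have [|k kA kE] := N i (m1 - i)%N 0%N; first lia.
  by exists k => //; rewrite -kE mi o /lerp /comb; congr (_, _); ring.
- have [|k kA kE] := N i 0%N (m1 - i)%N; first lia.
  by exists k => //; rewrite -kE mi o /lerp /comb; congr (_, _); ring.
- have [|k kA kE] := N (m1 - i)%N i 0%N; first lia.
  by exists k => //; rewrite -kE mi o /lerp /comb; congr (_, _); ring.
- have [|k kA kE] := N 0%N m1 0%N; first lia.
  by exists k => //; rewrite -kE mm o /lerp /comb; congr (_, _); ring.
- have [|k kA kE] := N 0%N i (m1 - i)%N; first lia.
  by exists k => //; rewrite -kE mi o /lerp /comb; congr (_, _); ring.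
- have [|k kA kE] := N (m1 - i)%N 0%N i; first lia.
  by exists k => //; rewrite -kE mi o /lerp /comb; congr (_, _); ring.
- have [|k kA kE] := N 0%N (m1 - i)%N i; first lia.
  by exists k => //; rewrite -kE mi o /lerp /comb; congr (_, _); ring.
- have [|k kA kE] := N 0%N 0%N m1; first lia.
  by exists k => //; rewrite -kE mm o /lerp /comb; congr (_, _); ring.
Qed.

Lemma isL_pow_af d (g : pt R -> R) (k : pt R * R) i : isL d g -> isL (d + i) (fun z => af k z ^+ i * g z).
Proof.
move=> h; elim: i => [|i IH]; first by rewrite addn0; apply: isL_ext h => z; rewrite expr0 mul1r.
by rewrite addnS; apply: isL_ext (isL_af k IH) => z; rewrite exprS mulrA.
Qed.

Lemma isL_comp d (g : pt R -> R) (k k' : pt R * R) : isL d g -> isL d (fun z => g (af k z, af k' z)).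
Proof.
move=> /isL_expand[c [c0 gE]].
apply: (@isL_ext _ _ (fun z => \sum_(i < d) \sum_(j < d) c i j * (af k z ^+ i * (af k' z ^+ j * 1)))).
  by move=> z; rewrite gE; apply: eq_bigr => i _; apply: eq_bigr => j _; rewrite /= mulr1.
apply: isL_sum => i _; apply: isL_sum => j _.
have [ij|ij] := leqP d (i + j).
  by apply: isL_ext (isL0 R d) => z; rewrite c0// mul0r.
apply: isLZ; apply: (@isL_le _ (1 + j + i)); first lia.
by apply: isL_pow_af; apply: isL_pow_af; exact: isL_cst.
Qed.

Lemma LI_node T (g : pt R -> R) l : nd T -> l \in idx -> LI m1 T g (node T l) = g (node T l).
Proof.
move=> n lA; rewrite /LI (bigD1 l)//= bas_node// eqxx mulr1 big1 ?addr0// => k /andP[kA kl].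
by rewrite bas_node// (negPf kl) mulr0.
Qed.

(** The interpolant on [T] composed with the affine map has degree less than m and the right values
    at the nodes of [u]. The map need not be invertible, which is what slivers require. *)
Lemma Err_aff u T (g : pt R -> R) (k k' : pt R * R) (z : pt R) : nd u -> nd T ->
  (forall l, l \in idx -> exists2 l', l' \in idx & (af k (node u l), af k' (node u l)) = node T l') ->
  Err m1 u (fun w => g (af k w, af k' w)) z = Err m1 T g (af k z, af k' z).
Proof.
move=> nu nT h; rewrite /Err; congr (_ - _).
rewrite (@LI_ext _ _ _ _ (fun w => LI m1 T g (af k w, af k' w))); last first.
  by move=> l /h[l' lA ->]; rewrite LI_node.
by rewrite LI_id//; apply: isL_comp; exact: isL_LI.
Qed.

Lemma sliver_distinct u (x y y' : pt R) : nd u -> verts u =i [:: x; y; y'] -> y != x /\ y' != x.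
Proof.
move=> n e; have xu : x \in verts u by rewrite e in_cons eqxx.
have [a [b [nab ve ab _ _]]] := vert_view n xu.
have xa : a != x by apply: contraNneq nab => ->; apply/eqP; rewrite /cr /=; ring.
have xb : b != x by apply: contraNneq nab => ->; apply/eqP; rewrite /cr /=; ring.
have ha : a \in [:: x; y; y'] by rewrite -e ve !in_cons eqxx orbT.
have hb : b \in [:: x; y; y'] by rewrite -e ve !in_cons eqxx !orbT.
move: ha hb; rewrite !in_cons !in_nil !orbF (negPf xa) (negPf xb) /=.
move=> /orP[]/eqP ea /orP[]/eqP eb; rewrite ?ea ?eb in xa xb ab *; rewrite ?eqxx// in ab.
Qed.

Lemma af_bound u (k : pt R * R) (s : R) (w : pt R) :
  (forall q, q \in verts u -> `|af k q| <= s) -> inT u w -> `|af k w| <= s.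
Proof.
move=> h uw; have h1 := uw (k.1, k.2 + s); have h2 := uw ((- k.1.1, - k.1.2), s - k.2).
rewrite ler_norml; apply/andP; split.
  suff : 0 <= af (k.1, k.2 + s) w by rewrite /af /=; lra.
  by apply: h1 => q /h; rewrite ler_norml /af /= => /andP[? ?]; lra.
suff : 0 <= af ((- k.1.1, - k.1.2), s - k.2) w by rewrite /af /=; lra.
by apply: h2 => q /h; rewrite ler_norml /af /= => /andP[? ?]; lra.
Qed.

(* On a sliver the polynomial nearly factors through the affine map that sends
   it onto an edge of the tile and its nodes to nodes of that edge. *)
Lemma sliver_sup u T a (v e : pt R) (D M d : R) (z : pt R) : nd u -> nd T -> 1 <= D -> 0 <= d <= 1 ->
  (forall w, inT T w -> `|w.1| <= D /\ `|w.2| <= D) -> sub u T ->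
  v \in verts T -> e \in verts T -> sliver d v e u -> (forall k, (k <= m)%N -> `|a k| <= M) ->
  inT u z -> exists2 y, inT T y & `|Err m1 u (hp a) z| <= `|Err m1 T (hp a) y| +
    Lam R m1 * (m.+1%:R * (M * (m%:R * (D + 2) ^+ m * (2 * d)))).
Proof.
move=> nu nT D1 /andP[d0 d1] TD uT vT eT [x [y [y' [r [vu r1 [yy1 yy2] [xy1 xy2]]]]]] aM uz.
have xu : x \in verts u by rewrite vu in_cons eqxx.
have [yx y'x] := sliver_distinct nu vu.
have [kx [kxx kx0 kxn]] := bary nu xu.
have kxy : af kx y = 0 by apply: kx0 => //; rewrite vu !in_cons eqxx orbT.
have kxy' : af kx y' = 0 by apply: kx0 => //; rewrite vu !in_cons eqxx !orbT.
(* These are the components of the affine map that collapses [u] onto the edge [ve]: [x] goes to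
   [v], and [y], [y'] both go to [e]. *)
pose K (v1 e1 : R) : pt R * R := (((v1 - e1) * kx.1.1, (v1 - e1) * kx.1.2), (v1 - e1) * kx.2 + e1).
have KE v1 e1 w : af (K v1 e1) w = (1 - (1 - af kx w)) * v1 + (1 - af kx w) * e1.
  by rewrite /K /af /=; ring.
have Alerp w : (af (K v.1 e.1) w, af (K v.2 e.2) w) = lerp (1 - af kx w) v e.
  by rewrite !KE.
have nodes l : l \in idx -> exists2 l', l' \in idx &
    (af (K v.1 e.1) (node u l), af (K v.2 e.2) (node u l)) = node T l'.
  by move=> /kxn[i im E]; rewrite Alerp E; apply: edge_node.
have vuP (P : pt R -> Prop) : P x -> P y -> P y' -> forall q, q \in verts u -> P q.
  by move=> hx hy hy' q; rewrite vu !in_cons in_nil orbF => /or3P[]/eqP->.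
have kx01 w : inT u w -> 0 <= af kx w <= 1.
  move=> uw; apply/andP; split.
    by apply: uw; apply: vuP; rewrite ?kxx ?kxy ?kxy'.
  apply: le_trans (ler_norm _) _; apply: af_bound uw.
  by apply: vuP; rewrite ?kxx ?kxy ?kxy' ?normr1 ?normr0.
have AT w : inT u w -> inT T (lerp (1 - af kx w) v e).
  move=> uw; apply: inT_lerp; [|exact: inT_mem..].
  by have := kx01 w uw; lra.
(* The homothety of ratio [r] that brings [v] back to [x]; composed with the collapse, it moves no
   point of [u] by more than [2 * d] in either coordinate. *)
pose c : pt R := (x.1 - r * v.1, x.2 - r * v.2).
pose W w := hpt r c (lerp (1 - af kx w) v e).
have Wnear w : inT u w -> `|w.1 - (W w).1| <= 2 * d /\ `|w.2 - (W w).2| <= 2 * d.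
  move=> uw; split.
    pose kk : pt R * R := ((1 + r * (e.1 - v.1) * kx.1.1, r * (e.1 - v.1) * kx.1.2),
      r * (e.1 - v.1) * kx.2 - x.1 - r * (e.1 - v.1)).
    have kkE q : af kk q = q.1 - x.1 - r * (1 - af kx q) * (e.1 - v.1) by rewrite /kk /af /=; ring.
    have -> : w.1 - (W w).1 = af kk w by rewrite kkE /W /hpt /lerp /=; ring.
    apply: af_bound uw; apply: vuP; rewrite kkE ?kxx ?kxy ?kxy' ?subrr ?subr0 ?mulr0 ?mul0r ?subr0 ?normr0
      ?mulr1//.
    - by rewrite mulr_ge0.
    - by apply: le_trans xy1 _; rewrite ler_peMl ?ler1n//; lra.
    - by apply: dist_shift yy1; exact: xy1.
  pose kk : pt R * R := ((r * (e.2 - v.2) * kx.1.1, 1 + r * (e.2 - v.2) * kx.1.2),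
    r * (e.2 - v.2) * kx.2 - x.2 - r * (e.2 - v.2)).
  have kkE q : af kk q = q.2 - x.2 - r * (1 - af kx q) * (e.2 - v.2) by rewrite /kk /af /=; ring.
  have -> : w.2 - (W w).2 = af kk w by rewrite kkE /W /hpt /lerp /=; ring.
  apply: af_bound uw; apply: vuP; rewrite kkE ?kxx ?kxy ?kxy' ?subrr ?subr0 ?mulr0 ?mul0r ?subr0 ?normr0
    ?mulr1//.
  - by rewrite mulr_ge0.
  - by apply: le_trans xy2 _; rewrite ler_peMl ?ler1n//; lra.
  - by apply: dist_shift yy2; exact: xy2.
exists (lerp (1 - af kx z) v e); first exact: AT.
have gW w : hp a (W w) = r ^+ m * hp a (lerp (1 - af kx w) v e) +
   (hp a (W w) - r ^+ m * hp a (lerp (1 - af kx w) v e)) by ring.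
have E1 : Err m1 u (fun w => hp a (W w)) z = r ^+ m * Err m1 T (hp a) (lerp (1 - af kx z) v e).
  have := @Err_aff u T (fun w => hp a (hpt r c w)) (K v.1 e.1) (K v.2 e.2) z nu nT nodes.
  under eq_fun do rewrite Alerp; rewrite Alerp => ->.
  have -> : (fun w => hp a (hpt r c w)) = (fun w => (hp a (hpt r c w) - r ^+ m * hp a w) + r ^+ m * hp a w).
    by apply/funext => w; rewrite subrK.
  by rewrite ErrD (Err_isL m1p _ nT (hp_hpt _ _ _ _)) add0r ErrZ.
have -> : Err m1 u (hp a) z = Err m1 u (fun w => hp a (W w)) z + Err m1 u (fun w => hp a w - hp a (W w)) z.
  by rewrite -ErrD; congr Err; apply/funext => w; ring.
rewrite E1 (le_trans (ler_normD _ _))// lerD//.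
  by rewrite normrM normrX ler_piMl// exprn_ile1.
apply: Err_bound => // w uw; have [w1 w2] := Wnear w uw.
have [b1 b2] := TD w (inT_sub uT uw).
have D2 : 1 <= D + 2 by rewrite (le_trans D1)// lerDl.
have le2 : D <= D + 2 by rewrite lerDl.
by apply: hp_lip => //; [exact: le_trans b1 le2|exact: le_trans b2 le2|exact: norm_shift d1 b1 w1|
  exact: norm_shift d1 b2 w2].
Qed.

Lemma cover_area u n (s : R) (b : nat -> pt R) : nd u -> 0 <= s ->
  (forall z, inT u z -> exists2 i, (i < n)%N & [/\ (b i).1 <= z.1, z.1 <= (b i).1 + s,
     (b i).2 <= z.2 & z.2 <= (b i).2 + s]) -> ar u <= n%:R * s ^+ 2.
Proof.
move=> nu s0 h.
pose Bx i : set (plane R) := `[(b i).1, (b i).1 + s] `*` `[(b i).2, (b i).2 + s].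
have mB i : measurable (Bx i) by apply: measurableX; exact: measurable_itv.
have m0 : mu (set0 : set (plane R)) = 0%E by exact: measure0.
have S k : (mu (\big[setU/set0]_(i < k) Bx i) <= (k%:R * s ^+ 2)%:E)%E.
  elim: k => [|k IH]; first by rewrite big_ord0 mul0r m0.
  rewrite big_ord_recr /=; apply: le_trans (measureU2 _ _ _) _ => //.
    exact: bigsetU_measurable.
  rewrite -natr1 mulrDl mul1r EFinD; apply: leeD => //.
  by rewrite -(mu_box (b k) (b k) s0); exact: lexx.
rewrite -lee_fin -arE//; apply: le_trans (S n); apply: le_measure; rewrite ?inE.
- exact: measurable_bdy.
- exact: bigsetU_measurable.
move=> z /h[i ni [z1 z2 z3 z4]]; rewrite -bigcup_mkord; exists i => //.
by rewrite /Bx /= !in_itv /= z1 z2 z3 z4.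
Qed.

(** A sliver is covered by about [n] squares of side O(D / n) strung along a segment, so its area is
    O(D ^ 2 / n). *)
Lemma sliver_area u (v e : pt R) (D d : R) n : nd u -> 0 <= d -> d <= D / n.+1%:R -> 0 <= D ->
  sliver d v e u -> `|e.1 - v.1| <= D -> `|e.2 - v.2| <= D ->
  ar u <= n.+2%:R * (6 * (D / n.+1%:R)) ^+ 2.
Proof.
move=> nu d0 dD D0 [x [y [y' [r [vu r1 [yy1 yy2] [xy1 xy2]]]]]] e1 e2.
have xu : x \in verts u by rewrite vu in_cons eqxx.
have [yx y'x] := sliver_distinct nu vu.
have [kx [kxx kx0 kxn]] := bary nu xu.
have kxy : af kx y = 0 by apply: kx0 => //; rewrite vu !in_cons eqxx orbT.
have kxy' : af kx y' = 0 by apply: kx0 => //; rewrite vu !in_cons eqxx !orbT.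
have vuP (P : pt R -> Prop) : P x -> P y -> P y' -> forall q, q \in verts u -> P q.
  by move=> hx hy hy' q; rewrite vu !in_cons in_nil orbF => /or3P[]/eqP->.
set q := D / n.+1%:R in dD *; have q0 : 0 <= q by rewrite divr_ge0.
(* A point is within [2 * q] of the segment and the segment parameter is rounded at a cost of [q]:
   squares of half-side [3 * q]. The index runs up to n + 1 inclusive, as the parameter may be 1. *)
pose b (i : nat) : pt R := (x.1 + i%:R / n.+1%:R * (r * (e.1 - v.1)) - 3 * q,
   x.2 + i%:R / n.+1%:R * (r * (e.2 - v.2)) - 3 * q).
apply: (@cover_area u n.+2 _ b) => //; first by rewrite mulr_ge0.
move=> z uz; set s := 1 - af kx z.
have s0 : 0 <= s.
  rewrite subr_ge0; apply: le_trans (ler_norm _) _; apply: af_bound uz.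
  by apply: vuP; rewrite ?kxx ?kxy ?kxy' ?normr1 ?normr0.
have s1 : s <= 1.
  by rewrite gerBl; apply: uz; apply: vuP; rewrite ?kxx ?kxy ?kxy'.
have [n1 n2] : `|z.1 - x.1 - s * (r * (e.1 - v.1))| <= 2 * q /\ `|z.2 - x.2 - s * (r * (e.2 - v.2))| <= 2 * q.
  split.
    pose kk : pt R * R := ((1 + r * (e.1 - v.1) * kx.1.1, r * (e.1 - v.1) * kx.1.2),
      r * (e.1 - v.1) * kx.2 - x.1 - r * (e.1 - v.1)).
    have kkE w : af kk w = w.1 - x.1 - (1 - af kx w) * (r * (e.1 - v.1)) by rewrite /kk /af /=; ring.
    rewrite -kkE; apply: af_bound uz; apply: vuP;
      rewrite kkE ?kxx ?kxy ?kxy' ?subrr ?subr0 ?mul0r ?mul1r ?subr0 ?normr0//.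
    - by rewrite mulr_ge0.
    - by apply: le_trans xy1 _; apply: le_trans dD _; rewrite ler_peMl ?ler1n//; lra.
    - by apply: (@le_trans _ _ (2 * d)); [apply: dist_shift yy1; exact: xy1|rewrite ler_pM2l].
  pose kk : pt R * R := ((r * (e.2 - v.2) * kx.1.1, 1 + r * (e.2 - v.2) * kx.1.2),
    r * (e.2 - v.2) * kx.2 - x.2 - r * (e.2 - v.2)).
  have kkE w : af kk w = w.2 - x.2 - (1 - af kx w) * (r * (e.2 - v.2)) by rewrite /kk /af /=; ring.
  rewrite -kkE; apply: af_bound uz; apply: vuP;
    rewrite kkE ?kxx ?kxy ?kxy' ?subrr ?subr0 ?mul0r ?mul1r ?subr0 ?normr0//.
  - by rewrite mulr_ge0.
  - by apply: le_trans xy2 _; apply: le_trans dD _; rewrite ler_peMl ?ler1n//; lra.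
  - by apply: (@le_trans _ _ (2 * d)); [apply: dist_shift yy2; exact: xy2|rewrite ler_pM2l].
have N0 : 0 < n.+1%:R :> R by [].
have sn0 : 0 <= s * n.+1%:R by rewrite mulr_ge0.
pose i := Num.truncn (s * n.+1%:R); have := truncn_itv sn0; rewrite -/i => /andP[i1 i2].
exists i.
  rewrite -(ltr_nat R); apply: le_lt_trans i1 _; apply: (@le_lt_trans _ _ n.+1%:R); last by rewrite ltr_nat.
  by rewrite ler_piMl.
have hs : `|s - i%:R / n.+1%:R| <= n.+1%:R^-1.
  have i1' : i%:R / n.+1%:R <= s by rewrite ler_pdivrMr.
  have i2' : s <= i.+1%:R / n.+1%:R by rewrite ler_pdivlMr// ltW.
  by rewrite ger0_norm ?subr_ge0// lerBlDr -{1}(mul1r n.+1%:R^-1) -mulrDl addrC natr1.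
have B (t1 : R) : `|t1| <= D -> `|s * (r * t1) - i%:R / n.+1%:R * (r * t1)| <= q.
  move=> ht; rewrite -mulrBl normrM /q mulrC ler_pM//.
  by rewrite normrM (le_trans _ ht)// ler_piMl.
have := B _ e1; have := B _ e2; move: n1 n2; rewrite /b /= !ler_norml.
clear.
set X1 := s * (r * (e.1 - v.1)); set X2 := s * (r * (e.2 - v.2)).
set Y1 := _ * (r * (e.1 - v.1)); set Y2 := _ * (r * (e.2 - v.2)).
by move=> /andP[? ?] /andP[? ?] /andP[? ?] /andP[? ?]; split; lra.
Qed.

End Slivers.

(** * Errors on slivers of a tile *)

Section SliverTiles.
Variables (R : realType) (m1 : nat) (p : \bar R).
Hypotheses (m1p : (0 < m1)%N) (p1 : (1 <= p)%E).
Local Notation m := m1.+1.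
Implicit Types (t u T : tri R).
Local Notation en := (en m1 p).
Local Notation hp := (hp m1).
Local Notation iq := (iq m1 p).

Lemma tile_pull u T (l d : R) (c v e : pt R) : l != 0 -> nd u -> sub u (htri l c T) ->
  v \in verts (htri l c T) -> e \in verts (htri l c T) -> sliver (d * `|l|) v e u ->
  exists u0 v0 e0, [/\ nd u0, sub u0 T, u = htri l c u0, v0 \in verts T & e0 \in verts T] /\ sliver d v0 e0
    u0.
Proof.
move=> l0 nu uT vT eT [x [y [y' [r [vu r1 [yy1 yy2] [xy1 xy2]]]]]].
have lV : l^-1 != 0 by rewrite invr_eq0.
pose b : pt R := (- (l^-1 * c.1), - (l^-1 * c.2)).
have fK w : hpt l c (hpt l^-1 b w) = w.
  by rewrite /hpt /b; case: (w) => w1 w2 /=; congr (_, _); field.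
move: vT eT; rewrite verts_htri => /mapP[v0 v0T vE] /mapP[e0 e0T eE].
exists (htri l^-1 b u), v0, e0; split; first split=> //.
- exact: nd_htri.
- move=> q; rewrite verts_htri => /mapP[w wu ->].
  have := bdy_htri T c l0; move/seteqP => [+ _] => /(_ (hpt l^-1 b w)); apply.
  by rewrite /bdy /= fK; exact: uT.
- by rewrite /htri !fK; case: (u) => -[].
exists (hpt l^-1 b x), (hpt l^-1 b y), (hpt l^-1 b y'), r; split=> //.
- by move=> q; rewrite verts_htri -[RHS]/(q \in map (hpt l^-1 b) [:: x; y; y']); exact: eq_mem_map.
- have lp : 0 < `|l| by rewrite normr_gt0.
  have S (w1 w2 c1 : R) : `|w1 - w2| <= d * `|l| -> `|l^-1 * w1 + c1 - (l^-1 * w2 + c1)| <= d.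
    move=> h; have -> : l^-1 * w1 + c1 - (l^-1 * w2 + c1) = l^-1 * (w1 - w2) by ring.
    by rewrite normrM normfV mulrC ler_pdivrMr.
  by split; apply: S.
have lp : 0 < `|l| by rewrite normr_gt0.
have S (w1 w2 z1 z2 c1 c2 : R) : `|w1 - w2 - r * ((l * z1 + c2) - (l * z2 + c2))| <= d * `|l| ->
    `|l^-1 * w1 + c1 - (l^-1 * w2 + c1) - r * (z1 - z2)| <= d.
  move=> h; have -> : l^-1 * w1 + c1 - (l^-1 * w2 + c1) - r * (z1 - z2) =
    l^-1 * (w1 - w2 - r * ((l * z1 + c2) - (l * z2 + c2))) by field.
  by rewrite normrM normfV mulrC ler_pdivrMr.
move: xy1 xy2; rewrite vE eE /hpt /= => h1 h2.
by split=> /=; [exact: S h1|exact: S h2].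
Qed.

Lemma tile_origin T : nd T -> exists c, [/\ nd (htri 1 c T), ar (htri 1 c T) = ar T,
  forall a, en (htri 1 c T) (hp a) <= en T (hp a) & (htri 1 c T).1.1 = (0, 0)].
Proof.
move=> n; have o0 : (1 : R) != 0 by exact: oner_neq0.
exists (- T.1.1.1, - T.1.1.2); split.
- exact: nd_htri.
- by rewrite ar_htri// expr1n mul1r.
- by move=> a; have := en_htri m1p p1 (- T.1.1.1, - T.1.1.2) a o0 n; rewrite expr1n powR1 mul1r.
- by rewrite /htri /hpt /= !mul1r !subrr.
Qed.

(** For infinite p this is the comparison with the edge of the tile. For finite p the error is
    already below [eps]: it is bounded pointwise and the area tends to 0. *)
Lemma sliver_en (n : nat) (M eps : R) : 0 < eps -> 0 <= M -> exists2 d0, 0 < d0 &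
  forall a T u (v e : pt R) d, (forall k, (k <= m)%N -> `|a k| <= M) -> nd T -> ar T = 1 ->
  (forall z, inT T z -> `|z.1| <= n%:R /\ `|z.2| <= n%:R) -> nd u -> sub u T ->
  v \in verts T -> e \in verts T -> 0 <= d <= d0 -> sliver d v e u ->
  en u (hp a) <= en T (hp a) + eps.
Proof.
move=> e0 M0; pose D : R := n.+1%:R; have D1 : 1 <= D by rewrite ler1n.
have D0 : 0 <= D by lra.
have nD : n%:R <= D by rewrite ler_nat.
have L0 : 0 <= Lam R m1 by exact: le_trans ler01 (Lam_ge1 _ _).
have [pE|[r pE r1]] := p_cases p1.
  pose C := Lam R m1 * (m.+1%:R * (M * (m%:R * (D + 2) ^+ m * 2))).
  have C0 : 0 <= C by rewrite !mulr_ge0// exprn_ge0//; lra.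
  have C1 : 0 < C + 1 by lra.
  exists (Num.min 1 (eps / (C + 1))); first by rewrite lt_min ltr01 divr_gt0.
  move=> a T u v e d aM nT _ TD nu uT vT eT /andP[d0 d1] sl.
  have [d1' d2] : d <= 1 /\ d <= eps / (C + 1) by move: d1; rewrite le_min => /andP[].
  rewrite -lee_fin -(enE m1p p1 nu (nice_isL nu (isL_hp m1 a))).
  have -> : (en T (hp a) + eps)%:E = ((en T (hp a) + eps) * ar u `^ ip p)%:E.
    by rewrite /ip pE invey /= powRr0 mulr1.
  apply: Nt_bound => //.
  - exact: measurable_bdy.
  - exact: mu_fin.
  - by apply: measurable_Err => //; case: (nice_isL nu (isL_hp m1 a)).
  - by rewrite addr_ge0 ?en_ge0// ltW.
  move=> z uz.
  have d01 : 0 <= d <= 1 by rewrite d0.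
  have TD' w : inT T w -> `|w.1| <= D /\ `|w.2| <= D.
    by move=> /TD[h1 h2]; split; apply: le_trans nD.
  have [y Ty h] := sliver_sup m1p nu nT D1 d01 TD' uT vT eT sl aM uz.
  rewrite (le_trans h)// lerD//; first exact: en_sup (isL_hp _ _) Ty.
  have -> : Lam R m1 * (m.+1%:R * (M * (m%:R * (D + 2) ^+ m * (2 * d)))) = C * d by rewrite /C; ring.
  apply: (@le_trans _ _ ((C + 1) * d)); first by rewrite ler_wpM2r//; lra.
  by rewrite mulrC -ler_pdivlMr.
have r0 : 0 < r by lra.
have ipE : ip p = r^-1 by rewrite /ip pE inver gt_eqF.
pose Mb := Lam R m1 * (m.+1%:R * (M * D ^+ m)).
have Mb0 : 0 <= Mb by rewrite !mulr_ge0// exprn_ge0.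
(* An area at most [eta] makes the error, at most [Mb] times the area to the power 1 / r, smaller
   than [eps]. *)
pose eta := (eps / (Mb + 1)) `^ r.
have Mb1 : 0 < Mb + 1 by lra.
have eM : 0 < eps / (Mb + 1) by rewrite divr_gt0.
have eta0 : 0 < eta by rewrite powR_gt0.
(* Here 72 = 2 * 6 ^ 2: the number [N.+2] of squares is at most [2 * N.+1], and their side carries
   the factor 6. *)
pose N := Num.truncn (72 * (2 * D) ^+ 2 / eta).
have N1 : 0 < N.+1%:R :> R by [].
have hN : 72 * (2 * D) ^+ 2 <= eta * N.+1%:R.
  by rewrite -ler_pdivrMl// mulrC; apply/ltW; exact: truncnS_gt.
exists (2 * D / N.+1%:R); first by rewrite divr_gt0//; lra.
move=> a T u v e d aM nT _ TD nu uT vT eT /andP[d0 d1] sl.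
have [a1 a2] : `|e.1 - v.1| <= 2 * D /\ `|e.2 - v.2| <= 2 * D.
  have [v1 v2] := TD v (inT_mem vT); have [f1 f2] := TD e (inT_mem eT).
  by split; rewrite (le_trans (ler_normB _ _))//; lra.
have D2 : 0 <= 2 * D by rewrite mulr_ge0.
have au := sliver_area m1p nu d0 d1 D2 sl a1 a2.
have au' : ar u <= eta.
  apply: (le_trans au); rewrite exprMn exprMn exprVn.
  have h : N.+2%:R <= 2 * N.+1%:R :> R by rewrite -natrM ler_nat mul2n -addnn addSnnS leq_addl.
  rewrite (@le_trans _ _ (2 * N.+1%:R * (6 ^+ 2 * ((2 * D) ^+ 2 / N.+1%:R ^+ 2))))//.
    by rewrite ler_wpM2r// !mulr_ge0// ?exprn_ge0// ?invr_ge0 ?exprn_ge0.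
  have -> : 2 * N.+1%:R * (6 ^+ 2 * ((2 * D) ^+ 2 / N.+1%:R ^+ 2)) = 72 * (2 * D) ^+ 2 / N.+1%:R.
    by field; rewrite addrC natr1 pnatr_eq0.
  by rewrite ler_pdivrMr.
have hb : en u (hp a) <= Mb * ar u `^ ip p.
  have := @en_bound _ _ _ m1p p1 u (hp a) (fun=> 0) (m.+1%:R * (M * D ^+ m)) nu
    (nice_isL nu (isL_hp m1 a)) (isL0 R m); rewrite -/Mb; apply=> z uz; rewrite subr0.
  by have [h1 h2] := TD z (inT_sub uT uz); apply: hp_bound => //; apply: le_trans nD.
apply: (le_trans hb); apply: (@le_trans _ _ eps); last by rewrite lerDr en_ge0.
apply: (@le_trans _ _ ((Mb + 1) * (eps / (Mb + 1)))); last by rewrite mulrC divfK// gt_eqF.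
apply: ler_pM => //; rewrite ?powR_ge0//; first lra.
have rn : r != 0 by rewrite gt_eqF.
have -> : eps / (Mb + 1) = eta `^ r^-1 by rewrite /eta -powRrM mulfV// powRr1// ltW.
have rV : 0 <= r^-1 by rewrite invr_ge0 ltW.
by rewrite ipE; apply: ge0_ler_powR => //; rewrite nnegrE ?ar_ge0// ltW.
Qed.

Lemma sliver_tile (n : nat) (M eps : R) : 0 < eps -> 0 <= M -> exists2 d0, 0 < d0 &
  forall a T u (l d : R) (c v e : pt R), (forall k, (k <= m)%N -> `|a k| <= M) -> nd T -> ar T = 1 ->
  wide n%:R T -> l != 0 -> nd u -> sub u (htri l c T) ->
  v \in verts (htri l c T) -> e \in verts (htri l c T) -> 0 <= d <= d0 -> sliver (d * `|l|) v e u ->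
  en u (hp a) <= (l ^+ 2) `^ iq * (en T (hp a) + eps).
Proof.
move=> e0 M0; have [d0 d0p H] := sliver_en n e0 M0; exists d0 => // a T u l d c v e aM nT aT wT l0 nu.
have [b [nT0 aT0 enT0 oT]] := tile_origin nT; set T0 := htri 1 b T in nT0 aT0 enT0 oT.
have TE : htri l c T = htri l (c.1 - l * b.1, c.2 - l * b.2) T0.
  by rewrite /T0 /htri /hpt /=; congr (_, _, _); congr (_, _); ring.
rewrite TE => uT vT eT hd sl.
have [u0 [v0 [f0 [[nu0 su0 uE v0T f0T] sl0]]]] := tile_pull l0 nu uT vT eT sl.
rewrite uE; apply: le_trans (en_htri m1p p1 _ a l0 nu0) _; apply: ler_wpM2l; first exact: powR_ge0.
apply: (@le_trans _ _ (en T0 (hp a) + eps)); last by rewrite lerD2r.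
have w0 : wide n%:R T0 by have := @wide_htri _ 1 b T _ wT; rewrite normr1 mul1r; apply.
have aT1 : ar T0 = 1 by rewrite aT0.
apply: (H a T0 u0 v0 f0 d aM nT0 aT1 _ nu0 su0 v0T f0T hd sl0) => z tz.
have o : inT T0 (0, 0) by rewrite -oT; apply: inT_mem; rewrite in_cons eqxx.
by have := wide_inT w0 tz o; rewrite /= !subr0.
Qed.

End SliverTiles.

(** * Triangulations of the domain *)

Section Conversions.
Variable R : realType.
Notation mu := (@plane_measure R).
Implicit Types (t : tri R) (T : triangle R).

Definition to_tri T : tri R := (T 0, T 1, T (1 + 1)).

Lemma ord3 (P : 'I_3 -> Prop) : P 0 -> P 1 -> P (1 + 1) -> forall i, P i.
Proof.
move=> p0 p1 p2 [[|[|[|k]]] h] //.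
- by rewrite (_ : Ordinal h = 0); [|exact: val_inj].
- by rewrite (_ : Ordinal h = 1); [|exact: val_inj].
- by rewrite (_ : Ordinal h = 1 + 1); [|exact: val_inj].
Qed.

Lemma sum3 (V : nmodType) (F : 'I_3 -> V) : \sum_(i < 3) F i = F 0 + F 1 + F (1 + 1).
Proof.
rewrite !big_ord_recl big_ord0 addr0 addrA.
by congr (F _ + F _ + F _); apply: val_inj.
Qed.

Lemma nd_to T : nd (to_tri T).
Proof. exact: Defs.nondegenerate. Qed.

Lemma tri_of t : nd t -> exists T, to_tri T = t.
Proof.
move=> n; pose f (i : 'I_3) := if i == 0 then t.1.1 else if i == 1 then t.1.2 else t.2.
by exists (@Triangle R f n); rewrite /to_tri /= /f /=; case: (t) => -[].
Qed.

Lemma barycenterE T (l : 'I_3 -> R) : barycenter T l = comb (l 0) (l 1) (l (1 + 1)) (to_tri T).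
Proof. by rewrite /barycenter sum3. Qed.

Lemma bodyE T : body T = bdy (to_tri T).
Proof.
apply/seteqP; split=> [x [l [l0 s ->]]|x tx].
  by rewrite barycenterE; apply: inT_comb => //; rewrite -s sum3.
have n := nd_to T; have [a b c] := (inTP x n).1 tx; have s := kb_sum x n.
pose l (i : 'I_3) := if i == 0 then af (k0 (to_tri T)) x else
  if i == 1 then af (k1 (to_tri T)) x else af (k2 (to_tri T)) x.
exists l; split; first by apply: ord3.
  by rewrite sum3 /l /=.
by rewrite barycenterE /l /=; exact: kb_comb.
Qed.

Lemma areaE T : area T = (ar (to_tri T))%:E.
Proof. by rewrite /area bodyE -arE//; exact: nd_to. Qed.

Lemma vert_idx T (x : pt R) : x \in verts (to_tri T) <-> exists i, x = T i.
Proof.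
rewrite mem_verts; split=> [/or3P[]/eqP->|[i ->]].
- by exists 0.
- by exists 1.
- by exists (1 + 1).
by move: i; apply: ord3; rewrite eqxx ?orbT.
Qed.

Lemma segmentE (x y z : pt R) : segment x y z <-> [\/ z = x, z = y | onE z x y].
Proof.
split=> [[s /andP[s0 s1] ->]|].
  have [->|n0] := eqVneq s 0; first by apply: Or31; rewrite subr0 scale1r scale0r addr0.
  have [->|n1] := eqVneq s 1; first by apply: Or32; rewrite subrr scale0r scale1r add0r.
  by apply: Or33; exists s => //; rewrite !lt_neqAle eq_sym n0 s0 n1.
case=> [->|->|[s /andP[s0 s1] ->]].
- by exists 0; rewrite ?lexx ?ler01// subr0 scale1r scale0r addr0.
- by exists 1; rewrite ?lexx ?ler01// subrr scale0r scale1r add0r.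
- by exists s => //; rewrite !ltW.
Qed.

Lemma onE_sym (x y z : pt R) : onE z x y -> onE z y x.
Proof.
move=> [s /andP[s0 s1] ->]; exists (1 - s); first by apply/andP; split; lra.
by rewrite /lerp; congr (_, _); ring.
Qed.

Lemma mesh_meet s t t' : mesh s -> nohang s -> t \in s -> t' \in s -> t != t' ->
  forall z, inT t z -> inT t' z ->
    (z \in verts t /\ z \in verts t') \/ exists x y, [/\ x != y, onE z x y,
      x \in verts t /\ x \in verts t' & y \in verts t /\ y \in verts t'].
Proof.
move=> ms nh ts t's ne z tz t'z; have [ns ps] := ms.
have [k [k0 kt kt']] := pw_sep ps ts t's ne.
have kz : af k z = 0.
  apply/eqP; rewrite eq_le (tz k kt) andbT -oppr_ge0 -af_opk.
  exact: t'z.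
have [zt|[x [y [xt yt xy oE _]]]] := face (ns _ ts) k0 kt tz kz.
  left; split=> //.
  have za : z \in allv s by apply/allvP; exists t.
  by have [//|/(nh _ _ _ t's ts zt)] := mesh_inT ms t's za t'z.
right; exists x, y; have [xt' yt'] := share_edge ms nh ts t's xt yt xy oE t'z.
by [].
Qed.

(** From a common interior point, a small move along the normal of the separating line stays in [t']
    but goes to the wrong side. *)
Lemma sep_interior t t' : nd t -> nd t' -> sep t t' ->
  ((bdy t : set (pt R))° `&` (bdy t' : set (pt R))°) = set0.
Proof.
move=> n n' [k [k0 kt kt']]; apply/seteqP; split=> // z [/nbhs_ballP[r /= r0 h] /nbhs_ballP[r' /= r'0 h']].
pose S := `|k.1.1| + `|k.1.2| + 1; have S0 : 0 < S by rewrite ltr_wpDl// addr_ge0.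
pose e := Num.min r r' / (2 * S).
have e0 : 0 < e by rewrite divr_gt0 ?lt_min ?r0// mulr_gt0.
have eS : e * S < r /\ e * S < r'.
  have -> : e * S = Num.min r r' / 2 by rewrite /e; field; rewrite gt_eqF.
  have m0 : 0 < Num.min r r' by rewrite lt_min r0.
  have [h1 h2] : Num.min r r' <= r /\ Num.min r r' <= r' by rewrite !ge_min !lexx orbT.
  by split; lra.
pose w : pt R := (z.1 + e * k.1.1, z.2 + e * k.1.2).
pose w' : pt R := (z.1 - e * k.1.1, z.2 - e * k.1.2).
have B (c : R) (s : R) : `|c| <= S -> e * S < s -> `|e * c| < s.
  by move=> cS; apply: le_lt_trans; rewrite normrM gtr0_norm// ler_wpM2l// ltW.
have c1 : `|k.1.1| <= S by rewrite /S -addrA lerDl addr_ge0.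
have c2 : `|k.1.2| <= S by rewrite /S addrAC lerDr addr_ge0.
have [es es'] := eS.
have tw' : inT t w'.
  by apply: h; split; rewrite /ball /= opprB addrC subrK; apply: B.
have t'w : inT t' w.
  by apply: h'; split; rewrite /ball /= opprD addrA subrr add0r normrN; apply: B.
have tz : inT t z by apply: h; exact: ballxx.
have t'z : inT t' z by apply: h'; exact: ballxx.
have := t'w _ kt'; have := tz k kt; have : 0 < e * (k.1.1 ^+ 2 + k.1.2 ^+ 2).
  rewrite mulr_gt0// lt_neqAle addr_ge0 ?sqr_ge0// andbT eq_sym paddr_eq0 ?sqr_ge0// !sqrf_eq0.
  apply: contraNN k0 => /andP[/eqP a /eqP b]; apply/eqP.
  by rewrite (surjective_pairing k.1) a b.
by rewrite af_opk /af /w /=; clear; lra.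
Qed.

Lemma conforming_of_mesh s (Omega : set (pt R)) N : mesh s -> nohang s -> size s = N ->
  (forall x, covers s x <-> Omega x) -> exists T : 'I_N -> triangle R,
  conforming Omega T /\ forall i, to_tri (T i) \in s.
Proof.
move=> ms nh sN cO; have [ns ps] := ms; have us := mesh_uniq ms.
pose t0 : tri R := ((0, 0), (0, 0), (0, 0)).
have H (i : 'I_N) : exists T, to_tri T = nth t0 s i.
  by apply: tri_of; apply: ns; rewrite mem_nth// sN.
have [T TE] := choice H; exists T; have Ts i : to_tri (T i) \in s by rewrite TE mem_nth// sN.
split=> //; split.
  apply/seteqP; split=> [x /cO[t ts tx]|x [i _]].
    have ti : (index t s < N)%N by rewrite -sN index_mem.
    by exists (Ordinal ti) => //; rewrite bodyE TE /= nth_index.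
  by rewrite bodyE => tx; apply/cO; exists (to_tri (T i)).
move=> i j ij; have tij : to_tri (T i) != to_tri (T j).
  by rewrite !TE nth_uniq ?sN//.
have sp := pw_sep ps (Ts i) (Ts j) tij.
split; first by rewrite !bodyE; apply: sep_interior (nd_to _) (nd_to _) sp.
set S := _ `&` _; set t := to_tri (T i) in tij sp; set t' := to_tri (T j) in tij sp.
have St z : S z <-> inT t z /\ inT t' z by rewrite /S !bodyE.
have MM z : S z -> (z \in verts t /\ z \in verts t') \/ exists x y, [/\ x != y, onE z x y,
      x \in verts t /\ x \in verts t' & y \in verts t /\ y \in verts t'].
  by move=> /St[a b]; exact: (mesh_meet ms nh (Ts i) (Ts j) tij a b).
(* Common vertices lie on the separating line, so there are at most two. The three cases of
   conformity then correspond to two, one or no common vertices. *)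
have two x y w : x \in verts t /\ x \in verts t' -> y \in verts t /\ y \in verts t' ->
    w \in verts t /\ w \in verts t' -> x != y -> w = x \/ w = y.
  move=> [xt xt'] [yt yt'] [wt wt'] xy.
  have [->|wx] := eqVneq w x; first by left.
  have [->|wy] := eqVneq w y; first by right.
  have [k [kn kt kt']] := sp.
  have u3 : uniq [:: w; x; y] by rewrite /= !in_cons !in_nil !orbF negb_or wx wy xy.
  have s3 : {subset [:: w; x; y] <= verts t}.
    by move=> q; rewrite !in_cons in_nil orbF => /or3P[]/eqP->.
  have [_ vE] := uniq_min_size u3 s3 isT.
  case/eqP: kn; apply: (af_const (nd_to (T i))) => q; rewrite -vE => qv.
  have [qt qt'] : q \in verts t /\ q \in verts t'.
    by move: qv; rewrite !in_cons in_nil orbF => /or3P[]/eqP->.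
  by apply/eqP; rewrite eq_le (kt q qt) andbT -oppr_ge0 -af_opk kt'.
have [[x [y [xy xc yc]]]|no2] := pselect (exists x y, [/\ x != y,
    x \in verts t /\ x \in verts t' & y \in verts t /\ y \in verts t']).
  have SE : S = segment x y.
    apply/seteqP; split=> z; rewrite segmentE.
      move=> /MM[zc|[a [b [ab ob ac bc]]]].
        by case: (two x y z xc yc zc xy) => ->; [exact: Or31|exact: Or32].
      apply: Or33; have [ea|ea] := two x y a xc yc ac xy; have [eb|eb] := two x y b xc yc bc xy;
        rewrite ea eb ?eqxx// in ab ob.
      exact: onE_sym.
    have [xt xt'] := xc; have [yt yt'] := yc.
    case=> [->|->|o]; rewrite St; split; try exact: inT_mem.
      exact: onE_inT xt yt o.
    exact: onE_inT xt' yt' o.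
  have E l : x \in verts (to_tri (T l)) /\ y \in verts (to_tri (T l)) -> edges (T l) S.
    move=> [/vert_idx[a xa] /vert_idx[b yb]]; exists a, b; rewrite -xa -yb; split=> //.
    by apply: contraNneq xy => ab; rewrite xa yb ab.
  by apply: Or33; split; apply: E; rewrite ?xc ?yc; case: xc; case: yc.
have [[x xc]|no1] := pselect (exists x, x \in verts t /\ x \in verts t').
  apply: Or32; exists x; last by split; apply/vert_idx; case: xc.
  apply/seteqP; split=> [z /MM[zc|[a [b [ab _ ac bc]]]]|z ->].
  - by apply/eqP/negPn/negP => zx; apply: no2; exists z, x.
  - by case: no2; exists a, b.
  - by rewrite St; split; apply: inT_mem; case: xc.
apply: Or31; apply/seteqP; split=> // z /MM[zc|[a [b [ab _ ac bc]]]].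
  by case: no1; exists z.
by case: no1; exists a.
Qed.

Lemma diam_wide T (d : R) : 0 <= d -> wide d (to_tri T) -> (diam (body T) <= (2 * d)%:E)%E.
Proof.
move=> d0 w; apply: ge_ereal_sup => _ [x + [y + ->]]; rewrite bodyE => tx ty; rewrite lee_fin.
have [h1 h2] := wide_inT w tx ty.
rewrite /Defs.edist; have d2 : 0 <= 2 * d by rewrite mulr_ge0.
rewrite -[leRHS](ger0_norm d2) -sqrtr_sqr ler_sqrt ?sqr_ge0//.
have a1 : (x.1 - y.1) ^+ 2 <= d ^+ 2 by rewrite -(real_normK (num_real (x.1 - y.1))) lerXn2r ?nnegrE.
have a2 : (x.2 - y.2) ^+ 2 <= d ^+ 2 by rewrite -(real_normK (num_real (x.2 - y.2))) lerXn2r ?nnegrE.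
by rewrite exprMn; have := sqr_ge0 d; lra.
Qed.

Lemma wide_diam T (d : R) : (diam (body T) <= d%:E)%E -> wide d (to_tri T).
Proof.
move=> h x y /inT_mem xt /inT_mem yt.
have : (Defs.edist x y <= d).
  rewrite -lee_fin; apply: le_trans h; apply: ereal_sup_ubound; exists x; first by rewrite bodyE.
  by exists y => //; rewrite bodyE.
rewrite /Defs.edist => e; have s1 := sqr_ge0 (x.1 - y.1); have s2 := sqr_ge0 (x.2 - y.2).
by split; apply: le_trans e; rewrite -sqrtr_sqr ler_sqrt ?addr_ge0// ?lerDl ?lerDr.
Qed.

Lemma polygonal_mesh (Omega : set (pt R)) : polygonal_domain Omega ->
  exists s, [/\ mesh s, s != [::] & forall x, covers s x <-> Omega x].
Proof.
move=> [n [T ->]]; pose l := [seq to_tri (T i) | i : 'I_n.+1].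
have ln t : t \in l -> nd t by move=> /codomP[i ->]; exact: nd_to.
have [s [ms cs]] := union_mesh ln; exists s; split=> //.
  apply/eqP => s0; have : covers s (T ord0 0).
    apply/cs; exists (to_tri (T ord0)); first by apply/codomP; exists ord0.
    by apply: inT_mem; rewrite in_cons eqxx.
  by rewrite s0 => -[].
move=> x; rewrite cs; split=> [[t /codomP[i ->] tx]|[i _]].
  by exists i => //; rewrite bodyE.
by rewrite bodyE => tx; exists (to_tri (T i)) => //; apply/codomP; exists i.
Qed.

Variables (m1 : nat) (p : \bar R).
Hypotheses (m1p : (0 < m1)%N) (p1 : (1 <= p)%E).
Local Notation m := m1.+1.

(** The nodal formula shows that an interpolant exists, so the chosen one is not the default 0; it
    is reproduced by [LI], which depends only on the nodal values. *)
Lemma lagrangeE T (v : pt R -> R) z : poly_fun (Defs.lagrange m T v) z = LI m1 (to_tri T) v z.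
Proof.
have n := nd_to T; set t := to_tri T in n *.
have [P [P0 PE]] := isL_LI m1p t v.
have ex : exists P, total_degree_le m.-1 P /\ {in lagrange_nodes m T, poly_fun P =1 v}.
  exists P; split=> [i j ij|x /set_mem[k [s ->]]]; first exact: P0.
  have m0 := m1R R m1p.
  have s' : (k 0%R + k 1%R + k (1 + 1)%R = m1)%N.
    apply/eqP; rewrite -(eqr_nat R) !natrD; apply/eqP.
    have := s; rewrite sum3 -!mulrDl => e.
    by apply: (mulIf (invr_neq0 m0)); rewrite divff//; exact: e.
  have kA : (k 1, k (1 + 1)) \in idx m1 by rewrite inE /=; lia.
  rewrite PE barycenterE.
  have -> : comb ((k 0)%:R / m1%:R) ((k 1)%:R / m1%:R) ((k (1 + 1))%:R / m1%:R) t = node t (k 1, k (1 + 1)).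
    by rewrite /node /=; have -> : (m1 - k 1%R - k (1 + 1)%R = k 0%R)%N by lia.
  exact: LI_node.
have [Q0 QE] := xgetPex 0 ex; rewrite -/(Defs.lagrange m T v) in Q0 QE.
have QL : isL m (poly_fun (Defs.lagrange m T v)) by exists (Defs.lagrange m T v); split.
rewrite -(LI_id m1p z n QL); apply: LI_ext => k kA; apply: QE; apply/mem_set.
have h := idxP kA.
have h0 : (m1 - k.1 - k.2 < m)%N by lia.
pose K (i : 'I_3) : 'I_m := if i == 0 then Ordinal h0 else if i == 1 then k.1 else k.2.
exists K => /=; split; last by rewrite barycenterE.
by rewrite sum3 /K /=; exact: node_sum.
Qed.

Lemma local_errorE T (v : pt R -> R) : local_error m T v p = Nt p (bdy (to_tri T)) (Err m1 (to_tri T) v).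
Proof.
rewrite /local_error /Nt bodyE; congr LpNorm; apply/funext => z.
by rewrite /= lagrangeE.
Qed.

Lemma shapeE (P : {poly {poly R}}) (a : nat -> R) : poly_fun P =1 hp m1 a ->
  shape_function m p P = (Kr m1 p a)%:E.
Proof.
move=> PE; have [k [t0 [n0 a0 _]]] := tile_ex R.
rewrite /shape_function /Kr -ereal_inf_EFin; last 2 first.
- by exists 0; exact: tiles_lb.
- by exists (en m1 p t0 (hp m1 a)), t0.
have -> : poly_fun P = hp m1 a by exact/funext.
congr ereal_inf; apply/seteqP; split=> e.
  move=> [T aT <-]; exists (en m1 p (to_tri T) (hp m1 a)).
    exists (to_tri T); split; [exact: nd_to| |exact: Logic.I|by []].
    by move: aT; rewrite /= areaE => -[].
  by rewrite local_errorE enE//; [exact: nd_to|apply: nice_isL (isL_hp _ _); exact: nd_to].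
move=> [_ [t [n a1 _ ->]] <-]; have [T TE] := tri_of n.
exists T; first by rewrite /= areaE TE a1.
by rewrite local_errorE TE enE//; exact: nice_isL (isL_hp _ _).
Qed.

End Conversions.

(** * Compactness and uniform continuity on the domain *)

Section Compactness.
Variable R : realType.
Notation mu := (@plane_measure R).
Implicit Types (t : tri R) (s : seq (tri R)) (z w : pt R).

Lemma closed_bdy t : nd t -> closed (bdy t : set (pt R)).
Proof.
move=> n; rewrite bdyE//.
have H (k : pt R * R) : closed ([set x | 0 <= af k x] : set (pt R)).
  have -> : [set x | 0 <= af k x] = (fun x : pt R => af k x) @^-1` [set y | 0 <= y] by [].
  apply: closed_comp; last exact: closed_ge.
  move=> x _; apply: (@isL_continuous _ 2); apply: isL_ext (isL_af k (isL_cst 0 1)) => z.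
  by rewrite mulr1.
by apply: closedI; [apply: closedI|].
Qed.

Lemma wide_ex t : exists2 d : R, 0 <= d & wide d t.
Proof.
exists (2 * (`|t.1.1.1| + `|t.1.2.1| + `|t.2.1| + (`|t.1.1.2| + `|t.1.2.2| + `|t.2.2|))).
  by rewrite mulr_ge0 ?addr_ge0.
have a1 := normr_ge0 t.1.1.1; have a2 := normr_ge0 t.1.2.1; have a3 := normr_ge0 t.2.1.
have a4 := normr_ge0 t.1.1.2; have a5 := normr_ge0 t.1.2.2; have a6 := normr_ge0 t.2.2.
by move=> x y; rewrite !mem_verts => /or3P[]/eqP-> /or3P[]/eqP->; split;
  rewrite (le_trans (ler_normB _ _))//; lra.
Qed.

Lemma compact_bdy t : nd t -> compact (bdy t : set (pt R)).
Proof.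
move=> n; have [d d0 w] := wide_ex t.
apply: (subclosed_compact (closed_bdy n) _ (bdy_box w)).
by apply: compact_setX; exact: segment_compact.
Qed.

(** Compactness of the finite union, in the filter form from which uniform continuity and
    boundedness follow directly. *)
Lemma near_covering_covers s : (forall t, t \in s -> nd t) ->
  near_covering ([set x | covers s x] : set (pt R)).
Proof.
move=> ns I F P FF H.
suff HH : \near F, forall t, t \in s -> bdy t `<=` P F.
  by apply: filterS HH => i h x [t ts tx]; apply: (h t ts).
elim: s ns H => [|t s IH] ns H; first by near=> i.
have h1 : \near F, bdy t `<=` P F.
  move: (compact_bdy (ns t (mem_head _ _))) => /compact_near_coveringP; apply => x tx; apply: H.
  by exists t => //; exact: mem_head.
have h2 : \near F, forall t', t' \in s -> bdy t' `<=` P F.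
  apply: IH => [t' ts|x [t' ts tx]]; first by apply: ns; rewrite in_cons ts orbT.
  by apply: H; exists t' => //; rewrite in_cons ts orbT.
apply: filterS2 h1 h2 => i h1 h2 t'; rewrite in_cons => /predU1P[->//|]; exact: h2.
Unshelve. all: by end_near. Qed.

Lemma near_le (d d' : R) z w : d' <= d -> near d' z w -> near d z w.
Proof. by move=> dd [h1 h2]; split; apply: lt_le_trans dd. Qed.

Lemma near_nbhs z (d : R) : 0 < d -> nbhs z (near d z).
Proof.
move=> d0; apply/nbhs_ballP; exists d => // w [h1 h2].
by split; rewrite distrC.
Qed.

Lemma near_add (d d' : R) x z w : near d x z -> near d' z w -> near (d + d') x w.
Proof.
move=> [h1 h2] [h3 h4]; split.
  by rewrite -(subrKA z.1) (le_lt_trans (ler_normD _ _))// addrC ltrD.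
by rewrite -(subrKA z.2) (le_lt_trans (ler_normD _ _))// addrC ltrD.
Qed.

Lemma unif_cont s (g : pt R -> R) (e : R) : (forall t, t \in s -> nd t) -> cont_on (covers s) g -> 0 < e ->
  exists2 d, 0 < d & forall z w, covers s z -> covers s w -> near d z w -> `|g w - g z| < e.
Proof.
move=> ns cg e0; have e2 : 0 < e / 2 by rewrite divr_gt0.
have NC := near_covering_covers ns.
have := NC R 0^'+ (fun d z => covers s z -> forall w, covers s w -> near d z w -> `|g w - g z| < e) _.
case.
- move=> x cx; have [d d0 H] := cg x cx _ e2; have d2 : 0 < d / 2 by rewrite divr_gt0.
  exists (near (d / 2) x, [set r | r < d / 2]); first split=> /=.
  + exact: near_nbhs.
  + exact: nbhs_right_lt.
  case=> z r /= [xz rd] cz w cw zw.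
  have hz : near d x z by apply: near_le xz; lra.
  have hw : near d x w by apply: near_le (near_add xz zw); lra.
  have := H z cz hz; have := H w cw hw; rewrite !ltr_norml => /andP[? ?] /andP[? ?].
  by apply/andP; split; lra.
move=> r /= r0 Hr; exists (r / 2); first by rewrite divr_gt0.
move=> z w cz cw zw; apply: (Hr (r / 2)) => //=; last by rewrite divr_gt0.
by rewrite /ball /= sub0r normrN ger0_norm ?divr_ge0 ?ltW//; lra.
Qed.

Lemma cont_bounded s (g : pt R -> R) : (forall t, t \in s -> nd t) -> cont_on (covers s) g ->
  exists2 M, 0 <= M & forall z, covers s z -> `|g z| <= M.
Proof.
move=> ns cg; have NC := near_covering_covers ns.
have := NC R (+oo)%R (fun M z => covers s z -> `|g z| <= M) _.
case.
- move=> x cx; have [d d0 H] := cg x cx _ ltr01.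
  exists (near d x, [set r | `|g x| + 1 <= r]); first split=> /=.
  + exact: near_nbhs.
  + by apply: nbhs_pinfty_ge; exact: num_real.
  case=> z r /= [xz rd] cz; have := H z cz xz; have := ler_normD (g z - g x) (g x).
  by rewrite subrK; lra.
move=> M [Mr HM]; exists (Num.max 0 (M + 1)); first by rewrite le_max lexx.
move=> z cz; apply: (le_trans (HM (M + 1) _ z cz cz)); first by rewrite ltrDl.
by rewrite le_max lexx orbT.
Qed.

Lemma fin_min (Q : nat -> R -> Prop) n : (forall k d d', Q k d -> d' <= d -> Q k d') ->
  (forall k, (k <= n)%N -> exists2 d, 0 < d & Q k d) ->
  exists2 d, 0 < d & forall k, (k <= n)%N -> Q k d.
Proof.
move=> mQ; elim: n => [|n IH] H.
  by have [d d0 Hd] := H 0%N (leqnn _); exists d => // k; rewrite leqn0 => /eqP->.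
have [|d d0 Hd] := IH; first by move=> k kn; apply: H; rewrite (leq_trans kn).
have [d' d'0 Hd'] := H n.+1 (leqnn _); exists (Num.min d d'); first by rewrite lt_min d0.
move=> k; rewrite leq_eqVlt => /predU1P[->|kn].
  by apply: mQ Hd' _; rewrite ge_min lexx orbT.
by apply: mQ (Hd k kn) _; rewrite ge_min lexx.
Qed.

Lemma fin_max (Q : nat -> R -> Prop) n : (forall k d d', Q k d -> d <= d' -> Q k d') ->
  (forall k, (k <= n)%N -> exists2 d, 0 <= d & Q k d) ->
  exists2 d, 0 <= d & forall k, (k <= n)%N -> Q k d.
Proof.
move=> mQ; elim: n => [|n IH] H.
  by have [d d0 Hd] := H 0%N (leqnn _); exists d => // k; rewrite leqn0 => /eqP->.
have [|d d0 Hd] := IH; first by move=> k kn; apply: H; rewrite (leq_trans kn).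
have [d' d'0 Hd'] := H n.+1 (leqnn _); exists (Num.max d d'); first by rewrite le_max d0.
move=> k; rewrite leq_eqVlt => /predU1P[->|kn].
  by apply: mQ Hd' _; rewrite le_max lexx orbT.
by apply: mQ (Hd k kn) _; rewrite le_max lexx.
Qed.

Lemma measurable_covers s : (forall t, t \in s -> nd t) ->
  measurable ([set x | covers s x] : set (plane R)) /\ (mu [set x | covers s x] < +oo)%E.
Proof.
elim: s => [|t s IH] ns.
  have -> : [set x | covers [::] x] = set0 :> set (plane R) by apply/seteqP; split=> // x [].
  have m0 : mu (set0 : set (plane R)) = 0%E by exact: measure0.
  by split=> //; rewrite m0 ltry.
have -> : [set x | covers (t :: s) x] = bdy t `|` [set x | covers s x] :> set (plane R).
  apply/seteqP; split=> [x [t']|x [tx|[t' ts tx]]].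
  - by rewrite in_cons => /predU1P[->|ts] tx; [left|right; exists t'].
  - by exists t => //; exact: mem_head.
  - by exists t' => //; rewrite in_cons ts orbT.
have [|ms fs] := IH; first by move=> t' ts; apply: ns; rewrite in_cons ts orbT.
have nt := ns t (mem_head _ _); have mt := measurable_bdy nt.
split; first exact: measurableU.
have ft : (mu (bdy t) < +oo)%E by rewrite arE// ltry.
by apply: le_lt_trans (measureU2 _ mt ms) _; apply: lte_add_pinfty.
Qed.

(* The pieces may overlap, so only subadditivity of the integral is available. *)
Lemma integral_covers s (g : plane R -> \bar R) : (forall t, t \in s -> nd t) ->
  measurable_fun ([set x | covers s x] : set (plane R)) g ->
  (forall x, covers s x -> (0 <= g x)%E) ->
  (\int[mu]_(x in [set x | covers s x]) g x <= \sum_(t <- s) \int[mu]_(x in bdy t) g x)%E.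
Proof.
elim: s => [|t s IH] ns mg g0.
  have -> : [set x | covers [::] x] = set0 :> set (plane R) by apply/seteqP; split=> // x [].
  by rewrite integral_set0 big_nil.
have E : [set x | covers (t :: s) x] = bdy t `|` ([set x | covers s x] `\` bdy t) :> set (plane R).
  apply/seteqP; split=> [x [t']|x [tx|[[t' ts tx] _]]].
  - rewrite in_cons => /predU1P[->|ts] tx; first by left.
    by have [h|h] := pselect (bdy t x); [left|right; split=> //; exists t'].
  - by exists t => //; exact: mem_head.
  - by exists t' => //; rewrite in_cons ts orbT.
have ns' t' : t' \in s -> nd t' by move=> ts; apply: ns; rewrite in_cons ts orbT.
have nt := ns t (mem_head _ _); have mt := measurable_bdy nt.
have [ms _] := measurable_covers ns'.
have sub1 : [set x | covers s x] `<=` [set x | covers (t :: s) x].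
  by move=> x [t' ts tx]; exists t' => //; rewrite in_cons ts orbT.
have sub2 : bdy t `<=` [set x | covers (t :: s) x] by move=> x tx; exists t => //; exact: mem_head.
have mst := measurable_covers ns.
rewrite big_cons E ge0_integral_setU//; last 4 first.
- exact: measurableD.
- by rewrite -E.
- by rewrite -E.
- by rewrite disj_set2E; apply/eqP; rewrite setIDA setIC -setIDA setDv setI0.
rewrite leeD2l//; apply: (@le_trans _ _ (\int[mu]_(x in [set x | covers s x]) g x)%E).
  apply: ge0_subset_integral => //.
  - exact: measurableD.
  - by apply: measurable_funS mg => //; case: mst.
  - by move=> x /sub1; exact: g0.
apply: IH => //.
  by apply: measurable_funS mg => //; case: mst.
by move=> x /sub1; exact: g0.
Qed.

End Compactness.

(** * Local errors of the given function *)

Section Domain.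
Variables (R : realType) (m1 : nat) (p : \bar R).
Hypotheses (m1p : (0 < m1)%N) (p1 : (1 <= p)%E).
Local Notation m := m1.+1.
Notation mu := (@plane_measure R).
Implicit Types (t u : tri R) (z w : pt R).
Local Notation en := (en m1 p).
Local Notation hp := (hp m1).
Local Notation iq := (iq m1 p).
Local Notation Kr := (Kr m1 p).
Local Notation Kn := (Kn m1 p).

Variables (s0 : seq (tri R)) (f : pt R -> R) (D : nat -> nat -> pt R -> R).
Local Notation Om := ([set x | covers s0 x] : set (pt R)).
Hypotheses (ms0 : mesh s0) (hD : partial_derivatives m Om f D).

Let ns0 t : t \in s0 -> nd t. Proof. by have [+ _] := ms0; apply. Qed.

(** The coefficients of the homogeneous polynomial d ^ m f(z) / m!. *)
Definition ac z (k : nat) : R := D k (m - k)%N z / (k`! * (m - k)`!)%:R.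

Lemma D_cont k l : (k + l <= m)%N -> cont_on Om (D k l).
Proof. by have [_ h _] := hD => /h; exact: cont_onP. Qed.

Lemma f_cont : cont_on Om f.
Proof.
have [h _ _] := hD; have hc := @D_cont 0 0 (leq0n _) => z Oz e e0.
have [d d0 H] := hc z Oz e e0; exists d => // w Ow zw.
by have := H w Ow zw; rewrite !h ?inE.
Qed.

Lemma D_partials t k l z : nd t -> bdy t `<=` Om -> (k + l < m)%N -> inI t z ->
  partials (D k l) (D k.+1 l) (D k l.+1) z.
Proof.
move=> n tO kl iz; have [_ _ h] := hD.
have [|h1 h2] := h k l kl z; last exact: partials_of_is_derive.
have [r r0 Hr] := inI_near iz.
by apply: filterS (near_nbhs z r0) => w /Hr/(inI_inT n)/tO.
Qed.

Lemma fact_ge1 k : 1 <= (k`! * (m - k)`!)%:R :> R.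
Proof. by rewrite ler1n muln_gt0 !fact_gt0. Qed.

Lemma ac_unif (e : R) : 0 < e -> exists2 d, 0 < d & forall z w, Om z -> Om w -> near d z w ->
  forall k, (k <= m)%N -> `|D k (m - k)%N w - D k (m - k)%N z| <= e /\ `|ac w k - ac z k| <= e.
Proof.
move=> e0; have := @fin_min R (fun k d => forall z w, Om z -> Om w -> near d z w ->
   `|D k (m - k)%N w - D k (m - k)%N z| <= e /\ `|ac w k - ac z k| <= e) m.
case.
- by move=> k d d' H dd z w Oz Ow zw; apply: H => //; exact: near_le zw.
- move=> k km; have [|d d0 H] := unif_cont ns0 (_ : cont_on (covers s0) (D k (m - k)%N)) e0.
    by apply: D_cont; rewrite subnKC.
  exists d => // z w Oz Ow zw; have h := H z w Oz Ow zw; split; first exact: ltW.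
  rewrite /ac -mulrBl normrM normfV (ger0_norm (ler0n _ _)).
  have h1 := fact_ge1 k; rewrite ler_pdivrMr; last by apply: lt_le_trans h1.
  by rewrite (le_trans (ltW h))// ler_peMr// ltW.
move=> d d0 H; exists d => // z w Oz Ow zw k km; exact: H.
Qed.

Lemma ac_bound : exists2 M, 0 <= M & forall z, Om z ->
  forall k, (k <= m)%N -> `|D k (m - k)%N z| <= M /\ `|ac z k| <= M.
Proof.
have := @fin_max R (fun k M => forall z, Om z -> `|D k (m - k)%N z| <= M /\ `|ac z k| <= M) m.
case.
- by move=> k d d' H dd z /H[h1 h2]; split; apply: le_trans dd.
- move=> k km; have [|M M0 H] := cont_bounded ns0 (_ : cont_on (covers s0) (D k (m - k)%N)).
    by apply: D_cont; rewrite subnKC.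
  exists M => // z Oz; split; first exact: H.
  rewrite /ac normrM normfV (ger0_norm (ler0n _ _)).
  have h1 := fact_ge1 k; rewrite ler_pdivrMr; last by apply: lt_le_trans h1.
  by rewrite (le_trans (H z Oz))// ler_peMr.
by move=> M M0 H; exists M => // z Oz k km; exact: H.
Qed.

Lemma nice_f t : nd t -> bdy t `<=` Om -> nice t f.
Proof.
move=> n tO; split.
  by apply: measurable_cont; [exact: measurable_bdy|exact: cont_onS f_cont].
by have [M M0 H] := cont_bounded ns0 f_cont; exists M => z /tO; exact: H.
Qed.

(** The effect on the local error of a Taylor remainder (2d) ^ m * w: since (2d) ^ 2 bounds the
    area, the power 1/q gathers the factor (2d) ^ m and the norm of a constant. *)
Definition er (d w : R) := Lam R m1 * w * ((2 * d) ^+ 2) `^ iq.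

Lemma er_area t (d w : R) : nd t -> wide d t -> 0 < d -> 0 <= w ->
  Lam R m1 * ((2 * d) ^+ m * w) * ar t `^ ip p <= er d w.
Proof.
move=> n wt d0 w0; have L0 : 0 <= Lam R m1 by exact: le_trans ler01 (Lam_ge1 _ _).
have d2 : 0 < 2 * d by rewrite mulr_gt0.
rewrite /er (sqr_iq _ _ (lt0r_neq0 d2)) (gtr0_norm d2).
have -> : Lam R m1 * ((2 * d) ^+ m * w) * ar t `^ ip p = Lam R m1 * w * ((2 * d) ^+ m * ar t `^ ip p) by ring.
apply: ler_wpM2l; first exact: mulr_ge0.
apply: ler_wpM2l; first by rewrite exprn_ge0// ltW.
apply: ge0_ler_powR; rewrite ?ip_ge0 ?nnegrE ?ar_ge0 ?sqr_ge0//.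
have := mu_wide n wt; rewrite arE// lee_fin exprMn => h; apply: (le_trans h).
by rewrite ler_wpM2r ?sqr_ge0//; lra.
Qed.

Lemma wide_gt0 t (d : R) : nd t -> wide d t -> 0 < d.
Proof.
move=> n wt; have d0 : 0 <= d.
  have m0 : t.1.1 \in verts t by rewrite in_cons eqxx.
  by have [+ _] := wt _ _ m0 m0; apply: le_trans.
rewrite lt_neqAle d0 andbT; apply/eqP => dE; have := mu_wide n wt.
rewrite -dE expr0n /= mulr0 arE// lee_fin leNgt => /negP; apply; exact: ar_gt0.
Qed.

Lemma local_poly t (d w : R) (A : nat -> R) : nd t -> bdy t `<=` Om -> wide d t -> 0 <= w ->
  (forall k, (k <= m)%N -> forall z, inT t z -> `|D k (m - k)%N z - A k| <= w) ->
  let a k := A k / (k`! * (m - k)`!)%:R in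
  en t f <= en t (hp a) + er d w /\ en t (hp a) <= en t f + er d w.
Proof.
move=> n tO wt w0 hA a; have d0 := wide_gt0 n wt; have nf := nice_f n tO.
have nh : nice t (hp a) by exact: nice_isL (isL_hp _ _).
have [Q QL HQ] : exists2 Q, isL m Q & forall z, inT t z -> `|f z - hp a z - Q z| <= (2 * d) ^+ m * w.
  apply: (@taylor R t m1 d w D f A) => //.
  - by move=> k l kl z iz; exact: D_partials iz.
  - by move=> k km z /(inI_inT n); exact: hA.
  - exact: cont_onS f_cont.
  - by have [h _ _] := hD => z /tO Oz; rewrite h ?inE.
have e1 := er_area n wt d0 w0.
split; [apply: le_trans (en_near m1p p1 n nf nh QL HQ) _; by rewrite lerD2l|].
have QN : isL m (fun z => - Q z) by apply: isL_ext (isLZ (-1) QL) => z; rewrite mulN1r.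
apply: le_trans (en_near m1p p1 n nh nf QN (c := (2 * d) ^+ m * w) _) _; last by rewrite lerD2l.
by move=> z tz; have := HQ z tz; rewrite -normrN; congr (`|_| <= _); ring.
Qed.

(** Comparison with the zero polynomial; it suffices for the tiny triangles. *)
Lemma local_crude t (d M : R) : nd t -> bdy t `<=` Om -> wide d t -> 0 <= M ->
  (forall k, (k <= m)%N -> forall z, inT t z -> `|D k (m - k)%N z| <= M) -> en t f <= er d M.
Proof.
move=> n tO wt M0 hM.
have [|h _] := @local_poly t d M (fun=> 0) n tO wt M0 _.
  by move=> k km z tz; rewrite subr0; exact: hM.
apply: (le_trans h); rewrite gerDr.
have h0 := en_bound m1p p1 n (nice_isL n (isL_hp m1 (fun k => 0 / (k`! * (m - k)`!)%:R))) (isL0 R m) (c := 0).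
apply: le_trans (h0 _) _; last by rewrite mulr0 mul0r.
move=> z _; rewrite subr0 /hp big1 ?normr0// => k _; by rewrite mul0r mul0r.
Qed.

End Domain.

(** * Asymptotic bounds *)

Section PowerMeans.
Variable R : realType.

(** The shares a / (a + b) and b / (a + b) are in [0, 1], hence at most their powers [q], and they
    add up to 1. *)
Lemma powD (a b q : R) : 0 <= a -> 0 <= b -> 0 < q <= 1 -> (a + b) `^ q <= a `^ q + b `^ q.
Proof.
move=> a0 b0 /andP[q0 q1]; have [e|n0] := eqVneq (a + b) 0.
  by rewrite e powR0 ?gt_eqF// addr_ge0 ?powR_ge0.
have s0 : 0 < a + b by rewrite lt_neqAle eq_sym n0 addr_ge0.
have H x : 0 <= x -> x <= a + b -> x / (a + b) * (a + b) `^ q <= x `^ q.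
  move=> x0 xs; have [->|xn] := eqVneq x 0; first by rewrite !mul0r powR_ge0.
  have xp : 0 < x by rewrite lt_neqAle eq_sym xn.
  have y01 : 0 < x / (a + b) <= 1 by rewrite divr_gt0//= ler_pdivrMr// mul1r.
  rewrite -[x in leRHS](divfK n0) powRM ?divr_ge0 ?(ltW s0)//.
  by rewrite ler_wpM2r ?powR_ge0// ger1_powR.
have := lerD (H a a0 _) (H b b0 _); rewrite -!mulrDl divff// mul1r; apply.
  by rewrite lerDl.
by rewrite lerDr.
Qed.

(** The tangent at 1 of a concave power, obtained from Young's inequality with exponents 1 / t and 1
    / (1 - t). *)
Lemma bernoulli (x t : R) : 0 <= x -> 0 < t < 1 -> x `^ t <= t * x + (1 - t).
Proof.
move=> x0 /andP[t0 t1]; have t1' : 0 < 1 - t by lra.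
have := @conjugate_powR R (x `^ t) 1 t^-1 (1 - t)^-1 (powR_ge0 _ _) ler01.
rewrite !invr_gt0 !invrK => /(_ t0 t1').
rewrite mulr1 -powRrM mulfV ?gt_eqF// powRr1// powR1 mul1r [t * x]mulrC; apply.
by rewrite addrC subrK.
Qed.

Lemma power_mean (I : Type) (s : seq I) (u : I -> R) (q r N : R) :
  (forall i, 0 <= u i) -> 0 < q -> q < r -> N = (size s)%:R -> 0 < N ->
  \sum_(i <- s) u i `^ q <= N * ((\sum_(i <- s) u i `^ r) / N) `^ (q / r).
Proof.
move=> u0 q0 qr NE N0; have r0 : 0 < r by lra.
set S := \sum_(i <- s) u i `^ r; set t := q / r.
have t0 : 0 < t by rewrite divr_gt0.
have t1 : t < 1 by rewrite ltr_pdivrMr// mul1r.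
have S0 : 0 <= S by apply: sumr_ge0 => i _; exact: powR_ge0.
have uE i : u i `^ q = (u i `^ r) `^ t by rewrite -powRrM /t mulrC divfK// gt_eqF.
have sum1 (c : R) : \sum_(i <- s) c = N * c.
  by rewrite NE big_const_seq count_predT iter_addr addr0 mulr_natl.
have [Sz|Sn] := eqVneq S 0.
  rewrite Sz mul0r powR0 ?gt_eqF// mulr0 -/S.
  have H : forall l : seq I, \sum_(i <- l) u i `^ r <= 0 -> \sum_(i <- l) u i `^ q <= 0.
    elim=> [|i l IH]; first by rewrite !big_nil.
    rewrite !big_cons => h; have a0 : 0 <= u i `^ r by exact: powR_ge0.
    have b0 : 0 <= \sum_(j <- l) u j `^ r by apply: sumr_ge0 => j _; exact: powR_ge0.
    have ai : u i `^ r = 0 by lra.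
    rewrite uE ai powR0 ?gt_eqF// add0r; apply: IH; lra.
  by apply: H; rewrite -/S Sz.
have Sp : 0 < S by rewrite lt_neqAle eq_sym Sn.
have SN : 0 < S / N by rewrite divr_gt0.
have term i : u i `^ q <= (S / N) `^ t * (t * (u i `^ r / (S / N)) + (1 - t)).
  have h : 0 <= u i `^ r / (S / N) by rewrite divr_ge0 ?powR_ge0// ltW.
  have hE : u i `^ q = (S / N) `^ t * (u i `^ r / (S / N)) `^ t.
    by rewrite uE -(powRM _ (ltW SN) h) [S / N * _]mulrC divfK// lt0r_neq0.
  rewrite hE.
  by rewrite ler_wpM2l ?powR_ge0// bernoulli// t0.
apply: (@le_trans _ _ (\sum_(i <- s) (S / N) `^ t * (t * (u i `^ r / (S / N)) + (1 - t)))).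
  exact: ler_sum.
rewrite -mulr_sumr big_split /= -mulr_sumr -mulr_suml -/S sum1 mulrC.
rewrite ler_wpM2r ?powR_ge0// le_eqVlt; apply/orP; left; apply/eqP; field.
by rewrite gt_eqF//= gt_eqF.
Qed.

End PowerMeans.

(** * The integral of the shape function *)

Section ShapeIntegral.
Variables (R : realType) (m1 : nat) (p : \bar R).
Hypotheses (m1p : (0 < m1)%N) (p1 : (1 <= p)%E).
Local Notation m := m1.+1.
Notation mu := (@plane_measure R).
Implicit Types (t u : tri R) (z w : pt R).
Local Notation iq := (iq m1 p).
Local Notation Kr := (Kr m1 p).
Local Notation Kn := (Kn m1 p).
Local Notation q := (iq^-1).

Variables (s0 : seq (tri R)) (f : pt R -> R) (D : nat -> nat -> pt R -> R).
Local Notation Om := ([set x | covers s0 x] : set (pt R)).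
Hypotheses (ms0 : mesh s0) (hD : partial_derivatives m Om f D).
Local Notation ac := (ac m1 D).
Local Notation has_tile n := (exists t : tri R, [/\ nd t, ar t = 1 & wide (n : nat)%:R t]).

Let ns0 t : t \in s0 -> nd t. Proof. by have [+ _] := ms0; apply. Qed.
Let mOm : measurable (Om : set (plane R)). Proof. by have [] := measurable_covers ns0. Qed.
Let fOm : (mu (Om : set (plane R)) < +oo)%E. Proof. by have [] := measurable_covers ns0. Qed.

Lemma q01 : 0 < q <= 1.
Proof. by rewrite invr_gt0 iq_gt0//= invf_le1 ?iq_ge1// iq_gt0. Qed.

Lemma q_gt0 : 0 < q.
Proof. by have /andP[] := q01. Qed.

Lemma Kn_unif n (e : R) : has_tile n -> 0 < e -> exists2 d, 0 < d & forall z w, Om z -> Om w ->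
  near d z w -> `|Kn n (ac w) - Kn n (ac z)| <= e.
Proof.
move=> tn e0; pose L := Lam R m1 * (m.+1%:R * n%:R ^+ m).
have L0 : 0 <= L by rewrite !mulr_ge0 ?exprn_ge0//; exact: le_trans ler01 (Lam_ge1 _ _).
have L1 : 0 < L + 1 by lra.
have e1 : 0 < e / (L + 1) by rewrite divr_gt0.
have [d d0 H] := ac_unif ms0 hD e1; exists d => // z w Oz Ow zw.
have le : Lam R m1 * (m.+1%:R * (e / (L + 1) * n%:R ^+ m)) <= e.
  have -> : Lam R m1 * (m.+1%:R * (e / (L + 1) * n%:R ^+ m)) = L * (e / (L + 1)) by rewrite /L; ring.
  apply: (@le_trans _ _ ((L + 1) * (e / (L + 1)))); first by rewrite ler_wpM2r ?(ltW e1)//; lra.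
  by rewrite mulrC divfK// gt_eqF.
have S x y : (forall k, (k <= m)%N -> `|ac x k - ac y k| <= e / (L + 1)) -> Kn n (ac x) <= Kn n (ac y) + e.
  by move=> /(Kn_lip m1p p1 tn) h; apply: (le_trans h); rewrite lerD2l.
have h1 : Kn n (ac w) <= Kn n (ac z) + e by apply: S => k km; have [] := H z w Oz Ow zw k km.
have h2 : Kn n (ac z) <= Kn n (ac w) + e.
  by apply: S => k km; have [_] := H z w Oz Ow zw k km; rewrite distrC.
by rewrite ler_norml; apply/andP; split; lra.
Qed.

Lemma Kn_cont n : has_tile n -> cont_on Om (fun z => Kn n (ac z)).
Proof.
move=> tn z Oz e e0; have [|d d0 H] := @Kn_unif n (e / 2) tn; first by rewrite divr_gt0.
by exists d => // w Ow zw; apply: le_lt_trans (H z w Oz Ow zw) _; lra.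
Qed.

Lemma has_tileW n n' : (n <= n')%N -> has_tile n -> has_tile n'.
Proof.
move=> nn [t [n1 n2 w]]; exists t; split=> // x y xt yt; have [h1 h2] := w x y xt yt.
by split; [apply: (le_trans h1)|apply: (le_trans h2)]; rewrite ler_nat.
Qed.

(** A pointwise limit of the continuous functions given by [Kn]; no continuity of the shape function
    itself is claimed. *)
Lemma Kr_meas : measurable_fun (Om : set (plane R)) (fun z => Kr (ac z)).
Proof.
have [n0 [t0 ht0]] := tile_ex R; have tn0 : has_tile n0 by exists t0.
apply: (@measurable_fun_cvg _ _ _ _ (fun n z => Kn (n0 + n) (ac z))).
  move=> n; apply: measurable_cont => //; apply: Kn_cont; apply: has_tileW tn0; exact: leq_addr.
move=> z Oz; apply/cvgrPdist_le => e e0; have [N HN] := Kn_cvg m1 p (ac z) e0.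
exists N => // n /= Nn; have tn : has_tile (n0 + n) by apply: has_tileW tn0; exact: leq_addr.
have h1 := HN (n0 + n)%N (leq_trans Nn (leq_addl _ _)); have h2 := Kr_le_Kn m1 p (ac z) tn.
by rewrite ler_norml; apply/andP; split; lra.
Qed.

Lemma measurable_powq (g : plane R -> R) : measurable_fun (Om : set (plane R)) g ->
  measurable_fun (Om : set (plane R)) (fun z => (g z `^ q)%:E).
Proof. by move=> mg; apply/measurable_EFinP; apply: (measurableT_comp (measurable_powR _)). Qed.

Lemma Kn_bound n0 : has_tile n0 -> exists2 B, 0 <= B & forall n z, (n0 <= n)%N -> Om z -> Kn n (ac z) <= B.
Proof.
move=> tn; have [B B0 H] := cont_bounded ns0 (Kn_cont tn); exists B => // n z nn Oz.
by apply: le_trans (Kn_mono m1 p (ac z) tn nn) _; apply: le_trans (ler_norm _) (H z Oz).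
Qed.

(** The right-hand side of the theorem to the power [q]; it is additive over the domain. *)
Definition J : R := fine (\int[mu]_(z in Om) (Kr (ac z) `^ q)%:E)%E.

Lemma int_bound (g : plane R -> R) (B : R) : measurable_fun (Om : set (plane R)) g -> 0 <= B ->
  (forall z, Om z -> 0 <= g z <= B) -> (\int[mu]_(z in Om) (g z `^ q)%:E < +oo)%E.
Proof.
move=> mg B0 H; apply: (@le_lt_trans _ _ (\int[mu]_(z in Om) (cst (B `^ q)%:E z))%E).
  apply: ge0_le_integral => //.
  - by move=> z _; rewrite lee_fin powR_ge0.
  - exact: measurable_powq.
  - move=> z /H/andP[h1 h2]; rewrite lee_fin; apply: ge0_ler_powR; rewrite ?nnegrE//.
    exact: ltW q_gt0.
rewrite integral_cst// -ge0_fin_numE; last by rewrite mule_ge0// lee_fin powR_ge0.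
by rewrite fin_numM// ge0_fin_numE.
Qed.

Lemma JE : (\int[mu]_(z in Om) (Kr (ac z) `^ q)%:E)%E = J%:E.
Proof.
have [n0 [t0 ht0]] := tile_ex R; have tn0 : has_tile n0 by exists t0.
have [B B0 HB] := Kn_bound tn0.
rewrite fineK// ge0_fin_numE; last by apply: integral_ge0 => z _; rewrite lee_fin powR_ge0.
apply: int_bound Kr_meas B0 _ => z Oz; rewrite Kr_ge0//=.
by apply: le_trans (Kr_le_Kn m1 p (ac z) tn0) (HB _ _ (leqnn _) Oz).
Qed.

Lemma J_ge0 : 0 <= J.
Proof. by rewrite -lee_fin -JE; apply: integral_ge0 => z _; rewrite lee_fin powR_ge0. Qed.

(** Dominated convergence: [Kn] decreases to [Kr] and is bounded on the domain by its first member.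
    The convergence of the powers [q] comes from subadditivity. *)
Lemma J_approx (e : R) : 0 < e -> exists2 n, has_tile n &
  (\int[mu]_(z in Om) (Kn n (ac z) `^ q)%:E <= (J + e)%:E)%E.
Proof.
move=> e0; have [n0 [t0 ht0]] := tile_ex R; have tn0 : has_tile n0 by exists t0.
have tn n : has_tile (n0 + n) by apply: has_tileW tn0; exact: leq_addr.
have [B B0 HB] := Kn_bound tn0.
have mK n : measurable_fun (Om : set (plane R)) (fun z => Kn (n0 + n) (ac z)).
  by apply: measurable_cont => //; exact: Kn_cont.
have H1 n : measurable_fun (Om : set (plane R)) (fun z => (Kn (n0 + n) (ac z) `^ q)%:E).
  exact: measurable_powq.
have H2 (z : plane R) : Om z ->
    (Kn (n0 + n) (ac z) `^ q)%:E @[n --> \oo] --> (Kr (ac z) `^ q)%:E.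
  move=> Oz; apply: cvg_EFin; first by apply: nearW.
  apply/cvgrPdist_le => d d0; have dq : 0 < d `^ iq by rewrite powR_gt0.
  have [N HN] := Kn_cvg m1 p (ac z) dq; exists N => // n /= Nn.
  have h1 := HN (n0 + n)%N (leq_trans Nn (leq_addl _ _)); have h2 := Kr_le_Kn m1 p (ac z) (tn n).
  have k0 := Kr_ge0 m1 p (ac z) : 0 <= Kr (ac z); have kn0 := Kn_ge0 m1 p (n0 + n) (ac z).
  have h3 : Kr (ac z) `^ q <= Kn (n0 + n) (ac z) `^ q.
    by apply: ge0_ler_powR; rewrite ?nnegrE//; exact: ltW q_gt0.
  have h4 : Kn (n0 + n) (ac z) `^ q <= Kr (ac z) `^ q + d.
    have dE : d = (d `^ iq) `^ q by rewrite -powRrM mulfV ?gt_eqF ?iq_gt0// powRr1// ltW.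
    rewrite [X in _ + X]dE; apply: le_trans (powD k0 (ltW dq) q01).
    by apply: ge0_ler_powR; rewrite ?nnegrE ?addr_ge0 ?(ltW dq) ?(ltW q_gt0).
  by rewrite ler_norml; apply/andP; split; lra.
have H3 (z : plane R) : Om z -> cst (B `^ q)%:E z \is a fin_num by [].
have H4 : mu.-integrable (Om : set (plane R)) (cst (B `^ q)%:E).
  apply/integrableP; split; first exact: measurable_cst.
  rewrite (_ : (fun x => `|cst (B `^ q)%:E x|%E) = cst (B `^ q)%:E); last first.
    by apply/funext => x /=; rewrite ger0_norm ?powR_ge0.
  rewrite integral_cst// -ge0_fin_numE; last by rewrite mule_ge0// lee_fin powR_ge0.
  by rewrite fin_numM// ge0_fin_numE.
have H5 n (z : plane R) : Om z -> (`|(Kn (n0 + n) (ac z) `^ q)%:E| <= cst (B `^ q)%:E z)%E.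
  move=> Oz /=; rewrite lee_fin ger0_norm ?powR_ge0//; apply: ge0_ler_powR;
    rewrite ?nnegrE ?(ltW q_gt0) ?Kn_ge0//.
  by apply: HB => //; exact: leq_addr.
have := dominated_cvg mOm H1 H2 H3 H4 H5; rewrite JE.
move=> /fine_cvgP[fin /cvgrPdist_le /(_ e e0) cv].
have [N _ HN] := filterI fin cv; have [f1 f2] := HN N (leqnn N); exists (n0 + N)%N => //.
move: f2 => /=; rewrite ler_norml => /andP[f2 _].
rewrite -(fineK f1) lee_fin; move: f2; rewrite /=; set F := fine _; lra.
Qed.

Lemma norm_shape (P : pt R -> {poly {poly R}}) : (forall z, poly_fun (P z) =1 hp m1 (ac z)) ->
  LpNorm q%:E Om (fun z => shape_function m p (P z)) = (J `^ iq)%:E.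
Proof.
move=> HP; have -> : (fun z => shape_function m p (P z)) = EFin \o (fun z => Kr (ac z)).
  by apply/funext => z /=; apply: shapeE.
have q0 : q != 0 by rewrite gt_eqF// q_gt0.
rewrite -/(Nt q%:E Om _) (Nt_fin_pE erefl mOm Kr_meas q0).
have -> : (\int[mu]_(z in Om) (`|Kr (ac z)| `^ q)%:E = J%:E)%E.
  by rewrite -JE; apply: eq_integral => z _; rewrite ger0_norm// Kr_ge0.
by rewrite poweR_EFin invrK.
Qed.

End ShapeIntegral.

(** * The lower bound *)

Section Bounds.
Variables (R : realType) (m1 : nat) (p : \bar R).
Hypotheses (m1p : (0 < m1)%N) (p1 : (1 <= p)%E).
Local Notation m := m1.+1.
Notation mu := (@plane_measure R).
Implicit Types (t u : tri R) (z w : pt R).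
Local Notation en := (en m1 p).
Local Notation hp := (hp m1).
Local Notation iq := (iq m1 p).
Local Notation Kr := (Kr m1 p).
Local Notation Kn := (Kn m1 p).
Local Notation q := (iq^-1).

Variables (s0 : seq (tri R)) (f : pt R -> R) (D : nat -> nat -> pt R -> R).
Local Notation Om := ([set x | covers s0 x] : set (pt R)).
Hypotheses (ms0 : mesh s0) (hD : partial_derivatives m Om f D).
Local Notation ac := (ac m1 D).
Local Notation J := (J m1 p s0 D).
Local Notation er := (er m1 p).

Let ns0 t : t \in s0 -> nd t. Proof. by have [+ _] := ms0; apply. Qed.
Let mOm : measurable (Om : set (plane R)). Proof. by have [] := measurable_covers ns0. Qed.
Let fOm : (mu (Om : set (plane R)) < +oo)%E. Proof. by have [] := measurable_covers ns0. Qed.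

Lemma powq_iq (x : R) : 0 <= x -> (x `^ q) `^ iq = x.
Proof. by move=> x0; rewrite -powRrM mulVf ?gt_eqF ?iq_gt0// powRr1. Qed.

Lemma powiq_q (x : R) : 0 <= x -> (x `^ iq) `^ q = x.
Proof. by move=> x0; rewrite -powRrM mulfV ?gt_eqF ?iq_gt0// powRr1. Qed.

Lemma ler_powq (x y : R) : 0 <= x -> x <= y -> x `^ q <= y `^ q.
Proof.
by move=> x0 xy; apply: ge0_ler_powR; rewrite ?nnegrE ?(ltW (q_gt0 _ p1)) ?(le_trans x0 xy).
Qed.

Lemma ler_powiq (x y : R) : 0 <= x -> x <= y -> x `^ iq <= y `^ iq.
Proof.
by move=> x0 xy; apply: ge0_ler_powR; rewrite ?nnegrE ?(ltW (iq_gt0 _ p1)) ?(le_trans x0 xy).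
Qed.

Lemma er_ge0 (d w : R) : 0 <= w -> 0 <= er d w.
Proof. by move=> w0; rewrite !mulr_ge0 ?powR_ge0//; exact: le_trans ler01 (Lam_ge1 _ _). Qed.

(** At every point of [t], K times the area to the power 1/q is at most the error plus [er]. Raised
    to the power [q] and divided by the area, this bounds the integrand by a constant. *)
Lemma integral_tile t (d w : R) : nd t -> bdy t `<=` Om -> wide d t -> 0 <= w ->
  (forall k, (k <= m)%N -> forall z z', inT t z -> inT t z' -> `|D k (m - k)%N z - D k (m - k)%N z'| <= w) ->
  (\int[mu]_(z in bdy t) (Kr (ac z) `^ q)%:E <= (en t f `^ q + er d w `^ q)%:E)%E.
Proof.
move=> n tO wt w0 osc; have a0 := ar_gt0 n; have mt := measurable_bdy n.
set E := en t f + er d w; have E0 : 0 <= E by rewrite addr_ge0 ?en_ge0 ?er_ge0.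
apply: (@le_trans _ _ (E `^ q)%:E); last by rewrite lee_fin powD ?en_ge0 ?er_ge0// q01.
apply: (@le_trans _ _ (\int[mu]_(z in bdy t) cst (E `^ q / ar t)%:E z)%E); last first.
  have := integral_cst mu mt (E `^ q / ar t)%:E.
  rewrite [X in _ = (_ * X)%E](arE n) -EFinM divfK ?gt_eqF// => ->.
  exact: lexx.
apply: ge0_le_integral => //.
- by move=> z _; rewrite lee_fin powR_ge0.
- by apply: measurable_funS (measurable_powq _ _ (Kr_meas m1p p1 ms0 hD)).
move=> z tz; rewrite lee_fin ler_pdivlMr//.
have [_ h2] := @local_poly R m1 p m1p p1 s0 f D ms0 hD t d w (fun k => D k (m - k)%N z) n tO wt w0
  (fun k km z' tz' => osc k km z' z tz' tz).
have h1 := le_trans (Kr_scale m1p p1 (ac z) n) h2.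
have K0 := Kr_ge0 m1 p (ac z).
have := ler_powq (mulr_ge0 K0 (powR_ge0 _ _)) h1.
by rewrite powRM ?powR_ge0// powiq_q// ltW.
Qed.

Lemma pow_half (N : nat) : (0 < N)%N -> (N%:R `^ (- 2^-1)) ^+ 2 = N%:R^-1 :> R.
Proof.
move=> N0; rewrite -powR_mulrn ?powR_ge0// -powRrM mulNr mulVf ?pnatr_eq0//.
by rewrite powR_inv1.
Qed.

Lemma half_lt (C d : R) : 0 < C -> 0 < d -> exists2 N1 : nat, (0 < N1)%N & forall N, (N1 <= N)%N ->
  C * N%:R `^ (- 2^-1) < d.
Proof.
move=> C0 d0; exists (Num.truncn ((C / d) ^+ 2)).+1 => // N N1.
have N0 : (0 < N)%N by apply: leq_trans N1.
have Np : 0 < N%:R :> R by rewrite ltr0n.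
rewrite -(@ltr_pXn2r _ 2) ?nnegrE ?mulr_ge0 ?powR_ge0 ?(ltW C0) ?(ltW d0)//.
rewrite exprMn pow_half// ltr_pdivrMr// mulrC -ltr_pdivrMr ?exprn_gt0// -expr_div_n.
by apply: lt_le_trans (truncnS_gt _) _; rewrite ler_nat.
Qed.

Lemma lower_raw (C eta : R) : 0 < C -> 0 < eta -> exists N1, forall N, (N1 <= N)%N ->
  forall s : seq (tri R), (forall t, t \in s -> [/\ nd t, wide (C * N%:R `^ (- 2^-1)) t & bdy t `<=` Om]) ->
  size s = N -> (forall x, Om x -> covers s x) ->
  J <= \sum_(t <- s) en t f `^ q + eta.
Proof.
move=> C0 e0; have L0 : 0 < Lam R m1 by exact: lt_le_trans ltr01 (Lam_ge1 _ _).
have C2 : 0 < 4 * C ^+ 2 by rewrite mulr_gt0// exprn_gt0.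
(* Chosen so that the [N] remainders, each to the power [q], add up to exactly [eta], independently
   of [N]; the modulus of continuity of the derivatives then fixes [N1]. *)
pose w := (eta / (4 * C ^+ 2)) `^ iq / Lam R m1.
have w0 : 0 < w by rewrite divr_gt0// powR_gt0// divr_gt0.
have [d d0 osc] := ac_unif ms0 hD w0; have [N1 N10 HN] := half_lt C0 d0.
exists N1 => N NN s hs sN cs; have N0 : (0 < N)%N by apply: leq_trans NN.
set dN := C * _ in hs; have dd := HN N NN; rewrite -/dN in dd.
have ns t : t \in s -> nd t by move=> /hs[].
have cO : [set x | covers s x] = Om.
  by apply/seteqP; split=> x; [move=> [t /hs[_ _ tO] tx]; exact: tO|exact: cs].
have erE : N%:R * er dN w `^ q = eta.
  have dN2 : (2 * dN) ^+ 2 = 4 * C ^+ 2 / N%:R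
    by rewrite /dN mulrA exprMn pow_half// exprMn; congr (_ * _ / _); ring.
  rewrite /(er _ _) dN2 /w [Lam R m1 * _]mulrC divfK ?gt_eqF//.
  have h1 : 0 <= eta / (4 * C ^+ 2) by rewrite divr_ge0// ltW.
  have h2 : 0 <= 4 * C ^+ 2 / N%:R by rewrite divr_ge0// ltW.
  rewrite -(powRM _ h1 h2) (powiq_q (mulr_ge0 h1 h2)).
  by field; rewrite pnatr_eq0 -lt0n N0 gt_eqF.
rewrite -erE -lee_fin -(JE m1p p1 ms0 hD) -cO.
apply: (le_trans (integral_covers ns _ _)).
- by rewrite cO; exact: measurable_powq _ _ (Kr_meas m1p p1 ms0 hD).
- by move=> z _; rewrite lee_fin powR_ge0.
have -> : \sum_(t <- s) en t f `^ q + N%:R * er dN w `^ q = \sum_(t <- s) (en t f `^ q + er dN w `^ q).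
  by rewrite big_split /= -sN big_const_seq count_predT iter_addr addr0 mulr_natl.
rewrite -sumEFin big_seq [leRHS]big_seq; apply: lee_sum => t ts; have [n wt tO] := hs t ts.
apply: (integral_tile n tO wt (ltW w0)) => k km z z' tz tz'.
have [h1 h2] := wide_inT wt tz tz'.
have [] // := osc z' z (tO _ tz') (tO _ tz) _ k km.
by split; apply: le_lt_trans dd.
Qed.

End Bounds.

(** * The upper bound *)

Section UpperBound.
Variables (R : realType) (m1 : nat) (p : \bar R).
Hypotheses (m1p : (0 < m1)%N) (p1 : (1 <= p)%E).
Local Notation m := m1.+1.
Notation mu := (@plane_measure R).
Implicit Types (t u : tri R) (z w : pt R).
Local Notation en := (en m1 p).
Local Notation hp := (hp m1).
Local Notation iq := (iq m1 p).
Local Notation Kr := (Kr m1 p).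
Local Notation Kn := (Kn m1 p).
Local Notation q := (iq^-1).

Variables (s0 : seq (tri R)) (f : pt R -> R) (D : nat -> nat -> pt R -> R).
Local Notation Om := ([set x | covers s0 x] : set (pt R)).
Hypotheses (ms0 : mesh s0) (hD : partial_derivatives m Om f D).
Local Notation ac := (ac m1 D).
Local Notation J := (J m1 p s0 D).
Local Notation er := (er m1 p).

Let ns0 t : t \in s0 -> nd t. Proof. by have [+ _] := ms0; apply. Qed.
Let mOm : measurable (Om : set (plane R)). Proof. by have [] := measurable_covers ns0. Qed.
Let fOm : (mu (Om : set (plane R)) < +oo)%E. Proof. by have [] := measurable_covers ns0. Qed.

Local Notation has_tile n := (exists t : tri R, [/\ nd t, ar t = 1 & wide (n : nat)%:R t]).

Lemma half_sum (a b e : R) : 0 < e -> a < b + e / 2 -> a + e / 2 + e / 2 <= b + 2 * e.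
Proof. by lra. Qed.

(** The added [2 * e] and the oscillation [e] make up [3 * e], which subadditivity of the power [q]
    splits off the integral. *)
Lemma riemann bs n (e : R) : has_tile n -> 0 < e -> mesh bs -> (forall x, covers bs x <-> Om x) ->
  (forall B z, B \in bs -> inT B z -> Kn n (ac B.1.1) <= Kn n (ac z) + e) ->
  ((\sum_(B <- bs) ar B * (Kn n (ac B.1.1) + 2 * e) `^ q)%:E <=
   \int[mu]_(z in Om) (Kn n (ac z) `^ q)%:E + ((3 * e) `^ q)%:E * mu (Om : set (plane R)))%E.
Proof.
move=> tn e0 mb cb osc; have e3 : 0 <= 3 * e by rewrite mulr_ge0// ltW.
have mK : measurable_fun (Om : set (plane R)) (fun z => (Kn n (ac z) `^ q)%:E).
  by apply: measurable_powq; apply: measurable_cont => //; exact: Kn_cont hD _ tn.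
have mG : measurable_fun (Om : set (plane R)) (fun z => (Kn n (ac z) `^ q)%:E + cst ((3 * e) `^ q)%:E z)%E.
  exact: emeasurable_funD.
have bO B : B \in bs -> bdy B `<=` Om by move=> Bb x Bx; apply/cb; exists B.
have [nb _] := mb.
rewrite -(integral_cst mu mOm) -ge0_integralD//; last 2 first.
- by move=> z _; rewrite lee_fin powR_ge0.
- by move=> z _; rewrite lee_fin powR_ge0.
apply: le_trans (mesh_integral mb mOm bO mG _); last first.
  by move=> z _; rewrite adde_ge0// lee_fin powR_ge0.
rewrite -sumEFin big_seq [leRHS]big_seq; apply: lee_sum => B Bb.
have mB := measurable_bdy (nb B Bb).
have -> : (ar B * (Kn n (ac B.1.1) + 2 * e) `^ q)%:E =
    (\int[mu]_(z in bdy B) cst ((Kn n (ac B.1.1) + 2 * e) `^ q)%:E z)%E.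
  apply: esym; apply: (etrans (integral_cst mu mB ((Kn n (ac B.1.1) + 2 * e) `^ q)%:E)).
  by rewrite [X in (_ * X)%E](arE (nb B Bb)) -EFinM mulrC.
apply: ge0_le_integral => //.
- by move=> z _; rewrite lee_fin powR_ge0.
- by apply: measurable_funS mG => //; exact: bO.
move=> z Bz; rewrite -EFinD lee_fin; have K0 := Kn_ge0 m1 p n (ac z).
apply: le_trans (powD K0 e3 (q01 m1p p1)); apply: ler_powq => //.
  by rewrite addr_ge0 ?Kn_ge0// mulr_ge0// ltW.
by have := osc B z Bb Bz; lra.
Qed.

Lemma er_scale (l d w : R) : er (`|l| * d) w = er d w * (l ^+ 2) `^ iq.
Proof.
have E : (2 * (`|l| * d)) ^+ 2 = (2 * d) ^+ 2 * l ^+ 2.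
  by rewrite -[in RHS](real_normK (num_real l)); ring.
by rewrite /(er _ _) E powRM ?sqr_ge0// mulrA.
Qed.

Lemma small_er (d M e : R) : 0 <= M -> 0 < e -> exists2 w, 0 < w & er d w <= e.
Proof.
move=> M0 e0; set c := Lam R m1 * ((2 * d) ^+ 2) `^ iq.
have c0 : 0 <= c by rewrite mulr_ge0 ?powR_ge0//; exact: le_trans ler01 (Lam_ge1 _ _).
have c1 : 0 < c + 1 by lra.
exists (e / (c + 1)); first by rewrite divr_gt0.
have -> : er d (e / (c + 1)) = c * (e / (c + 1)) by rewrite /(er _ _) /c; ring.
apply: (@le_trans _ _ ((c + 1) * (e / (c + 1)))); first by rewrite ler_wpM2r ?divr_ge0 ?ltW//; lra.
by rewrite mulrC divfK// gt_eqF.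
Qed.

Lemma small_tau (M : R) : 0 <= M -> exists2 x, 0 < x & forall y, 0 <= y <= x -> er y M <= 1.
Proof.
move=> M0; set c := Lam R m1 * M.
have c0 : 0 <= c by rewrite mulr_ge0//; exact: le_trans ler01 (Lam_ge1 _ _).
have c1 : 0 < c + 1 by lra.
pose g := (c + 1)^-1 `^ q; have g0 : 0 < g by rewrite powR_gt0 ?invr_gt0.
exists (Num.sqrt g / 2); first by rewrite divr_gt0 ?sqrtr_gt0.
move=> y /andP[y0 yg]; rewrite /(er _ _) -/c.
have h : (2 * y) ^+ 2 <= g.
  rewrite -[leRHS]sqr_sqrtr ?(ltW g0)// lerXn2r ?nnegrE ?sqrtr_ge0 ?mulr_ge0//; lra.
have h2 : ((2 * y) ^+ 2) `^ iq <= (c + 1)^-1.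
  apply: (@le_trans _ _ (g `^ iq)); first by apply: ler_powiq => //; rewrite sqr_ge0.
  by rewrite /g powq_iq// invr_ge0 ltW.
apply: (@le_trans _ _ ((c + 1) * (c + 1)^-1)); last by rewrite divff// gt_eqF.
by apply: ler_pM => //; rewrite ?powR_ge0//; lra.
Qed.

Lemma wide_list (s : seq (tri R)) : exists d : R, forall t, t \in s -> wide d t.
Proof.
elim: s => [|t s [d hd]]; first by exists 0.
have [d' _ wt] := wide_ex t; exists (Num.max d d') => u; rewrite in_cons => us x y xu yu.
have [d1 d2] : d <= Num.max d d' /\ d' <= Num.max d d' by rewrite !le_max !lexx orbT.
case/predU1P: us => [E|us]; last by have [h1 h2] := hd u us x y xu yu; split; apply: le_trans d1.
by rewrite E in xu yu; have [h1 h2] := wt x y xu yu; split; apply: le_trans d2.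
Qed.

Lemma powN_le (x y a : R) : 0 < x -> x <= y -> 0 <= a -> y `^ (- a) <= x `^ (- a).
Proof.
move=> x0 xy a0; have y0 := lt_le_trans x0 xy.
rewrite !powRN lef_pV2 ?posrE ?powR_gt0//.
by apply: ge0_ler_powR; rewrite ?nnegrE ?(ltW x0) ?(ltW y0).
Qed.

Lemma wide_le (d d' : R) t : d <= d' -> wide d t -> wide d' t.
Proof. by move=> dd w x y xt yt; have [h1 h2] := w x y xt yt; split; apply: le_trans dd. Qed.

Lemma wide_sub (d : R) t u : wide d t -> sub u t -> wide d u.
Proof. by move=> w ut x y /ut xt /ut yt; exact: wide_inT w xt yt. Qed.

(** The cells and the shapes [TB B] are fixed before [N]; only the scale [h] depends on [N]. All
    three kinds of triangles are shown to have error at most (h ^ 2) ^ (1/q), and h ^ 2 = (J +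
    delta) / N. *)
Lemma upper_raw (delta : R) : s0 != [::] -> 0 < delta -> exists (N0 : nat) (C : R), [/\ (0 < N0)%N, 0 < C &
  forall N, (N0 <= N)%N -> exists s, [/\ mesh s, nohang s, size s = N,
    forall x, covers s x <-> Om x & forall u, u \in s ->
      wide (C * N%:R `^ (- 2^-1)) u /\ en u f <= ((J + delta) / N%:R) `^ iq]].
Proof.
move=> sn0 dl0; have d3 : 0 < delta / 3 by rewrite divr_gt0.
have [n tn Jn] := J_approx m1p p1 ms0 hD d3.
have [M M0 HM] := ac_bound ms0 hD.
have [Kb Kb0 HK] := Kn_bound m1p p1 ms0 hD tn.
set mO := fine (mu (Om : set (plane R))).
have mOE : mu (Om : set (plane R)) = mO%:E by rewrite fineK// ge0_fin_numE.
have mO0 : 0 <= mO by exact: fine_ge0.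
(* One third of [delta] pays for bounding the diameter of the tiles, one third for the term (3e) ^ q
   in the Riemann sum, and the last third makes the final inequality strict. *)
pose e := (delta / 3 / (mO + 1)) `^ iq / 3.
have mO1 : 0 < mO + 1 by lra.
have e0 : 0 < e by rewrite divr_gt0// powR_gt0// divr_gt0.
have e3 : (3 * e) `^ q * mO <= delta / 3.
  have -> : 3 * e = (delta / 3 / (mO + 1)) `^ iq by rewrite /e mulrC divfK// pnatr_eq0.
  rewrite powiq_q//; last by rewrite divr_ge0// ltW.
  apply: (@le_trans _ _ (delta / 3 / (mO + 1) * (mO + 1))); last by rewrite divfK// gt_eqF.
  by apply: ler_wpM2l; [rewrite divr_ge0// ltW|rewrite lerDl].
have e2 : 0 < e / 2 by rewrite divr_gt0.
have n0 : 0 < n%:R :> R.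
  by have [t [nt _ wt]] := tn; exact: wide_gt0 nt wt.
have [w w0 Hw] := small_er n%:R M0 e2.
have [ds ds0 Hs] := sliver_tile m1p p1 n e2 M0.
have [tw tw0 Htw] := small_tau M0.
have [d1 d10 H1] := ac_unif ms0 hD w0.
have [d2 d20 H2] := Kn_unif m1p p1 ms0 hD tn e0.
pose dd := Num.min d1 d2 / 2; have dd0 : 0 < dd by rewrite divr_gt0// lt_min d10.
have [d11 d22] : dd < d1 /\ dd < d2.
  have h : dd < Num.min d1 d2 by rewrite ltr_pdivrMr// ltr_pMr ?ltr1n// lt_min d10.
  by move: h; rewrite lt_min => /andP[].
have [d0 hd] := wide_list s0.
have [bs [mb cb wb]] := mesh_subdiv ms0 hd dd0.
have [nb _] := mb.
have b0 : bs != [::].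
  case: (s0) sn0 cb => // t l _ cb; have : covers bs t.1.1.
    by apply/cb; exists t; [exact: mem_head|apply: inT_mem; rewrite in_cons eqxx].
  by case: (bs) => // -[].
have bO B : B \in bs -> bdy B `<=` Om by move=> Bb x Bx; apply/cb; exists B.
have zB (B : tri R) : inT B B.1.1 by apply: inT_mem; rewrite in_cons eqxx.
have osc (B : tri R) z : B \in bs -> inT B z -> near d1 B.1.1 z /\ near d2 B.1.1 z.
  move=> Bb Bz; have [h1 h2] := wide_inT (wb B Bb) Bz (zB B).
  by split; split; [apply: le_lt_trans d11|apply: le_lt_trans d11|apply: le_lt_trans d22|apply: le_lt_trans
    d22].
have [TB HTB] := choice (fun B : tri R => Kn_near m1 p (ac B.1.1) tn e2).
(* The margin [2 * e] keeps [kap] positive where K vanishes and covers three errors of e / 2: a tile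
   that is only nearly optimal, the sliver estimate and the Taylor remainder. *)
pose kap (B : tri R) := Kn n (ac B.1.1) + 2 * e.
have ee : 0 < 2 * e by rewrite mulr_gt0.
have kap_ge B : 2 * e <= kap B by rewrite lerDr Kn_ge0.
have kap0 B : 0 < kap B by exact: lt_le_trans (kap_ge B).
have qh : 0 <= q / 2 by rewrite divr_ge0// ltW// q_gt0.
(* Equidistribution: a tile of area h ^ 2 * kap ^ -q has error about (h ^ 2) ^ (1/q), the same in
   all cells, and the number of tiles becomes a Riemann sum for [J]. *)
pose rho B := kap B `^ (- (q / 2)).
have rho0 B : 0 < rho B by rewrite powR_gt0.
have rho2 B : rho B ^+ 2 = (kap B `^ q)^-1.
  rewrite -powR_mulrn ?powR_ge0// -powRrM -powRN; congr (_ `^ _).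
  by rewrite mulNr divfK// pnatr_eq0.
have rhoq B : (rho B ^+ 2) `^ iq = (kap B)^-1.
  by rewrite rho2 -powRN -powRrM mulNr mulVf ?gt_eqF ?iq_gt0// powR_inv1// ltW.
(* Bounds on [rho] that do not depend on the cell: the upper one gives the diameter constant, the
   lower one the sliver width relative to the tile. *)
pose rmax := (2 * e) `^ (- (q / 2)); pose rmin := (Kb + 2 * e) `^ (- (q / 2)).
have rM B : rho B <= rmax by exact: powN_le.
have rm0 : 0 < rmin by rewrite powR_gt0// ltr_wpDl.
have rm B : B \in bs -> rmin <= rho B.
  move=> Bb; apply: powN_le => //; rewrite lerD2r; apply: HK => //.
  by apply: (bO B Bb); exact: zB.
(* Small enough for the crude estimate on tiny triangles and for the sliver estimate after rescaling
   by [rho]. *)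
pose tau := Num.min tw (ds * rmin).
have tau0 : 0 < tau by rewrite lt_min tw0 mulr_gt0.
have sum : \sum_(B <- bs) ar B / rho B ^+ 2 < J + delta.
  rewrite (eq_bigr (fun B => ar B * kap B `^ q)); last by move=> B _; rewrite rho2 invrK.
  apply: (@le_lt_trans _ _ (J + delta / 3 + delta / 3)); last by lra.
  rewrite -lee_fin; apply: le_trans (riemann tn e0 mb cb _) _.
    move=> B z Bb Bz; have [_ h] := osc B z Bb Bz.
    have := H2 _ _ (bO B Bb _ (zB B)) (bO B Bb _ Bz) h; rewrite ler_norml => /andP[+ _]; lra.
  by rewrite [X in (_ * X)%E]mOE -EFinM EFinD leeD// lee_fin.
have tp B : B \in bs -> [/\ nd (TB B), ar (TB B) = 1, wide n%:R (TB B) & 0 < rho B].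
  by move=> _; have [] := HTB B.
have [N0 HN] := mesh_theorem mb b0 tp tau0 sum.
have J0 := J_ge0 m1p p1 ms0 hD.
have x0 : 0 < J + delta by rewrite ltr_wpDl.
have rM0 : 0 < rmax by rewrite powR_gt0.
exists (maxn N0 1), (Num.sqrt (J + delta) * (n%:R * rmax + tau)); split.
- by rewrite leq_max orbT.
- by rewrite mulr_gt0 ?sqrtr_gt0// addr_gt0// mulr_gt0.
move=> N; rewrite geq_max => /andP[NN Np]; have [s [ms nh cs sN cl]] := HN N NN Np.
have Nr : 0 < N%:R :> R by rewrite ltr0n.
have xN : 0 < (J + delta) / N%:R by rewrite divr_gt0.
set h := Num.sqrt _ in cl; have h0 : 0 < h by rewrite sqrtr_gt0.
have h2 : h ^+ 2 = (J + delta) / N%:R by rewrite sqr_sqrtr// ltW.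
have hE : h = Num.sqrt (J + delta) * N%:R `^ (- 2^-1).
  apply: (@pexpIrn _ 2) => //; rewrite ?nnegrE ?mulr_ge0 ?powR_ge0 ?sqrtr_ge0 ?(ltW h0)//.
  by rewrite h2 exprMn pow_half// sqr_sqrtr// ltW.
exists s; split=> //; first by move=> x; rewrite cs; exact: cb.
have [ns _] := ms.
move=> u us; have [B [Bb uB cases]] := cl u us; have nu := ns u us.
have uO : bdy u `<=` Om by move=> x ux; apply: (bO B Bb); exact: inT_sub uB ux.
have [nT aT wT eT] := HTB B; set T := TB B in nT aT wT eT cases.
have CE : Num.sqrt (J + delta) * (n%:R * rmax + tau) * N%:R `^ (- 2^-1) = h * (n%:R * rmax + tau).
  by rewrite hE; ring.
rewrite CE -h2.
have ocD k z : (k <= m)%N -> inT u z -> `|D k (m - k)%N z - D k (m - k)%N B.1.1| <= w.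
  move=> km uz; have Bz := inT_sub uB uz; have [h1 _] := osc B z Bb Bz.
  by have [] := H1 _ _ (bO B Bb _ (zB B)) (bO B Bb _ Bz) h1 k km.
have near_tile l c : `|l| = h * rho B -> sub u (htri l c T) ->
    [/\ l != 0, wide (h * (n%:R * rmax + tau)) u, (l ^+ 2) `^ iq * kap B = (h ^+ 2) `^ iq &
        en u f <= en u (hp (ac B.1.1)) + (l ^+ 2) `^ iq * (e / 2)].
  move=> lE uT; have l0 : l != 0 by rewrite -normr_gt0 lE mulr_gt0.
  have wu : wide (`|l| * n%:R) u by apply: wide_sub uT; exact: wide_htri.
  split=> //.
  - apply: wide_le wu; rewrite lE -mulrA ler_pM2l// mulrC.
    by apply: (@le_trans _ _ (n%:R * rmax)); [rewrite ler_pM2l|rewrite lerDl ltW].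
  - rewrite -(real_normK (num_real l)) lE exprMn powRM ?sqr_ge0// rhoq -mulrA mulVf ?mulr1//.
    by rewrite gt_eqF.
  have [h1 _] := @local_poly R m1 p m1p p1 s0 f D ms0 hD u (`|l| * n%:R) w (fun k => D k (m - k)%N B.1.1)
    nu uO wu (ltW w0) (fun k km z uz => ocD k z km uz).
  by apply: (le_trans h1); rewrite lerD2l er_scale mulrC ler_wpM2l ?powR_ge0.
have fin l (X : R) : (l ^+ 2) `^ iq * kap B = (h ^+ 2) `^ iq ->
  X <= (l ^+ 2) `^ iq * (en T (hp (ac B.1.1)) + e / 2) ->
    en u f <= X + (l ^+ 2) `^ iq * (e / 2) -> en u f <= (h ^+ 2) `^ iq.
  move=> <- h1 h3; apply: (le_trans h3);
    apply: (@le_trans _ _ ((l ^+ 2) `^ iq * (en T (hp (ac B.1.1)) + e / 2 + e / 2))).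
    by rewrite [in leRHS]mulrDr lerD2r.
  by apply: ler_wpM2l; [exact: powR_ge0|exact: half_sum].
case: cases => [[l [c [lE uE]]]|[l [c [v [a [lE uT vT aT' sl]]]]]|wu].
- have uT : sub u (htri l c T) by rewrite uE; exact: sub_refl.
  have [l0 wu kE h1] := near_tile l c lE uT; split=> //.
  apply: fin kE _ h1; rewrite uE; apply: le_trans (en_htri m1p p1 c _ l0 nT) _.
  by apply: ler_wpM2l; [exact: powR_ge0|rewrite lerDl ltW].
- have [l0 wu kE h1] := near_tile l c lE uT; split=> //.
  apply: fin kE _ h1; have aM k : (k <= m)%N -> `|ac B.1.1 k| <= M.
    by move=> km; have [] := HM _ (bO B Bb _ (zB B)) k km.
  have sl' : sliver (tau / rho B * `|l|) v a u.
    by have -> : tau / rho B * `|l| = tau * h by rewrite lE; field; rewrite gt_eqF.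
  apply: (Hs _ T u l (tau / rho B) c v a aM nT aT wT l0 nu uT vT aT' _ sl').
  apply/andP; split; first by rewrite divr_ge0// ltW.
  rewrite ler_pdivrMr//; apply: (@le_trans _ _ (ds * rmin)).
    by rewrite ge_min lexx orbT.
  by rewrite ler_pM2l// rm.
split.
  by apply: wide_le wu; rewrite mulrC ler_pM2l// lerDr mulr_ge0// ltW.
have hM k z : (k <= m)%N -> inT u z -> `|D k (m - k)%N z| <= M.
  by move=> km uz; have [] := HM z (uO z uz) k km.
have wu' : wide (`|h| * tau) u by rewrite (gtr0_norm h0) mulrC.
apply: le_trans (local_crude m1p p1 ms0 hD nu uO wu' M0 (fun k km z uz => hM k z km uz)) _.
rewrite er_scale -[leRHS]mul1r; apply: ler_wpM2r; first exact: powR_ge0.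
by apply: Htw; rewrite (ltW tau0) ge_min lexx.
Qed.

End UpperBound.

(** * From local to global errors *)

Section GlobalError.
Variables (R : realType) (m1 : nat) (p : \bar R).
Hypotheses (m1p : (0 < m1)%N) (p1 : (1 <= p)%E).
Local Notation m := m1.+1.
Local Notation iq := (iq m1 p).
Local Notation q := (iq^-1).

Definition gl (N : nat) (e : 'I_N -> R) : R :=
  match p with
  | r%:E => (\sum_(i < N) e i `^ r) `^ r^-1
  | _ => \big[Num.max/0]_(i < N) e i
  end.

Lemma global_errorE N (T : 'I_N -> triangle R) (v : pt R -> R) (e : 'I_N -> R) :
  (forall i, local_error m (T i) v p = (e i)%:E) -> global_error m T v p = (gl e)%:E.
Proof.
move=> he; have [pE|[r pE _]] := p_cases p1; rewrite /global_error /gl pE.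
  rewrite -EFin_bigmax; apply: eq_bigr => i _; by rewrite -pE he.
rewrite (eq_bigr (fun i => (e i `^ r)%:E)); first by rewrite sumEFin poweR_EFin.
by move=> i _; rewrite -pE he poweR_EFin.
Qed.

Lemma gl_ge0 N (e : 'I_N -> R) : 0 <= gl e.
Proof.
have [pE|[r pE _]] := p_cases p1; rewrite /gl pE ?powR_ge0//.
by elim/big_rec: _ => // i x _ x0; rewrite le_max x0 orbT.
Qed.

Lemma iqE r : p = r%:E -> 1 <= r -> iq = m%:R / 2 + r^-1.
Proof. by move=> pE r1; rewrite -[iq]/(m%:R / 2 + ip p) /ip pE inver gt_eqF//; apply: lt_le_trans r1. Qed.

(** Comparison of the means of exponents q < p: the power of [N] is 1/q - 1/p = m/2. For infinite p
    the mean of exponent p is the maximum. *)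
Lemma gl_lower N (e : 'I_N -> R) : (0 < N)%N -> (forall i, 0 <= e i) ->
  (\sum_(i < N) e i `^ q) `^ iq <= N%:R `^ (m%:R / 2) * gl e.
Proof.
move=> N0 e0; have Nr : 0 < N%:R :> R by rewrite ltr0n.
have qp := q_gt0 m1p p1; have iqp := iq_gt0 m1 p1.
have S0 : 0 <= \sum_(i < N) e i `^ q by apply: sumr_ge0 => i _; exact: powR_ge0.
have [pE|[r pE r1]] := p_cases p1.
  have iE : iq = m%:R / 2 by rewrite -[iq]/(m%:R / 2 + ip p) /ip pE invey /= addr0.
  have g0 := gl_ge0 e.
  have h : \sum_(i < N) e i `^ q <= N%:R * gl e `^ q.
    have -> : N%:R * gl e `^ q = \sum_(i < N) gl e `^ q by rewrite sumr_const card_ord mulr_natl.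
    apply: ler_sum => i _; apply: ler_powq => //.
    by rewrite /gl pE; exact: le_bigmax.
  apply: (@le_trans _ _ ((N%:R * gl e `^ q) `^ iq)); first exact: ler_powiq.
  by rewrite powRM ?powR_ge0 ?(ltW Nr)// powq_iq// iE.
have r0 : 0 < r by apply: lt_le_trans r1.
have iE := iqE pE r1.
have qr : q < r.
  apply: lt_le_trans r1; rewrite invf_lt1// iE.
  have h : 1 <= m%:R / 2 :> R by rewrite ler_pdivlMr// mul1r ler_nat.
  by rewrite (le_lt_trans h)// ltrDl invr_gt0.
set S := \sum_(i < N) e i `^ r.
have SS : 0 <= S by apply: sumr_ge0 => i _; exact: powR_ge0.
have NE : N%:R = (size (index_enum 'I_N))%:R :> R by rewrite -[in LHS](card_ord N) cardT enumT.
have h := power_mean e0 qp qr NE Nr.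
have SN : 0 <= S / N%:R by rewrite divr_ge0// ltW.
apply: (@le_trans _ _ ((N%:R * (S / N%:R) `^ (q / r)) `^ iq)); first exact: ler_powiq.
rewrite powRM ?powR_ge0 ?(ltW Nr)// -powRrM mulrAC mulVf ?gt_eqF// mul1r.
have hN : (N%:R^-1 : R) `^ r^-1 = N%:R `^ (- r^-1).
  by rewrite -[N%:R^-1]powR_inv1 ?(ltW Nr)// -powRrM mulN1r.
have NV : 0 <= (N%:R^-1 : R) by rewrite invr_ge0 ltW.
have -> : gl e = S `^ r^-1 by rewrite /gl pE.
rewrite (powRM _ SS NV) hN mulrCA iE -powRD; last by rewrite (gt_eqF Nr) implybT.
by rewrite addrK mulrC.
Qed.

Lemma gl_upper N (e : 'I_N -> R) (c : R) : (0 < N)%N -> (forall i, 0 <= e i <= c) -> 0 <= c ->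
  gl e <= c * N%:R `^ ip p.
Proof.
move=> N0 he c0; have Nr : 0 < N%:R :> R by rewrite ltr0n.
have [pE|[r pE r1]] := p_cases p1.
  rewrite /gl /ip pE invey /= powRr0 mulr1; apply: bigmax_le => // i _.
  by have /andP[] := he i.
have r0 : 0 < r by apply: lt_le_trans r1.
rewrite /gl /ip pE inver gt_eqF//=.
have -> : c * N%:R `^ r^-1 = (c `^ r * N%:R) `^ r^-1.
  by rewrite powRM ?powR_ge0 ?(ltW Nr)// -powRrM mulfV ?gt_eqF// powRr1.
apply: ge0_ler_powR; rewrite ?invr_ge0 ?(ltW r0) ?nnegrE ?mulr_ge0 ?powR_ge0 ?(ltW Nr)//.
  by apply: sumr_ge0 => i _; exact: powR_ge0.
have -> : c `^ r * N%:R = \sum_(i < N) c `^ r by rewrite sumr_const card_ord mulr_natr.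
apply: ler_sum => i _; have /andP[h1 h2] := he i.
by apply: ge0_ler_powR; rewrite ?nnegrE ?(ltW r0).
Qed.

End GlobalError.

(** * Lower and upper limits from eventual bounds *)

Section Limits.
Variable R : realType.
Implicit Types (u : nat -> \bar R).

Lemma limn_einf_ge u (a : \bar R) N1 : (forall N, (N1 <= N)%N -> (a <= u N)%E) -> (a <= limn_einf u)%E.
Proof.
move=> h; rewrite limn_einf_lim (cvg_lim _ (@cvg_einfs_sup R u))//.
apply: le_trans (ereal_sup_ubound (imageT (einfs u) N1)).
by apply/ereal_infP => _ [k /= Nk <-]; exact: h.
Qed.

Lemma limn_esup_le u (a : \bar R) N1 : (forall N, (N1 <= N)%N -> (u N <= a)%E) -> (limn_esup u <= a)%E.
Proof.
move=> h; rewrite -leeN2 -limn_einfN; apply: (@limn_einf_ge _ _ N1) => N NN /=.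
by rewrite leeN2; exact: h.
Qed.

End Limits.

Lemma dm_polyE (R : realType) m1 (Omega : set (pt R)) f z :
  poly_fun (dm_poly m1.+1 Omega f z) =1 hp m1 (ac m1 (partial m1.+1 Omega f) z).
Proof.
move=> w; rewrite /poly_fun /dm_poly /hp !horner_sum; apply: eq_bigr => k _.
by rewrite !hornerM !(hornerC, hornerXn, horner_exp, hornerX) -mulrA.
Qed.

Theorem theorem1p2 (R : realType) (m : nat) (hm : (2 <= m)%N)
    (p : \bar R) (hp : (1 <= p)%E)
    (q : R) (hq : ((q^-1)%:E = (m%:R / 2)%:E + p^-1)%E)
    (Omega : set (R * R)) (hOmega : polygonal_domain Omega)
    (f : R * R -> R) (hf : Cm m Omega f) :
  (forall (N0 : nat) (T : forall N : nat, 'I_N -> triangle R),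
     admissible Omega N0 T ->
     (LpNorm q%:E Omega (fun z => shape_function m p (dm_poly m Omega f z))
      <= limn_einf (fun N : nat =>
           (N%:R `^ (m%:R / 2))%:E * global_error m (T N) f p))%E) /\
  (forall eps : R, 0 < eps ->
     exists (N0 : nat) (T : forall N : nat, 'I_N -> triangle R),
       admissible Omega N0 T /\
       (limn_esup (fun N : nat =>
          (N%:R `^ (m%:R / 2))%:E * global_error m (T N) f p)
        <= LpNorm q%:E Omega (fun z => shape_function m p (dm_poly m Omega f z))
           + eps%:E)%E).
Proof.
case: m hm hq hf => [|m1]//; rewrite ltnS => m1p hq hf.
have qE : q = (iq m1 p)^-1.
  have : q^-1 = iq m1 p.
    apply: EFin_inj; rewrite hq /iq EFinD; congr (_ + _)%E; rewrite /ip.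
    by have [->|[r -> r1]] := p_cases hp; rewrite ?invey ?inver ?gt_eqF//; apply: lt_le_trans r1.
  by move=> <-; rewrite invrK.
have [s0 [ms0 sn0 cO]] := polygonal_mesh hOmega.
have OE : Omega = [set x | covers s0 x] by apply/seteqP; split=> x /cO.
have hD : partial_derivatives m1.+1 [set x | covers s0 x] f (partial m1.+1 Omega f).
  by rewrite -OE; exact: (xgetPex (fun _ _ _ => 0) hf).
set D := partial m1.+1 Omega f in hD.
pose J := J m1 p s0 D; have J0 : 0 <= J := J_ge0 m1p hp ms0 hD.
have iq0 := iq_gt0 m1 hp.
have normE : LpNorm q%:E Omega (fun z => shape_function m1.+1 p (dm_poly m1.+1 Omega f z)) =
    (J `^ iq m1 p)%:E.
  rewrite qE {1}OE; apply: (norm_shape m1p hp ms0 hD) => z; exact: dm_polyE.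
have loc T : bdy (to_tri T) `<=` Omega ->
    local_error m1.+1 T f p = (en m1 p (to_tri T) f)%:E.
  move=> tO; rewrite local_errorE// enE//; first exact: nd_to.
  by apply: (nice_f ms0 hD); [exact: nd_to|rewrite -OE].
rewrite normE; split.
  move=> N0 T [hc [CA CA0 hd]].
  apply/lee_subgt0Pr => eps eps0.
  have bO N i : (N0 <= N)%N -> bdy (to_tri (T N i)) `<=` Omega.
    by move=> /hc[-> _] x Tx; exists i => //; rewrite bodyE.
  have gE N : (N0 <= N)%N -> global_error m1.+1 (T N) f p = (gl p (fun i => en m1 p (to_tri (T N i)) f))%:E.
    by move=> NN; apply: global_errorE => // i; apply: loc; exact: bO.
  pose a := J `^ iq m1 p - eps.
  (* Nonpositive targets are trivial and excluded because the power [q] needs a nonnegative base. *)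
  have [a0|a0] := leP a 0.
    apply: (@limn_einf_ge _ _ _ N0) => N NN; rewrite gE// -EFinB -EFinM lee_fin -/a.
    by rewrite (le_trans a0)// mulr_ge0 ?powR_ge0 ?gl_ge0.
  (* The allowed loss on [J] that turns J ^ (1/q) into exactly [a]. *)
  have eta0 : 0 < J - a `^ (iq m1 p)^-1.
    rewrite subr_gt0 -[X in _ < X](powiq_q m1 hp J0).
    apply: gt0_ltr_powR; rewrite ?invr_gt0 ?nnegrE ?powR_ge0 ?(ltW a0)//.
    by rewrite /a gtrBl.
  have [N1 HN1] := lower_raw m1p hp ms0 hD CA0 eta0.
  apply: (@limn_einf_ge _ _ _ (maxn (maxn N0 N1) 1)) => N; rewrite !geq_max => /andP[/andP[NN NN1] Np].
  rewrite gE// -EFinB -EFinM lee_fin -/a.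
  apply: le_trans (gl_lower m1p hp Np (fun i => en_ge0 m1 p _ _)).
  rewrite -[X in X <= _](powq_iq m1 hp (ltW a0)); apply: ler_powiq => //; first exact: powR_ge0.
  pose s := [seq to_tri (T N i) | i : 'I_N].
  have := HN1 N NN1 s; rewrite /s big_map big_enum /=.
  move=> /(_ _ _ _)/wrap[|||]; last by rewrite -/J; lra.
  - move=> t /mapP[i _ ->]; split; first exact: nd_to.
      by apply: wide_diam; exact: hd.
    by rewrite -OE; exact: bO.
  - by rewrite size_map size_enum_ord.
  - move=> x; rewrite /= => /cO; have [-> _] := hc N NN => -[i _]; rewrite bodyE => Tx.
    by exists (to_tri (T N i)) => //; apply/mapP; exists i; rewrite ?mem_enum.
move=> eps eps0.
(* Chosen so that (J + delta) ^ (1/q) equals J ^ (1/q) + eps. *)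
have dl0 : 0 < (J `^ iq m1 p + eps) `^ (iq m1 p)^-1 - J.
  rewrite subr_gt0 -[X in X < _](powiq_q m1 hp J0).
  by apply: gt0_ltr_powR; rewrite ?invr_gt0 ?nnegrE ?addr_ge0 ?powR_ge0 ?(ltW eps0)// ltrDl.
have [N0 [C [N00 C0 HN]]] := upper_raw m1p hp ms0 hD sn0 dl0.
set x0 := J + _ in HN.
have x0E : x0 `^ iq m1 p = J `^ iq m1 p + eps.
  by rewrite /x0 addrC subrK powq_iq// addr_ge0 ?powR_ge0 ?ltW.
have x00 : 0 <= x0 by rewrite addr_ge0// ltW.
(* The family must be total in [N]; below [N0] an arbitrary triangle is repeated. *)
have HT N : exists T : 'I_N -> triangle R, (N0 <= N)%N -> conforming Omega T /\
    forall i, wide (C * N%:R `^ (- 2^-1)) (to_tri (T i)) /\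
      en m1 p (to_tri (T i)) f <= (x0 / N%:R) `^ iq m1 p.
  have [NN|NN] := boolP (N0 <= N)%N.
    have [s [ms nh sN cs hs]] := HN N NN.
    have [|T [cT Ts]] := @conforming_of_mesh R s Omega N ms nh sN.
      by move=> x; rewrite cs; exact: cO.
    by exists T => _; split=> // i; exact: hs.
  have [n [t [nt _ _]]] := tile_ex R; have [T _] := tri_of nt.
  by exists (fun=> T).
exists N0, (fun N => projT1 (cid (HT N))).
have H N : (N0 <= N)%N -> _ := projT2 (cid (HT N)).
split.
  split; first by move=> N /H[].
  exists (2 * C); first by rewrite mulr_gt0.
  move=> N NN i; have [_ /(_ i)[w _]] := H N NN.
  by rewrite -mulrA; apply: diam_wide w; rewrite mulr_ge0 ?powR_ge0// ltW.
apply: (@limn_esup_le _ _ _ N0) => N NN; have [cT hT] := H N NN.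
have Np : (0 < N)%N by apply: leq_trans NN.
have Nr : 0 < N%:R :> R by rewrite ltr0n.
have bO i : bdy (to_tri (projT1 (cid (HT N)) i)) `<=` Omega.
  have [OT _] := cT => x Tx; have : (\bigcup_j body (projT1 (cid (HT N)) j)) x by exists i => //;
    rewrite bodyE.
  by rewrite -OT.
rewrite (@global_errorE _ _ _ hp _ _ _ _ (fun i => loc _ (bO i))) -EFinM -EFinD lee_fin -x0E.
have xN : 0 <= x0 / N%:R by rewrite divr_ge0// ltW.
have g := @gl_upper R p hp N (fun i => en m1 p (to_tri (projT1 (cid (HT N)) i)) f) ((x0 / N%:R) `^ iq m1 p)
  Np _ (powR_ge0 _ _).
apply: (@le_trans _ _ (N%:R `^ (m1.+1%:R / 2) * ((x0 / N%:R) `^ iq m1 p * N%:R `^ ip p))).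
  rewrite ler_wpM2l ?powR_ge0// g// => i; rewrite en_ge0 /=.
  by have [_] := hT i.
(* The powers m/2 and 1/p of [N] combine to 1/q and cancel the denominator of x0 / N. *)
rewrite mulrCA -powRD ?(gt_eqF Nr) ?implybT// -/(iq m1 p) -powRM// ?(ltW Nr)//.
by rewrite divfK// gt_eqF.
Qed.
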